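(* There are absolute constants $c_0>0$ (sufficiently small) and $C_0$ (sufficiently large) such that the following holds. Assume $p>2$ is a fixed constant, $\delta>2^{-n^{c_0}}$, and $W\ge(n/\delta)^{C_0}$. Any randomized turnstile streaming algorithm that, on every unit update turnstile stream on $\mathbb Z^n$ of length at most $W$, outputs a $(1+\epsilon)$-approximation to the $L_p$ norm of the final frequency vector with success probability at least $1-\delta$ must use $\Omega\Bigl(\min\{n^{1-2/p}\epsilon^{-2/p}\log n\,\log^{2/p}(1/\delta)+n^{1-2/p}\epsilon^{-2}\log(1/\delta),\,n\}\cdot\log W\Bigr)$ bits of space.
   Context: A unit update turnstile stream is a sequence of updates $(i,\Delta)$, $i\in[n]$, $\Delta\in\{\pm1\}$, each adding $\Delta$ to coordinate $i$ of a vector starting at $0$; the final frequency vector is the vector at the end. A randomized streaming algorithm using $S$ bits is a public-coin family of deterministic streaming algorithms each with at most $2^S$ memory states; the random seed is not counted toward the space, and the success probability is over the seed for each fixed stream.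
   Formalization: The formal theorem additionally assumes 0 < ε < 1 and δ < 1/2; without such bounds the claim fails (an L_2 estimate beats it for ε of order n^{1/2-1/p}, and guessing the scale from the seed uses 0 bits when δ is near 1). *)

(* Defs.v *)
From HB Require Import structures.
From mathcomp Require Import all_boot all_order all_algebra.
From mathcomp Require Import all_classical all_reals all_analysis.

Set Implicit Arguments.
Unset Strict Implicit.
Unset Printing Implicit Defensive.

Import Order.TTheory GRing.Theory Num.Theory.
Local Open Scope ring_scope.

(* [(i, b)] is the update (i, +1) if [b] is [true] and (i, -1) otherwise. *)
Definition update (n : nat) : Type := ('I_n * bool)%type.

Definition update_sign (n : nat) (u : update n) : int := if u.2 then 1 else -1.

Definition stream (n : nat) : Type := seq (update n).

Definition frequency (n : nat) (s : stream n) : 'rV[int]_n :=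
  \row_i \sum_(u <- s | u.1 == i) update_sign u.

Definition lp_norm (R : realType) (n : nat) (p : R) (x : 'rV[int]_n) : R :=
  (\sum_(i < n) (`|x 0 i|%:~R : R) `^ p) `^ p^-1.

Record stream_alg (R : realType) (n : nat) := StreamAlg {
  state : finType;
  init : state;
  step : state -> update n -> state;
  output : state -> R
}.

Definition run (R : realType) (n : nat) (A : stream_alg R n) (s : stream n) : R :=
  output (foldl (@step R n A) (init A) s).

(* The seed ranges over a probability space carried by [T]; each seed selects
   its own automaton (in particular its own state set), and the output on a
   fixed stream is required to be a random variable. *)
Record rand_stream_alg (R : realType) (n : nat) (d : measure_display)
    (T : measurableType d) := RandStreamAlg {
  alg_of_seed :> T -> stream_alg R n;
  measurable_run : forall s : stream n,
    measurable_fun [set: T] (fun w => run (alg_of_seed w) s)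
}.

Definition uses_bits (R : realType) (n : nat) (d : measure_display)
    (T : measurableType d) (A : rand_stream_alg R n T) (S : nat) : Prop :=
  forall w : T, (#|state (A w)| <= 2 ^ S)%N.

(* Contains the range a <= v <= (1 + eps) * a of the one-sided convention. *)
Definition approximates (R : realType) (eps a v : R) : Prop :=
  a / (1 + eps) <= v <= (1 + eps) * a.

Definition estimates_lp_norm (R : realType) (n : nat) (d : measure_display)
    (T : measurableType d) (P : probability T R) (A : rand_stream_alg R n T)
    (p eps delta : R) (W : nat) : Prop :=
  forall s : stream n, (size s <= W)%N ->
    ((1 - delta)%:E <=
       P [set w | approximates eps (lp_norm p (frequency s)) (run (A w) s)]%classic)%E.

(* Main.v *)
(* While an algorithm with few states reads uniformly random chunks [z] of a box [0, L)^n, the entropy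
   of the frequency vector given the state can grow only so much.  Hence at most times, and for most
   states, the conditional law of the frequency vector is almost invariant under the differences
   [z - z0] of a dense set of chunks.  Let [Sigma] be the covariance of these differences and
   [H = (1 + Sigma)^-1].  Integer combinations of the differences approximate [y - y H] for every
   integer vector [y], so the algorithm cannot tell an input [y] from [y H]; counting the chunks in a
   slab cut out by pivots of [H] gives tr H <= O(S / ln L).

   Both terms of the bound come from testing multiples [mu y] of a random vector [y] on top of
   discrete Gaussian noise [g] of scale [s].  The second moment of the likelihood ratio of the
   displacement [y H] is the mean of exp (<y H, y' H> / s^2), which is small when tr H is small, while
   the norms of [mu y + g] for different [mu] differ by a factor (1 + eps)^2.  For the term with eps^-2,
   [y] is a small multiple of [e_j] and sits on a spike of height n^(1/p) s at the random coordinate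
   [j].  For the other term, [y] is a sum of about ln (1 / delta) random spikes of height
   (eps n / ln (1 / delta))^(1/p) s; restricting these to words which hit only coordinates with small
   [H j j], and not too many coordinates coupled by [H], keeps the second moment small. *)

Require Import Defs.
From HB Require Import structures.
From mathcomp Require Import all_boot all_order all_algebra.
From mathcomp Require Import all_classical all_reals all_analysis.
From mathcomp Require Import measurable_realfun.
From mathcomp Require Import ring lra zify.

Set Implicit Arguments.
Unset Strict Implicit.
Unset Printing Implicit Defensive.

Import Order.TTheory GRing.Theory Num.Theory.
Local Open Scope ring_scope.

(** The frequency vector is read modulo [Q]: in a finite group its entropy given the state is at
    most n ln Q, so over many chunks the average growth per chunk is tiny. Every prefix is completed
    to a stream with a prescribed frequency vector [x]. The answer is then a function of the state
    and of prefix minus [x] alone, and a displacement of [x] goes unnoticed when the law of the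
    vector given the state is almost invariant under it. Invariance under integer combinations
    degrades with the size of the coefficients; the ridge term 1 keeps them bounded, and [y H] is
    the part of [y] that they fail to produce.

    The factor log n comes from the words of spikes. Coordinates coupled by [H] to a given one have
    frequency about n^(2/p - 1) up to logarithms, so the second moment tolerates couplings up to a
    small multiple of ln n, provided that a word meets boundedly many of them. This allows a trace
    larger by ln n than if all couplings had to be bounded. The factor log W appears because the
    side [L] of the box can be a fixed power of W. *)

(** * Scalar inequalities for relative entropy *)

Lemma eq_ler (R : realType) (x y : R) : x = y -> x <= y.
Proof. by move=> ->. Qed.

Lemma ln_le_sub1 (R : realType) (x : R) : 0 < x -> ln x <= x - 1.
Proof.
by move=> x0; have := @le_ln1Dx R (x - 1); rewrite addrCA subrr addr0; apply; rewrite ltrBrDl subrr.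
Qed.

(** With [u] and [v] the square roots, this is twice the inequality ln (v / u) <= v / u - 1
    multiplied by u^2. The term [a - b] makes it hold pointwise and disappears when two families of
    equal mass are summed. *)
Lemma relent_hellinger (R : realType) (a b : R) : 0 <= a -> 0 <= b -> (0 < a -> 0 < b) ->
  (Num.sqrt a - Num.sqrt b) ^+ 2 + (a - b) <= a * (ln a - ln b).
Proof.
move=> a0 b0 ab; case: (ltgtP 0 a) a0 => // [ap _|<- _]; last first.
  by rewrite sqrtr0 !sub0r sqrrN sqr_sqrtr// mul0r subrr.
have bp := ab ap.
have sa : 0 < Num.sqrt a by rewrite sqrtr_gt0.
have sb : 0 < Num.sqrt b by rewrite sqrtr_gt0.
have Ea : a = Num.sqrt a ^+ 2 by rewrite sqr_sqrtr// ltW.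
have Eb : b = Num.sqrt b ^+ 2 by rewrite sqr_sqrtr// ltW.
move: (Num.sqrt a) (Num.sqrt b) sa sb Ea Eb => u v u0 v0 -> ->.
rewrite !lnXn// -mulrnBl -[_ *+ 2]mulr_natl.
have := ln_le_sub1 (divr_gt0 v0 u0); rewrite ln_div ?posrE// => H.
have : u ^+ 2 * (ln v - ln u) <= u ^+ 2 * (v / u - 1).
  by rewrite ler_wpM2l// sqr_ge0.
have -> : u ^+ 2 * (v / u - 1) = u * v - u ^+ 2 by field; rewrite gt_eqF.
nra.
Qed.

Lemma amgm_sqr (R : realType) (k x y : R) : 0 < k -> 0 <= x -> 0 <= y ->
  `|x ^+ 2 - y ^+ 2| <= (x - y) ^+ 2 / (2 * k) + k * (x ^+ 2 + y ^+ 2).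
Proof.
move=> k0 x0 y0; rewrite subr_sqr normrM [`|x + y|]ger0_norm ?addr_ge0//.
have -> : (x - y) ^+ 2 = `|x - y| ^+ 2 by rewrite -normrX ger0_norm ?sqr_ge0.
have k2 : 0 < 2 * k by rewrite mulr_gt0.
have H : 0 <= (`|x - y| - k * (x + y)) ^+ 2 by exact: sqr_ge0.
have K : 0 <= k ^+ 2 * (x - y) ^+ 2 by rewrite mulr_ge0 ?sqr_ge0.
rewrite -(ler_pM2r k2) [leRHS]mulrDl mulfVK ?gt_eqF//.
move: `|x - y| H => d H; nra.
Qed.

(** * Entropy of the frequency vector given the state *)

Section Step.
Variables (R : realType) (St Z : finType) (G : finZmodType).
Variables (iota : Z -> G) (dl : St -> Z -> St).
Hypothesis Z0 : (0 < #|Z|)%N.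

(** Throughout, [f t u] is the joint probability of the state [t] and the frequency vector [u]. *)
Definition marg (f : St -> G -> R) (t : St) : R := \sum_u f t u.

Definition is_pmf (f : St -> G -> R) : Prop :=
  (forall t u, 0 <= f t u) /\ \sum_t marg f t = 1.

Definition next (f : St -> G -> R) (t : St) (u : G) : R :=
  #|Z|%:R^-1 * \sum_z \sum_(s | dl s z == t) f s (u - iota z).

Definition condent (f : St -> G -> R) : R :=
  \sum_t marg f t * ln (marg f t) - \sum_t \sum_u f t u * ln (f t u).

(* [cond_next f s z] is the law of the frequency vector before a step from the state [s] with the chunk
   [z], if the vector after the step were independent of [s] and [z] given the new state. *)
Definition cond_next (f : St -> G -> R) (s : St) (z : Z) (u : G) : R :=
  next f (dl s z) (u + iota z) * (marg f s / marg (next f) (dl s z)).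

Definition step_dist (f : St -> G -> R) : R :=
  #|Z|%:R^-1 * \sum_s \sum_z \sum_u `|f s u - cond_next f s z u|.

Let cZ : 0 < (#|Z|%:R : R). Proof. by rewrite ltr0n. Qed.

Lemma sum_constZ (c : R) : #|Z|%:R^-1 * \sum_(z : Z) c = c.
Proof. by rewrite sumr_const -[c *+ _]mulr_natl mulKf// gt_eqF. Qed.

Lemma next_ge0 f : is_pmf f -> forall t u, 0 <= next f t u.
Proof.
move=> [f0 _] t u; rewrite mulr_ge0 ?invr_ge0 ?ler0n//.
by apply: sumr_ge0 => z _; apply: sumr_ge0.
Qed.

(** [next] is the image of [f] and a uniform chunk under (s, z, u) -> (dl s z, u + iota z). *)
Lemma sum_next f (phi : St -> G -> R) :
  \sum_t \sum_u next f t u * phi t u =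
  #|Z|%:R^-1 * \sum_s \sum_z \sum_u f s u * phi (dl s z) (u + iota z).
Proof.
transitivity (#|Z|%:R^-1 *
    \sum_t \sum_u \sum_z \sum_(s | dl s z == t) f s (u - iota z) * phi t u).
  rewrite mulr_sumr; apply: eq_bigr => t _; rewrite mulr_sumr; apply: eq_bigr => u _.
  rewrite /next -mulrA mulr_suml; congr (_ * _); apply: eq_bigr => z _.
  by rewrite mulr_suml.
congr (_ * _).
transitivity (\sum_t \sum_z \sum_(s | dl s z == t) \sum_u f s u * phi t (u + iota z)).
  apply: eq_bigr => t _; rewrite exchange_big; apply: eq_bigr => z _ /=.
  rewrite exchange_big; apply: eq_bigr => s _ /=.
  rewrite (reindex (fun u => u + iota z)) /=.
    by apply: eq_bigr => u _; rewrite addrK.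
  by exists (fun u => u - iota z) => u _; rewrite ?addrK ?subrK.
rewrite exchange_big [RHS]exchange_big; apply: eq_bigr => z _ /=.
rewrite (exchange_big_dep predT)//=; apply: eq_bigr => s _.
by rewrite (eq_bigl (pred1 (dl s z))) ?big_pred1_eq// => t; rewrite eq_sym.
Qed.

Lemma next_pmf f : is_pmf f -> is_pmf (next f).
Proof.
move=> fp; split; first exact: next_ge0.
have := sum_next f (fun _ _ => 1).
under eq_bigr => t _ do (under eq_bigr do rewrite mulr1).
rewrite /marg => ->.
transitivity (#|Z|%:R^-1 * \sum_s \sum_(z : Z) marg f s).
  congr (_ * _); apply: eq_bigr => s _; apply: eq_bigr => z _.
  by apply: eq_bigr => u _; rewrite mulr1.
by rewrite mulr_sumr; under eq_bigr do rewrite sum_constZ; exact: (proj2 fp).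
Qed.

Lemma marg_ge0 f t : is_pmf f -> 0 <= marg f t.
Proof. by move=> [f0 _]; apply: sumr_ge0. Qed.

Lemma le_marg f t u : is_pmf f -> f t u <= marg f t.
Proof.
by move=> [f0 _]; rewrite /marg (bigD1 u)//= lerDl sumr_ge0.
Qed.

Lemma le_next f s z u : is_pmf f -> #|Z|%:R^-1 * f s u <= next f (dl s z) (u + iota z).
Proof.
move=> [f0 _]; rewrite ler_wpM2l ?invr_ge0 ?ler0n// (bigD1 z)//= (bigD1 s)//= addrK.
rewrite -addrA lerDl addr_ge0//; first by apply: sumr_ge0.
by apply: sumr_ge0 => ? _; apply: sumr_ge0.
Qed.

Lemma cond_next_ge0 f s z u : is_pmf f -> 0 <= cond_next f s z u.
Proof.
move=> fp; rewrite mulr_ge0 ?divr_ge0 ?marg_ge0 ?next_ge0//.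
exact: next_pmf.
Qed.

Lemma cond_next_gt0 f s z u : is_pmf f -> 0 < f s u -> 0 < cond_next f s z u.
Proof.
move=> fp fsu.
have nx : 0 < next f (dl s z) (u + iota z).
  by apply: lt_le_trans (le_next s z u fp); rewrite mulr_gt0 ?invr_gt0.
rewrite mulr_gt0 ?divr_gt0//.
  by apply: lt_le_trans (le_marg s u fp).
by apply: lt_le_trans (le_marg _ (u + iota z) (next_pmf fp)).
Qed.

Lemma sum_cond_next f s z : is_pmf f -> \sum_u cond_next f s z u = marg f s.
Proof.
move=> fp; rewrite -mulr_suml.
have -> : \sum_u next f (dl s z) (u + iota z) = marg (next f) (dl s z).
  rewrite /marg [RHS](reindex (fun u => u + iota z)) //=.
  by exists (fun u => u - iota z) => u _; rewrite ?addrK ?subrK.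
(* A zero marginal makes the quotient in [cond_next] 0; this is consistent, because [f s] then
   vanishes too. *)
have [m0|m0] := eqVneq (marg (next f) (dl s z)) 0; last by rewrite mulrC divfK.
rewrite m0 mul0r; apply/esym/eqP; rewrite eq_le marg_ge0// andbT leNgt.
apply/negP => ms; have [u fu] : exists u, 0 < f s u.
  apply/existsP; rewrite -[[exists _, _]]negbK negb_exists; apply/negP => /forallP H.
  suff : marg f s <= 0 by lra.
  by apply: sumr_le0 => u _; rewrite leNgt H.
have := lt_le_trans (cond_next_gt0 z fp fu) (lexx _).
by rewrite /cond_next m0 invr0 mulr0 mulr0 ltxx.
Qed.

(** Adding [iota z] does not change the entropy of the vector given (s, z). The increase is
    therefore the mutual information of the new vector and (s, z) given the new state: an average of
    relative entropies of [f s] to [cond_next f s z], each bounded below by [relent_hellinger]. *)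
Lemma condent_step f : is_pmf f ->
  #|Z|%:R^-1 * (\sum_s \sum_z \sum_u
     (Num.sqrt (f s u) - Num.sqrt (cond_next f s z u)) ^+ 2)
  <= condent (next f) - condent f.
Proof.
move=> fp; have nfp := next_pmf fp.
have sumconst (F : St -> R) : \sum_s F s = #|Z|%:R^-1 * \sum_s \sum_(z : Z) F s.
  by rewrite mulr_sumr; apply: eq_bigr => s _; rewrite sum_constZ.
have -> : condent (next f) - condent f =
   #|Z|%:R^-1 * (\sum_s \sum_z \sum_u f s u * (ln (f s u) - ln (cond_next f s z u))).
  have Hnm : \sum_t marg (next f) t * ln (marg (next f) t) =
     #|Z|%:R^-1 * \sum_s \sum_z \sum_u f s u * ln (marg (next f) (dl s z)).
    rewrite -(sum_next f (fun t _ => ln (marg (next f) t))).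
    by apply: eq_bigr => t _; rewrite mulr_suml.
  have Hm : \sum_t marg f t * ln (marg f t) =
     #|Z|%:R^-1 * \sum_s \sum_(z : Z) \sum_u f s u * ln (marg f s).
    by rewrite sumconst; congr (_ * _); apply: eq_bigr => s _; apply: eq_bigr => z _;
       rewrite mulr_suml.
  have Hf : \sum_t \sum_u f t u * ln (f t u) =
     #|Z|%:R^-1 * \sum_s \sum_(z : Z) \sum_u f s u * ln (f s u) by rewrite sumconst.
  rewrite /condent Hnm Hm Hf (sum_next f (fun t u => ln (next f t u))).
  rewrite -!mulrBr; congr (_ * _).
  rewrite -!sumrB; apply: eq_bigr => s _; rewrite -!sumrB; apply: eq_bigr => z _.
  rewrite -!sumrB; apply: eq_bigr => u _.
  have [->|fn0] := eqVneq (f s u) 0; first by rewrite !mul0r !subr0.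
  have f0 : 0 < f s u by rewrite lt_neqAle eq_sym fn0 (proj1 fp).
  have c0 := cond_next_gt0 z fp f0.
  rewrite /cond_next in c0 *.
  have m0 : 0 < marg f s by apply: lt_le_trans (le_marg s u fp).
  have n0 : 0 < next f (dl s z) (u + iota z).
    by apply: lt_le_trans (le_next s z u fp); rewrite mulr_gt0 ?invr_gt0.
  have nm0 : 0 < marg (next f) (dl s z).
    by apply: lt_le_trans n0 (le_marg _ _ nfp).
  rewrite lnM ?posrE ?divr_gt0// ln_div ?posrE//; ring.
rewrite ler_wpM2l ?invr_ge0 ?ler0n//; apply: ler_sum => s _; apply: ler_sum => z _.
have -> : \sum_u (Num.sqrt (f s u) - Num.sqrt (cond_next f s z u)) ^+ 2 =
   \sum_u ((Num.sqrt (f s u) - Num.sqrt (cond_next f s z u)) ^+ 2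
           + (f s u - cond_next f s z u)).
  by rewrite big_split /= sumrB sum_cond_next// subrr addr0.
apply: ler_sum => u _; apply: relent_hellinger; first exact: (proj1 fp).
  exact: cond_next_ge0.
exact: cond_next_gt0.
Qed.

Lemma condent_ge0 f : is_pmf f -> 0 <= condent f.
Proof.
move=> fp; rewrite /condent -sumrB sumr_ge0// => t _.
rewrite mulr_suml -sumrB sumr_ge0// => u _; rewrite -mulrBr.
have [->|fn0] := eqVneq (f t u) 0; first by rewrite mul0r.
have f0 : 0 < f t u by rewrite lt_neqAle eq_sym fn0 (proj1 fp).
rewrite mulr_ge0 ?(proj1 fp)// subr_ge0 ler_ln ?posrE ?le_marg//.
exact: lt_le_trans f0 (le_marg _ _ fp).
Qed.

(** Gibbs' inequality against the uniform law on [G], for each state. *)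
Lemma condent_le f : is_pmf f -> condent f <= ln #|G|%:R.
Proof.
move=> fp; have G0 : 0 < (#|G|%:R : R) by rewrite ltr0n; apply/card_gt0P; exists 0.
have -> : ln #|G|%:R = \sum_t marg f t * ln #|G|%:R by rewrite -mulr_suml (proj2 fp) mul1r.
rewrite /condent -sumrB; apply: ler_sum => t _.
rewrite lerBlDl -lerBlDr -mulrBr.
have -> : marg f t * (ln (marg f t) - ln #|G|%:R) =
  \sum_u (f t u * (ln (marg f t) - ln #|G|%:R) + (f t u - marg f t / #|G|%:R)).
  rewrite big_split /= -mulr_suml sumrB sumr_const -[_ *+ #|_|]mulr_natr divfK ?gt_eqF//.
  by rewrite -/(marg f t) subrr addr0.
apply: ler_sum => u _.
have [->|fn0] := eqVneq (f t u) 0.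
  by rewrite !mul0r add0r sub0r oppr_le0 divr_ge0 ?marg_ge0 ?ler0n.
have f0 : 0 < f t u by rewrite lt_neqAle eq_sym fn0 (proj1 fp).
have m0 : 0 < marg f t by apply: lt_le_trans (le_marg t u fp).
have q0 : 0 < marg f t / #|G|%:R / f t u by rewrite !divr_gt0.
have := ln_le_sub1 q0.
rewrite ln_div ?posrE ?divr_gt0// ln_div ?posrE// => H.
have : f t u * (ln (marg f t) - ln #|G|%:R - ln (f t u)) <=
   f t u * (marg f t / #|G|%:R / f t u - 1) by rewrite ler_wpM2l// ltW.
rewrite [in X in _ <= X -> _]mulrBr [f t u * (_ / f t u)]mulrC divfK// mulr1; lra.
Qed.

Lemma sum_next_marg f : is_pmf f ->
  #|Z|%:R^-1 * (\sum_(s : St) \sum_(z : Z) marg f s) = 1.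
Proof.
by move=> fp; rewrite mulr_sumr; under eq_bigr do rewrite sum_constZ; exact: (proj2 fp).
Qed.

(* AM-GM with a free parameter in place of Cauchy-Schwarz:
   |a - b| <= (sqrt a - sqrt b)^2 / (2 k) + k (a + b). *)
Lemma step_dist_le f (k : R) : 0 < k -> is_pmf f ->
  step_dist f <= (condent (next f) - condent f) / (2 * k) + 2 * k.
Proof.
move=> k0 fp; have nfp := next_pmf fp.
apply: (@le_trans _ _ (#|Z|%:R^-1 * (\sum_s \sum_z \sum_u
     (Num.sqrt (f s u) - Num.sqrt (cond_next f s z u)) ^+ 2) / (2 * k) + 2 * k)).
  have E : 2 * k = #|Z|%:R^-1 * (\sum_s \sum_z \sum_u k * (f s u + cond_next f s z u)).
    transitivity (#|Z|%:R^-1 * (\sum_(s : St) \sum_(z : Z) marg f s) * (2 * k)).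
      by rewrite sum_next_marg// mul1r.
    rewrite -mulrA mulr_suml; congr (_ * _); apply: eq_bigr => s _.
    rewrite mulr_suml; apply: eq_bigr => z _.
    rewrite -mulr_sumr big_split /= sum_cond_next// -/(marg f s); ring.
  rewrite [X in _ + X]E -mulrA -mulrDr ler_wpM2l ?invr_ge0 ?ler0n//.
  rewrite mulr_suml -big_split; apply: ler_sum => s _ /=.
  rewrite mulr_suml -big_split; apply: ler_sum => z _ /=.
  rewrite mulr_suml -big_split; apply: ler_sum => u _ /=.
  have := cond_next_ge0 s z u fp; have := proj1 fp s u.
  move: (f s u) (cond_next f s z u) => a b a0 b0.
  have Ea : a = Num.sqrt a ^+ 2 by rewrite sqr_sqrtr.
  have Eb : b = Num.sqrt b ^+ 2 by rewrite sqr_sqrtr.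
  rewrite [in `|_|]Ea [in `|_|]Eb [in k * _]Ea [in k * _]Eb.
  exact: amgm_sqr.
by rewrite lerD2r ler_pM2r ?invr_gt0 ?mulr_gt0// condent_step.
Qed.

End Step.

(** * States at which many chunks act as almost the same shift *)

Section GoodState.
Variables (R : realType) (St Z : finType) (G : finZmodType).
Variables (iota : Z -> G) (dl : St -> Z -> St).
Hypothesis Z0 : (0 < #|Z|)%N.

Lemma iter_next_pmf (f : St -> G -> R) t : is_pmf f -> is_pmf (iter t (next iota dl) f).
Proof. by move=> fp; elim: t => //= t IH; apply: next_pmf. Qed.

(** The entropy increments telescope, and the conditional entropy stays between 0 and ln |G|. *)
Lemma sum_step_dist_le (f : St -> G -> R) (T : nat) (k : R) : 0 < k -> is_pmf f ->
  \sum_(t < T) step_dist iota dl (iter t (next iota dl) f) <=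
  ln #|G|%:R / (2 * k) + T%:R * (2 * k).
Proof.
move=> k0 fp; pose F t := iter t (next iota dl) f.
have Fp t : is_pmf (F t) by exact: iter_next_pmf.
have k2 : 0 < 2 * k by rewrite mulr_gt0.
apply: (@le_trans _ _ (\sum_(t < T) ((condent (F t.+1) - condent (F t)) / (2 * k) + 2 * k))).
  by apply: ler_sum => t _; have H := step_dist_le iota dl Z0 k0 (Fp t); exact: H.
rewrite big_split /= sumr_const card_ord -[_ *+ T]mulr_natl lerD2r -mulr_suml.
rewrite ler_pM2r ?invr_gt0//.
rewrite -(big_mkord xpredT (fun t => condent (F t.+1) - condent (F t))).
rewrite telescope_sumr//.
by have := condent_le (Fp T); have := condent_ge0 (Fp 0%N); lra.
Qed.

Definition shift_stable (f : St -> G -> R) (k : R) (t : St) (C : {set Z}) : bool :=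
  [forall z in C, forall z0 in C,
    \sum_u `|f t (u + iota z) - f t (u + iota z0)| <= k * marg f t].

Definition good_state (f : St -> G -> R) (k m : R) (t : St) : bool :=
  [exists C : {set Z}, (m <= #|C|%:R) && shift_stable f k t C].

(** Let [t] fail to be good. For each [s], the set [C s t] of chunks leading from [s] to [t] is
    either small, which costs mass [th] in total, or has mean error at least [k * marg f s], which
    is charged to [step_dist]. Otherwise Markov's inequality keeps half of [C s t] with errors at
    most twice that bound, and for two such chunks the translates of the new law are close to the
    same multiple of [f s], hence to each other. *)
Lemma good_state_mass (f : St -> G -> R) (k th : R) : 0 < k -> 0 < th -> is_pmf f ->
  1 - th - step_dist iota dl f / k <=
  \sum_(t | good_state (next iota dl f) (4 * k) (th * #|Z|%:R / (2 * #|St|%:R)) t)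
     marg (next iota dl f) t.
Proof.
move=> k0 th0 fp; set f' := next iota dl f; have f'p : is_pmf f' by exact: next_pmf.
have cZ : 0 < (#|Z|%:R : R) by rewrite ltr0n.
set m := th * _ / _; set gd := good_state f' (4 * k) m.
pose C s t := [set z | dl s z == t].
pose P s t := marg f s * #|C s t|%:R / #|Z|%:R.
pose E s z : R := \sum_u `|f s u - cond_next iota dl f s z u|.
pose e s t : R := #|Z|%:R^-1 * \sum_(z in C s t) E s z.
have E0 s z : 0 <= E s z by apply: sumr_ge0.
have margP t : marg f' t = \sum_s P s t.
  have := sum_next iota dl f (fun t' _ => (t' == t)%:R).
  have -> : \sum_t0 \sum_u next iota dl f t0 u * (t0 == t)%:R = marg f' t.
    rewrite (bigD1 t)//= [X in _ + X]big1 ?addr0.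
      by apply: eq_bigr => u _; rewrite eqxx mulr1.
    by move=> t' /negPf tt; apply: big1 => u _; rewrite tt mulr0.
  move=> ->; rewrite mulr_sumr; apply: eq_bigr => s _.
  rewrite mulrC /P; congr (_ / _).
  rewrite -sum1_card natr_sum mulr_sumr [RHS]big_mkcond; apply: eq_bigr => z _.
  rewrite inE -mulr_suml -/(marg f s); case: eqP => _; rewrite ?mulr1 ?mulr0//.
have totP : \sum_t \sum_s P s t = 1.
  by rewrite -(proj2 f'p); apply: eq_bigr => t _; rewrite margP.
have tote : \sum_t \sum_s e s t = step_dist iota dl f.
  rewrite exchange_big /step_dist mulr_sumr; apply: eq_bigr => s _ /=.
  rewrite /e -mulr_sumr; congr (_ * _).
  rewrite (exchange_big_dep predT)//=; apply: eq_bigr => z _.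
  rewrite (eq_bigl (pred1 (dl s z))) ?big_pred1_eq// => t.
  by rewrite inE eq_sym.
have cSt : (0 < #|St|)%N.
  rewrite lt0n; apply/negP => /eqP S0; have := proj2 fp.
  rewrite big1 => [/esym/eqP|s _]; first by rewrite oner_eq0.
  by have := fintype0 s S0.
have cStR : 0 < (#|St|%:R : R) by rewrite ltr0n.
have key s t : ~~ gd t -> P s t <= marg f s * th / #|St|%:R + e s t / k.
  move=> ngd.
  have e0 : 0 <= e s t / k.
    by rewrite divr_ge0 ?(ltW k0)// mulr_ge0 ?invr_ge0 ?ler0n// sumr_ge0.
  have [small|big] := ltP (#|C s t|%:R) (th * #|Z|%:R / #|St|%:R).
    apply: (@le_trans _ _ (marg f s * th / #|St|%:R)); last by rewrite lerDl.
    rewrite /P -!mulrA ler_wpM2l ?marg_ge0// ler_pdivrMr//.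
    by rewrite mulrAC ltW.
  apply: (@le_trans _ _ (e s t / k)); last first.
    by rewrite lerDr !mulr_ge0 ?marg_ge0 ?invr_ge0 ?ler0n// ltW.
  rewrite ler_pdivlMr// leNgt; apply/negP => elt; move/negP: ngd; apply.
  have SE : \sum_(z in C s t) E s z < k * marg f s * #|C s t|%:R.
    move: elt; rewrite /e /P -(ltr_pM2l cZ) mulrA mulfV ?gt_eqF// mul1r.
    congr (_ < _); field; exact: lt0r_neq0.
  have SE0 : 0 <= \sum_(z in C s t) E s z by apply: sumr_ge0.
  have m0 : 0 < marg f s.
    rewrite lt_neqAle marg_ge0// andbT eq_sym; apply/negP => /eqP M.
    by move: SE; rewrite M mulr0 mul0r; lra.
  pose C' := [set z in C s t | E s z <= 2 * k * marg f s].
  have C'C : C' \subset C s t by apply/fintype.subsetP => z; rewrite inE => /andP[].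
  have cC : #|C s t|%:R <= 2 * #|C'|%:R :> R.
    have : #|C s t :\: C'|%:R * (2 * k * marg f s) <= \sum_(z in C s t) E s z.
      rewrite (big_setID C') /= -[leLHS]add0r lerD ?sumr_ge0//.
      rewrite -sum1_card natr_sum mulr_suml; apply: ler_sum => z.
      by rewrite !inE mul1r => /andP[H dz]; move: H; rewrite dz /= -ltNge => /ltW.
    rewrite cardsD (finset.setIidPr C'C) natrB ?subset_leq_card//.
    have km : 0 < k * marg f s by rewrite mulr_gt0.
    move=> H; have := le_lt_trans H SE.
    have -> : (#|C s t|%:R - #|C'|%:R) * (2 * k * marg f s) =
       (k * marg f s) * (2 * (#|C s t|%:R - #|C'|%:R)) :> R by ring.
    by rewrite ltr_pM2l// => ?; lra.
  have C'm : m <= #|C'|%:R.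
    rewrite -(ler_pM2l (_ : 0 < 2))//; apply: le_trans cC; apply: le_trans big.
    rewrite /m invfM; apply: eq_ler; field; exact: lt0r_neq0.
  apply/existsP; exists C'; rewrite C'm /=.
  have mt0 : 0 < marg f' t.
    rewrite margP (bigD1 s)//= ltr_pwDl ?sumr_ge0//.
      rewrite /P divr_gt0// mulr_gt0//; apply: lt_le_trans big.
      by rewrite !divr_gt0 ?mulr_gt0.
    by move=> s' _; rewrite /P !mulr_ge0 ?marg_ge0 ?invr_ge0 ?ler0n.
  apply/forall_inP => z; rewrite !inE => /andP[/eqP dz Ez].
  apply/forall_inP => z0; rewrite !inE => /andP[/eqP dz0 Ez0].
  (* [c] rescales the law after the step to the one before it; undoing it turns two errors of 2 k
     marg f s into 4 k marg f' t. *)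
  pose c := marg f s / marg f' t; have c0 : 0 < c by rewrite divr_gt0.
  rewrite -(ler_pM2r c0) mulr_suml.
  apply: (@le_trans _ _ (E s z + E s z0)).
    rewrite /E -big_split; apply: ler_sum => u _ /=.
    rewrite /cond_next dz dz0 -/f' -/c -[in leLHS](gtr0_norm c0) -normrM mulrBl.
    rewrite [`|f s u - _|]distrC; apply: le_trans (ler_normD _ _).
    by apply: eq_ler; congr (`|_|); ring.
  apply: (le_trans (lerD Ez Ez0)); rewrite /c; apply: eq_ler; field.
  exact: lt0r_neq0.
have : \sum_(t | ~~ gd t) marg f' t <= th + step_dist iota dl f / k.
  rewrite -tote; apply: (@le_trans _ _ (\sum_t \sum_s (marg f s * th / #|St|%:R + e s t / k))).
    rewrite big_mkcond; apply: ler_sum => t _; rewrite margP.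
    case: ifPn => [/key H|_]; first by apply: ler_sum => s _; exact: H.
    apply: sumr_ge0 => s _; rewrite addr_ge0 ?mulr_ge0 ?divr_ge0 ?marg_ge0 ?invr_ge0 ?ler0n ?(ltW th0) ?(ltW k0)//.
    by rewrite sumr_ge0.
  under eq_bigr do rewrite big_split /= -!mulr_suml (proj2 fp) mul1r.
  rewrite big_split /= sumr_const -[_ *+ _]mulr_natr -mulr_suml divfK ?gt_eqF//.
have := proj2 f'p; rewrite (bigID gd) /=; lra.
Qed.

End GoodState.

(** * Ridge matrices, pivots and rounding *)

Section Vec.
Variables (R : realType) (n : nat).
Implicit Types x y : 'rV[R]_n.

Definition dotv x y : R := \sum_i x 0 i * y 0 i.
Definition norm2 x : R := dotv x x.

Lemma dotvE x y : dotv x y = (x *m y^T) 0 0.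
Proof. by rewrite mxE; apply: eq_bigr => i _; rewrite mxE. Qed.

Lemma dotvC x y : dotv x y = dotv y x.
Proof. by apply: eq_bigr => i _; rewrite mulrC. Qed.

Lemma dotvDl x y z : dotv (x + y) z = dotv x z + dotv y z.
Proof. by rewrite -big_split; apply: eq_bigr => i _; rewrite mxE mulrDl. Qed.

Lemma dotvZl a x z : dotv (a *: x) z = a * dotv x z.
Proof. by rewrite mulr_sumr; apply: eq_bigr => i _; rewrite mxE mulrA. Qed.

Lemma dotvDr x y z : dotv z (x + y) = dotv z x + dotv z y.
Proof. by rewrite dotvC dotvDl !(dotvC z). Qed.

Lemma dotvZr a x z : dotv z (a *: x) = a * dotv z x.
Proof. by rewrite dotvC dotvZl dotvC. Qed.

Lemma dotvNl x z : dotv (- x) z = - dotv x z.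
Proof. by rewrite -scaleN1r dotvZl mulN1r. Qed.

Lemma dotvNr x z : dotv z (- x) = - dotv z x.
Proof. by rewrite dotvC dotvNl dotvC. Qed.

Lemma dotv_suml I (r : seq I) (P : pred I) (F : I -> 'rV[R]_n) z :
  dotv (\sum_(i <- r | P i) F i) z = \sum_(i <- r | P i) dotv (F i) z.
Proof.
elim/big_rec2: _ => [|i a b _ <-]; last by rewrite dotvDl.
by rewrite /dotv big1// => i _; rewrite mxE mul0r.
Qed.

Lemma norm2_ge0 x : 0 <= norm2 x.
Proof. by apply: sumr_ge0 => i _; rewrite -expr2 sqr_ge0. Qed.

Lemma norm2_eq0 x : norm2 x = 0 -> x = 0.
Proof.
move=> /eqP; rewrite psumr_eq0 => [/allP H|i _]; last by rewrite -expr2 sqr_ge0.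
apply/rowP => i; rewrite mxE; have := H i (mem_index_enum _).
by rewrite /= -expr2 sqrf_eq0 => /eqP.
Qed.

Lemma norm2Z a x : norm2 (a *: x) = a ^+ 2 * norm2 x.
Proof. by rewrite /norm2 dotvZl dotvZr mulrA expr2. Qed.

Lemma norm2D x y : norm2 (x + y) = norm2 x + 2 * dotv x y + norm2 y.
Proof. by rewrite /norm2 !dotvDl !dotvDr (dotvC y x); ring. Qed.

Lemma norm2N x : norm2 (- x) = norm2 x.
Proof. by rewrite /norm2 dotvNl dotvNr opprK. Qed.

Lemma dotv_le (k : R) x y : 0 < k -> 2 * dotv x y <= k * norm2 x + k^-1 * norm2 y.
Proof.
move=> k0; have := norm2_ge0 (k *: x - y).
rewrite norm2D norm2Z norm2N dotvNr dotvZl => H.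
rewrite -(ler_pM2l k0) mulrDr mulrA [X in _ <= _ + X]mulrA mulfV ?gt_eqF// mul1r.
by move: H; rewrite expr2; lra.
Qed.

Lemma norm2D_le x y : norm2 (x + y) <= 2 * norm2 x + 2 * norm2 y.
Proof. by have := @dotv_le 1 x y ltr01; rewrite norm2D invr1; lra. Qed.

Lemma dotv_sqr_le x y : dotv x y ^+ 2 <= norm2 x * norm2 y.
Proof.
have [x0|x0] := eqVneq (norm2 x) 0.
  by rewrite (norm2_eq0 x0) /dotv big1 ?expr2 ?mul0r ?mulr_ge0 ?norm2_ge0// => i _; rewrite mxE mul0r.
have {}x0 : 0 < norm2 x by rewrite lt_neqAle eq_sym x0 norm2_ge0.
have := norm2_ge0 (norm2 x *: y - dotv x y *: x).
rewrite norm2D norm2N !norm2Z dotvNr dotvZl dotvZr (dotvC y x) => H.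
by rewrite -(ler_pM2l x0); nra.
Qed.

Lemma mx_quad_tr (A : 'M[R]_n) x y : dotv (x *m A) y = dotv x (y *m A^T).
Proof. by rewrite !dotvE trmx_mul trmxK mulmxA. Qed.

End Vec.

Section Ridge.
Variables (R : realType) (n : nat) (S : 'M[R]_n).
Hypothesis Ssym : S^T = S.
Hypothesis Spsd : forall x, 0 <= dotv (x *m S) x.

Definition ridge : 'M[R]_n := invmx (1%:M + S).

Lemma ridge_unit : 1%:M + S \in unitmx.
Proof.
rewrite -row_free_unit; apply: inj_row_free => v vM; apply: norm2_eq0.
have : dotv (v *m (1%:M + S)) v = 0 by rewrite vM /dotv big1// => i _; rewrite mxE mul0r.
rewrite mulmxDr mulmx1 dotvDl -/(norm2 v).
by have := Spsd v; have := norm2_ge0 v; lra.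
Qed.

(* Satisfied by [ridge] and preserved by pivoting, which projects out one row of [G]. *)
Definition pivotal (G : 'M[R]_n) : Prop := G^T = G /\ G *m (1%:M + S) *m G = G.

Lemma ridge_pivotal : pivotal ridge.
Proof.
split; last by rewrite mulVmx ?ridge_unit// mul1mx.
by rewrite /ridge trmx_inv linearD /= trmx1 Ssym.
Qed.

Lemma pivotal_quad G x : pivotal G ->
  dotv (x *m G) x = norm2 (x *m G) + dotv (x *m G *m S) (x *m G).
Proof.
move=> [Gs GMG]; rewrite -{1}GMG mulmxA mx_quad_tr Gs.
by rewrite mulmxA mulmxDr mulmx1 dotvDl.
Qed.

Lemma pivotal_ge0 G x : pivotal G -> 0 <= dotv (x *m G) x.
Proof. by move=> Gp; rewrite pivotal_quad// addr_ge0 ?norm2_ge0. Qed.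

Lemma pivotal_norm2_le G x : pivotal G -> norm2 (x *m G) <= dotv (x *m G) x.
Proof. by move=> Gp; rewrite pivotal_quad// lerDl. Qed.

Lemma pivotal_quad_le G x : pivotal G -> dotv (x *m G *m S) (x *m G) <= dotv (x *m G) x.
Proof. by move=> Gp; rewrite [leRHS]pivotal_quad// lerDr norm2_ge0. Qed.

Lemma pivotal_le G x : pivotal G -> dotv (x *m G) x <= norm2 x.
Proof.
move=> Gp; have := pivotal_norm2_le x Gp.
by have := dotv_le (x *m G) x ltr01; rewrite invr1 !mul1r; lra.
Qed.

Lemma row_dot (G : 'M[R]_n) i : dotv (delta_mx 0 i *m G) (delta_mx 0 i) = G i i.
Proof.
rewrite -rowE /dotv (bigD1 i)//= [X in _ + X]big1 ?addr0.
  by rewrite !mxE !eqxx mulr1.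
by move=> j /negPf ji; rewrite !mxE ji mulr0.
Qed.

Lemma pivotal_diag_ge0 G i : pivotal G -> 0 <= G i i.
Proof. by move=> Gp; rewrite -row_dot pivotal_ge0. Qed.

Lemma pivotal_row_norm2 G i : pivotal G -> norm2 (row i G) <= G i i.
Proof. by move=> Gp; rewrite rowE -[leRHS]row_dot pivotal_norm2_le. Qed.

Lemma pivotal_diag_le1 G i : pivotal G -> G i i <= 1.
Proof.
move=> Gp; rewrite -row_dot; apply: le_trans (pivotal_le _ Gp) _.
rewrite /norm2 /dotv (bigD1 i)//= [X in _ + X]big1 ?addr0 ?mxE ?eqxx ?mulr1//.
by move=> j /negPf ji; rewrite !mxE ji mulr0.
Qed.

(** The Schur complement at (j, j), one step of Gaussian elimination. *)
Definition pivot (G : 'M[R]_n) j : 'M[R]_n :=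
  G - (G j j)^-1 *: ((row j G)^T *m row j G).

Lemma pivotE G j i k : pivot G j i k = G i k - (G j j)^-1 * (G j i * G j k).
Proof. by rewrite !mxE big_ord1 !mxE. Qed.

Lemma pivot_pivotal G j : pivotal G -> 0 < G j j -> pivotal (pivot G j).
Proof.
move=> Gp g0; have [Gs GMG] := Gp; split.
  by rewrite /pivot linearB linearZ /= trmx_mul trmxK Gs.
set r := row j G; set c := (G j j)^-1; set M := 1%:M + S.
have rE : r = delta_mx 0 j *m G by rewrite /r rowE.
have E1 : G *m M *m r^T = r^T by rewrite rE trmx_mul Gs mulmxA GMG.
have E2 : r *m M *m G = r by rewrite {1}rE -!mulmxA [G *m (M *m G)]mulmxA GMG -rE.
have E3 : r *m M *m r^T = (G j j)%:M.
  rewrite [in r^T]rE trmx_mul Gs mulmxA E2.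
  by apply/matrixP => a b; rewrite !ord1 -[LHS]trace_mx11 trmx_delta /r
     -[row j G *m _]colE trace_mx11 !mxE eqxx mulr1n.
set X := c *: (r^T *m r).
have X1 : G *m M *m X = X by rewrite /X -scalemxAr mulmxA E1.
have X2 : X *m M *m G = X by rewrite /X -!scalemxAl -!mulmxA [r *m (M *m G)]mulmxA E2.
have X3 : X *m M *m X = X.
  rewrite {2}/X -scalemxAr {1}/X -!scalemxAl.
  have -> : r^T *m r *m M *m (r^T *m r) = r^T *m (r *m M *m r^T) *m r by rewrite !mulmxA.
  by rewrite E3 mul_mx_scalar -scalemxAl !scalerA mulfVK ?gt_eqF.
have -> : pivot G j = G - X by [].
by rewrite mulmxBr !mulmxBl GMG X1 X2 X3 subrr subr0.
Qed.

(** The subtracted matrix has trace |row j|^2 / G j j, which [pivotal_row_norm2] bounds by 1. *)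
Lemma pivot_trace G j : pivotal G -> 0 < G j j -> \tr G - 1 <= \tr (pivot G j).
Proof.
move=> Gp g0; rewrite /pivot linearB linearZ /= lerD2l lerN2.
rewrite ler_pdivrMl// mulr1; apply: le_trans (pivotal_row_norm2 j Gp).
by apply: eq_ler; rewrite mxtrace_mulC trace_mx11 -dotvE.
Qed.

Lemma pivot_col0 G j : G^T = G -> 0 < G j j -> forall i, pivot G j i j = 0.
Proof.
move=> Gs g0 i; have Gji : G i j = G j i by rewrite -[in LHS]Gs mxE.
by rewrite pivotE mulrCA mulVf ?gt_eqF// mulr1 Gji subrr.
Qed.

Fixpoint echelon (l : seq ('I_n * 'rV[R]_n)) : Prop :=
  if l is p :: l' then
    [/\ p.2 0 p.1 = 1, (forall q, q \in l' -> q.2 0 p.1 = 0) & echelon l']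
  else True.

(** Greedy elimination: while the trace exceeds [eta], some diagonal entry is at least eta / n, and
    pivoting there lowers the trace by at most 1. The normalised pivot row has quadratic form at
    most 1 / G j j. The last clause is the induction invariant behind [echelon]: an eliminated
    column stays zero. *)
Lemma pivots (eta : R) k G : 0 < eta -> pivotal G -> k%:R + eta < \tr G + 1 ->
  exists l, [/\ size l = k, echelon l,
    forall q, q \in l -> dotv (q.2 *m S) q.2 <= n%:R / eta &
    forall a, (forall i, G i a = 0) -> forall q, q \in l -> q.2 0 a = 0].
Proof.
move=> e0; elim: k G => [|k IH] G Gp trG; first by exists nil; split.
have {}trG : k%:R + eta < \tr G by move: trG; rewrite -natr1; lra.
have trG' : eta < \tr G by apply: le_lt_trans trG; rewrite lerDr.
have n0 : 0 < (n%:R : R).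
  rewrite ltr0n lt0n; apply/negP => /eqP n0; move: trG'.
  rewrite /mxtrace big1; first by rewrite ltNge (ltW e0).
  by case=> i ilt; exfalso; move: ilt; rewrite n0.
have [j gj] : exists j, eta / n%:R <= G j j.
  apply/existsP; rewrite -[[exists _, _]]negbK negb_exists; apply/negP => /forallP H.
  suff : \tr G <= eta by rewrite leNgt trG'.
  have -> : eta = \sum_(j < n) eta / n%:R.
    by rewrite sumr_const card_ord -[_ *+ n]mulr_natr divfK ?gt_eqF.
  by apply: ler_sum => j _; have := H j; rewrite -ltNge => /ltW.
have g0 : 0 < G j j by apply: lt_le_trans gj; rewrite divr_gt0.
have P'p := pivot_pivotal Gp g0.
have [|l [sl el ql cl]] := IH _ P'p; first by have := pivot_trace Gp g0; lra.
exists ((j, (G j j)^-1 *: row j G) :: l); split=> /=.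
- by rewrite sl.
- split=> //; first by rewrite !mxE mulVf ?gt_eqF.
  by move=> q; apply: cl => i; apply: pivot_col0 => //; case: Gp.
- move=> q; rewrite inE => /orP[/eqP -> /=|/ql//].
  rewrite -scalemxAl dotvZl dotvZr rowE.
  have := pivotal_quad_le (delta_mx 0 j) Gp; rewrite row_dot => H.
  apply: (@le_trans _ _ ((G j j)^-1 * ((G j j)^-1 * G j j))).
    by rewrite !ler_wpM2l// invr_ge0 ltW.
  by rewrite mulVf ?gt_eqF// mulr1 -[leRHS]invf_div lef_pV2 ?posrE ?divr_gt0.
- move=> a Ga q; rewrite inE => /orP[/eqP -> /=|ql'].
    by rewrite !mxE Ga mulr0.
  by apply: cl ql' => i; rewrite pivotE !Ga !mulr0 subr0.
Qed.

End Ridge.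

Section Rounding.
Variables (R : realType) (n : nat).

(** Randomised rounding: rounding up with probability [f], the fractional part of [a], is unbiased,
    so on average the squared norm grows by f (1 - f) |v|^2 and |d| equals |a|. Since f (1 - f) <=
    |a|, one of the two outcomes meets the bound. *)
Lemma round_step (e v : 'rV[R]_n) (a B : R) : norm2 v <= B ->
  exists d : int, norm2 (e + (a - d%:~R) *: v) + B * `|d|%:~R <= norm2 e + 2 * B * `|a|.
Proof.
move=> vB; pose fl := Num.floor a; pose f := a - fl%:~R.
have f0 : 0 <= f by rewrite subr_ge0 ge_floor.
have f1 : f <= 1 by rewrite lerBlDl ltW// -intrD1 floorD1_gt.
have v0 := norm2_ge0 v; have B0 : 0 <= B by lra.
have aE : a = fl%:~R + f by rewrite /f addrCA subrr addr0.
have H : (1 - f) * (`|fl|%:~R : R) + f * `|fl + 1|%:~R = `|a| /\ f * (1 - f) <= `|a|.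
  have [a0|a0] := lerP 0 a.
    have fl0 : 0 <= fl by rewrite floor_ge0.
    rewrite !ger0_norm// ?addr_ge0// intrD1; split; first by rewrite [in RHS]aE; ring.
    have : 0 <= (fl%:~R : R) by rewrite ler0z.
    rewrite aE; nra.
  have fl0 : fl + 1 <= 0 by rewrite -ltzD1 ltrD2r floor_lt0.
  have fl0' : fl <= 0 by apply: le_trans fl0; rewrite lerDl.
  rewrite (ler0_norm fl0) (ler0_norm fl0') (ltr0_norm a0) !intrN intrD1; split.
    by rewrite [in RHS]aE; ring.
  have : (fl%:~R : R) + 1 <= 0 by rewrite -intrD1 lerz0.
  rewrite aE; nra.
case: H => H1 H2.
set V0 := norm2 (e + (a - fl%:~R) *: v) + B * `|fl|%:~R.
set V1 := norm2 (e + (a - (fl + 1)%:~R) *: v) + B * `|fl + 1|%:~R.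
have HV : (1 - f) * V0 + f * V1 <= norm2 e + 2 * B * `|a|.
  rewrite /V0 /V1 !norm2D !norm2Z !dotvZr intrD1 -/f.
  have -> : a - (fl%:~R + 1) = f - 1 by rewrite /f; ring.
  have -> : (1 - f) * (norm2 e + 2 * (f * dotv e v) + f ^+ 2 * norm2 v + B * `|fl|%:~R) +
    f * (norm2 e + 2 * ((f - 1) * dotv e v) + (f - 1) ^+ 2 * norm2 v + B * `|fl + 1|%:~R)
    = norm2 e + f * (1 - f) * norm2 v + B * ((1 - f) * `|fl|%:~R + f * `|fl + 1|%:~R) by ring.
  rewrite H1; have : f * (1 - f) * norm2 v <= `|a| * B.
    by apply: ler_pM => //; rewrite mulr_ge0// subr_ge0.
  lra.
have [le0|gt0] := lerP V0 (norm2 e + 2 * B * `|a|); first by exists fl.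
exists (fl + 1); rewrite -/V1 leNgt; apply/negP => gt1.
move: (norm2 e + _) V0 V1 HV gt0 gt1 => N V0 V1 HV gt0 gt1.
have [f00|fn0] := eqVneq f 0; first by move: HV; rewrite f00; lra.
have fp : 0 < f by rewrite lt_neqAle eq_sym fn0.
have : 0 < f * (V1 - N) by rewrite mulr_gt0// subr_gt0.
have : 0 <= (1 - f) * (V0 - N) by apply: mulr_ge0; rewrite subr_ge0// ltW.
lra.
Qed.

(** One potential carries both the error and the size of the coefficients. The bound depends on the
    sum of the |a i| and not on the number of vectors, which here is a number of chunks. *)
Lemma rounding (I : finType) (a : I -> R) (v : I -> 'rV[R]_n) (B : R) :
  (forall i, norm2 (v i) <= B) ->
  exists c : I -> int, norm2 (\sum_i (a i - (c i)%:~R) *: v i)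
    + B * \sum_i `|c i|%:~R <= 2 * B * \sum_i `|a i|.
Proof.
move=> vB.
suff H (r : seq I) : uniq r -> exists c : I -> int,
  norm2 (\sum_(i <- r) (a i - (c i)%:~R) *: v i)
    + B * \sum_(i <- r) `|c i|%:~R <= 2 * B * \sum_(i <- r) `|a i|.
  by exact: H (index_enum_uniq I).
elim: r => [|i r IH] /=.
  by exists (fun=> 0); rewrite !big_nil !mulr0 addr0 /norm2 /dotv big1// => i _; rewrite mxE mul0r.
case/andP=> ir /IH [c Hc].
have [d Hd] := round_step (\sum_(i <- r) (a i - (c i)%:~R) *: v i) (a i) (vB i).
exists (fun j => if j == i then d else c j); rewrite !big_cons eqxx.
have ne j : j \in r -> (j == i) = false.
  by move=> jr; apply/negbTE; apply: contraNneq ir => <-.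
have -> : \sum_(j <- r) (a j - (if j == i then d else c j)%:~R) *: v j =
          \sum_(j <- r) (a j - (c j)%:~R) *: v j by apply: eq_big_seq => j /ne ->.
have -> : \sum_(j <- r) `|if j == i then d else c j|%:~R =
          \sum_(j <- r) `|c j|%:~R :> R by apply: eq_big_seq => j /ne ->.
rewrite [in norm2 _]addrC; lra.
Qed.

End Rounding.

Lemma norm_le_amgm (R : realType) (b A : R) : 0 < A -> `|b| <= b ^+ 2 / (2 * A) + A / 2.
Proof.
move=> A0; rewrite -[in leRHS](real_normK (num_real b)).
have A2 : 0 < 2 * A by rewrite mulr_gt0.
rewrite -(ler_pM2r A2) [leRHS]mulrDl mulfVK ?gt_eqF//.
by have := sqr_ge0 (`|b| - A); rewrite sqrrB; lra.
Qed.

(** * Chunks and their covariance *)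

Section Box.
Variables (R : realType) (n L : nat).
Local Notation Z := {ffun 'I_n -> 'I_L}.

Definition box_int (z : Z) : 'rV[int]_n := \row_i (z i : nat)%:Z.
Definition box_diff (z z0 : Z) : 'rV[R]_n := map_mx intr (box_int z - box_int z0).

Lemma box_diffE z z0 i : box_diff z z0 0 i = (z i)%:R - (z0 i)%:R.
Proof. by rewrite !mxE intrB. Qed.

Lemma norm2_box_diff z z0 : norm2 (box_diff z z0) <= n%:R * L%:R ^+ 2.
Proof.
rewrite mulr_natl -[X in _ *+ X](card_ord n) -sumr_const /norm2 /dotv; apply: ler_sum => i _.
rewrite box_diffE -expr2 -[leLHS]real_normK ?num_real// ler_pXn2r ?nnegrE ?ler0n//.
have := ltn_ord (z i); have := ltn_ord (z0 i); rewrite -!(ltr_nat R).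
have := ler0n R (z i); have := ler0n R (z0 i).
by rewrite ler_norml; lra.
Qed.

Lemma card_window (F : nat) (b t : R) : 2 * t + 1 <= F%:R ->
  (#|[set a : 'I_L | (`|a%:R - b| <= t)%R]| <= F)%N.
Proof.
move=> tF; set A := [set a : 'I_L | _].
have [->|[a1 a1A]] := set_0Vmem A; first by rewrite cards0.
pose a0 := [arg min_(a < a1 in A) (a : nat)].
have [a0A mina] : a0 \in A /\ forall a, a \in A -> (a0 <= a)%N.
  by rewrite /a0; case: arg_minnP => // a aA H; split.
rewrite cardE -(size_map (fun a : 'I_L => (a - a0)%N)) -(size_iota 0 F).
apply: uniq_leq_size.
  rewrite map_inj_in_uniq ?enum_uniq// => a b'; rewrite !mem_enum => aA bA E.
  by apply: val_inj; rewrite /= -(subnK (mina _ aA)) E subnK// mina.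
move=> k /mapP[a]; rewrite mem_enum => aA ->; rewrite mem_iota add0n /=.
rewrite -(ltr_nat R) natrB ?mina//; apply: lt_le_trans tF.
move: a0A aA; rewrite !inE !ler_norml => /andP[H1 H2] /andP[H3 H4]; lra.
Qed.

Definition slab (l : seq ('I_n * 'rV[R]_n)) (z0 : Z) (t : R) : {set Z} :=
  [set z | all (fun q => `|dotv q.2 (box_diff z z0)| <= t) l].

(** Once the other coordinates are fixed, each echelon vector leaves its pivot coordinate at most
    [F] of the [L] values. In the injection [f] the coordinate [j] is overwritten by a free value
    and its old value recorded: the later vectors vanish at [j] and do not see the change, and the
    old value lies in a window fixed by the rest. *)
Lemma card_slab (F : nat) l z0 (t : R) : 2 * t + 1 <= F%:R -> echelon l ->
  (#|slab l z0 t| * L ^ size l <= F ^ size l * L ^ n)%N.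
Proof.
move=> tF; elim: l => [_|[j xi] l IH] /=.
  rewrite !expn0 muln1 mul1n; apply: leq_trans (max_card _) _.
  by rewrite card_ffun !card_ord.
case=> xij lj /IH {}IH.
suff H : (#|slab ((j, xi) :: l) z0 t| * L <= F * #|slab l z0 t|)%N.
  rewrite !expnS mulnA; apply: leq_trans (leq_mul H (leqnn _)) _.
  by rewrite -!mulnA leq_mul2l IH orbT.
pose upd (z : Z) (a : 'I_L) : Z := [ffun i => if i == j then a else z i].
pose gam (z : Z) : R := \sum_(i | i != j) xi 0 i * box_diff z z0 0 i - (z0 j)%:R.
pose Y := [set p : Z * 'I_L | (p.1 \in slab l z0 t) && (`|p.2%:R - - gam p.1| <= t)].
have cY : (#|Y| <= F * #|slab l z0 t|)%N.
  rewrite -sum1_card.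
  under eq_bigl do rewrite inE.
  rewrite -(pair_big_dep (fun z => z \in slab l z0 t)
     (fun z (a : 'I_L) => `|a%:R - - gam z| <= t) (fun _ _ => 1%N)) /=.
  rewrite mulnC -sum_nat_const; apply: leq_sum => z _.
  rewrite sum1_card; apply: leq_trans (card_window (- gam z) tF).
  by rewrite leq_eqVlt; apply/orP; left; apply/eqP; apply: eq_card => a; rewrite !inE.
apply: leq_trans cY; rewrite -[X in (_ * X)%N]card_ord -cardsT -cardsX.
pose f (p : Z * 'I_L) := (upd p.1 p.2, p.1 j).
have f_inj : injective f.
  move=> [z a] [z' a'] [] /ffunP E Ej; congr (_, _).
    apply/ffunP => i; have := E i; rewrite !ffunE; case: (eqVneq i j) => [-> _|_ ->//].
    exact: Ej.
  by have := E j; rewrite !ffunE eqxx.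
rewrite -[X in (X <= _)%N](card_imset _ f_inj); apply: subset_leq_card.
apply/fintype.subsetP => y /finset.imsetP[[z a] + ->].
rewrite !inE andbT /= => /andP[zx zl]; apply/andP; split.
  apply/allP => q ql; have := allP zl q ql; congr (`|_| <= _).
  apply: eq_bigr => i _; rewrite !box_diffE ffunE; case: eqP => [->|//].
  by rewrite (lj q ql) !mul0r.
move: zx; congr (`|_| <= _); rewrite /dotv (bigD1 j)//= xij mul1r box_diffE opprK /gam.
rewrite addrAC addrA; congr (_ - _); congr (_ + _); apply: eq_bigr => i /negPf ij.
by rewrite !box_diffE ffunE ij.
Qed.

(** Second moments about the chunk [z0] rather than about the mean, because [shift_stable] concerns
    differences of two chunks of [C]. *)
Definition covm (C : {set Z}) (z0 : Z) : 'M[R]_n :=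
  #|C|%:R^-1 *: \sum_(z in C) (box_diff z z0)^T *m box_diff z z0.

Lemma covm_sym C z0 : (covm C z0)^T = covm C z0.
Proof.
rewrite /covm linearZ linear_sum /=; congr (_ *: _); apply: eq_bigr => z _.
by rewrite trmx_mul trmxK.
Qed.

Lemma mul_covm C z0 x : x *m covm C z0 =
  \sum_(z in C) (#|C|%:R^-1 * dotv x (box_diff z z0)) *: box_diff z z0.
Proof.
rewrite /covm -scalemxAr mulmx_sumr scaler_sumr; apply: eq_bigr => z _.
rewrite mulmxA -scalerA; congr (_ *: _).
by rewrite [X in X *m box_diff z z0]mx11_scalar mul_scalar_mx dotvE.
Qed.

Lemma quad_covm C z0 x : dotv (x *m covm C z0) x =
  #|C|%:R^-1 * \sum_(z in C) dotv x (box_diff z z0) ^+ 2.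
Proof.
rewrite mul_covm dotv_suml mulr_sumr; apply: eq_bigr => z _.
by rewrite dotvZl -mulrA (dotvC (box_diff _ _)) expr2.
Qed.

Lemma quad_covm_ge0 C z0 x : 0 <= dotv (x *m covm C z0) x.
Proof.
rewrite quad_covm mulr_ge0 ?invr_ge0 ?ler0n//; apply: sumr_ge0 => z _; exact: sqr_ge0.
Qed.

(** For the least [k] with tr H <= k + eta, [pivots] yields [k] echelon vectors whose second moment
    over [C] is at most n / eta. By Chebyshev's inequality half of [C] lies in the slab where all of
    them are at most (F - 1) / 2, and [card_slab] counts that slab: a large trace forces [C] to be
    small. *)
Lemma trace_ridge_le (C : {set Z}) z0 (eta : R) (F : nat) : 0 < eta -> (0 < F)%N ->
  8 * n%:R ^+ 2 / eta <= (F%:R - 1) ^+ 2 ->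
  exists k : nat, \tr (ridge (covm C z0)) <= k%:R + eta /\
    (#|C| * L ^ k <= 2 * F ^ k * L ^ n)%N.
Proof.
move=> e0 F0 HF; set H := ridge _.
have Hp : pivotal (covm C z0) H := ridge_pivotal (covm_sym C z0) (@quad_covm_ge0 C z0).
have exk : exists k : nat, \tr H <= k%:R + eta.
  exists n; apply: (@le_trans _ _ n%:R); last by rewrite lerDl ltW.
  rewrite -[leRHS]mulr1 mulr_natl -[X in _ *+ X](card_ord n) -sumr_const.
  by apply: ler_sum => i _; exact: pivotal_diag_le1 (quad_covm_ge0 C z0) _ _ Hp.
have [k trk mink] := ex_minnP exk; exists k; split=> //.
have Cn : (#|C| <= L ^ n)%N.
  by apply: leq_trans (max_card _) _; rewrite card_ffun !card_ord.
case: k => [|k] in trk mink *.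
  by rewrite !expn0 !muln1; apply: leq_trans Cn _; rewrite leq_pmull.
have trH : k%:R + eta < \tr H by rewrite ltNge; apply/negP => /mink; rewrite ltnn.
have kn : (k < n)%N.
  rewrite -(ltr_nat R); apply: (@lt_le_trans _ _ (\tr H)).
    by apply: le_lt_trans trH; rewrite lerDl ltW.
  rewrite -[leRHS]mulr1 mulr_natl -[X in _ *+ X](card_ord n) -sumr_const.
  by apply: ler_sum => i _; exact: pivotal_diag_le1 (quad_covm_ge0 C z0) _ _ Hp.
have n0 : 0 < (n%:R : R) by rewrite ltr0n; case: (n) kn.
have [|l [sl el ql _]] := pivots (quad_covm_ge0 C z0) (k := k.+1) e0 Hp.
  by rewrite -natr1; lra.
pose t : R := (F%:R - 1) / 2.
have t2 : 2 * n%:R ^+ 2 / eta <= t ^+ 2.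
  by rewrite /t expr_div_n ler_pdivlMr//; move: HF; rewrite -!mulrA; lra.
have t0 : 0 <= t by rewrite divr_ge0// subr_ge0 ler1n.
have cX : (#|slab l z0 t| * L ^ k.+1 <= F ^ k.+1 * L ^ n)%N.
  by rewrite -sl; apply: card_slab => //; rewrite /t; lra.
suff half : (#|C| <= 2 * #|slab l z0 t|)%N.
  apply: leq_trans (leq_mul half (leqnn _)) _.
  by rewrite -!mulnA leq_mul2l cX.
have [C0|Cpos] := posnP #|C|; first by rewrite C0.
have CR : 0 < (#|C|%:R : R) by rewrite ltr0n.
have t2p : 0 < t ^+ 2.
  by apply: lt_le_trans t2; rewrite divr_gt0// mulr_gt0// exprn_gt0.
(* A chunk outside the slab violates one of the [k.+1] constraints and contributes at least [t ^+ 2]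
   to the sum of squares. *)
have bad : #|C :\: slab l z0 t|%:R * t ^+ 2 <= k.+1%:R * (#|C|%:R * (n%:R / eta)).
  apply: (@le_trans _ _ (\sum_(z in C) \sum_(q <- l) dotv q.2 (box_diff z z0) ^+ 2)).
    rewrite [leRHS](big_setID (slab l z0 t)) /= -[leLHS]add0r lerD//.
      by apply: sumr_ge0 => z _; apply: sumr_ge0 => q _; exact: sqr_ge0.
    rewrite -sum1_card natr_sum mulr_suml; apply: ler_sum => z.
    rewrite !inE mul1r => /andP[/allPn[q qin nq] _].
    rewrite (big_rem q)//= -[leLHS]addr0 lerD//; last first.
      by apply: sumr_ge0 => ? _; exact: sqr_ge0.
    rewrite -[leRHS]real_normK ?num_real// ler_pXn2r ?nnegrE//.
    by rewrite ltW// ltNge.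
  rewrite exchange_big /= -sl -sum1_size natr_sum mulr_suml.
  rewrite big_seq [leRHS]big_seq; apply: ler_sum => q /ql.
  by rewrite quad_covm mul1r ler_pdivrMl.
have : (#|C :\: slab l z0 t|%:R : R) * 2 <= #|C|%:R.
  rewrite -(ler_pM2r t2p); apply: (@le_trans _ _ (#|C|%:R * (2 * n%:R ^+ 2 / eta))); last first.
    by rewrite ler_pM2l.
  have : (k.+1%:R : R) <= n%:R by rewrite ler_nat.
  have q0 : 0 <= #|C|%:R * (n%:R / eta) by rewrite mulr_ge0 ?divr_ge0 ?ltW.
  move/(ler_wpM2r q0) => H1; have := le_trans bad H1.
  have -> : #|C|%:R * (2 * n%:R ^+ 2 / eta) = 2 * (n%:R * (#|C|%:R * (n%:R / eta))) by ring.
  by rewrite mulrAC; lra.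
rewrite -(ler_nat R) natrM.
have : (#|C|%:R : R) <= #|slab l z0 t|%:R + #|C :\: slab l z0 t|%:R.
  rewrite -natrD ler_nat -(cardsID (slab l z0 t) C) leq_add2r subset_leq_card//.
  by apply/fintype.subsetP => z; rewrite inE => /andP[].
lra.
Qed.

(** With x = y H, the vector y - y H = x Sigma is the mean of <x, d> d over the differences d. The
    mean of |<x, d>| is at most [A], because x Sigma x^T <= |y|^2. Rounding these coefficients gives
    the combination, and their total size controls how much invariance is lost. *)
Lemma integer_combination (C : {set Z}) z0 (y : 'rV[int]_n) (A : R) :
  (0 < n)%N -> (0 < L)%N -> (0 < #|C|)%N -> 0 < A ->
  norm2 (map_mx intr y : 'rV[R]_n) <= A ^+ 2 ->
  let Y := map_mx intr y : 'rV[R]_n in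
  exists c : Z -> int,
    norm2 (map_mx intr (\sum_(z in C) c z *: (box_int z - box_int z0))
           - (Y - Y *m ridge (covm C z0))) <= 2 * (n%:R * L%:R ^+ 2) * A /\
    \sum_(z in C) `|c z|%:~R <= 2 * A.
Proof.
move=> n0 L0 C0 A0 yA Y; set H := ridge _; set x := Y *m H.
have Hp : pivotal (covm C z0) H := ridge_pivotal (covm_sym C z0) (@quad_covm_ge0 C z0).
have CR : 0 < (#|C|%:R : R) by rewrite ltr0n.
pose a z := if z \in C then #|C|%:R^-1 * dotv x (box_diff z z0) else 0.
pose v z := if z \in C then box_diff z z0 else 0.
pose B : R := n%:R * L%:R ^+ 2.
have B0 : 0 < B by rewrite mulr_gt0 ?exprn_gt0 ?ltr0n.
have [z|c Hc] := @rounding R n Z a v B.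
  rewrite /v; case: ifP => _; first exact: norm2_box_diff.
  by rewrite /norm2 /dotv big1 ?(ltW B0)// => i _; rewrite mxE mul0r.
have sa : \sum_z `|a z| <= A.
  have q : dotv (x *m covm C z0) x <= A ^+ 2.
    apply: le_trans yA; apply: le_trans (pivotal_le (quad_covm_ge0 C z0) _ Hp).
    exact: pivotal_quad_le.
  apply: (@le_trans _ _ (\sum_(z in C) #|C|%:R^-1 *
      (dotv x (box_diff z z0) ^+ 2 / (2 * A) + A / 2))).
    rewrite [leRHS]big_mkcond; apply: ler_sum => z _; rewrite /a; case: ifP => _; last by rewrite normr0.
    rewrite normrM ger0_norm ?invr_ge0 ?ler0n// ler_pM2l ?invr_gt0//.
    exact: norm_le_amgm.
  rewrite -mulr_sumr big_split /= -mulr_suml sumr_const -[(A / 2) *+ _]mulr_natl mulrDr.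
  rewrite mulKf ?gt_eqF// mulrA -quad_covm.
  have : dotv (x *m covm C z0) x / (2 * A) <= A ^+ 2 / (2 * A) by rewrite ler_pM2r ?invr_gt0 ?mulr_gt0.
  have -> : A ^+ 2 / (2 * A) = A / 2 by field; rewrite gt_eqF.
  lra.
have sc0 : 0 <= \sum_z (`|c z|%:~R : R) by apply: sumr_ge0 => z _; rewrite ler0z.
have Hc' : 2 * B * \sum_z `|a z| <= 2 * B * A by rewrite ler_wpM2l// mulr_ge0// ltW.
have Yx : Y - x = \sum_z a z *: v z.
  have -> : Y = x *m (1%:M + covm C z0).
    by rewrite /x -mulmxA mulVmx ?mulmx1// ridge_unit//; exact: quad_covm_ge0.
  rewrite mulmxDr mulmx1 addrAC subrr add0r mul_covm big_mkcond.
  by apply: eq_bigr => z _; rewrite /a /v; case: ifP => _//; rewrite scaler0.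
exists c; split.
  have -> : map_mx intr (\sum_(z in C) c z *: (box_int z - box_int z0)) - (Y - x) =
     - (\sum_z (a z - (c z)%:~R) *: v z).
    rewrite Yx; under [in RHS]eq_bigr do rewrite scalerBl.
    rewrite sumrB opprB; congr (_ - _).
    rewrite (raddf_sum (map_mx intr)) big_mkcond; apply: eq_bigr => z _.
    rewrite /v; case: ifP => _; last by rewrite scaler0.
    by apply/rowP => i; rewrite mxE [RHS]mxE box_diffE !mxE /= intrM intrB.
  rewrite norm2N; have : 0 <= B * \sum_z (`|c z|%:~R : R) by rewrite mulr_ge0 ?(ltW B0).
  by rewrite -/B; lra.
apply: (@le_trans _ _ (\sum_z `|c z|%:~R)).
  by rewrite [leLHS]big_mkcond; apply: ler_sum => z _; case: ifP => _//; rewrite ler0z.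
rewrite -(ler_pM2l B0); have := norm2_ge0 (\sum_z (a z - (c z)%:~R) *: v z); lra.
Qed.

End Box.

(** * Streams with prescribed frequency vectors, and the law after random chunks *)

Section Encode.
Variable n : nat.
Implicit Types (s : stream n) (y : 'rV[int]_n).

Definition encode y : stream n :=
  flatten [seq nseq `|y 0%R i|%N (i, 0 <= y 0 i) | i <- enum 'I_n].

Lemma frequency_nil : frequency ([::] : stream n) = 0.
Proof. by apply/rowP => i; rewrite !mxE big_nil. Qed.

Lemma frequency_cat s1 s2 : frequency (s1 ++ s2) = frequency s1 + frequency s2.
Proof. by apply/rowP => i; rewrite !mxE big_cat. Qed.

Lemma frequency_encode y : frequency (encode y) = y.
Proof.
apply/rowP => j; rewrite mxE /encode big_flatten big_map big_enum /= (bigD1 j)//=.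
rewrite [X in _ + X]big1 ?addr0 => [|i /negPf ij]; last first.
  rewrite big1_seq// => u /andP[ui]; rewrite mem_nseq => /andP[_ /eqP E].
  by move: ui; rewrite E /= ij.
rewrite big_nseq_cond /= eqxx /update_sign /=.
have -> : forall k (c : int), iter k (+%R c) 0 = c *+ k.
  by elim=> [|k IH] c /=; rewrite ?mulr0n// IH mulrS.
case: ifPn => [y0|]; rewrite ?pmulrn.
  by rewrite -[LHS]/(_ *~ _%:Z) intz gez0_abs.
by rewrite -ltNge => y0; rewrite -[LHS]/(_ *~ _%:Z) mulNrz intz ltz0_abs// opprK.
Qed.

Lemma size_encode y (b : nat) : (forall i, `|y 0%R i|%N <= b)%N -> (size (encode y) <= n * b)%N.
Proof.
move=> yb; rewrite /encode size_flatten /shape -map_comp sumnE big_map big_enum /=.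
rewrite -[X in (_ <= X * _)%N]card_ord -sum_nat_const; apply: leq_sum => i _.
by rewrite size_nseq.
Qed.

Variables (R : realType) (L : nat).
Local Notation Z := {ffun 'I_n -> 'I_L}.

(** A list with multiplicities, so that its average is the expectation over independent uniform
    chunks. *)
Fixpoint prefixes (t : nat) : seq (stream n) :=
  if t is t'.+1 then [seq s ++ encode (box_int z) | s <- prefixes t', z <- enum (Finite.clone _ Z)]
  else [:: [::]].

Lemma size_prefixes t : size (prefixes t) = (#|{: Z}| ^ t)%N.
Proof. by elim: t => //= t IH; rewrite size_allpairs IH expnSr cardE. Qed.

Lemma prefix_bounds t s : s \in prefixes t ->
  (size s <= t * (n * L))%N /\ forall i, 0 <= frequency s 0 i <= (t * L)%:Z.
Proof.
elim: t s => [|t IH] s /=.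
  by rewrite inE => /eqP ->; split=> // i; rewrite frequency_nil mxE lexx.
case/allpairsP => -[s' z] /= [/IH[ss fs] _ ->]; split.
  rewrite size_cat mulSn addnC leq_add//; apply: size_encode => i.
  by rewrite mxE absz_nat ltnW.
move=> i; rewrite frequency_cat frequency_encode mxE [X in _ + X]mxE.
have /andP[f0 f1] := fs i; rewrite addr_ge0//= mulSn addnC PoszD lerD//.
by rewrite lez_nat ltnW.
Qed.

Variable Q : nat.
Hypothesis Q1 : (1 < Q)%N.
Local Notation G := 'rV['Z_Q]_n.

(** Frequencies are reduced modulo [Q] because the entropy argument needs a finite group; nothing is
    lost as long as no entry wraps around. *)
Definition proj y : G := map_mx intr y.

Lemma projD y y' : proj (y + y') = proj y + proj y'.
Proof. exact: map_mxD. Qed.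

Lemma projN y : proj (- y) = - proj y.
Proof. exact: map_mxN. Qed.

Lemma projB y y' : proj (y - y') = proj y - proj y'.
Proof. exact: map_mxB. Qed.

Lemma proj0 : proj 0 = 0.
Proof. exact: map_mx0. Qed.

(* The representative with entries in [-X, Q - X). *)
Definition lift (X : nat) (u : G) : 'rV[int]_n :=
  \row_i (((u 0 i + X%:R)%R : 'Z_Q) : nat)%:Z - (const_mx X%:Z).

Lemma lift_proj X y : (forall i, - X%:Z <= y 0 i < Q%:Z - X%:Z) -> lift X (proj y) = y.
Proof.
move=> yX; apply/rowP => i; have /andP[y0 y1] := yX i.
have k0 : 0 <= y 0 i + X%:Z by rewrite -lerBlDr sub0r.
have kE : ((`|(y 0 i + X%:Z)%R|)%N : int) = y 0 i + X%:Z by rewrite gez0_abs.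
have E : proj y 0 i + X%:R = (`|(y 0 i + X%:Z)%R|)%N%:R :> 'Z_Q.
  by rewrite /proj mxE -[RHS]/(Posz `|_|%N)%:~R kE intrD.
rewrite /lift mxE [X in X + _]mxE E mxE [const_mx _ _ _]mxE.
rewrite val_Zp_nat// modn_small; first by rewrite kE addrK.
by rewrite -ltz_nat kE; move: y1; rewrite ltrBrDr.
Qed.

Variable A : stream_alg R n.

Definition run_state (s : stream n) : state A := foldl (@step R n A) (init A) s.
Definition chunk_step (t : state A) (z : Z) : state A :=
  foldl (@step R n A) t (encode (box_int z)).
Definition chunk_shift (z : Z) : G := proj (box_int z).
Definition pmf0 (t : state A) (u : G) : R := ((t == init A) && (u == 0))%:R.
Definition pmf_at t := iter t (next chunk_shift chunk_step) pmf0.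

Lemma pmf0_pmf : is_pmf pmf0.
Proof.
split; first by move=> t u; rewrite ler0n.
rewrite (bigD1 (init A))//= [X in _ + X]big1 ?addr0 => [|t /negPf ti].
  rewrite /marg (bigD1 0)//= [X in _ + X]big1 ?addr0 => [|u /negPf u0].
    by rewrite /pmf0 !eqxx.
  by rewrite /pmf0 u0 andbF.
by apply: big1 => u _; rewrite /pmf0 ti.
Qed.

Hypothesis L0 : (0 < L)%N.

Lemma card_chunks : (0 < #|{: Z}|)%N.
Proof. by rewrite card_ffun !card_ord expn_gt0 L0. Qed.

Lemma pmf_at_pmf t : is_pmf (pmf_at t).
Proof. apply: iter_next_pmf; [exact: card_chunks|exact: pmf0_pmf]. Qed.

(** Identifies [pmf_at], obtained by iterating the abstract step, with the joint law of the state
    and the reduced frequency vector after [t] uniform chunks. *)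
Lemma sum_prefixes t (phi : state A -> G -> R) :
  (size (prefixes t))%:R^-1 * \sum_(s <- prefixes t) phi (run_state s) (proj (frequency s)) =
  \sum_a \sum_u pmf_at t a u * phi a u.
Proof.
elim: t phi => [|t IH] phi.
  rewrite /= big_seq1 invr1 mul1r frequency_nil proj0 (bigD1 (init A))//=.
  rewrite [X in _ + X]big1 ?addr0 => [|a /negPf ai]; last first.
    by apply: big1 => u _; rewrite /pmf_at /= /pmf0 ai mul0r.
  rewrite (bigD1 0)//= [X in _ + X]big1 ?addr0 => [|u /negPf u0].
    by rewrite /pmf_at /= /pmf0 !eqxx mul1r.
  by rewrite /pmf_at /= /pmf0 u0 andbF mul0r.
have cZ : (#|{: Z}|%:R : R) != 0 by rewrite pnatr_eq0 -lt0n card_chunks.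
rewrite size_prefixes expnSr -size_prefixes natrM invfM /= big_flatten big_map /=.
pose phi' a u := #|{: Z}|%:R^-1 * \sum_z phi (chunk_step a z) (u + chunk_shift z).
transitivity ((size (prefixes t))%:R^-1 *
   \sum_(s <- prefixes t) phi' (run_state s) (proj (frequency s))).
  rewrite -mulrA /phi' -mulr_sumr; congr (_ * (_ * _)).
  apply: eq_bigr => s _; rewrite big_map big_enum /=; apply: eq_bigr => z _.
  by rewrite /run_state foldl_cat frequency_cat frequency_encode projD.
rewrite IH sum_next mulr_sumr; apply: eq_bigr => a _.
rewrite exchange_big mulr_sumr; apply: eq_bigr => u _ /=.
by rewrite /phi' mulrCA mulr_sumr.
Qed.

End Encode.

(** * Discrete Gaussian noise *)

Section Window.
Variables (R : realType) (s : nat).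
Hypothesis s0 : (0 < s)%N.

Definition gker (x : R) : R := expR (- (x ^+ 2 / (2 * s%:R ^+ 2))).

Lemma gker_gt0 x : 0 < gker x.
Proof. exact: expR_gt0. Qed.

Lemma gker_sym x : gker (- x) = gker x.
Proof. by rewrite /gker sqrrN. Qed.

Lemma s2_gt0 : 0 < 2 * s%:R ^+ 2 :> R.
Proof. by rewrite mulr_gt0// exprn_gt0// ltr0n. Qed.

Lemma gker_le x y : `|x| <= `|y| -> gker y <= gker x.
Proof.
move=> xy; rewrite ler_expR lerN2 ler_pM2r ?invr_gt0 ?s2_gt0//.
by rewrite -(real_normK (num_real x)) -(real_normK (num_real y)) ler_pXn2r ?nnegrE.
Qed.

(** Raising the shift from [a] to [a.+1] exchanges the kernel value at M - a for that at -(M + a +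
    1), which is farther from 0. *)
Lemma window_le_nat (M a : nat) :
  \sum_(k < (2 * M).+1) gker (k%:R - M%:R - a%:R) <= \sum_(k < (2 * M).+1) gker (k%:R - M%:R).
Proof.
elim: a => [|a IH]; first by under eq_bigr do rewrite subr0.
apply: le_trans IH; rewrite -!(big_mkord xpredT (fun k => gker (k%:R - M%:R - _))).
rewrite big_nat_recl// [leRHS]big_nat_recr//= [leRHS]addrC lerD//; last first.
  apply: ler_sum => k _; apply: eq_ler; congr gker.
  by rewrite -[k.+1%:R]natr1 -[a.+1%:R]natr1; ring.
apply: gker_le; have a0 := ler0n R a; have M0 := ler0n R M.
have -> : 0 - M%:R - a.+1%:R = - (M%:R + (a%:R + 1)) :> R by rewrite -natr1; ring.
rewrite natrM normrN [leRHS]ger0_norm; last by lra.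
by rewrite ler_norml; lra.
Qed.

Lemma window_le (M : nat) (a : int) :
  \sum_(k < (2 * M).+1) gker (k%:R - M%:R - a%:~R) <= \sum_(k < (2 * M).+1) gker (k%:R - M%:R).
Proof.
case: a => a; first exact: window_le_nat.
apply: le_trans (window_le_nat M a.+1).
rewrite (reindex_inj rev_ord_inj) /=; apply: ler_sum => k _; apply: eq_ler.
rewrite -gker_sym; congr gker; rewrite subSS natrB; last by rewrite -ltnS.
by rewrite NegzE intrN natrM; ring.
Qed.

End Window.

Section Noise.
Variables (R : realType) (n Q s M X : nat).
Hypotheses (s0 : (0 < s)%N) (Q1 : (1 < Q)%N) (MX : (M <= X)%N) (XQ : (X + M < Q)%N).
Local Notation G := 'rV['Z_Q]_n.

Definition clift (c : 'Z_Q) : int := (((c + X%:R)%R : 'Z_Q) : nat)%:Z - X%:Z.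

Lemma liftE (u : G) i : lift X u 0 i = clift (u 0 i).
Proof. by rewrite !mxE. Qed.

(** The Gaussian weight is cut off at [M] so that noise plus displacement never wraps around modulo
    [Q]. *)
Definition wt1 (c : 'Z_Q) : R := if `|clift c| <= M%:Z then gker s (clift c)%:~R else 0.
Definition tot1 : R := \sum_c wt1 c.
Definition noise1 c : R := wt1 c / tot1.

Lemma sum_clift (F : int -> R) : (forall l : int, M%:Z < `|l| -> F l = 0) ->
  \sum_(c : 'Z_Q) F (clift c) = \sum_(k < (2 * M).+1) F (k%:Z - M%:Z).
Proof.
move=> F0.
transitivity (\sum_(c : 'Z_Q) F ((c : nat)%:Z - X%:Z)).
  rewrite [RHS](reindex (fun c : 'Z_Q => c + X%:R))//=.
  by exists (fun c => c - X%:R) => c _; rewrite ?addrK ?subrK.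
rewrite -(big_mkord xpredT (fun k => F (k%:Z - X%:Z))).
have -> : (Zp_trunc Q).+2 = Q by rewrite Zp_cast.
rewrite (@big_cat_nat _ _ _ (X - M)%N)//=; last by lia.
rewrite [X in X + _]big_nat_cond big1 ?add0r => [|k /andP[/andP[_ kX] _]]; last first.
  by apply: F0; lia.
rewrite (@big_cat_nat _ _ _ (X + M).+1)//=; last by lia.
rewrite [X in _ + X]big_nat_cond [X in _ + X]big1 ?addr0 => [|k /andP[/andP[kX _] _]]; last first.
  by apply: F0; lia.
have -> : (X + M).+1 = ((2 * M).+1 + (X - M))%N by lia.
rewrite -{1}[(X - M)%N]add0n big_addn addnK big_mkord; apply: eq_bigr => k _; congr F; lia.
Qed.

Lemma wt1_ge0 c : 0 <= wt1 c.
Proof. by rewrite /wt1; case: ifP => // _; rewrite ltW ?gker_gt0. Qed.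

Lemma sum_wt1 (F : int -> R) :
  \sum_c wt1 c * F (clift c) = \sum_(k < (2 * M).+1) gker s (k%:R - M%:R) * F (k%:Z - M%:Z).
Proof.
rewrite -/(wt1 _); have := @sum_clift (fun l => (if `|l| <= M%:Z then gker s l%:~R else 0) * F l).
rewrite /wt1 => ->; last by move=> l; rewrite ltNge => /negPf ->; rewrite mul0r.
apply: eq_bigr => k _; have -> : `|k%:Z - M%:Z| <= M%:Z by have := ltn_ord k; lia.
by rewrite intrB.
Qed.

Lemma tot1E : tot1 = \sum_(k < (2 * M).+1) gker s (k%:R - M%:R).
Proof.
have := sum_wt1 (fun=> 1); rewrite /tot1 => E.
by under eq_bigr do rewrite -[wt1 _]mulr1; rewrite E; apply: eq_bigr => k _; rewrite mulr1.
Qed.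

Lemma tot1_gt0 : 0 < tot1.
Proof.
rewrite tot1E big_ord_recl ltr_wpDr ?gker_gt0//.
by apply: sumr_ge0 => k _; rewrite ltW ?gker_gt0.
Qed.

Lemma noise1_ge0 c : 0 <= noise1 c.
Proof. by rewrite divr_ge0 ?wt1_ge0// ltW// tot1_gt0. Qed.

Lemma sum_noise1 : \sum_c noise1 c = 1.
Proof. by rewrite -mulr_suml mulfV// gt_eqF// tot1_gt0. Qed.

(** Completing the square turns the sum into the total of a shifted window. For an integer shift
    [window_le] then gives exactly the bound of a true Gaussian, with no error from discretisation
    or truncation. *)
Lemma noise1_mgf (a : int) :
  \sum_c noise1 c * expR ((a%:~R * (clift c)%:~R) / s%:R ^+ 2 - a%:~R ^+ 2 / (2 * s%:R ^+ 2)) <= 1.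
Proof.
have s2 : (s%:R ^+ 2 : R) != 0 by rewrite expf_neq0// pnatr_eq0 -lt0n.
have -> : \sum_c noise1 c * expR ((a%:~R * (clift c)%:~R) / s%:R ^+ 2 - a%:~R ^+ 2 / (2 * s%:R ^+ 2))
  = (\sum_(k < (2 * M).+1) gker s (k%:R - M%:R - a%:~R)) / tot1.
  have := sum_wt1 (fun l => expR ((a%:~R * l%:~R) / s%:R ^+ 2 - a%:~R ^+ 2 / (2 * s%:R ^+ 2))).
  move=> E; under eq_bigr do rewrite /noise1 mulrAC.
  rewrite -mulr_suml E; congr (_ / _); apply: eq_bigr => k _.
  rewrite /gker -expRD intrB; congr expR; field.
  by rewrite pnatr_eq0 -lt0n.
by rewrite ler_pdivrMr ?tot1_gt0// mul1r tot1E; exact: window_le.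
Qed.

(** The exponential moments at [a = s] and [a = - s], each at most exp (1/2) <= 2, added. *)
Lemma noise1_expabs : \sum_c noise1 c * expR (`|(clift c)%:~R| / s%:R) <= 4.
Proof.
have sR : (s%:R : R) != 0 by rewrite pnatr_eq0 -lt0n.
have half2 : expR (2^-1) <= 2 :> R.
  have := expR_ge1Dx (- (2^-1) : R); rewrite expRN => H.
  by rewrite -[leLHS]invrK -[leRHS]invrK lef_pV2 ?posrE ?invr_gt0 ?expR_gt0//; lra.
have H (a : int) : (a%:~R ^+ 2 = s%:R ^+ 2 :> R) ->
   \sum_c noise1 c * expR ((a%:~R * (clift c)%:~R) / s%:R ^+ 2) <= 2.
  move=> as2; have := noise1_mgf a; rewrite as2.
  have -> : s%:R ^+ 2 / (2 * s%:R ^+ 2) = 2^-1 :> R by field.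
  under eq_bigr do rewrite expRD expRN mulrA.
  by rewrite -mulr_suml ler_pdivrMr ?expR_gt0// mul1r => /le_trans; apply.
have Hp := H s%:Z erefl; have Hn := H (- s%:Z); rewrite intrN sqrrN in Hn.
apply: le_trans (_ : 2 + 2 <= 4); last by lra.
apply: le_trans (lerD Hp (Hn erefl)); rewrite -big_split; apply: ler_sum => c _ /=.
rewrite -mulrDr ler_wpM2l ?noise1_ge0//.
have E (x : R) : s%:R * x / s%:R ^+ 2 = x / s%:R by field.
have E' (x : R) : - s%:R * x / s%:R ^+ 2 = - x / s%:R by field.
rewrite -[s%:~R]/(s%:R) E E'.
have [x0|x0] := lerP 0 ((clift c)%:~R : R).
  by rewrite (ger0_norm x0) lerDl ltW ?expR_gt0.
by rewrite (ltr0_norm x0) lerDr ltW ?expR_gt0.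
Qed.

Lemma noise1_tail (m : R) : \sum_(c | m < `|(clift c)%:~R|) noise1 c <= 4 * expR (- (m / s%:R)).
Proof.
rewrite expRN ler_pdivlMr ?expR_gt0//; apply: le_trans noise1_expabs.
rewrite mulr_suml big_mkcond; apply: ler_sum => c _; case: ifP => [mc|_].
  by rewrite ler_wpM2l ?noise1_ge0// ler_expR ler_pM2r ?invr_gt0 ?ltr0n// ltW.
by rewrite mulr_ge0 ?noise1_ge0 ?expR_ge0.
Qed.

Lemma powR_le_expR (p x : R) : 0 < p -> 0 <= x -> x `^ p <= p `^ p * expR x.
Proof.
move=> p0; rewrite le0r => /orP[/eqP ->|x0].
  by rewrite powR0 ?gt_eqF// mulr_ge0 ?powR_ge0 ?expR_ge0.
rewrite /powR !gt_eqF// -expRD ler_expR.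
have := ln_le_sub1 (divr_gt0 x0 p0); rewrite ln_div ?posrE// => H.
have : p * (ln x - ln p) <= p * (x / p - 1) by rewrite ler_pM2l.
rewrite [in X in _ <= X -> _]mulrBr mulrCA mulfV ?gt_eqF// mulr1; lra.
Qed.

Lemma noise1_moment (p : R) : 0 < p ->
  \sum_c noise1 c * (`|(clift c)%:~R| / s%:R) `^ p <= 4 * p `^ p.
Proof.
move=> p0; apply: (@le_trans _ _ (p `^ p * \sum_c noise1 c * expR (`|(clift c)%:~R| / s%:R))).
  rewrite mulr_sumr; apply: ler_sum => c _; rewrite mulrCA ler_wpM2l ?noise1_ge0//.
  by apply: powR_le_expR => //; rewrite divr_ge0.
by rewrite mulrC ler_wpM2r ?powR_ge0// noise1_expabs.
Qed.

Definition noise (g : G) : R := \prod_i noise1 (g 0 i).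
Definition inbox (g : G) : bool := [forall i, `|lift X g 0 i| <= M%:Z].

Lemma sum_prod_row (F : 'I_n -> 'Z_Q -> R) :
  \sum_(u : G) \prod_i F i (u 0 i) = \prod_i \sum_c F i c.
Proof.
rewrite bigA_distr_bigA (reindex (fun f : {ffun 'I_n -> 'Z_Q} => \row_i f i : G)) /=.
  by apply: eq_bigr => f _; apply: eq_bigr => i _; rewrite mxE.
exists (fun u : G => [ffun i => u 0 i]) => [f _|u _].
  by apply/ffunP => i; rewrite ffunE mxE.
by apply/rowP => i; rewrite mxE ffunE.
Qed.

Lemma noise_ge0 g : 0 <= noise g.
Proof. by apply: prodr_ge0 => i _; exact: noise1_ge0. Qed.

Lemma sum_noise : \sum_g noise g = 1.
Proof. by rewrite (sum_prod_row (fun _ => noise1)) big1// => i _; rewrite sum_noise1. Qed.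

Lemma noise_marg i (F : 'Z_Q -> R) : \sum_(g : G) noise g * F (g 0 i) = \sum_c noise1 c * F c.
Proof.
transitivity (\sum_(g : G) \prod_j (noise1 (g 0 j) * (if j == i then F (g 0 j) else 1))).
  apply: eq_bigr => g _; rewrite big_split /=; congr (_ * _).
  by rewrite -big_mkcond big_pred1_eq.
rewrite (sum_prod_row (fun j c => noise1 c * (if j == i then F c else 1))) (bigD1 i)//= eqxx.
rewrite [X in _ * X]big1 ?mulr1// => j /negPf ->.
by under eq_bigr do rewrite mulr1; rewrite sum_noise1.
Qed.

Lemma noise_mgf (W : 'rV[int]_n) :
  \sum_(g : G) noise g * expR (dotv (map_mx intr W) (map_mx intr (lift X g)) / s%:R ^+ 2
      - norm2 (map_mx intr W) / (2 * s%:R ^+ 2)) <= 1.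
Proof.
have -> : \sum_(g : G) noise g * expR (dotv (map_mx intr W) (map_mx intr (lift X g)) / s%:R ^+ 2
      - norm2 (map_mx intr W) / (2 * s%:R ^+ 2)) =
  \sum_(g : G) \prod_i (noise1 (g 0 i) *
     expR ((W 0 i)%:~R * (clift (g 0 i))%:~R / s%:R ^+ 2 - (W 0 i)%:~R ^+ 2 / (2 * s%:R ^+ 2))).
  apply: eq_bigr => g _; rewrite big_split /= -expR_sum; congr (_ * expR _).
  rewrite sumrB -!mulr_suml; congr (_ / _ - _ / _); apply: eq_bigr => i _.
    by rewrite mxE [in X in _ * X]mxE liftE.
  by rewrite mxE expr2.
rewrite (sum_prod_row (fun i c => noise1 c * expR ((W 0 i)%:~R * (clift c)%:~R / s%:R ^+ 2
    - (W 0 i)%:~R ^+ 2 / (2 * s%:R ^+ 2)))).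
apply: prodr_ile1 => i _; rewrite noise1_mgf andbT.
by apply: sumr_ge0 => c _; rewrite mulr_ge0 ?noise1_ge0 ?expR_ge0.
Qed.

Lemma noise_inbox g : inbox g ->
  noise g = expR (- (norm2 (map_mx intr (lift X g)) / (2 * s%:R ^+ 2))) / tot1 ^+ n.
Proof.
move=> /forallP gb; rewrite /noise /noise1 prodf_div prodr_const card_ord; congr (_ / _).
rewrite /norm2 /dotv mulr_suml -sumrN expR_sum; apply: eq_bigr => i _.
by rewrite /wt1 -liftE gb /gker [(map_mx _ _) 0 i]mxE expr2.
Qed.

Lemma noise_gt0 g : (0 < noise g) = inbox g.
Proof.
apply/idP/idP => [g0|gb]; last first.
  by rewrite noise_inbox// divr_gt0 ?expR_gt0// exprn_gt0 ?tot1_gt0.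
apply/forallP => i; apply: contraTT g0 => gi; rewrite -leNgt /noise (bigD1 i)//=.
by rewrite /noise1 /wt1 -liftE (negPf gi) mul0r mul0r.
Qed.

(** An equality while [g + proj Q w] stays in the box; once it has left the box, the left side is
    0. *)
Lemma noise_shift_le (g : G) (w : 'rV[int]_n) : inbox g ->
  lift X (g + proj Q w) = lift X g + w ->
  noise (g + proj Q w) <= noise g *
    expR (dotv (- map_mx intr w) (map_mx intr (lift X g)) / s%:R ^+ 2
      - norm2 (- map_mx intr w : 'rV[R]_n) / (2 * s%:R ^+ 2)).
Proof.
move=> gb E; have [gwb|ngwb] := boolP (inbox (g + proj Q w)); last first.
  move: ngwb; rewrite -noise_gt0 -leNgt => /le_trans; apply.
  by rewrite mulr_ge0 ?noise_ge0 ?expR_ge0.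
rewrite !noise_inbox// mulrAC -expRD; apply: eq_ler; congr (expR _ / _).
rewrite E map_mxD norm2D norm2N dotvNl (dotvC (map_mx _ w)).
by field; rewrite pnatr_eq0 -lt0n.
Qed.

End Noise.

(** * The L_p norm on real vectors *)

Section LpNorm.
Variables (R : realType) (p : R).
Hypothesis p1 : 1 <= p.

Let p0 : 0 < p. Proof. exact: lt_le_trans p1. Qed.

Lemma powR_convex (t x y : R) : 0 <= t <= 1 -> 0 <= x -> 0 <= y ->
  (t * x + (1 - t) * y) `^ p <= t * x `^ p + (1 - t) * y `^ p.
Proof.
move=> /andP[t0 t1] x0 y0; have := @convex_powR R p p1 (Itv01 t0 t1) x y.
by rewrite !inE /= !in_itv /= !andbT => /(_ x0 y0); rewrite !convRE.
Qed.

(** For [z] equal to [x] or [y], the ratio z / (x + y) is at most 1 and decreases under the power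
    [p]; the two ratios add up to 1. *)
Lemma powR_superadd (x y : R) : 0 <= x -> 0 <= y -> x `^ p + y `^ p <= (x + y) `^ p.
Proof.
rewrite le0r => /orP[/eqP ->|x0] y0; first by rewrite powR0 ?gt_eqF// !add0r.
have xy : 0 < x + y by rewrite ltr_wpDr.
have P (z : R) : 0 <= z <= x + y -> z `^ p <= (x + y) `^ p * (z / (x + y)).
  move=> /andP[z0 zxy]; rewrite -[in leLHS](divfK (lt0r_neq0 xy) z) mulrC.
  rewrite powRM ?divr_ge0 ?(ltW xy)// ler_wpM2l ?powR_ge0//.
  have := z0; rewrite le0r => /orP[/eqP ->|zp]; first by rewrite mul0r powR0 ?gt_eqF.
  by apply: ge1r_powR => //; rewrite divr_gt0//= ler_pdivrMr// mul1r.
apply: (le_trans (lerD (P x _) (P y _))); [lra|lra|].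
by rewrite -mulrDr -mulrDl mulfV ?gt_eqF// mulr1.
Qed.

Lemma powR_mean (x : R) : 0 <= x -> ((1 + x) / 2) `^ p <= (1 + x `^ p) / 2.
Proof.
move=> x0; have := @powR_convex 2^-1 1 x _ ler01 x0; rewrite powR1.
have -> : 2^-1 * 1 + (1 - 2^-1) * x = (1 + x) / 2 by field.
by move=> H; have := H _; lra.
Qed.

Lemma powRK (x : R) : 0 <= x -> (x `^ p) `^ p^-1 = x.
Proof. by move=> x0; rewrite -powRrM mulfV ?gt_eqF// powRr1. Qed.

Lemma powRVK (x : R) : 0 <= x -> (x `^ p^-1) `^ p = x.
Proof. by move=> x0; rewrite -powRrM mulVf ?gt_eqF// powRr1. Qed.

Lemma powR_inv_le (x y : R) : 0 <= x -> 0 <= y -> x <= y `^ p -> x `^ p^-1 <= y.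
Proof.
move=> x0 y0 xy; rewrite -[leRHS]powRK//; apply: ge0_ler_powR => //.
  by rewrite invr_ge0 ltW.
by rewrite nnegrE powR_ge0.
Qed.

Lemma powR_inv_ge (x y : R) : 0 <= x -> 0 <= y -> y `^ p <= x -> y <= x `^ p^-1.
Proof.
move=> x0 y0 xy; rewrite -[leLHS]powRK//; apply: ge0_ler_powR => //.
  by rewrite invr_ge0 ltW.
by rewrite nnegrE powR_ge0.
Qed.

Variable n : nat.
Implicit Types x y : 'rV[R]_n.

Definition lpsum x : R := \sum_i `|x 0 i| `^ p.
(* Locked, lest conversion unfold real powers. *)
Fact lpR_key : unit. Proof. exact: tt. Qed.
Definition lpR x : R := locked_with lpR_key (lpsum x `^ p^-1).

Lemma lpRE x : lpR x = lpsum x `^ p^-1.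
Proof. by rewrite /lpR unlock. Qed.

Lemma lp_normE (y : 'rV[int]_n) : lp_norm p y = lpR (map_mx intr y).
Proof.
rewrite /lp_norm lpRE /lpsum; congr (_ `^ _); apply: eq_bigr => i _.
by rewrite mxE intr_norm.
Qed.

Lemma lpsum_ge0 x : 0 <= lpsum x.
Proof. by apply: sumr_ge0 => i _; exact: powR_ge0. Qed.

Lemma lpR_ge0 x : 0 <= lpR x.
Proof. by rewrite lpRE powR_ge0. Qed.

Lemma lpRX x : lpR x `^ p = lpsum x.
Proof. by rewrite lpRE powRVK// lpsum_ge0. Qed.

Lemma lpR_eq0 x : lpR x = 0 -> x = 0.
Proof.
move=> x0; have := lpRX x; rewrite x0 powR0 ?gt_eqF// => /esym/eqP.
rewrite psumr_eq0 => [/allP H|i _]; last exact: powR_ge0.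
apply/rowP => i; have /eqP/powR_eq0_eq0/eqP := H i (mem_index_enum _).
by rewrite normr_eq0 mxE => /eqP.
Qed.

Lemma lpR_abs_le x y : (forall i, `|x 0 i| <= `|y 0 i|) -> lpR x <= lpR y.
Proof.
move=> xy; rewrite !lpRE; apply: ge0_ler_powR; rewrite ?nnegrE ?lpsum_ge0 ?invr_ge0 ?(ltW p0)//.
by apply: ler_sum => i _; apply: ge0_ler_powR; rewrite ?nnegrE// ltW.
Qed.

Lemma lpRN x : lpR (- x) = lpR x.
Proof. by rewrite !lpRE; congr (_ `^ _); apply: eq_bigr => i _; rewrite mxE normrN. Qed.

(** Minkowski's inequality by convexity: [x + y] is A + B times the convex combination of x / A and
    y / B with weights A / (A + B) and B / (A + B). *)
Lemma lpR_triangle x y : lpR (x + y) <= lpR x + lpR y.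
Proof.
have := lpR_ge0 x; rewrite le0r => /orP[/eqP x0|A0].
  by rewrite x0 (lpR_eq0 x0) !add0r.
have := lpR_ge0 y; rewrite le0r => /orP[/eqP y0|B0].
  by rewrite y0 (lpR_eq0 y0) !addr0.
have E (z : 'rV[R]_n) : 0 < lpR z -> \sum_i (`|z 0 i| / lpR z) `^ p = 1.
  move=> z0; under eq_bigr do rewrite powRM ?invr_ge0 ?(ltW z0)//.
  rewrite -mulr_suml -/(lpsum z) -lpRX -powRM ?invr_ge0 ?(ltW z0)//.
  by rewrite mulfV ?gt_eqF// powR1.
have := E y B0; have := E x A0; rewrite [lpR (x + y)]lpRE.
move: (lpR x) (lpR y) A0 B0 => A B A0 B0 Ex Ey.
have AB : 0 < A + B by rewrite addr_gt0.
have [t [t0 t1 tA tB]] : exists t : R, [/\ 0 <= t, 0 <= 1 - t, (A + B) * t = A & (A + B) * (1 - t) = B].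
  exists (A / (A + B)); have -> : 1 - A / (A + B) = B / (A + B) by field; rewrite gt_eqF.
  by split; rewrite ?divr_ge0 ?(ltW A0) ?(ltW B0) ?(ltW AB)// mulrC divfK ?gt_eqF.
apply: powR_inv_le; rewrite ?lpsum_ge0 ?(ltW AB)//.
apply: (@le_trans _ _ (\sum_i (A + B) `^ p *
   (t * (`|x 0 i| / A) `^ p + (1 - t) * (`|y 0 i| / B) `^ p))).
  apply: ler_sum => i _; rewrite mxE.
  have a0 : 0 <= `|x 0 i| / A by rewrite divr_ge0// ltW.
  have b0 : 0 <= `|y 0 i| / B by rewrite divr_ge0// ltW.
  have c0 : 0 <= t * (`|x 0 i| / A) + (1 - t) * (`|y 0 i| / B).
    by apply: addr_ge0; exact: mulr_ge0.
  apply: (@le_trans _ _ (((A + B) * (t * (`|x 0 i| / A) + (1 - t) * (`|y 0 i| / B))) `^ p)).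
    have d0 := mulr_ge0 (ltW AB) c0.
    apply: ge0_ler_powR; rewrite ?nnegrE ?(ltW p0)//.
    apply: le_trans (ler_normD _ _) _; apply: eq_ler.
    by rewrite mulrDr !mulrA tA tB; field; rewrite !gt_eqF.
  rewrite powRM ?(ltW AB)// ler_wpM2l ?powR_ge0//.
  by apply: powR_convex => //; rewrite t0/= -subr_ge0.
rewrite -mulr_sumr big_split /= -!mulr_sumr Ex Ey !mulr1.
by rewrite addrCA subrr addr0 mulr1.
Qed.

Lemma lpR_triangleB x y : lpR x - lpR y <= lpR (x + y).
Proof. by rewrite lerBlDr; have := lpR_triangle (x + y) (- y); rewrite addrK lpRN. Qed.

Lemma lpR_le_norm2 x : 2 <= p -> lpR x <= Num.sqrt (norm2 x).
Proof.
move=> p2; set N := Num.sqrt _; have N0 : 0 <= N by exact: sqrtr_ge0.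
rewrite lpRE; apply: powR_inv_le; rewrite ?lpsum_ge0//.
have xN i : `|x 0 i| <= N.
  rewrite -sqrtr_sqr ler_sqrt ?norm2_ge0// /norm2 /dotv (bigD1 i)//= -expr2 lerDl.
  by apply: sumr_ge0 => j _; rewrite -expr2 sqr_ge0.
have split2 (z : R) : 0 <= z -> z `^ p = z ^+ 2 * z `^ (p - 2).
  move=> z0; rewrite -powR_mulrn// -powRD; first by congr (_ `^ _); lra.
  by apply/implyP => /eqP; lra.
rewrite (split2 N)// sqr_sqrtr ?norm2_ge0// /norm2 /dotv mulr_suml; apply: ler_sum => i _.
rewrite split2// real_normK ?num_real// -expr2 ler_wpM2l ?sqr_ge0//.
by apply: ge0_ler_powR; rewrite ?nnegrE// subr_ge0.
Qed.

End LpNorm.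

(** * Almost shift-invariant functions and hypothesis testing *)

Section ShiftDist.
Variables (R : realType) (G : finZmodType) (F : G -> R).

Definition shift_dist (v : G) : R := \sum_u `|F (u + v) - F u|.

Lemma shift_dist0 : shift_dist 0 = 0.
Proof. by rewrite /shift_dist big1// => u _; rewrite addr0 subrr normr0. Qed.

Lemma shift_distD v w : shift_dist (v + w) <= shift_dist v + shift_dist w.
Proof.
rewrite [shift_dist v](reindex (fun u => u + w)) /=; last first.
  by exists (fun u => u - w) => u _; rewrite ?addrK ?subrK.
rewrite -big_split; apply: ler_sum => u _ /=; rewrite addrAC.
apply: le_trans (_ : `|(F (u + (v + w)) - F (u + w)) + (F (u + w) - F u)| <= _).
  by rewrite [X in _ <= `|X|]addrA [X in _ <= `|X + _|]subrK.
by rewrite (addrA u v w); exact: ler_normD.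
Qed.

Lemma shift_distN v : shift_dist (- v) = shift_dist v.
Proof.
rewrite [RHS](reindex (fun u => u - v)) /=; last first.
  by exists (fun u => u + v) => u _; rewrite ?addrK ?subrK.
by apply: eq_bigr => u _; rewrite subrK distrC.
Qed.

Lemma shift_distMn v k : shift_dist (v *+ k) <= k%:R * shift_dist v.
Proof.
elim: k => [|k IH]; first by rewrite mulr0n shift_dist0 mul0r.
by rewrite mulrSr -natr1 mulrDl mul1r; apply: le_trans (shift_distD _ _) _; rewrite lerD2r.
Qed.

Lemma shift_distMz v (c : int) : shift_dist (v *~ c) <= `|c|%:~R * shift_dist v.
Proof.
case: c => k; first by rewrite -pmulrn; exact: shift_distMn.
by rewrite NegzE mulrNz -pmulrn shift_distN normrN; exact: shift_distMn.
Qed.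

Lemma shift_dist_sum (I : finType) (P : pred I) (w : I -> G) :
  shift_dist (\sum_(i | P i) w i) <= \sum_(i | P i) shift_dist (w i).
Proof.
elim/big_rec2: _ => [|i a b _ ab]; first by rewrite shift_dist0.
by apply: le_trans (shift_distD _ _) _; rewrite lerD2l.
Qed.

End ShiftDist.

Section Kernel.
Variables (R : realType) (n L Q : nat) (St : finType).
Hypotheses (n0 : (0 < n)%N) (L0 : (0 < L)%N) (Q1 : (1 < Q)%N).
Local Notation Z := {ffun 'I_n -> 'I_L}.
Local Notation G := 'rV['Z_Q]_n.

(** What the tests know about [H]: from here on the chunks that produced it are hidden. *)
Record ridge_like (H S : 'M[R]_n) : Prop := RidgeLike {
  rl_sym : S^T = S;
  rl_psd : forall x, 0 <= dotv (x *m S) x;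
  rl_piv : pivotal S H }.

(** [shift_dist] is subadditive, so a combination of chunk differences with coefficients of total
    size 2 A moves [f t] by at most 2 A times the bound for a single difference. *)
Lemma good_state_kernel (f : St -> G -> R) (k m eta : R) (F : nat) (t : St) :
  (forall a u, 0 <= f a u) -> 0 < m -> 0 < eta -> 0 <= k -> (0 < F)%N ->
  8 * n%:R ^+ 2 / eta <= (F%:R - 1) ^+ 2 ->
  good_state (Z := Z) (@chunk_shift n L Q) f k m t ->
  exists H, (exists S, ridge_like H S) /\
    (exists j : nat, \tr H <= j%:R + eta /\ m * L%:R ^+ j <= 2 * F%:R ^+ j * L%:R ^+ n) /\
    forall (y : 'rV[int]_n) (A : R), 0 < A -> norm2 (map_mx intr y : 'rV[R]_n) <= A ^+ 2 ->
    exists v : 'rV[int]_n,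
      norm2 (map_mx intr v - (map_mx intr y - map_mx intr y *m H)) <= 2 * (n%:R * L%:R ^+ 2) * A /\
      shift_dist (f t) (proj Q v) <= 2 * A * k * marg f t.
Proof.
move=> f0 m0 e0 k0 F0 HF /existsP[C /andP[mC /forall_inP stab]].
have C0 : (0 < #|C|)%N by rewrite -(ltr_nat R); apply: lt_le_trans mC.
have [z0 z0C] : exists z0, z0 \in C by apply/card_gt0P.
exists (ridge (covm R C z0)); split; last split.
- exists (covm R C z0); split; [exact: covm_sym|exact: quad_covm_ge0|].
  exact: ridge_pivotal (covm_sym R C z0) (@quad_covm_ge0 R n L C z0).
- have [j [trj cj]] := trace_ridge_le C z0 e0 F0 HF.
  exists j; split=> //; apply: (@le_trans _ _ (#|C|%:R * L%:R ^+ j)).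
    by rewrite ler_wpM2r// exprn_ge0.
  by rewrite -!natrX -!natrM ler_nat.
move=> y A A0 yA; have [c [c1 c2]] := integer_combination z0 n0 L0 C0 A0 yA.
exists (\sum_(z in C) c z *: (box_int z - box_int z0)); split; first exact: c1.
have pE : proj Q (\sum_(z in C) c z *: (box_int z - box_int z0)) =
   \sum_(z in C) (chunk_shift Q z - chunk_shift Q z0) *~ c z.
  rewrite /proj (raddf_sum (map_mx intr)); apply: eq_bigr => z _.
  apply/rowP => i; rewrite mxE [in LHS]mxE /=.
  have -> : ((chunk_shift Q z - chunk_shift Q z0) *~ c z) 0 i =
            (chunk_shift Q z - chunk_shift Q z0) 0 i *~ c z.
    case: (c z) => l; first by rewrite -!pmulrn mulmxnE.
    by rewrite !NegzE !mulrNz -!pmulrn mxE mulmxnE.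
  by rewrite intrM -mulrzr mulrC /chunk_shift -projB [proj _ _ 0 i]mxE mul1r mulrzr.
rewrite pE; apply: le_trans (shift_dist_sum _ _ _) _.
have mg0 : 0 <= k * marg f t by rewrite mulr_ge0// sumr_ge0.
apply: (@le_trans _ _ (\sum_(z in C) `|c z|%:~R * (k * marg f t))).
  apply: ler_sum => z zC; apply: le_trans (shift_distMz _ _ _) _.
  rewrite ler_wpM2l ?ler0z//; have /forall_inP/(_ z0 z0C) := stab z zC.
  apply: le_trans; rewrite /shift_dist (reindex (fun u => u + chunk_shift Q z0)) /=; last first.
    by exists (fun u => u - chunk_shift Q z0) => u _; rewrite ?addrK ?subrK.
  by apply: eq_ler; apply: eq_bigr => u _; rewrite (addrC (chunk_shift Q z)) addrA addrK.
by rewrite -mulr_suml -[leRHS]mulrA ler_wpM2r.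
Qed.

End Kernel.

Section Couple.
Variables (R : realType) (n Q s M X : nat).
Hypotheses (s0 : (0 < s)%N) (Q1 : (1 < Q)%N) (MX : (M <= X)%N) (XQ : (X + M < Q)%N).
Local Notation G := 'rV['Z_Q]_n.
Local Notation D := (@noise R n Q s M X).
Local Notation lft := (@lift n Q X).
Local Notation vR := (map_mx intr : 'rV[int]_n -> 'rV[R]_n).

Lemma proj_lift (u : G) : proj Q (lft u) = u.
Proof.
by apply/rowP => i; rewrite /proj mxE liftE /clift intrB -!pmulrn natr_Zp addrK.
Qed.

Variables (F : G -> R) (K : nat) (mu : 'I_K -> nat) (I : finType) (pi : I -> R).
Variables (xb : 'rV[int]_n) (y v : I -> 'rV[int]_n) (good : pred I) (kap : R).
Variables (bad : G -> 'rV[int]_n -> bool) (Om : 'I_K -> I -> G -> bool).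
Hypotheses (F0 : forall u, 0 <= F u) (pi0 : forall i, 0 <= pi i) (pi1 : \sum_i pi i = 1).
Hypothesis kap0 : 0 <= kap.

(** Moving the noise by [disp k i] turns the displacement [y i *+ mu k] into [v i *+ mu k], to which
    [F] is almost blind. The price is the likelihood ratio of the moved noise. In the application
    [v i - y i] is close to - y H. *)
Definition disp (k : 'I_K) i : 'rV[int]_n := (v i - y i) *+ mu k.

Hypothesis hv : forall i, good i -> shift_dist F (proj Q (v i)) <= kap.
Hypothesis hl : forall k i g, good i -> inbox M X g ->
  lft (g + proj Q (disp k i)) = lft g + disp k i.
Hypothesis hOm : forall k i g, Om k i g -> good i /\ inbox M X g.
Hypothesis sep : forall g u k1 k2 i1 i2, k1 != k2 -> Om k1 i1 g -> Om k2 i2 g ->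
  bad u (xb + lft g + v i1 *+ mu k1) || bad u (xb + lft g + v i2 *+ mu k2).

(** [u] is prefix minus final input, so the prefix has frequency [u] plus the input, and the
    completing stream, hence the output, depends on the state and [u] only. *)
Definition fail_mass k : R := \sum_i pi i * \sum_g D g *
  \sum_u F (u + proj Q (xb + y i *+ mu k + lft g)) * (bad u (xb + y i *+ mu k + lft g))%:R.

Definition lratio k g : R := (\sum_(i | Om k i g) pi i * D (g + proj Q (disp k i))) / D g.

Let D0 := @noise_ge0 R n Q s M X s0 Q1 MX XQ.

Lemma lratio_ge0 k g : 0 <= lratio k g.
Proof. by rewrite divr_ge0 ?D0//; apply: sumr_ge0 => i _; rewrite mulr_ge0 ?D0. Qed.

Let T k g u : R := \sum_(i | Om k i g) pi i * D (g + proj Q (disp k i)) *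
   (bad u (xb + lft g + v i *+ mu k))%:R.

Lemma projMn y' k : proj Q (y' *+ k) = proj Q y' *+ k :> G.
Proof. exact: (raddfMn (map_mx intr)). Qed.

Lemma sum_noise_shift (a : G) : \sum_g D (g + a) = 1.
Proof.
rewrite -(sum_noise R n s0 Q1 MX XQ) [RHS](reindex (fun g => g + a))//=.
by exists (fun g => g - a) => g _; rewrite ?addrK ?subrK.
Qed.

(** After the change of variable from [g] to [g + proj Q (disp k i)] the input is xb + g + mu k v i,
    and dropping the last term inside [F] costs at most (mu k) kap. *)
Lemma fail_mass_ge k :
  \sum_g \sum_u F (u + (proj Q xb + g)) * T k g u - (mu k)%:R * kap <= fail_mass k.
Proof.
rewrite lerBlDr.
have E i : \sum_g D g * \sum_u F (u + proj Q (xb + y i *+ mu k + lft g)) *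
     (bad u (xb + y i *+ mu k + lft g))%:R =
  \sum_g D (g + proj Q (disp k i)) *
   \sum_u F (u + proj Q (xb + y i *+ mu k + lft (g + proj Q (disp k i)))) *
     (bad u (xb + y i *+ mu k + lft (g + proj Q (disp k i))))%:R.
  rewrite (reindex (fun g => g + proj Q (disp k i)))//=.
  by exists (fun g => g - proj Q (disp k i)) => g _; rewrite ?addrK ?subrK.
rewrite /fail_mass; under [in leRHS]eq_bigr do rewrite E.
have -> : \sum_g \sum_u F (u + (proj Q xb + g)) * T k g u =
  \sum_i pi i * \sum_(g | Om k i g) D (g + proj Q (disp k i)) *
    \sum_u F (u + (proj Q xb + g)) * (bad u (xb + lft g + v i *+ mu k))%:R.
  under [RHS]eq_bigr do rewrite mulr_sumr big_mkcond.
  rewrite [RHS]exchange_big; apply: eq_bigr => g _ /=.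
  transitivity (\sum_u \sum_(i | Om k i g) F (u + (proj Q xb + g)) *
     (pi i * D (g + proj Q (disp k i)) * (bad u (xb + lft g + v i *+ mu k))%:R)).
    by apply: eq_bigr => u _; rewrite mulr_sumr.
  rewrite exchange_big [LHS]big_mkcond; apply: eq_bigr => i _ /=.
  case: ifP => // _; rewrite !mulr_sumr; apply: eq_bigr => u _; ring.
have -> : (mu k)%:R * kap =
   \sum_i pi i * \sum_g D (g + proj Q (disp k i)) * ((mu k)%:R * kap).
  under eq_bigr do rewrite -mulr_suml sum_noise_shift mul1r.
  by rewrite -mulr_suml pi1 mul1r.
rewrite -big_split; apply: ler_sum => i _ /=; rewrite -mulrDr ler_wpM2l//.
rewrite [leLHS]big_mkcond -big_split; apply: ler_sum => g _ /=.
have mk0 : 0 <= (mu k)%:R * kap by rewrite mulr_ge0.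
rewrite -mulrDr; case: ifP => [om|_]; last first.
  rewrite mulr_ge0 ?D0// addr_ge0// sumr_ge0// => u _; rewrite mulr_ge0 ?F0//.
rewrite ler_wpM2l ?D0//; have [gi gb] := hOm om.
have E' : xb + y i *+ mu k + (lft g + disp k i) = xb + lft g + v i *+ mu k.
  by rewrite addrACA /disp mulrnBl [X in _ + X]addrC subrK.
rewrite hl// E' projD projD proj_lift projMn -lerBlDl -sumrB.
apply: (@le_trans _ _ (shift_dist F (proj Q (v i) *+ mu k))); last first.
  by apply: le_trans (shift_distMn _ _ _) _; rewrite ler_wpM2l// hv.
rewrite /shift_dist [leRHS](reindex (fun u => u + (proj Q xb + g)))/=; last first.
  by exists (fun u => u - (proj Q xb + g)) => u _; rewrite ?addrK ?subrK.
apply: ler_sum => u _; rewrite -mulrBl distrC -(addrA u (proj Q xb + g)).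
case: (bad _ _); rewrite ?mulr1 ?mulr0//; exact: ler_norm.
Qed.

(** An output acceptable for one [k] is bad for all others by [sep]. For given [g] and [u] at most
    one [k] escapes, and the remaining [K.-1] contribute their full ratio. *)
Lemma sum_T_ge (Mn : G -> R) g u : 0 <= Mn g -> (forall k, Mn g <= lratio k g) ->
  K.-1%:R * (D g * Mn g) <= \sum_k T k g u.
Proof.
move=> Mn0 Mle; have T0 k : 0 <= T k g u.
  by apply: sumr_ge0 => i _; rewrite !mulr_ge0 ?D0.
have [Dg|Dg] := eqVneq (D g) 0; first by rewrite Dg mul0r mulr0 sumr_ge0.
have Dgp : 0 < D g by rewrite lt_neqAle eq_sym Dg D0.
pose full k : R := \sum_(i | Om k i g) pi i * D (g + proj Q (disp k i)).
have full_ge k : D g * Mn g <= full k.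
  by rewrite mulrC -ler_pdivlMr// Mle.
have full0 k : 0 <= full k by apply: sumr_ge0 => i _; rewrite mulr_ge0 ?D0.
have TE k : (forall i, Om k i g -> bad u (xb + lft g + v i *+ mu k)) -> T k g u = full k.
  by move=> H; apply: eq_bigr => i /H ->; rewrite mulr1.
have [/existsP[k0 /existsP[i0 /andP[om0 nb0]]]|none] :=
  boolP [exists k0, exists i0, Om k0 i0 g && ~~ bad u (xb + lft g + v i0 *+ mu k0)].
  apply: (@le_trans _ _ (\sum_(k | k != k0) T k g u)); last first.
    by rewrite [leRHS](bigD1 k0)//= lerDr.
  have -> : K.-1%:R * (D g * Mn g) = \sum_(k | k != k0) D g * Mn g.
    rewrite sumr_const mulr_natl; congr (_ *+ _).
    by have := cardC1 k0; rewrite card_ord => <-; apply: eq_card => k; rewrite !inE.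
  apply: ler_sum => k kk0; rewrite TE// => i om.
  by have := sep u kk0 om om0; rewrite (negPf nb0) orbF.
apply: (@le_trans _ _ (\sum_(k < K) full k)); last first.
  apply: ler_sum => k _; rewrite TE// => i om; move: none; rewrite negb_exists => /forallP/(_ k).
  by rewrite negb_exists => /forallP/(_ i); rewrite om /= negbK.
rewrite -[X in X.-1]card_ord mulr_natl.
apply: (@le_trans _ _ (D g * Mn g *+ #|'I_K|)); last by rewrite -sumr_const; exact: ler_sum.
case: (posnP K) => [K0|Kp].
  by rewrite card_ord K0 !mulr0n.
have [k0 _] : exists k0 : 'I_K, true by exists (Ordinal Kp).
rewrite card_ord -[X in _ <= _ *+ X](prednK Kp) mulrS lerDr.
by rewrite mulr_ge0 ?D0.
Qed.

(** A bound of Le Cam type: on the common part [Mn] of the [K] displaced noises the algorithm meets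
    the same state and the same [u], whichever multiple was used. *)
Lemma couple (Mn : G -> R) : (forall g, 0 <= Mn g) -> (forall k g, Mn g <= lratio k g) ->
  K.-1%:R * (\sum_u F u) * (\sum_g D g * Mn g) <=
  \sum_k fail_mass k + kap * \sum_k (mu k)%:R.
Proof.
move=> Mn0 Mle; rewrite [kap * _]mulr_sumr -big_split /=.
apply: (@le_trans _ _ (\sum_k \sum_g \sum_u F (u + (proj Q xb + g)) * T k g u)); last first.
  by apply: ler_sum => k _; have := fail_mass_ge k; rewrite lerBlDr [kap * _]mulrC.
rewrite exchange_big mulr_sumr; apply: ler_sum => g _ /=; rewrite exchange_big /=.
have -> : \sum_u F u = \sum_u F (u + (proj Q xb + g)).
  rewrite [LHS](reindex (fun u => u + (proj Q xb + g)))//=.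
  by exists (fun u => u - (proj Q xb + g)) => u _; rewrite ?addrK ?subrK.
rewrite mulr_sumr mulr_suml; apply: ler_sum => u _; rewrite -mulr_sumr.
by rewrite [leLHS]mulrAC [leLHS]mulrC ler_wpM2l//; exact: sum_T_ge.
Qed.

(** Expanding the square gives products of two displaced densities. Each is at most [D g ^+ 2] times
    an exponential tilt by -(disp k i + disp k j), which [noise_mgf] averages to at most 1;
    completing the square leaves the cross term. *)
Lemma lratio_moment2 k : \sum_g D g * lratio k g ^+ 2 <=
  \sum_(i | good i) \sum_(j | good j) pi i * pi j *
     expR (dotv (vR (disp k i)) (vR (disp k j)) / s%:R ^+ 2).
Proof.
pose W i j : 'rV[int]_n := - (disp k i + disp k j).
pose e i j := expR (dotv (vR (disp k i)) (vR (disp k j)) / s%:R ^+ 2) : R.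
pose h i j (g : G) := expR (dotv (vR (W i j)) (vR (lft g)) / s%:R ^+ 2
      - norm2 (vR (W i j)) / (2 * s%:R ^+ 2)) : R.
apply: (@le_trans _ _ (\sum_g \sum_(i | good i) \sum_(j | good j)
    pi i * pi j * e i j * (D g * h i j g))); last first.
  rewrite exchange_big; apply: ler_sum => i gi /=.
  rewrite exchange_big; apply: ler_sum => j gj /=.
  rewrite -mulr_sumr -[leRHS]mulr1 ler_wpM2l ?mulr_ge0 ?expR_ge0//.
  exact: noise_mgf.
have h0 i j g : 0 <= pi i * pi j * e i j * (D g * h i j g).
  by rewrite !mulr_ge0 ?expR_ge0 ?D0.
apply: ler_sum => g _; have [Dg|Dg] := eqVneq (D g) 0.
  by rewrite Dg mul0r; apply: sumr_ge0 => i _; apply: sumr_ge0 => j _; rewrite -[X in X * h _ _ _]Dg.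
have Dgp : 0 < D g by rewrite lt_neqAle eq_sym Dg D0.
have -> : D g * lratio k g ^+ 2 =
   (\sum_(i | Om k i g) pi i * D (g + proj Q (disp k i))) ^+ 2 / D g.
  by rewrite /lratio expr_div_n; field.
rewrite ler_pdivrMr// expr2 mulr_suml mulr_suml [leLHS]big_mkcond [leRHS]big_mkcond.
apply: ler_sum => i _ /=; case: ifPn => [omi|_]; last first.
  case: ifP => // _; rewrite mulr_suml; apply: sumr_ge0 => j _; rewrite mulr_ge0 ?D0//.
have [gi gb] := hOm omi; rewrite gi mulr_sumr mulr_suml [leLHS]big_mkcond [leRHS]big_mkcond.
apply: ler_sum => j _ /=; case: ifPn => [omj|_]; last first.
  by case: ifP => // _; rewrite mulr_ge0 ?D0.
have [gj _] := hOm omj; rewrite gj mulrACA -[leRHS]mulrA -[leRHS]mulrA ler_wpM2l ?mulr_ge0//.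
have Hi := noise_shift_le R s0 Q1 MX XQ gb (hl k gi gb).
have Hj := noise_shift_le R s0 Q1 MX XQ gb (hl k gj gb).
apply: le_trans (ler_pM (D0 _) (D0 _) Hi Hj) _.
have -> : e i j * (D g * h i j g * D g) = D g * D g * (e i j * h i j g) by ring.
rewrite mulrACA -expRD ler_wpM2l ?mulr_ge0 ?D0// /e /h -expRD ler_expR /W.
have -> : vR (- (disp k i + disp k j)) = - (vR (disp k i) + vR (disp k j)) :> 'rV[R]_n.
  by rewrite map_mxN map_mxD.
apply: eq_ler; rewrite !norm2N norm2D !dotvNl dotvDl.
field; by rewrite pnatr_eq0 -lt0n.
Qed.

Lemma lratio_mean_ge k (e : R) :
  (forall i, good i -> \sum_(g | ~~ Om k i (g - proj Q (disp k i))) D g <= e) ->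
  (1 - e) * \sum_(i | good i) pi i <= \sum_g D g * lratio k g.
Proof.
move=> He.
have -> : \sum_g D g * lratio k g =
   \sum_g \sum_(i | Om k i g) pi i * D (g + proj Q (disp k i)).
  apply: eq_bigr => g _; have [Dg|Dg] := eqVneq (D g) 0; last by rewrite mulrC divfK.
  rewrite Dg mul0r big1// => i om; have [_ gb] := hOm om.
  by move: gb; rewrite -(noise_gt0 R s0 Q1 MX XQ) Dg ltxx.
rewrite (exchange_big_dep good)/=; last by move=> g i _ /hOm[].
rewrite mulr_sumr; apply: ler_sum => i gi; rewrite mulrC -mulr_sumr ler_wpM2l//.
rewrite (reindex (fun g => g - proj Q (disp k i)))/=; last first.
  by exists (fun g => g + proj Q (disp k i)) => g _; rewrite ?addrK ?subrK.
under eq_bigr do rewrite subrK.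
have := He i gi; have := sum_noise R n s0 Q1 MX XQ.
rewrite (bigID (fun g => Om k i (g - proj Q (disp k i))))/=; lra.
Qed.

End Couple.

Section MinBound.
Variables (R : realType) (G : finType) (D : G -> R).
Hypotheses (D0 : forall g, 0 <= D g) (D1 : \sum_g D g = 1).

(** Cauchy-Schwarz after min(1, z) >= z / (1 + z). The pointwise form is min(1, z) >= 2 c z - c^2 (z
    + z^2), with the optimal c = e1 / e2. *)
Lemma min1_ge (Y : G -> R) (e1 e2 : R) : (forall g, 0 <= Y g) -> 0 <= e1 -> 0 < e2 ->
  e1 <= \sum_g D g * Y g -> \sum_g D g * Y g + \sum_g D g * Y g ^+ 2 <= e2 ->
  e1 ^+ 2 / e2 <= \sum_g D g * Num.min 1 (Y g).
Proof.
move=> Y0 e10 e20 H1 H2; pose c := e1 / e2.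
have c0 : 0 <= c by rewrite divr_ge0// ltW.
apply: (@le_trans _ _ (\sum_g D g * (2 * c * Y g - c ^+ 2 * (Y g + Y g ^+ 2)))).
  have -> : \sum_g D g * (2 * c * Y g - c ^+ 2 * (Y g + Y g ^+ 2)) =
     2 * c * \sum_g D g * Y g - c ^+ 2 * (\sum_g D g * Y g + \sum_g D g * Y g ^+ 2).
    rewrite -big_split /= !mulr_sumr -sumrB; apply: eq_bigr => g _; ring.
  have -> : e1 ^+ 2 / e2 = 2 * c * e1 - c ^+ 2 * e2 by rewrite /c; field; rewrite gt_eqF.
  by apply: lerB; rewrite ler_wpM2l// ?sqr_ge0// mulr_ge0.
apply: ler_sum => g _; rewrite ler_wpM2l//; have y0 := Y0 g.
move: (Y g) y0 => z z0; have c2 : 0 <= c ^+ 2 by exact: sqr_ge0.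
have [z1|z1] := lerP 1 z; rewrite -subr_ge0.
  have -> : 1 - (2 * c * z - c ^+ 2 * (z + z ^+ 2)) = (1 - c * z) ^+ 2 + c ^+ 2 * z by ring.
  by rewrite addr_ge0 ?sqr_ge0// mulr_ge0.
have -> : z - (2 * c * z - c ^+ 2 * (z + z ^+ 2)) = z * (1 - c) ^+ 2 + c ^+ 2 * z ^+ 2 by ring.
by rewrite addr_ge0// mulr_ge0 ?sqr_ge0.
Qed.

(** The minimum is at least 1 - |1 - Y1| - |1 - Y2|, and the hypotheses bound the means of the
    squares (1 - Y)^2. *)
Lemma min3_ge (Y1 Y2 : G -> R) (e : R) : 0 < e ->
  1 - 2 * (\sum_g D g * Y1 g) + \sum_g D g * Y1 g ^+ 2 <= e ^+ 2 ->
  1 - 2 * (\sum_g D g * Y2 g) + \sum_g D g * Y2 g ^+ 2 <= e ^+ 2 ->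
  1 - 2 * e <= \sum_g D g * Num.min 1 (Num.min (Y1 g) (Y2 g)).
Proof.
move=> e0 H1 H2.
have E (Y : G -> R) : 1 - 2 * (\sum_g D g * Y g) + \sum_g D g * Y g ^+ 2 =
    \sum_g D g * (1 - Y g) ^+ 2.
  rewrite -[X in X - _ + _]D1 mulr_sumr -sumrB -big_split; apply: eq_bigr => g _ /=; ring.
rewrite E in H1; rewrite E in H2.
apply: (@le_trans _ _ (\sum_g D g * (1 - ((1 - Y1 g) ^+ 2 / (2 * e) + e / 2)
    - ((1 - Y2 g) ^+ 2 / (2 * e) + e / 2)))).
  have -> : \sum_g D g * (1 - ((1 - Y1 g) ^+ 2 / (2 * e) + e / 2)
    - ((1 - Y2 g) ^+ 2 / (2 * e) + e / 2)) =
    (1 - e) * (\sum_g D g) - (\sum_g D g * (1 - Y1 g) ^+ 2) / (2 * e)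
      - (\sum_g D g * (1 - Y2 g) ^+ 2) / (2 * e).
    rewrite mulr_sumr !mulr_suml -!sumrB; apply: eq_bigr => g _; field; by rewrite gt_eqF.
  rewrite D1; have e2 : 0 < 2 * e by rewrite mulr_gt0.
  have H (S : R) : S <= e ^+ 2 -> S / (2 * e) <= e / 2.
    by move=> Se; rewrite ler_pdivrMr//; apply: le_trans Se _; apply: eq_ler; field.
  by have := H _ H1; have := H _ H2; lra.
apply: ler_sum => g _; rewrite ler_wpM2l//.
have := norm_le_amgm (1 - Y1 g) e0; have := norm_le_amgm (1 - Y2 g) e0.
have := ler_norm (1 - Y1 g); have := ler_norm (1 - Y2 g).
have := normr_ge0 (1 - Y1 g); have := normr_ge0 (1 - Y2 g).
rewrite !le_min; lra.
Qed.

End MinBound.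

(** * From randomized to deterministic algorithms *)

Section Yao.
Variables (R : realType) (n : nat) (d : measure_display) (T : measurableType d)
  (P : probability T R) (A : rand_stream_alg R n T).

Definition succeeds (eps : R) (a v : R) : bool := a / (1 + eps) <= v <= (1 + eps) * a.

Lemma measurable_success (eps a : R) (s : stream n) :
  measurable [set w | succeeds eps a (run (A w) s)]%classic.
Proof.
have := measurable_run A s measurableT (measurable_itv `[a / (1 + eps), (1 + eps) * a]%R).
by rewrite setTI; congr (measurable _); apply/seteqP; split=> w /=; rewrite in_itv.
Qed.

(** The easy half of Yao's principle: the failure weight of the automaton selected by a seed is
    integrated over the seeds, and the integral of each term is at most delta times its weight. *)
Lemma success_average (p eps delta : R) (W : nat) (ws : seq (R * stream n)) (c : R) :
  0 <= c -> estimates_lp_norm P A p eps delta W ->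
  (forall q, q \in ws -> 0 <= q.1 /\ (size q.2 <= W)%N) ->
  (forall w : T, c <= \sum_(q <- ws) q.1 *
     (~~ succeeds eps (lp_norm p (frequency q.2)) (run (A w) q.2))%:R) ->
  c <= delta * \sum_(q <- ws) q.1.
Proof.
move=> c0 est wsP cle.
pose S (q : R * stream n) : set T :=
  [set w | succeeds eps (lp_norm p (frequency q.2)) (run (A w) q.2)]%classic.
have mS q : measurable (~` S q)%classic by apply: measurableC; exact: measurable_success.
have PS q : q \in ws -> (P (~` S q)%classic <= delta%:E)%E.
  move=> qws; rewrite probability_setC; last exact: measurable_success.
  have := est q.2 (wsP q qws).2; rewrite -/(S q).
  have /fineK <- : P (S q) \is a fin_num by exact/fin_num_measure/measurable_success.
  by rewrite -EFinB !lee_fin; lra.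
(* The absolute value makes the integrand nonnegative for every [q], also outside the list [ws]. *)
pose f (q : R * stream n) : T -> \bar R := fun w => (`|q.1| * \1_(~` S q)%classic w)%:E.
have mI q : measurable_fun [set: T] (f q).
  apply/measurable_EFinP; apply: measurable_funM; first exact: measurable_cst.
  exact: measurable_indic.
have I0 q w : (0 <= f q w)%E.
  by rewrite lee_fin mulr_ge0.
have -> : \sum_(q <- ws) q.1 = \sum_(q <- ws) `|q.1|.
  by apply: eq_big_seq => q /wsP[q0 _]; rewrite ger0_norm.
rewrite -lee_fin; apply: (@le_trans _ _
    (\int[P]_w (\sum_(q <- ws) f q w))%E).
  have -> : (c%:E = \int[P]_w (cst c%:E w))%E.
    by rewrite (integral_cst P (@measurableT _ T)) [X in (_ * X)%E](probability_setT P) mule1.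
  apply: ge0_le_integral => //.
  - by apply: emeasurable_sum.
  - move=> w _ /=; rewrite /f sumEFin lee_fin; apply: le_trans (cle w) _.
    apply: eq_ler; apply: eq_big_seq => q /wsP[q0 _]; rewrite ger0_norm//; congr (_ * _).
    rewrite indicE; congr (_%:R); rewrite in_setC /S; congr (~~ _).
    by apply/idP/idP; rewrite inE.
rewrite ge0_integral_sum//.
apply: (@le_trans _ _ (\sum_(q <- ws) (delta * `|q.1|)%:E)%E); last first.
  by rewrite sumEFin -mulr_sumr.
rewrite big_seq [leRHS]big_seq; apply: lee_sum => q qws.
have -> : (\int[P]_x f q x)%E = (`|q.1|%:E * \int[P]_x (\1_(~` S q)%classic x)%:E)%E.
  rewrite -ge0_integralZl_EFin//; first by apply/measurable_EFinP; exact: measurable_indic.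
rewrite integral_indic//.
have -> : (~` S q `&` [set: T])%classic = (~` S q)%classic by apply/seteqP; split=> w //= -[].
rewrite EFinM [leRHS]muleC.
by rewrite lee_wpmul2l ?lee_fin// PS.
Qed.

End Yao.

Arguments pmf_at {n R} L Q A t _ _.

(** For j >= 1 the constant is absorbed by ln c <= ln B / 2 <= j ln B / 2. *)
Lemma exponent_le_bits (R : realType) (c B : R) (j S : nat) : 1 < c -> 0 < B ->
  2 * ln c <= ln B -> B ^+ j <= c * 2 ^+ S -> j%:R <= 2 * S%:R / ln B.
Proof.
move=> c1 B0 HL cnt.
have c0 : 0 < c by apply: lt_trans c1.
have lc : 0 < ln c by rewrite ln_gt0.
have lB : 0 < ln B by apply: lt_le_trans HL; rewrite mulr_gt0.
have p2 : 0 < (2 : R) by [].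
have p2S : 0 < (2 : R) ^+ S by rewrite exprn_gt0.
have : ln (B ^+ j) <= ln (c * 2 ^+ S).
  by rewrite ler_ln ?posrE ?exprn_gt0 ?mulr_gt0.
rewrite lnXn// lnM ?posrE// lnXn// -[ln B *+ j]mulr_natl -[ln 2 *+ S]mulr_natl => jl.
have S0 : 0 <= (S%:R : R) by rewrite ler0n.
have l2 : ln 2 <= 1 :> R by have := @le_ln1Dx R 1; rewrite -[1 + 1]/2 => ->.
rewrite ler_pdivlMr//.
case: j {cnt} jl => [|j] jl; first by rewrite mul0r mulr_ge0.
have j1 : 1 <= (j.+1%:R : R) by rewrite ler1n.
have S2 : S%:R * ln 2 <= S%:R :> R by rewrite ler_piMr.
move: HL lB jl; move: (ln B) (ln c) (S%:R * ln 2) S2 => l l4 s2 S2 HL lB jl.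
have : l <= j.+1%:R * l by rewrite ler_peMl// ltW.
by move: (j.+1%:R * l) jl => z; lra.
Qed.

Section Reduction.
Variables (R : realType) (n L Q X : nat).
Hypotheses (n0 : (0 < n)%N) (L0 : (0 < L)%N) (Q1 : (1 < Q)%N).
Local Notation G := 'rV['Z_Q]_n.
Local Notation Z := {ffun 'I_n -> 'I_L}.

Definition has_kernel (rho k : R) (F : G -> R) : Prop :=
  exists H, [/\ exists S, ridge_like H S, \tr H <= rho &
    forall (y : 'rV[int]_n) (A : R), 0 < A -> norm2 (map_mx intr y : 'rV[R]_n) <= A ^+ 2 ->
    exists v : 'rV[int]_n,
      norm2 (map_mx intr v - (map_mx intr y - map_mx intr y *m H)) <= 2 * (n%:R * L%:R ^+ 2) * A /\
      shift_dist F (proj Q v) <= 2 * A * k * \sum_u F u].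

Definition input_fail (p eps : R) (xs : seq (R * 'rV[int]_n)) (F o : G -> R) : R :=
  \sum_(q <- xs) q.1 * \sum_u F (u + proj Q q.2) * (~~ succeeds eps (lp_norm p q.2) (o u))%:R.

(** The stream ends at the frequency vector [x] whatever the prefix was, so the correct answer is
    independent of the prefix. *)
Definition complete (x : 'rV[int]_n) (s : stream n) : stream n := s ++ encode (x - frequency s).

Definition final_output (A : stream_alg R n) (t : state A) (u : G) : R :=
  output (foldl (@step R n A) t (encode (- lift X u))).

(** The hypothesis [t * L + 2 * X < Q] keeps prefix minus input in the range where [lift] inverts
    [proj]. *)
Lemma prefix_fail (A : stream_alg R n) (p eps : R) t (x : 'rV[int]_n) :
  (forall i, `|x 0 i| <= X%:Z) -> (t * L + 2 * X < Q)%N ->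
  (size (prefixes n L t))%:R^-1 * \sum_(s <- prefixes n L t)
     (~~ succeeds eps (lp_norm p x) (run A (complete x s)))%:R =
  \sum_a \sum_u pmf_at L Q A t a (u + proj Q x) *
     (~~ succeeds eps (lp_norm p x) (final_output a u))%:R.
Proof.
move=> xX tQ.
pose phi (a : state A) (u : G) : R :=
  (~~ succeeds eps (lp_norm p x) (final_output a (u - proj Q x)))%:R.
transitivity ((size (prefixes n L t))%:R^-1 *
    \sum_(s <- prefixes n L t) phi (run_state A s) (proj Q (frequency s))).
  congr (_ * _); rewrite big_seq [RHS]big_seq; apply: eq_bigr => s /prefix_bounds[_ fs].
  rewrite /phi /final_output -projB lift_proj//; last first.
    by move=> i; rewrite mxE [(- x) _ _]mxE; move: (fs i) (xX i); move: (frequency s 0 i) (x 0 i) => a b; move: (t * L)%N tQ => tL; lia.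
  by rewrite opprB /run /run_state /complete foldl_cat.
rewrite sum_prefixes//; apply: eq_bigr => a _.
rewrite (reindex (fun u => u + proj Q x))/=; last first.
  by exists (fun u => u - proj Q x) => u _; rewrite ?addrK ?subrK.
by apply: eq_bigr => u _; rewrite /phi addrK.
Qed.

Variables (p eps : R) (xs : seq (R * 'rV[int]_n)) (T : nat).
Hypotheses (T0 : (0 < T)%N) (TQ : (T * L + 2 * X < Q)%N).
Hypothesis xsP : forall q, q \in xs -> 0 <= q.1 /\ forall i, `|q.2 0 i| <= X%:Z.

(** The number of chunks is averaged too, since the distance of a step is small only on average over
    time. It starts from 1 because good states are those reached by a step. *)
Definition test_streams : seq (R * stream n) :=
  flatten [seq [seq (T%:R^-1 * ((size (prefixes n L t.+1))%:R^-1 * q.1), complete q.2 s)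
    | q <- xs, s <- prefixes n L t.+1] | t <- iota 0 T].

Lemma big_test_streams (phi : stream n -> 'rV[int]_n -> R) (psi : stream n -> R) :
  (forall q s, q \in xs -> psi (complete q.2 s) = phi (complete q.2 s) q.2) ->
  \sum_(q <- test_streams) q.1 * psi q.2 =
  T%:R^-1 * \sum_(t < T) \sum_(q <- xs) q.1 *
     ((size (prefixes n L t.+1))%:R^-1 * \sum_(s <- prefixes n L t.+1) phi (complete q.2 s) q.2).
Proof.
move=> E; rewrite /test_streams big_flatten big_map.
have -> : iota 0 T = index_iota 0 T by rewrite /index_iota subn0.
rewrite big_mkord mulr_sumr; apply: eq_bigr => t _.
rewrite big_flatten big_map mulr_sumr big_seq [RHS]big_seq; apply: eq_bigr => q qxs.
rewrite big_map /= !mulr_sumr; apply: eq_bigr => s _; rewrite E//; ring.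
Qed.

Lemma test_streams_weight : \sum_(q <- test_streams) q.1 = \sum_(q <- xs) q.1.
Proof.
have := @big_test_streams (fun _ _ => 1) (fun=> 1) (fun _ _ _ => erefl).
under eq_bigr do rewrite mulr1.
move=> ->.
have E (t : nat) : (size (prefixes n L t))%:R^-1 * \sum_(s <- prefixes n L t) 1 = 1 :> R.
  rewrite big_const_seq count_predT iter_addr_0 mulVf// pnatr_eq0 -lt0n size_prefixes.
  by rewrite expn_gt0 card_chunks.
transitivity (T%:R^-1 * \sum_(t < T) \sum_(q <- xs) q.1).
  congr (_ * _); apply: eq_bigr => t _; apply: eq_bigr => q _; by rewrite E mulr1.
move: (\sum_(q <- xs) q.1) => c.
by rewrite sumr_const card_ord -[c *+ T]mulr_natl mulKf// pnatr_eq0 -lt0n.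
Qed.

Lemma test_streams_size (W : nat) : (T * (n * L) + n * (T * L + X) <= W)%N ->
  forall q, q \in test_streams -> 0 <= q.1 /\ (size q.2 <= W)%N.
Proof.
move=> HW q /flatten_mapP[t]; rewrite mem_iota add0n => /andP[_ tT].
case/allpairsP => -[q' s] [/xsP[]]; rewrite -[(q', s).1]/q' -[(q', s).2]/s.
move=> q0 qX /prefix_bounds[ss fs] ->; split.
  by rewrite -[X in _ <= X]/(_ * (_ * q'.1)) !mulr_ge0 ?invr_ge0 ?ler0n.
rewrite -[X in size X]/(complete q'.2 s) size_cat; apply: leq_trans HW; apply: leq_add.
  by apply: leq_trans ss _; rewrite leq_mul2r tT orbT.
apply: size_encode => i; rewrite mxE [(- frequency s) _ _]mxE.
have tL : (t.+1 * L <= T * L)%N by rewrite leq_mul2r tT orbT.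
move: (fs i) (qX i); move: (frequency s 0 i) (q'.2 0 i) => a b; move: (t.+1 * L)%N (T * L)%N tL => tL TL; lia.
Qed.

Lemma det_fail (A : stream_alg R n) (k0 k th mu : R) :
  0 < k0 -> 0 < k -> 0 < th -> 0 <= mu ->
  (forall t a, good_state (Z := Z) (@chunk_shift n L Q) (pmf_at L Q A t.+1) (4 * k)
      (th * #|{: Z}|%:R / (2 * #|state A|%:R)) a ->
     mu * marg (pmf_at L Q A t.+1) a <=
     input_fail p eps xs (pmf_at L Q A t.+1 a) (@final_output A a)) ->
  (1 - th - (ln #|{: G}|%:R / (2 * k0) + T%:R * (2 * k0)) / (T%:R * k)) * mu <=
  \sum_(q <- test_streams) q.1 *
    (~~ succeeds eps (lp_norm p (frequency q.2)) (run A q.2))%:R.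
Proof.
move=> k00 kp thp mu0 inst.
have TR : 0 < (T%:R : R) by rewrite ltr0n.
rewrite (@big_test_streams (fun s x => (~~ succeeds eps (lp_norm p x) (run A s))%:R)
   (fun s => (~~ succeeds eps (lp_norm p (frequency s)) (run A s))%:R)); last first.
  move=> q s _; have -> // : frequency (complete q.2 s) = q.2.
  by rewrite /complete frequency_cat frequency_encode addrC subrK.
have pf t : (t < T)%N -> \sum_(q <- xs) q.1 * ((size (prefixes n L t.+1))%:R^-1 *
    \sum_(s <- prefixes n L t.+1) (~~ succeeds eps (lp_norm p q.2) (run A (complete q.2 s)))%:R)
  = \sum_a input_fail p eps xs (pmf_at L Q A t.+1 a) (@final_output A a).
  move=> tT; rewrite /input_fail exchange_big big_seq [RHS]big_seq; apply: eq_bigr => q qxs.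
  have [_ qX] := xsP qxs; rewrite (@prefix_fail A p eps t.+1 q.2 qX); first by rewrite mulr_sumr.
  by apply: leq_ltn_trans TQ; rewrite leq_add2r leq_mul2r tT orbT.
have inp0 t a : 0 <= input_fail p eps xs (pmf_at L Q A t a) (@final_output A a).
  rewrite /input_fail big_seq; apply: sumr_ge0 => q /xsP[q0 _]; rewrite mulr_ge0//.
  by apply: sumr_ge0 => u _; rewrite mulr_ge0//; have [] := pmf_at_pmf Q A L0 t.
have st t : (1 - th - step_dist (@chunk_shift n L Q) (@chunk_step n R L A) (pmf_at L Q A t) / k) * mu
   <= \sum_a input_fail p eps xs (pmf_at L Q A t.+1 a) (@final_output A a).
  apply: (@le_trans _ _ (mu * \sum_(a | good_state (Z := Z) (@chunk_shift n L Q)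
     (pmf_at L Q A t.+1) (4 * k) (th * #|{: Z}|%:R / (2 * #|state A|%:R)) a)
      marg (pmf_at L Q A t.+1) a)).
    rewrite mulrC ler_wpM2l//.
    exact: (good_state_mass _ _ (card_chunks n L0) kp thp (pmf_at_pmf Q A L0 t)).
  rewrite mulr_sumr big_mkcond; apply: ler_sum => a _; case: ifP => [/(inst t a)//|_].
  exact: inp0.
apply: (@le_trans _ _ (T%:R^-1 * \sum_(t < T) (1 - th -
   step_dist (@chunk_shift n L Q) (@chunk_step n R L A) (pmf_at L Q A t) / k) * mu)); last first.
  rewrite ler_wpM2l ?invr_ge0 ?(ltW TR)//; apply: ler_sum => t _; rewrite pf//.
rewrite -mulr_suml [leRHS]mulrA; apply: ler_wpM2r => //; rewrite sumrB sumr_const card_ord -mulr_suml.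
rewrite -[(1 - th) *+ T]mulr_natl mulrBr mulKf ?gt_eqF// lerD2l lerN2.
have := sum_step_dist_le (@chunk_shift n L Q) (@chunk_step n R L A) (card_chunks n L0) T k00
  (pmf0_pmf Q A).
move=> H; rewrite [(T%:R * k)^-1]invfM [leRHS]mulrCA.
by rewrite ler_pM2l ?invr_gt0// ler_pM2r ?invr_gt0.
Qed.

(* A counting bound [(L/F)^j <= 400 2^S] with [ln (L/F)] large leaves [j = 0] or [j ln (L/F) <= 2 S]. *)
Lemma reduction (d : measure_display) (T' : measurableType d) (P : probability T' R)
    (A : rand_stream_alg R n T') (S W F : nat) (delta k eta mu : R) :
  uses_bits A S -> estimates_lp_norm P A p eps delta W ->
  (T * (n * L) + n * (T * L + X) <= W)%N ->
  0 < k -> 0 < eta -> (0 < F)%N -> 8 * n%:R ^+ 2 / eta <= (F%:R - 1) ^+ 2 -> 0 <= mu ->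
  200 ^+ 2 * ln #|{: G}|%:R <= T%:R * k ^+ 2 ->
  2 * ln 400 <= ln (L%:R / F%:R : R) ->
  (forall f o : G -> R, (forall u, 0 <= f u) ->
     has_kernel (eta + 2 * S%:R / ln (L%:R / F%:R)) (4 * k) f ->
     mu * (\sum_u f u) <= input_fail p eps xs f o) ->
  98 / 100 * mu <= delta * \sum_(q <- xs) q.1.
Proof.
move=> AS est HW k0 eta0 F0 HF mu0 HT HL inst; rewrite -test_streams_weight.
have TR : 0 < (T%:R : R) by rewrite ltr0n.
apply: (success_average _ est (test_streams_size HW)) => [|w]; first by rewrite mulr_ge0.
(* Of the lost 2/100, [th] takes 1/100, and with this parameter each of the two entropy terms takes
   at most 1/200. *)
have kq : 0 < k / 400 by lra.
have th0 : 0 < (1 / 100 : R) by lra.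
apply: le_trans (det_fail kq k0 th0 mu0 _); last first.
  move=> t a gs; apply: inst => [u|]; first by have [] := pmf_at_pmf Q (A w) L0 t.+1.
  have m0 : 0 < 1 / 100 * #|{: Z}|%:R / (2 * #|state (A w)|%:R) :> R.
    have Z0 := card_chunks n L0.
    by rewrite divr_gt0 ?mulr_gt0 ?ltr0n//; apply/card_gt0P; exists a.
  have f0 : forall b u, 0 <= pmf_at (R := R) L Q (A w) t.+1 b u.
    by have [] := pmf_at_pmf Q (A w) L0 t.+1.
  have k4 : 0 <= 4 * k by lra.
  have [H [SH [[j [tr cnt]] ker]]] := good_state_kernel n0 L0 f0 m0 eta0 k4 F0 HF gs.
  exists H; split=> //.
  apply: le_trans tr _; rewrite addrC lerD2l.
  have FR : 0 < (F%:R : R) by rewrite ltr0n.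
  have LR : 0 < (L%:R : R) by rewrite ltr0n.
  have lB : 0 < ln (L%:R / F%:R : R).
    by apply: lt_le_trans HL; rewrite mulr_gt0// ln_gt0; lra.
  (* A good state has a set of chunks of density at least 1 / (200 |state|), and [trace_ridge_le]
     loses a further factor 2. *)
  have cnt2 : (L%:R / F%:R) ^+ j <= 400 * 2 ^+ S :> R.
    have NS : #|state (A w)|%:R <= 2 ^+ S :> R by rewrite -natrX ler_nat; exact: AS.
    have N0 : 0 < #|state (A w)|%:R :> R by rewrite ltr0n; apply/card_gt0P; exists a.
    apply: (@le_trans _ _ (400 * #|state (A w)|%:R)); last by apply: ler_wpM2l; rewrite ?ler0n.
    rewrite expr_div_n ler_pdivrMr ?exprn_gt0//.
    move: cnt; rewrite card_ffun !card_ord natrX.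
    have Ln : 0 < (L%:R : R) ^+ n by rewrite exprn_gt0.
    move: (L%:R ^+ j) (F%:R ^+ j) (L%:R ^+ n) Ln (#|state (A w)|%:R) N0 => lj fj ln' Ln N N0.
    rewrite mulrAC ler_pdivrMr ?mulr_gt0// => cnt.
    by rewrite -(ler_pM2r Ln); lra.
  by apply: exponent_le_bits HL cnt2; rewrite ?divr_gt0// ltr1n.
rewrite ler_wpM2r//.
have E : (ln #|{: G}|%:R / (2 * (k / 400)) + T%:R * (2 * (k / 400))) / (T%:R * k) =
   200 * (ln #|{: G}|%:R / (T%:R * k ^+ 2)) + 1 / 200 :> R.
  by field; rewrite !gt_eqF.
rewrite E; have : ln #|{: G}|%:R / (T%:R * k ^+ 2) <= 1 / 200 ^+ 2 :> R.
  rewrite ler_pdivrMr ?mulr_gt0 ?exprn_gt0//.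
  by rewrite mul1r ler_pdivlMl ?exprn_gt0//; lra.
by move: (ln _ / _) => z; rewrite expr2; lra.
Qed.

End Reduction.

(** * The scales of box, noise and group, and the resulting bound on the failure *)

Section Core.
Variables (R : realType) (n L q : nat) (p eps delta : R).
Hypotheses (n0 : (0 < n)%N) (nq : (n <= q)%N) (q400 : (400 <= q)%N) (qL : (q ^ 5 <= L)%N).
Variables (d : measure_display) (T : measurableType d) (P : probability T R).
Variables (A : rand_stream_alg R n T) (S W : nat).
Hypotheses (AS : uses_bits A S) (est : estimates_lp_norm P A p eps delta W).
Hypothesis WL : (L ^ 20 <= W)%N.

(** The exponents: rounding for a [y] of norm up to L^5 leaves an error of squared norm 2 n L^7,
    small against s^2 = L^8. With L^14 chunks and k = L^-6, the product L^14 k^2 = L^2 exceeds the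
    entropy n ln Q by the required constant. [X] bounds all inputs, [M] cuts the noise off at q^2
    times its scale, and [Q] exceeds everything that occurs in a stream. *)
Local Notation s := (L ^ 4)%N.
Local Notation Q := (L ^ 17)%N.
Local Notation X := (L ^ 8)%N.
Local Notation M := (L ^ 4 * q ^ 2)%N.
Local Notation G := 'rV['Z_Q]_n.
Local Notation D := (@noise R n Q s M X).
Local Notation lft := (@lift n Q X).

Definition scaled (z : 'rV[int]_n) : 'rV[R]_n := s%:R^-1 *: map_mx intr z.

Lemma q_gt0 : (0 < q)%N. Proof. exact: leq_trans q400. Qed.
Lemma q_leL : (q * 400 ^ 4 <= L)%N.
Proof. by apply: leq_trans qL; rewrite -[(q ^ 5)%N]/(q * q ^ 4)%N leq_mul2l leq_exp2r// q400 orbT. Qed.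
Lemma L_gt : (400 < L)%N.
Proof.
apply: leq_trans qL; apply: (@leq_trans (q ^ 2)%N); last by rewrite leq_pexp2l// q_gt0.
by rewrite -[(q ^ 2)%N]/(q * q)%N (leq_ltn_trans q400)// ltn_Pmulr ?q_gt0// (leq_trans _ q400).
Qed.
Lemma L_gt0 : (0 < L)%N. Proof. by apply: ltn_trans L_gt. Qed.
Lemma s_gt0 : (0 < s)%N. Proof. by rewrite expn_gt0 L_gt0. Qed.
Lemma q2_leL : (q ^ 2 <= L)%N.
Proof. by apply: leq_trans qL; rewrite leq_pexp2l// q_gt0. Qed.
Lemma M_leX : (M <= X)%N.
Proof.
apply: (@leq_trans (L ^ 4 * L)%N); first by rewrite leq_mul2l q2_leL orbT.
by rewrite -expnSr leq_pexp2l// L_gt0.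
Qed.
Lemma X_Q k : (k <= 400)%N -> (k * X < Q)%N.
Proof.
move=> k4; apply: (@leq_ltn_trans (400 * L ^ 8)%N); first by rewrite leq_mul2r k4 orbT.
apply: (@leq_trans (L ^ 9)%N); last by rewrite leq_pexp2l// L_gt0.
by rewrite -[(L ^ 9)%N]/(L * L ^ 8)%N ltn_mul2r expn_gt0 L_gt0 L_gt.
Qed.
Lemma Q_gt1 : (1 < Q)%N.
Proof. by rewrite -[1%N](exp1n 17) ltn_exp2r// (leq_trans _ L_gt). Qed.
Lemma XM_Q : (X + M < Q)%N.
Proof.
apply: leq_ltn_trans (X_Q (k := 2) isT); rewrite mul2n -addnn leq_add2l; exact: M_leX.
Qed.

Hypothesis delta0 : 0 < delta.

Variables (K : nat) (mu : 'I_K -> nat) (J I : finType) (wJ : J -> R) (pi : I -> R).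
Variables (xb : J -> 'rV[int]_n) (y : J -> I -> 'rV[int]_n) (E : R).
Hypotheses (K3 : (K <= 3)%N) (mu20 : forall k, (mu k <= 20)%N).
Hypotheses (wJ0 : forall j, 0 <= wJ j) (wJ1 : \sum_j wJ j = 1).
Hypotheses (pi0 : forall i, 0 <= pi i) (pi1 : \sum_i pi i = 1) (E0 : 0 <= E).
Hypothesis xbX : forall j i, `|xb j 0 i| <= (L ^ 6)%:Z.
Hypothesis yX : forall j i i', `|y j i 0 i'| <= (L ^ 6)%:Z.
Hypothesis yL : forall j i, norm2 (map_mx intr (y j i) : 'rV[R]_n) <= (L%:R ^+ 5) ^+ 2.

Definition fails (o : G -> R) (u : G) (x : 'rV[int]_n) : bool :=
  ~~ succeeds eps (lp_norm p x) (o u).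

Definition separates j (w : I -> 'rV[int]_n) : Prop :=
  forall (f o : G -> R) (kap : R), (forall u, 0 <= f u) -> 0 <= kap ->
  (forall i, shift_dist f (proj Q (y j i + w i)) <= kap) ->
  K.-1%:R * (\sum_u f u) * E <=
    \sum_k fail_mass s M X f mu pi (xb j) (y j) (fails o) k + kap * \sum_k (mu k)%:R.

Hypothesis inst : forall (H Sg : 'M[R]_n) (w : J -> I -> 'rV[int]_n),
  ridge_like H Sg -> \tr H <= q%:R^-1 + 4 * S%:R / ln L%:R ->
  (forall j i, norm2 (scaled (w j i) + scaled (y j i) *m H) <= (q%:R ^+ 3)^-1) ->
  exists2 goodJ : pred J, 99 / 100 <= \sum_(j | goodJ j) wJ j &
    forall j, goodJ j -> separates j (w j).

Definition test_inputs : seq (R * 'rV[int]_n) :=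
  [seq (wJ a.1.1.1 * pi a.1.1.2 * D a.2, xb a.1.1.1 + y a.1.1.1 a.1.1.2 *+ mu a.1.2 + lft a.2)
    | a <- enum [pred a : J * I * 'I_K * G | inbox M X a.2]].

Lemma sum_test_inputs (phi : 'rV[int]_n -> R) :
  \sum_(a <- test_inputs) a.1 * phi a.2 = \sum_j wJ j * \sum_k \sum_i pi i * \sum_g D g *
    phi (xb j + y j i *+ mu k + lft g).
Proof.
rewrite /test_inputs big_map big_enum_cond /=.
have D0 (g : G) : ~~ inbox M X g -> D g = 0.
  rewrite -(noise_gt0 R s_gt0 Q_gt1 M_leX XM_Q) -leNgt => g0.
  by apply/eqP; rewrite eq_le g0 (noise_ge0 _ s_gt0 Q_gt1 M_leX XM_Q).
pose f j i k g := wJ j * pi i * D g * phi (xb j + y j i *+ mu k + lft g).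
transitivity (\sum_(a : J * I * 'I_K * G) f a.1.1.1 a.1.1.2 a.1.2 a.2).
  rewrite big_mkcond; apply: eq_bigr => a _; rewrite andbT inE /f; case: ifPn => // gb.
  by rewrite (D0 a.2 gb) mulr0 mul0r.
rewrite -(pair_bigA _ (fun a g => f a.1.1 a.1.2 a.2 g)) /=.
rewrite -(pair_bigA _ (fun a k => \sum_g f a.1 a.2 k g)) /=.
rewrite -(pair_bigA _ (fun j i => \sum_k \sum_g f j i k g)) /=.
apply: eq_bigr => j _; rewrite exchange_big mulr_sumr; apply: eq_bigr => k _ /=.
rewrite mulr_sumr; apply: eq_bigr => i _; rewrite !mulr_sumr; apply: eq_bigr => g _.
by rewrite /f; ring.
Qed.

Lemma test_inputs_weight : \sum_(a <- test_inputs) a.1 = K%:R.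
Proof.
under eq_bigr do rewrite -[_.1]mulr1.
rewrite (sum_test_inputs (fun=> 1)).
under eq_bigr => j _ do under eq_bigr => k _ do under eq_bigr => i _ do
  under eq_bigr => g _ do rewrite mulr1.
rewrite (sum_noise R n s_gt0 Q_gt1 M_leX XM_Q).
under eq_bigr => j _ do under eq_bigr => k _ do under eq_bigr => i _ do rewrite mulr1.
rewrite pi1; under eq_bigr do rewrite sumr_const card_ord.
by rewrite -mulr_suml wJ1 mul1r.
Qed.

Lemma test_inputsP a : a \in test_inputs -> 0 <= a.1 /\ forall i, `|a.2 0 i| <= X%:Z.
Proof.
case/mapP => -[[[j i] k] g]; rewrite mem_enum inE => /= gb ->; split.
  by rewrite /= !mulr_ge0// (noise_ge0 _ s_gt0 Q_gt1 M_leX XM_Q).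
move=> i'; rewrite -[(_, _).2]/(xb j + y j i *+ mu k + lft g).
rewrite mxE [(xb j + _) _ _]mxE mulmxnE.
have /forallP/(_ i') gi := gb; have := xbX j i'; have := yX j i i'.
have LX : (22 * L ^ 6 <= X)%N.
  rewrite -[8%N]/(2 + 6)%N expnD leq_mul2r orbC; apply/orP; left.
  by apply: (@leq_trans (L ^ 1)%N); rewrite ?leq_pexp2l ?L_gt0// expn1 (leq_trans _ L_gt).
have ML : (M <= L ^ 6)%N.
  by rewrite -[6%N]/(4 + 2)%N expnD leq_mul2l leq_exp2r// orbC (leq_trans _ q2_leL)// leq_pmulr// q_gt0.
move: gi (mu20 k) LX ML; move: (xb j 0 i') (y j i 0 i') (lft g 0 i') (mu k) => x' y' g' m.
move: (L ^ 6)%N (L ^ 8)%N (L ^ 4 * q ^ 2)%N => a0 b c gc m20 ab ca ya xa.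
have ym : `|y' *+ m| <= 20 * a0%:Z.
  rewrite normrMn -[`|y'| *+ m]mulr_natl natz; apply: ler_pM => //; lia.
by move: (y' *+ m) ym => z; lia.
Qed.

Lemma ln_natX m k : ln ((m ^ k)%N%:R) = k%:R * ln m%:R :> R.
Proof.
case: m => [|m]; last by rewrite natrX lnXn ?ltr0n// mulr_natl.
case: k => [|k]; first by rewrite ln1 mul0r.
by rewrite exp0n// ln0// mulr0.
Qed.

(** 98/100 is the loss in [reduction] and 99/100 the weight of the good [j]. The imperfect
    invariance costs 504 / L: 8 / L per unit of multiple, and the multiples add up to at most 63. *)
Lemma core_bound : 98 / 100 * (99 / 100 * K.-1%:R * E - 504 / L%:R) <= delta * K%:R.
Proof.
set m := _ - 504 / _; have [m0|m0] := ltP m 0.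
  by apply: (@le_trans _ _ 0); rewrite ?mulr_ge0 ?(ltW delta0)//; lra.
have LR : 0 < (L%:R : R) by rewrite ltr0n L_gt0.
have qR : 0 < (q%:R : R) by rewrite ltr0n q_gt0.
have F0 : (0 < 4 * q ^ 2)%N by rewrite muln_gt0 expn_gt0 q_gt0.
have q4 : 400 <= (q%:R : R) by rewrite ler_nat.
have FR : ((4 * q ^ 2)%N%:R : R) = 4 * q%:R ^+ 2 by rewrite natrM natrX.
have LB : q%:R ^+ 5 <= (L%:R : R) by rewrite -natrX ler_nat.
rewrite -test_inputs_weight.
have k0 : 0 < (L%:R ^+ 6)^-1 :> R by rewrite invr_gt0 exprn_gt0.
have eta0 : 0 < (q%:R)^-1 :> R by rewrite invr_gt0.
have nR : n%:R <= (q%:R : R) by rewrite ler_nat.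
have lnL : ln L%:R <= (L%:R : R).
  by apply: le_trans (ln_le_sub1 LR) _; rewrite lerBlDr lerDl.
(* The window size 4 q^2 is at most the square root of [L], because 16 q^4 <= q^5 <= L; passing from
   L / F to [L] therefore costs a factor 2. *)
have HlnB : ln L%:R / 2 <= ln (L%:R / (4 * q ^ 2)%N%:R) :> R.
  rewrite FR ln_div ?posrE// ?mulr_gt0// ?exprn_gt0//.
  have : ln ((4 * q%:R ^+ 2) ^+ 2) <= ln L%:R :> R.
    rewrite ler_ln ?posrE ?exprn_gt0 ?mulr_gt0 ?exprn_gt0//; apply: le_trans LB.
    have -> : (4 * q%:R ^+ 2) ^+ 2 = 16 * q%:R ^+ 4 :> R by ring.
    by rewrite [leRHS]exprS ler_wpM2r ?exprn_ge0 ?ltW//; lra.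
  rewrite lnXn ?mulr_gt0 ?exprn_gt0// mulr2n; lra.
have lnL0 : 0 < ln L%:R :> R by rewrite ln_gt0// ltr1n (leq_trans _ L_gt).
apply: (reduction (S := S) (F := (4 * q ^ 2)%N) (T := (L ^ 14)%N) (L := L) (X := X)
  n0 L_gt0 Q_gt1 _ _ test_inputsP AS est _ k0 eta0 F0 _ m0).
- by rewrite expn_gt0 L_gt0.
- rewrite -expnSr; apply: (@leq_ltn_trans (L ^ 16)%N); last first.
    by rewrite ltn_exp2l// (leq_trans _ L_gt).
  apply: (@leq_trans (L ^ 15 * 2)%N); last first.
    by rewrite [X in (_ <= X)%N]expnSr leq_mul2l (leq_trans _ L_gt) ?orbT.
  rewrite muln2 -addnn leq_add2l; apply: (@leq_trans (L * L ^ 8)%N).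
    by rewrite leq_mul2r (leq_trans _ L_gt) ?orbT.
  by rewrite -expnS leq_pexp2l// L_gt0.
- apply: leq_trans WL; have nL : (n <= L)%N.
    by apply: leq_trans nq _; apply: leq_trans q_leL; rewrite leq_pmulr// expn_gt0.
  rewrite mulnCA -expnSr -mulnDr; apply: (@leq_trans (L * L ^ 17)%N).
    apply: leq_mul nL _; apply: (@leq_trans (L ^ 15 * 3)%N).
      by rewrite mulnSr muln2 -addnn addnA leq_add2l leq_pexp2l// L_gt0.
    rewrite -[17%N]/(15 + 2)%N expnD leq_mul2l; apply/orP; right.
    by apply: (@leq_trans (L ^ 1)%N); rewrite ?leq_pexp2l ?L_gt0// expn1 (leq_trans _ L_gt).
  by rewrite -expnS leq_pexp2l// L_gt0.
- rewrite invrK FR; apply: (@le_trans _ _ (8 * q%:R ^+ 2 * q%:R)).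
    by rewrite ler_wpM2r ?(ltW qR)// ler_wpM2l// lerXn2r// nnegrE.
  move: q4; move: (q%:R : R) => z z4.
  have z2 : 400 * z <= z ^+ 2 by rewrite expr2; nra.
  have : 3 * z ^+ 2 <= 4 * z ^+ 2 - 1 by nra.
  have z2p : 0 <= 3 * z ^+ 2 by rewrite mulr_ge0 ?sqr_ge0.
  move=> H; apply: (@le_trans _ _ ((3 * z ^+ 2) ^+ 2)); last by rewrite lerXn2r// nnegrE// (le_trans z2p).
  have -> : (3 * z ^+ 2) ^+ 2 = 9 * z * (z ^+ 2 * z) by ring.
  have zz : 0 <= z ^+ 2 * z by nra.
  rewrite -mulrA; move: (z ^+ 2 * z) zz => t t0; nra.
- rewrite card_mx mul1n card_ord Zp_cast ?Q_gt1// -expnM ln_natX natrM natrX.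
  rewrite exprVn -exprM -[17%:R * _ * _]mulrA.
  have -> : L%:R ^+ 14 / L%:R ^+ (6 * 2) = L%:R ^+ 2 :> R.
    by rewrite -[14%N]/(12 + 2)%N exprD mulrAC mulfV ?mul1r// expf_neq0 ?gt_eqF.
  apply: (@le_trans _ _ (200 ^+ 2 * (17 * (q%:R * L%:R)))).
    apply: ler_wpM2l; first by rewrite exprn_ge0.
    by apply: ler_wpM2l => //; apply: ler_pM => //; rewrite ltW.
  rewrite expr2 !mulrA ler_wpM2r ?(ltW LR)//.
  have : (q%:R : R) * 400 ^+ 4 <= L%:R by rewrite -natrX -natrM ler_nat q_leL.
  apply: le_trans; rewrite mulrC ler_wpM2l ?ltW//.
  have -> : (400 : R) = 2 * 200 by rewrite -natrM.
  have : 2 <= (200 : R) by rewrite ler_nat.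
  move: (200 : R) => z z1; have z4 : 4 <= z * z by nra.
  have -> : (2 * z) ^+ 4 = 16 * (z * z) * (z * z) by ring.
  by move: (z * z) z4 => t t4; nra.
- apply: le_trans HlnB.
  have : ln (400 ^+ 4) <= ln L%:R :> R.
    rewrite ler_ln ?posrE ?exprn_gt0 ?ltr0n ?L_gt0//.
    rewrite -natrX ler_nat; apply: leq_trans q_leL; exact: (leq_pmull _ q_gt0).
  rewrite lnXn ?ltr0n// -[ln 400 *+ 4]mulr_natl.
  by move: (ln L%:R) (ln 400) => a c; lra.
move=> f o f0 [H [[Sg rl] tr ker]].
have tr' : \tr H <= q%:R^-1 + 4 * S%:R / ln L%:R.
  apply: le_trans tr _; rewrite lerD2l.
  have -> : 4 * S%:R / ln L%:R = 2 * S%:R / (ln L%:R / 2) :> R by field; rewrite gt_eqF.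
  rewrite ler_wpM2l ?mulr_ge0// lef_pV2// posrE; last by rewrite divr_gt0.
  by apply: lt_le_trans HlnB; rewrite divr_gt0.
have AL : 0 < (L%:R ^+ 5 : R) by rewrite exprn_gt0.
pose v j i := sval (cid (ker (y j i) _ AL (yL j i))).
have vP j i : norm2 (map_mx intr (v j i) - (map_mx intr (y j i) - map_mx intr (y j i) *m H))
     <= 2 * (n%:R * L%:R ^+ 2) * L%:R ^+ 5 /\
   shift_dist f (proj Q (v j i)) <= 2 * L%:R ^+ 5 * (4 * (L%:R ^+ 6)^-1) * \sum_u f u.
  exact: (svalP (cid (ker (y j i) _ AL (yL j i)))).
have [j i|goodJ gJ sepJ] := inst (w := fun j i => v j i - y j i) rl tr'.
  have [+ _] := vP j i.
  have -> : scaled (v j i - y j i) + scaled (y j i) *m H = s%:R^-1 *: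
     (map_mx intr (v j i) - (map_mx intr (y j i) - map_mx intr (y j i) *m H)).
    by rewrite /scaled -scalemxAl -scalerDr map_mxB opprB [in RHS]addrA [in LHS]addrAC.
  rewrite norm2Z => Hv; apply: (@le_trans _ _ ((s%:R^-1) ^+ 2 * (2 * (n%:R * L%:R ^+ 2) * L%:R ^+ 5))).
    by rewrite ler_wpM2l ?sqr_ge0.
  rewrite natrX -exprVn -exprM.
  have -> : (L%:R)^-1 ^+ 8 * (2 * (n%:R * L%:R ^+ 2) * L%:R ^+ 5) = 2 * n%:R / L%:R :> R.
    by field; rewrite gt_eqF.
  rewrite ler_pdivrMr// ler_pdivlMl ?exprn_gt0//; apply: le_trans LB.
  move: nR q4; move: (q%:R : R) (n%:R : R) => z x xz z4.
  have z3 : 0 <= z ^+ 3 by rewrite exprn_ge0//; lra.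
  have -> : z ^+ 5 = z ^+ 3 * z ^+ 2 by ring.
  by rewrite ler_wpM2l//; nra.
have -> : input_fail p eps test_inputs f o =
   \sum_j wJ j * \sum_k fail_mass s M X f mu pi (xb j) (y j) (fails o) k.
  rewrite /input_fail.
  by rewrite (sum_test_inputs (fun x => \sum_u f (u + proj Q x) * (~~ succeeds eps (lp_norm p x) (o u))%:R)).
set kap := 2 * L%:R ^+ 5 * (4 * (L%:R ^+ 6)^-1) * \sum_u f u.
have sf0 : 0 <= \sum_u f u by exact: sumr_ge0.
have kap0 : 0 <= kap by rewrite !mulr_ge0// ?exprn_ge0// ?invr_ge0 ?exprn_ge0// ltW.
have fm0 j k : 0 <= fail_mass s M X f mu pi (xb j) (y j) (fails o) k.
  apply: sumr_ge0 => i _; rewrite mulr_ge0//; apply: sumr_ge0 => g _.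
  rewrite mulr_ge0 ?(noise_ge0 _ s_gt0 Q_gt1 M_leX XM_Q)//.
  by apply: sumr_ge0 => u _; rewrite mulr_ge0.
have smu : \sum_k (mu k)%:R <= 63 :> R.
  rewrite -natr_sum ler_nat; apply: (@leq_trans (\sum_(k < K) 20)%N).
    by apply: leq_sum => k _; exact: mu20.
  rewrite sum_nat_const card_ord; apply: (@leq_trans (3 * 20)%N) => //.
  by rewrite leq_mul2r K3 orbT.
apply: (@le_trans _ _ (\sum_(j | goodJ j) wJ j * (K.-1%:R * (\sum_u f u) * E - kap * 63))).
  rewrite -mulr_suml.
  have w1 : \sum_(j | goodJ j) wJ j <= 1.
    by rewrite -wJ1 [leRHS](bigID goodJ)/= lerDl sumr_ge0.
  have kE : kap * 63 = 504 / L%:R * \sum_u f u.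
    have -> : (504 : R) = 8 * 63 by rewrite -natrM.
    by rewrite /kap; field; rewrite gt_eqF.
  rewrite kE /m; move: gJ w1 sf0; move: (\sum_(j | _) _) (\sum_u _) => a z a0 a1 z0.
  have [Ka kb] : 0 <= K.-1%:R * E /\ 0 <= 504 / L%:R :> R.
    by split; [rewrite mulr_ge0|apply: divr_ge0; rewrite ler0n].
  rewrite -[99 / 100 * _ * E]mulrA; move: Ka kb; rewrite -[K.-1%:R * z * E]mulrAC.
  move: (K.-1%:R * E) (504 / _) => x y' x0 y0.
  have xz := mulr_ge0 x0 z0; have yz := mulr_ge0 y0 z0.
  by rewrite mulrBl mulrBr -!mulrA; move: (x * z) (y' * z) xz yz => t t' t0 t'0; nra.
rewrite [leRHS](bigID goodJ) /= -[leLHS]addr0 lerD//; last first.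
  by apply: sumr_ge0 => j _; rewrite mulr_ge0// sumr_ge0.
apply: ler_sum => j gj; rewrite ler_wpM2l// lerBlDr.
have := sepJ j gj f o kap f0 kap0; move=> H1.
apply: le_trans (H1 _) _ => [i|].
  by rewrite addrC subrK; have [] := vP j i.
by rewrite lerD2l ler_wpM2l.
Qed.

End Core.

Lemma succeeds_excl (R : realType) (eps a1 a2 v : R) : 0 < eps ->
  (1 + eps) ^+ 2 * a1 < a2 -> ~~ succeeds eps a1 v || ~~ succeeds eps a2 v.
Proof.
move=> e0 H; rewrite -negb_and; apply/negP => /andP[/andP[_ v1] /andP[v2 _]].
have e1 : 0 < 1 + eps by rewrite addr_gt0.
move: v2; rewrite ler_pdivrMr// => v2.
have : v * (1 + eps) <= (1 + eps) ^+ 2 * a1 by rewrite mulrC expr2 -mulrA ler_pM2l.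
lra.
Qed.

Lemma map_intrMn (R : realType) n (x : 'rV[int]_n) m :
  map_mx intr (x *+ m) = m%:R *: map_mx intr x :> 'rV[R]_n.
Proof. by apply/rowP => i; rewrite !mxE mulmxnE rmorphMn mulr_natl. Qed.

Lemma weighted_min_le (R : realType) (P z : R) : 0 <= P <= 1 -> 0 <= z -> P * Num.min 1 z <= z.
Proof.
move=> /andP[P0 P1] z0; apply: (@le_trans _ _ (1 * z)); last by rewrite mul1r.
by apply: ler_pM => //; rewrite ?ge_min ?lexx ?orbT// le_min ler01.
Qed.

Lemma weighted_min_le0 (R : realType) (P z0 z1 : R) : 0 <= P -> 0 <= z0 -> 0 <= z1 ->
  (0 < z1 -> z0 = P) -> P * Num.min 1 z1 <= z0.
Proof.
move=> P0 z00; rewrite le0r => /orP[/eqP ->|z10] z01; first by rewrite min_r ?ler01// mulr0.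
by rewrite z01// ler_piMr// ge_min lexx.
Qed.

(** * Separated norms and truncated likelihood ratios *)

Section Separation.
Variables (R : realType) (n Q s M X : nat).
Hypotheses (s0 : (0 < s)%N) (Q1 : (1 < Q)%N) (MX : (2 * M <= X)%N) (XQ : (3 * X < Q)%N).
Local Notation G := 'rV['Z_Q]_n.
Local Notation D := (@noise R n Q s M X).
Local Notation lft := (@lift n Q X).

Let MX1 : (M <= X)%N. Proof. by apply: leq_trans MX; rewrite leq_pmull. Qed.
Let XQ1 : (X + M < Q)%N. Proof. by lia. Qed.

Variables (p eps : R) (K : nat) (mu : 'I_K -> nat) (k0 : 'I_K) (I : finType) (pi : I -> R).
Variables (xb : 'rV[int]_n) (y w : I -> 'rV[int]_n) (good : pred I).
Variables (typ typS : pred 'rV[int]_n) (e Pg : R).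
Hypotheses (eps0 : 0 < eps) (mu0 : mu k0 = 0%N).
Hypotheses (pi0 : forall i, 0 <= pi i) (pi1 : \sum_i pi i = 1).
Hypothesis wM : forall k i c, good i -> 2 * (`|w i 0 c| *+ mu k) <= M%:Z.
Hypothesis hS : forall k i g, good i -> typS g -> typ g && typ (g - w i *+ mu k).
Hypothesis he : \sum_(g | ~~ (typS (lft g) && [forall c, 2 * `|lft g 0 c| <= M%:Z])) D g <= e.
Hypothesis hPg : Pg = \sum_(i | good i) pi i.
Hypothesis hN : forall (k1 k2 : 'I_K) i1 i2 g1 g2, (k1 < k2)%N -> good i1 -> good i2 -> typ g1 -> typ g2 ->
  g1 - w i1 *+ mu k1 = g2 - w i2 *+ mu k2 ->
  (1 + eps) ^+ 2 * lp_norm p (xb + y i1 *+ mu k1 + g1) < lp_norm p (xb + y i2 *+ mu k2 + g2).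

Let v i := y i + w i.
Local Notation dsp := (disp mu y v).

Lemma disp_w k i : dsp k i = w i *+ mu k.
Proof. by rewrite /disp; congr (_ *+ _); rewrite /v [y i + _]addrC addrK. Qed.

Lemma lift_shift (g : G) (z : 'rV[int]_n) : inbox M X g -> (forall c, `|z 0 c| <= M%:Z) ->
  lft (g + proj Q z) = lft g + z.
Proof.
move=> /forallP gb zM; rewrite -{1}(proj_lift X g) -projD lift_proj// => c.
by rewrite mxE; move: (gb c) (zM c); move: (lft g 0 c) (z 0 c) => a b; lia.
Qed.

(** The displaced noise has to be typical for the norms to separate. Requiring it of [lft g] as well
    makes each [g] tested for some [k] also tested for [k0], whose displacement is 0; hence the
    ratio of [k0] is exactly [Pg] there. *)
Definition tested k i (g : G) : bool :=
  [&& good i, inbox M X g, typ (lft g) & typ (lft g + dsp k i)].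

Let hOm k i g : tested k i g -> good i /\ inbox M X g.
Proof. by case/and4P. Qed.

Lemma disp_bound k i c : good i -> 2 * `|dsp k i 0 c| <= M%:Z.
Proof. by move=> gi; rewrite disp_w mulmxnE normrMn; exact: wM. Qed.

Let hl k i g : good i -> inbox M X g -> lft (g + proj Q (dsp k i)) = lft g + dsp k i.
Proof.
move=> gi gb; apply: lift_shift => // c.
by have := disp_bound k c gi; move: (dsp k i 0 c) => a; lia.
Qed.

(** Noise in the half box has room for a displacement of size M / 2, and [typS] survives it. *)
Lemma tested_fail k i : good i -> \sum_(g | ~~ tested k i (g - proj Q (dsp k i))) D g <= e.
Proof.
move=> gi; apply: le_trans he; rewrite [leRHS]big_mkcond [leLHS]big_mkcond.
apply: ler_sum => g _; case: ifPn => [nt|_]; last first.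
  by case: ifP => // _; rewrite (noise_ge0 _ s0 Q1 MX1 XQ1).
case: ifPn => // /negPn/andP[tS /forallP gs].
have gb : inbox M X g.
  by apply/forallP => c; move: (gs c); move: (lft g 0 c) => a; lia.
case/negP: nt; rewrite -projN.
have E : lft (g + proj Q (- dsp k i)) = lft g - dsp k i.
  apply: lift_shift => // c; rewrite mxE normrN.
  by have := disp_bound k c gi; move: (dsp k i 0 c) => a; lia.
have /andP[t1 t2] := hS k gi tS.
rewrite /tested gi E subrK t1 {2}disp_w t2 !andbT /=; apply/forallP => c.
rewrite E mxE [(- dsp k i) _ _]mxE; have := disp_bound k c gi; move: (gs c).
by move: (lft g 0 c) (dsp k i 0 c) => a b; lia.
Qed.

Local Notation Y := (lratio s M X mu pi y v tested).

Lemma tested_ratio_ge0 k g : 0 <= Y k g.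
Proof. exact: (lratio_ge0 s0 Q1 MX1 XQ1). Qed.

Lemma tested_ratio0 k g : 0 < Y k g -> Y k0 g = Pg.
Proof.
move=> Yp; have [i /and4P[_ gb tg _]] : exists i, tested k i g.
  apply/existsP; apply: contraTT Yp => /existsPn nt.
  by rewrite -leNgt /lratio big1 ?mul0r// => i; rewrite (negPf (nt i)).
have Dg : D g != 0 by rewrite gt_eqF// noise_gt0.
rewrite /lratio hPg (eq_bigl good); last first.
  by move=> j; rewrite /tested disp_w mu0 mulr0n addr0 gb tg !andbT.
under eq_bigr do rewrite disp_w mu0 mulr0n proj0 addr0.
by rewrite -mulr_suml mulfK.
Qed.

Lemma tested_mean k : (1 - e) * Pg <= \sum_g D g * Y k g.
Proof.
rewrite hPg; apply: (lratio_mean_ge s0 Q1 MX1 XQ1 pi0 hOm).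
by move=> i gi; exact: tested_fail.
Qed.

Lemma tested_mean_le1 k : \sum_g D g * Y k g <= 1.
Proof.
rewrite -pi1; apply: (@le_trans _ _ (\sum_g \sum_i pi i * D (g + proj Q (dsp k i)))).
  apply: ler_sum => g _; have [Dg|Dg] := eqVneq (D g) 0.
    by rewrite Dg mul0r sumr_ge0// => i _; rewrite mulr_ge0// (noise_ge0 _ s0 Q1 MX1 XQ1).
  rewrite /lratio mulrC divfK// [leLHS]big_mkcond; apply: ler_sum => i _; case: ifP => // _.
  by rewrite mulr_ge0// (noise_ge0 _ s0 Q1 MX1 XQ1).
rewrite exchange_big; apply: ler_sum => i _ /=.
by rewrite -mulr_sumr (sum_noise_shift R s0 Q1 MX1 XQ1) mulr1.
Qed.

Lemma tested_moment2 k X2 :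
  \sum_(i | good i) \sum_(j | good j) pi i * pi j *
     expR ((mu k)%:R ^+ 2 * dotv (map_mx intr (w i)) (map_mx intr (w j)) / s%:R ^+ 2) <= X2 ->
  \sum_g D g * Y k g ^+ 2 <= X2.
Proof.
apply: le_trans; apply: le_trans (lratio_moment2 s0 Q1 MX1 XQ1 pi0 hl hOm k) _.
apply: ler_sum => i _; apply: ler_sum => j _; apply: eq_ler.
have -> // : dotv (map_mx intr (dsp k i)) (map_mx intr (dsp k j)) =
  (mu k)%:R ^+ 2 * dotv (map_mx intr (w i)) (map_mx intr (w j)) :> R.
by rewrite !disp_w !map_intrMn dotvZl dotvC dotvZl dotvC mulrA -expr2.
Qed.

Lemma separates_of (f o : G -> R) (kap E : R) (Mn : G -> R) : (forall u, 0 <= f u) -> 0 <= kap ->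
  (forall i, shift_dist f (proj Q (y i + w i)) <= kap) ->
  (forall g, 0 <= Mn g) -> (forall k g, Mn g <= Y k g) -> E <= \sum_g D g * Mn g ->
  K.-1%:R * (\sum_u f u) * E <= \sum_k fail_mass s M X f mu pi xb y
     (fun u x => ~~ succeeds eps (lp_norm p x) (o u)) k + kap * \sum_k (mu k)%:R.
Proof.
move=> f0 kap0 hv Mn0 MnY EM; apply: (@le_trans _ _ (K.-1%:R * (\sum_u f u) * \sum_g D g * Mn g)).
  by rewrite ler_wpM2l// mulr_ge0// sumr_ge0.
apply: (couple s0 Q1 MX1 XQ1 f0 pi0 pi1 kap0 (v := v) (good := good) (Om := tested)) => // [i _|]; first exact: hv.
move=> g u k1 k2 i1 i2 k12 /and4P[g1 gb tg t1] /and4P[g2 _ _ t2].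
have E' k i : xb + lft g + v i *+ mu k = xb + y i *+ mu k + (lft g + dsp k i).
  by rewrite disp_w mulrnDl addrACA.
rewrite !E'; have [lt12|lt21|/val_inj eq12] := ltngtP k1 k2; last by rewrite eq12 eqxx in k12.
  apply: succeeds_excl => //; apply: hN => //.
  by rewrite !disp_w !addrK.
rewrite orbC; apply: succeeds_excl => //; apply: hN => //.
by rewrite !disp_w !addrK.
Qed.

Lemma tested_Pg : 0 <= Pg <= 1.
Proof.
rewrite hPg sumr_ge0//= -pi1 [leRHS](bigID good)/= lerDl; exact: sumr_ge0.
Qed.

(** The ratio of [k0] equals [Pg] wherever that of [k1] is positive, so Pg min(1, Y k1) lies below
    both. *)
Lemma separates_min1 (k1 : 'I_K) (f o : G -> R) (kap X2 : R) :
  (forall k, (k == k0) || (k == k1)) -> e <= 1 ->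
  \sum_(i | good i) \sum_(j | good j) pi i * pi j *
     expR ((mu k1)%:R ^+ 2 * dotv (map_mx intr (w i)) (map_mx intr (w j)) / s%:R ^+ 2) <= X2 ->
  (forall u, 0 <= f u) -> 0 <= kap -> (forall i, shift_dist f (proj Q (y i + w i)) <= kap) ->
  K.-1%:R * (\sum_u f u) * (Pg * (((1 - e) * Pg) ^+ 2 / (1 + X2))) <=
  \sum_k fail_mass s M X f mu pi xb y
     (fun u x => ~~ succeeds eps (lp_norm p x) (o u)) k + kap * \sum_k (mu k)%:R.
Proof.
move=> kk e1 HX f0 kap0 hv; have /andP[P0 P1] := tested_Pg.
have X20 : 0 <= X2.
  by apply: le_trans HX; do 2 apply: sumr_ge0 => ? _; rewrite !mulr_ge0 ?expR_ge0.
apply: (@separates_of f o kap _ (fun g => Pg * Num.min 1 (Y k1 g))) => //.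
- by move=> g; rewrite mulr_ge0// le_min ler01 tested_ratio_ge0.
- move=> k g; have y0 := tested_ratio_ge0 k0 g; have y1 := tested_ratio_ge0 k1 g.
  have y01 := @tested_ratio0 k1 g.
  have /orP[/eqP ->|/eqP ->] := kk k; move: (Y k0 g) (Y k1 g) y0 y1 y01 => z0 z1 z00 z10 z01.
    exact: (weighted_min_le0 P0 z00 z10 z01).
  by apply: weighted_min_le; rewrite ?P0.
have -> : \sum_g D g * (Pg * Num.min 1 (Y k1 g)) = Pg * \sum_g D g * Num.min 1 (Y k1 g).
  by rewrite mulr_sumr; apply: eq_bigr => g _; rewrite mulrCA.
rewrite ler_wpM2l//; apply: min1_ge => [g|g||||].
- exact: (noise_ge0 _ s0 Q1 MX1 XQ1).
- exact: tested_ratio_ge0.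
- by rewrite mulr_ge0// subr_ge0.
- by rewrite ltr_pwDl.
- exact: tested_mean.
- by apply: lerD; [exact: tested_mean_le1|exact: tested_moment2].
Qed.

Lemma separates_min2 (k1 k2 : 'I_K) (f o : G -> R) (kap X2 e' : R) :
  (forall k, [|| k == k0, k == k1 | k == k2]) ->
  (forall k, \sum_(i | good i) \sum_(j | good j) pi i * pi j *
     expR ((mu k)%:R ^+ 2 * dotv (map_mx intr (w i)) (map_mx intr (w j)) / s%:R ^+ 2) <= X2) ->
  0 < e' -> 1 - 2 * ((1 - e) * Pg) + X2 <= e' ^+ 2 ->
  (forall u, 0 <= f u) -> 0 <= kap -> (forall i, shift_dist f (proj Q (y i + w i)) <= kap) ->
  K.-1%:R * (\sum_u f u) * (Pg * (1 - 2 * e')) <=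
  \sum_k fail_mass s M X f mu pi xb y
     (fun u x => ~~ succeeds eps (lp_norm p x) (o u)) k + kap * \sum_k (mu k)%:R.
Proof.
move=> kk HX e'0 He f0 kap0 hv; have /andP[P0 P1] := tested_Pg.
apply: (@separates_of f o kap _ (fun g => Pg * Num.min 1 (Num.min (Y k1 g) (Y k2 g)))) => //.
- move=> g; have := tested_ratio_ge0 k1 g; have := tested_ratio_ge0 k2 g.
  by move: (Y k1 g) (Y k2 g) => z1 z2 z20 z10; rewrite mulr_ge0// !le_min ler01 z10.
- move=> k g; have y0 := tested_ratio_ge0 k0 g; have y1 := tested_ratio_ge0 k1 g.
  have y2 := tested_ratio_ge0 k2 g; have y01 := @tested_ratio0 k1 g.
  have [/eqP ->|/eqP ->|/eqP ->] := or3P (kk k);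
    move: (Y k0 g) (Y k1 g) (Y k2 g) y0 y1 y2 y01 => z0 z1 z2 z00 z10 z20 z01.
  + apply: le_trans (weighted_min_le0 P0 z00 z10 z01); rewrite ler_wpM2l// le_min !ge_min.
    by rewrite !lexx !orbT.
  + apply: (le_trans _ (weighted_min_le tested_Pg z10)); rewrite ler_wpM2l// le_min !ge_min.
    by rewrite !lexx !orbT.
  + apply: (le_trans _ (weighted_min_le tested_Pg z20)); rewrite ler_wpM2l// le_min !ge_min.
    by rewrite !lexx !orbT.
have -> : \sum_g D g * (Pg * Num.min 1 (Num.min (Y k1 g) (Y k2 g))) =
    Pg * \sum_g D g * Num.min 1 (Num.min (Y k1 g) (Y k2 g)).
  by rewrite mulr_sumr; apply: eq_bigr => g _; rewrite mulrCA.
rewrite ler_wpM2l//.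
have D0 := @noise_ge0 R n Q s M X s0 Q1 MX1 XQ1.
have H k : 1 - 2 * (\sum_g D g * Y k g) + \sum_g D g * Y k g ^+ 2 <= e' ^+ 2.
  apply: le_trans He; apply: lerD; last exact: tested_moment2.
  by rewrite lerD2l lerN2 ler_wpM2l// tested_mean.
by apply: min3_ge => //; rewrite (sum_noise R n s0 Q1 MX1 XQ1).
Qed.

End Separation.

Lemma expRN_le (R : realType) (x : R) : 0 < x -> expR (- x) <= 4 / x ^+ 2.
Proof.
move=> x0; rewrite expRN -[leRHS]invrK lef_pV2 ?posrE ?expR_gt0 ?invr_gt0 ?divr_gt0 ?exprn_gt0//.
rewrite invf_div; have -> : x = x / 2 + x / 2 by field.
rewrite expRD; have := expR_ge1Dx (x / 2); move: (expR _) => t H.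
have x2 : 0 < x / 2 by rewrite divr_gt0.
have -> : (x / 2 + x / 2) ^+ 2 / 4 = x / 2 * (x / 2) by field.
by apply: ler_pM; rewrite ?ltW//; lra.
Qed.

(** * Testable families of inputs *)

Section NoiseTails.
Variables (R : realType) (n Q s M X : nat).
Hypotheses (s0 : (0 < s)%N) (Q1 : (1 < Q)%N) (MX : (M <= X)%N) (XQ : (X + M < Q)%N).
Local Notation G := 'rV['Z_Q]_n.
Local Notation D := (@noise R n Q s M X).
Local Notation lft := (@lift n Q X).

Let D0 := @noise_ge0 R n Q s M X s0 Q1 MX XQ.

Lemma noise_orb (P1 P2 : pred G) :
  \sum_(g | P1 g || P2 g) D g <= \sum_(g | P1 g) D g + \sum_(g | P2 g) D g.
Proof.
rewrite big_mkcond [X in _ <= X + _]big_mkcond [X in _ <= _ + X]big_mkcond -big_split.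
by apply: ler_sum => g _ /=; case: (P1 g); case: (P2 g); rewrite ?addr0 ?add0r// lerDl.
Qed.

Lemma noise_sub (P1 P2 : pred G) : (forall g, P1 g -> P2 g) ->
  \sum_(g | P1 g) D g <= \sum_(g | P2 g) D g.
Proof.
move=> H; rewrite big_mkcond [leRHS]big_mkcond; apply: ler_sum => g _.
by case: ifP => [/H ->//|_]; case: ifP.
Qed.

Lemma noise_coord_tail i (m : R) :
  \sum_(g | m < `|(lft g 0 i)%:~R|) D g <= 4 * expR (- (m / s%:R)).
Proof.
apply: le_trans (noise1_tail s0 Q1 MX XQ m); rewrite big_mkcond [leRHS]big_mkcond.
have := @noise_marg R n Q s M X s0 Q1 MX XQ i (fun c => (m < `|(clift X c)%:~R| :> R)%:R).
move=> H; apply: eq_ler; transitivity (\sum_g D g * (m < `|(clift X (g 0 i))%:~R| :> R)%:R).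
  by apply: eq_bigr => g _; rewrite liftE; case: ifP; rewrite ?mulr1 ?mulr0.
by rewrite H; apply: eq_bigr => c _; case: ifP; rewrite ?mulr1 ?mulr0.
Qed.

Lemma noise_coords_tail (m : R) :
  \sum_(g | [exists i, m < `|(lft g 0 i)%:~R|]) D g <= n%:R * (4 * expR (- (m / s%:R))).
Proof.
apply: (@le_trans _ _ (\sum_i \sum_(g | m < `|(lft g 0 i)%:~R|) D g)); last first.
  apply: (@le_trans _ _ (\sum_(i < n) (4 * expR (- (m / s%:R))))).
    by apply: ler_sum => i _; exact: noise_coord_tail.
  by rewrite sumr_const card_ord -[X in X <= _]mulr_natl.
under [leRHS]eq_bigr do rewrite big_mkcond.
rewrite exchange_big [leLHS]big_mkcond; apply: ler_sum => g _ /=.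
case: ifP => [/existsP[i gi]|_]; last by apply: sumr_ge0 => i _; case: ifP.
rewrite (bigD1 i)//= gi lerDl; apply: sumr_ge0 => j _; by case: ifP.
Qed.

Lemma noise_lp_tail (p Lam : R) : 0 < p -> 0 < Lam ->
  \sum_(g | Lam < \sum_i (`|(lft g 0 i)%:~R| / s%:R) `^ p) D g <= n%:R * (4 * p `^ p) / Lam.
Proof.
move=> p0 L0; rewrite ler_pdivlMr// mulr_suml.
apply: (@le_trans _ _ (\sum_g D g * \sum_i (`|(lft g 0 i)%:~R| / s%:R) `^ p)).
  rewrite big_mkcond; apply: ler_sum => g _; have S0 : 0 <= \sum_i (`|(lft g 0 i)%:~R| / s%:R) `^ p :> R.
    by apply: sumr_ge0 => i _; exact: powR_ge0.
  by case: ifP => H; [rewrite ler_wpM2l// ltW|rewrite mulr_ge0].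
under eq_bigr do rewrite mulr_sumr.
rewrite exchange_big /=; apply: (@le_trans _ _ (\sum_(i < n) (4 * p `^ p))).
  apply: ler_sum => i _; apply: le_trans (noise1_moment s0 Q1 MX XQ p0).
  rewrite -(noise_marg s0 Q1 MX XQ i (fun c => (`|(clift X c)%:~R| / s%:R) `^ p)).
  by apply: eq_ler; apply: eq_bigr => g _; rewrite liftE.
by rewrite sumr_const card_ord -[X in X <= _]mulr_natl.
Qed.

End NoiseTails.

Lemma double_mulrn_le (m : nat) (a : int) : (m <= 20)%N -> 2 * (`|a| *+ m) <= 40 * `|a|.
Proof.
by move=> m20; rewrite -[_ *+ m]mulr_natl mulrA ler_wpM2r// natz; lia.
Qed.

Lemma tiny_div (R : realType) (c z t x : R) : 400 <= c -> 1 <= z * t -> z * c ^+ 4 <= x ->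
  0 < t -> 0 < x -> 504 / x <= t / 100.
Proof.
move=> c4 zt zx t0 x0; rewrite ler_pdivrMr// mulrAC.
have H := ler_wpM2l (ltW t0) zx.
have c2 : 300 <= c ^+ 2 by rewrite expr2; nra.
have : 300 * 300 <= c ^+ 2 * c ^+ 2 by nra.
move: H; rewrite -[c ^+ 4]/(c ^+ (2 + 2)) exprD; move: (c ^+ 2 * c ^+ 2) => u H u0.
have : u <= z * t * u by rewrite ler_peMl//; lra.
have -> : z * t * u = t * (z * u) by ring.
by move: (t * (z * u)) (t * x) H => a b; lra.
Qed.

(** At delta = 1/2 the left side is about 0.98 (1.5424 - 0.005), or 1.507, just above 3/2. *)
Lemma three_tests_false (R : realType) (z t : R) : t < 1 / 2 -> z <= t / 100 ->
  98 / 100 * (99 / 100 * 2%:R * (779 / 1000) - z) <= t * 3%:R -> False.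
Proof. lra. Qed.

Lemma expRN2_le (R : realType) : expR (- 2) <= 1 / 5 :> R.
Proof.
rewrite expRN mul1r lef_pV2 ?posrE ?expR_gt0 ?ltr0n//.
have -> : 2 = 1 / 2 + 1 / 2 + (1 / 2 + 1 / 2) :> R by lra.
rewrite !expRD; have := @expR_ge1Dx R (1 / 2); move: (expR _) => t t1.
have : 9 / 4 <= t * t by nra.
by move: (t * t) => u; nra.
Qed.

Lemma two_tests_false (R : realType) (z t u v : R) : 0 < v -> u <= 1 / 5 -> t = u * v -> z <= t / 100 ->
  98 / 100 * (99 / 100 * 1%:R * (49 / 100 * v) - z) <= t * 2%:R -> False.
Proof.
move=> v0 u5 ->; have : u * v <= 1 / 5 * v by apply: ler_wpM2r => //; exact: ltW.
by move: (u * v) => w; lra.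
Qed.

(* Failing on one of two indistinguishable hypotheses is compatible with a failure probability close
   to 1/2; failing on two out of three is not. *)
Definition mults (K : nat) (k : 'I_K) : nat := nth 0%N [:: 0; 1; 20]%N k.
Definition num_mults (R : realType) (delta : R) : nat := if ln (1 / delta) < 8 then 3%N else 2%N.
(** For small delta the failure on two hypotheses is at least of order Pg^3 / (1 + second moment),
    that is delta^(3/12) delta^(1/2) = delta^(3/4), which beats a failure probability delta. For
    larger delta both quantities have to be close to 1. *)
Definition min_good (R : realType) (delta : R) : R :=
  if ln (1 / delta) < 8 then 1 - 1 / 1000 else delta `^ (1 / 12).
Definition max_moment (R : realType) (delta : R) : R :=
  if ln (1 / delta) < 8 then 1 + 1 / 200 else delta `^ (- (1 / 2)).

Section Test.
Variables (R : realType) (n L q : nat) (p eps delta : R).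
Hypotheses (n0 : (0 < n)%N) (nq : (n <= q)%N) (q400 : (400 <= q)%N) (qL : (q ^ 5 <= L)%N).
Variables (d : measure_display) (T : measurableType d) (P : probability T R).
Variables (A : rand_stream_alg R n T) (S W : nat).
Hypotheses (AS : uses_bits A S) (est : estimates_lp_norm P A p eps delta W).
Hypothesis WL : (L ^ 20 <= W)%N.
Hypotheses (eps0 : 0 < eps) (delta0 : 0 < delta) (delta2 : delta < 1 / 2).
Hypothesis dq : delta^-1 <= q%:R.

Local Notation s := (L ^ 4)%N.
Local Notation Q := (L ^ 17)%N.
Local Notation X := (L ^ 8)%N.
Local Notation M := (L ^ 4 * q ^ 2)%N.
Local Notation G := 'rV['Z_Q]_n.
Local Notation D := (@noise R n Q s M X).
Local Notation lft := (@lift n Q X).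
Local Notation K := (num_mults delta).

(* [typ] contains the noises for which the norms separate, [typS] those which stay in [typ] under the
   displacements [w]. *)
Definition testable (I : finType) (pi : I -> R) (xb : 'rV[int]_n) (y w : I -> 'rV[int]_n) : Prop :=
  exists (good : pred I) (typ typS : pred 'rV[int]_n),
  [/\ forall i c, good i -> 40 * `|w i 0 c| <= M%:Z,
      forall (k : 'I_K) i g, good i -> typS g -> typ g && typ (g - w i *+ mults k),
      \sum_(g | ~~ typS (lft g)) D g <= 1 / 1000,
      min_good delta <= \sum_(i | good i) pi i &
      (forall (k1 k2 : 'I_K) i1 i2 g1 g2, (k1 < k2)%N -> good i1 -> good i2 -> typ g1 -> typ g2 ->
         g1 - w i1 *+ mults k1 = g2 - w i2 *+ mults k2 ->
         (1 + eps) ^+ 2 * lp_norm p (xb + y i1 *+ mults k1 + g1) <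
         lp_norm p (xb + y i2 *+ mults k2 + g2)) /\
      forall k : 'I_K, \sum_(i | good i) \sum_(j | good j) pi i * pi j *
        expR ((mults k)%:R ^+ 2 * dotv (map_mx intr (w i)) (map_mx intr (w j)) / s%:R ^+ 2)
        <= max_moment delta].

Lemma box_tail : \sum_(g | ~~ [forall c, 2 * `|lft g 0 c| <= M%:Z]) D g <= 1 / 1000.
Proof.
apply: (@le_trans _ _ (\sum_(g | [exists c, s%:R * (q%:R ^+ 2 / 2) < `|(lft g 0 c)%:~R|]) D g)).
  apply: (@noise_sub R n Q s M X (s_gt0 q400 qL) (Q_gt1 q400 qL) (M_leX q400 qL) (XM_Q q400 qL)) => g.
  rewrite negb_forall => /existsP[c]; rewrite -ltNge => gc; apply/existsP; exists c.
  move: (lft g 0 c) gc => a; rewrite -(ltr_int R) intrM intr_norm -[X in X < _]/(M%:R) natrM.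
  by rewrite [(q ^ 2)%N%:R]natrX -[2%:~R]/(2 : R) => gc; lra.
apply: le_trans (@noise_coords_tail R n Q s M X (s_gt0 q400 qL) (Q_gt1 q400 qL) (M_leX q400 qL)
  (XM_Q q400 qL) (s%:R * (q%:R ^+ 2 / 2))) _.
have sR : (s%:R : R) != 0 by rewrite pnatr_eq0 -lt0n (s_gt0 q400 qL).
rewrite [_ * (_ / 2)]mulrC mulfK//.
have q4 : 400 <= (q%:R : R) by rewrite ler_nat.
have nR : n%:R <= (q%:R : R) by rewrite ler_nat.
have qq : 0 < (q%:R ^+ 2 / 2 : R) by rewrite divr_gt0// exprn_gt0// ltr0n (q_gt0 q400).
have := expRN_le qq; move: (expR _) (expR_ge0 (- (q%:R ^+ 2 / 2) : R)) => t t0 tq.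
move: nR q4 tq; move: (q%:R : R) (n%:R : R) (ler0n R n) => z x x0 xz z4 tz.
have z0 : 0 < z by lra.
have t1 : t <= 16 / z ^+ 4.
  by apply: le_trans tz _; apply: eq_ler; field; rewrite gt_eqF.
apply: (@le_trans _ _ (z * (4 * (16 / z ^+ 4)))).
  by apply: ler_pM => //; rewrite ?mulr_ge0// ler_pM2l.
have -> : z * (4 * (16 / z ^+ 4)) = 64 / z ^+ 3 by field; rewrite gt_eqF.
rewrite ler_pdivrMr ?exprn_gt0// exprS.
have z2 : 160 <= z ^+ 2 by rewrite expr2; nra.
by move: (z ^+ 2) z2 => zz z2; nra.
Qed.

Let sQ : (3 * X < Q)%N. Proof. exact: (X_Q q400 qL (k := 3)). Qed.
Let sM : (2 * M <= X)%N.
Proof.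
apply: (@leq_trans (L ^ 5 * L)%N); last by rewrite -expnSr leq_pexp2l// (L_gt0 q400 qL).
rewrite mulnC; apply: leq_mul; last by rewrite (leq_trans _ (L_gt q400 qL)).
by rewrite [(L ^ 5)%N]expnSr leq_mul2l (q2_leL q400 qL) orbT.
Qed.

Variables (J I : finType) (wJ : J -> R) (pi : I -> R).
Variables (xb : J -> 'rV[int]_n) (y : J -> I -> 'rV[int]_n).
Hypotheses (wJ0 : forall j, 0 <= wJ j) (wJ1 : \sum_j wJ j = 1).
Hypotheses (pi0 : forall i, 0 <= pi i) (pi1 : \sum_i pi i = 1).
Hypothesis xbX : forall j i, `|xb j 0 i| <= (L ^ 6)%:Z.
Hypothesis yX : forall j i i', `|y j i 0 i'| <= (L ^ 6)%:Z.
Hypothesis yL : forall j i, norm2 (map_mx intr (y j i) : 'rV[R]_n) <= (L%:R ^+ 5) ^+ 2.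
Hypothesis inst : forall (H Sg : 'M[R]_n) (w : J -> I -> 'rV[int]_n),
  ridge_like H Sg -> \tr H <= q%:R^-1 + 4 * S%:R / ln L%:R ->
  (forall j i, norm2 (scaled R L (w j i) + scaled R L (y j i) *m H) <= (q%:R ^+ 3)^-1) ->
  exists2 goodJ : pred J, 99 / 100 <= \sum_(j | goodJ j) wJ j &
    forall j, goodJ j -> testable pi (xb j) (y j) (w j).

Let Emin : R := if ln (1 / delta) < 8 then 779 / 1000 else 49 / 100 * delta `^ (3 / 4).

Lemma mults_le k : (mults (K := K) k <= 20)%N.
Proof. by rewrite /mults; case: (val k) => [|[|[|j]]]//=; rewrite nth_nil. Qed.

Let delta1 : delta <= 1. Proof. by apply/ltW/(lt_trans delta2); rewrite mul1r invf_lt1 ?ltr1n. Qed.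

Lemma testable_separates j (w : J -> I -> 'rV[int]_n) : testable pi (xb j) (y j) (w j) ->
  separates L q p eps (@mults K) pi xb y Emin j (w j).
Proof.
case=> [good [typ [typS [wM hS hT hP [hN hM]]]]] f o kap f0 kap0 hv.
have KK : (0 < K)%N by rewrite /num_mults; case: ifP.
pose k0 : 'I_K := Ordinal KK.
have mu0 : mults k0 = 0%N by [].
have wM' (k : 'I_K) i c : good i -> 2 * (`|w j i 0 c| *+ mults k) <= M%:Z.
  move=> /wM => /(_ c); have := mults_le k; move: (mults k) (w j i 0 c) => m a m20.
  by apply: le_trans; exact: double_mulrn_le.
have he : \sum_(g | ~~ (typS (lft g) && [forall c, 2 * `|lft g 0 c| <= M%:Z])) D g <= 1 / 500.
  apply: le_trans (_ : 1 / 1000 + 1 / 1000 <= _); last by lra.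
  apply: le_trans (lerD hT box_tail); 
  apply: le_trans (@noise_orb R n Q s M X (s_gt0 q400 qL) (Q_gt1 q400 qL) (M_leX q400 qL) (XM_Q q400 qL)
    (fun g => ~~ typS (lft g)) (fun g => ~~ [forall c, 2 * `|lft g 0 c| <= M%:Z])).
  by apply: eq_ler; apply: eq_bigl => g; rewrite negb_and.
have Kc : K = 3%N /\ ln (1 / delta) < 8 \/ K = 2%N /\ 8 <= ln (1 / delta).
  by rewrite /num_mults; case: ltP => _; [left|right].
have [sp qp] := (s_gt0 q400 qL, Q_gt1 q400 qL).
set Pg := \sum_(i | good i) pi i in hP.
have Pg1 : Pg <= 1 by rewrite -pi1 [leRHS](bigID good)/= lerDl sumr_ge0.
have ln0 : 0 < 1 / delta by rewrite divr_gt0.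
have [[K3 m8]|[K2 m8]] := Kc.
  have ltK k : (k < 3)%N -> (k < K)%N by rewrite K3.
  pose k1 : 'I_K := Ordinal (ltK 1%N isT); pose k2 : 'I_K := Ordinal (ltK 2%N isT).
  have kk k : [|| k == k0, k == k1 | k == k2].
    by have := ltn_ord k; rewrite -!val_eqE /= {2}K3; case: (val k) => [|[|[|]]].
  move: hP hM; rewrite /min_good /max_moment /Emin m8 => hP hM.
  (* The mean square distance of a ratio from 1 is at most 2.005 - 2 * 0.998 * 0.999, which is below
     0.11^2; the resulting failure 0.999 (1 - 0.22) gives the 779/1000 of [Emin]. *)
  have e'0 : 0 < (11 / 100 : R) by lra.
  have He : 1 - 2 * ((1 - 1 / 500) * Pg) + (1 + 1 / 200) <= (11 / 100) ^+ 2 by rewrite expr2; lra.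
  apply: le_trans (@separates_min2 R n Q s M X sp qp sM sQ p eps K _ k0 I pi (xb j) (y j) (w j) good
    typ typS _ Pg eps0 mu0 pi0 pi1 wM' hS he erefl hN k1 k2 f o kap _ _ kk hM e'0 He f0 kap0 hv).
  rewrite ler_wpM2l ?mulr_ge0 ?sumr_ge0//.
  apply: (@le_trans _ _ ((1 - 1 / 1000) * (1 - 2 * (11 / 100)))); first lra.
  by apply: ler_wpM2r => //; lra.
have ltK k : (k < 2)%N -> (k < K)%N by rewrite K2.
pose k1 : 'I_K := Ordinal (ltK 1%N isT).
have kk k : (k == k0) || (k == k1).
  by have := ltn_ord k; rewrite -!val_eqE /= {2}K2; case: (val k) => [|[|]].
have m8F : (ln (1 / delta) < 8) = false by apply/negbTE; rewrite -leNgt.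
move: hP hM; rewrite /min_good /max_moment /Emin m8F => hP hM.
have e1 : 1 / 500 <= 1 :> R by lra.
apply: le_trans (@separates_min1 R n Q s M X sp qp sM sQ p eps K _ k0 I pi (xb j) (y j) (w j) good
    typ typS _ Pg eps0 mu0 pi0 pi1 wM' hS he erefl hN k1 f o kap _ kk e1 (hM k1) f0 kap0 hv).
rewrite ler_wpM2l ?mulr_ge0 ?sumr_ge0//.
(* All powers of delta that occur are integer powers of [a], which makes the comparison
   polynomial. *)
set a := delta `^ (1 / 12) in hP.
have a0 : 0 < a by rewrite powR_gt0.
have a1 : a <= 1.
  have -> : 1 = 1 `^ (1 / 12) :> R by rewrite powR1.
  by apply: ge0_ler_powR => //; rewrite ?nnegrE ?ler01 ?(ltW delta0)// mul1r invr_ge0 ler0n.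
have da n' : delta `^ (n'%:R / 12) = a ^+ n'.
  by rewrite -powR_mulrn ?(ltW a0)// /a -powRrM; congr (_ `^ _); field.
have -> : delta `^ (- (1 / 2)) = (a ^+ 6)^-1.
  by rewrite powRN -da; congr (_ `^ _)^-1; field.
have -> : delta `^ (3 / 4) = a ^+ 9 by rewrite -da; congr (_ `^ _); field.
have a6 : 0 < a ^+ 6 by rewrite exprn_gt0.
have a61 : a ^+ 6 <= 1 by rewrite exprn_ile1// ltW.
have P0 : 0 < Pg by apply: lt_le_trans hP.
have P3 : a ^+ 3 <= Pg ^+ 3 by rewrite lerXn2r// nnegrE ltW.
have -> : 1 + (a ^+ 6)^-1 = (1 + a ^+ 6) / a ^+ 6 by field; rewrite gt_eqF.
rewrite invf_div -[leRHS]/(_ * (_ * _)) mulrA [leRHS]mulrA ler_pdivlMr; last by lra.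
have e2 : 99 / 100 <= (1 - 1 / 500) ^+ 2 :> R.
  by rewrite expr2; lra.
have -> : Pg * ((1 - 1 / 500) * Pg) ^+ 2 = (1 - 1 / 500) ^+ 2 * Pg ^+ 3 by ring.
have -> : a ^+ 9 = a ^+ 3 * a ^+ 6 by rewrite -exprD.
move: P3 a61 a6 e2; have := exprn_gt0 3 a0.
move: (a ^+ 3) (a ^+ 6) (Pg ^+ 3) ((1 - 1 / 500) ^+ 2) => b c z t b0 bz c1 c0 t9.
have bc : 0 < b * c by rewrite mulr_gt0.
apply: (@le_trans _ _ (99 / 100 * b * c)).
  have : b * c * c <= b * c by rewrite ger_pMr.
  by rewrite -[49 / 100 * _ * _]mulrA [b * c * (1 + c)]mulrDr mulr1; lra.
by rewrite ler_pM2r// ler_pM// ltW.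
Qed.

Lemma no_test : False.
Proof.
have ln0 : 0 < 1 / delta by rewrite divr_gt0.
have E0 : 0 <= Emin.
  by rewrite /Emin; case: ifP => _; [lra|apply: mulr_ge0; [lra|exact: powR_ge0]].
have K3 : (K <= 3)%N by rewrite /num_mults; case: ifP.
have := @core_bound R n L q p eps delta n0 nq q400 qL d T P A S W AS est WL delta0 K (@mults K) J I
  wJ pi xb y Emin K3 mults_le wJ0 wJ1 pi0 pi1 E0 xbX yX yL.
have sep H Sg w : ridge_like H Sg -> \tr H <= q%:R^-1 + 4 * S%:R / ln L%:R ->
    (forall j i, norm2 (scaled R L (w j i) + scaled R L (y j i) *m H) <= (q%:R ^+ 3)^-1) ->
    exists2 goodJ : pred J, 99 / 100 <= \sum_(j | goodJ j) wJ j &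
    forall j, goodJ j -> separates L q p eps (@mults K) pi xb y Emin j (w j).
  move=> h1 h2 h3; have [goodJ gJ tJ] := inst h1 h2 h3.
  by exists goodJ => // j /tJ; exact: testable_separates.
move=> /(_ sep).
have LR : 0 < (L%:R : R) by rewrite ltr0n (L_gt0 q400 qL).
have {LR} : 504 / L%:R <= delta / 100.
  have H : (q%:R : R) * 400 ^+ 4 <= L%:R by rewrite -natrX -natrM ler_nat (q_leL q400 qL).
  have dq1 : 1 <= q%:R * delta by rewrite -ler_pdivrMr// mul1r.
  exact: (tiny_div (lexx _) dq1 H delta0 LR).
move: (504 / _) => z; rewrite /Emin /num_mults; case: ltP => m8 zd /=; first exact: three_tests_false delta2 zd.
have d4 : delta `^ (1 / 4) <= 1 / 5.
  have -> : delta = expR (- ln (1 / delta)) by rewrite expRN lnK ?posrE// div1r invrK.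
  rewrite -expRM; apply: (@le_trans _ _ (expR (- 2))).
    by rewrite ler_expR; lra.
  exact: expRN2_le.
have dE : delta = delta `^ (1 / 4) * delta `^ (3 / 4).
  rewrite -powRD; last by apply/implyP => _; rewrite gt_eqF.
  by rewrite -[LHS]powRr1 ?ltW//; congr (_ `^ _); field.
exact: two_tests_false (powR_gt0 (3 / 4) delta0) d4 dE zd.
Qed.

End Test.

Section Spike.
Variables (R : realType) (p : R) (n : nat).
Hypothesis p2 : 2 <= p.

Let p1 : 1 <= p. Proof. by apply: le_trans p2; rewrite ler1n. Qed.
Let p0 : 0 < p. Proof. exact: lt_le_trans p1. Qed.

Definition erase (j : 'I_n) (z : 'rV[R]_n) : 'rV[R]_n := \row_i (if i == j then 0 else z 0 i).

Lemma lpsum_erase j z : lpsum p z = `|z 0 j| `^ p + lpsum p (erase j z).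
Proof.
rewrite /lpsum (bigD1 j)//= [in RHS](bigD1 j)//= mxE eqxx normr0 powR0 ?gt_eqF// add0r.
by congr (_ + _); apply: eq_bigr => i /negPf ij; rewrite mxE ij.
Qed.

Lemma erase_lp_le j z : lpR p (erase j z) <= lpR p z.
Proof. by apply: lpR_abs_le => // i; rewrite mxE; case: ifP; rewrite ?normr0. Qed.

Lemma erase_norm2_le j (z : 'rV[R]_n) : norm2 (erase j z) <= norm2 z.
Proof.
apply: ler_sum => i _; rewrite mxE; case: ifP => // _.
by rewrite mul0r -expr2 sqr_ge0.
Qed.

(* Powers are averaged: since the rest of [z1] weighs less than its spike, multiplying the spike by
   [1 + 8 e] multiplies the whole norm by at least [1 + 4 e]. *)
Lemma spike_sep j (z1 z2 : 'rV[R]_n) (e d : R) : 0 < e < 1 -> 0 < z1 0 j ->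
  (1 + 8 * e) * z1 0 j <= z2 0 j -> lpR p (erase j z1) <= z1 0 j ->
  norm2 (erase j (z2 - z1)) <= d ^+ 2 -> 0 <= d -> d <= e / 2 * z1 0 j ->
  (1 + e) ^+ 2 * lpR p z1 < lpR p z2.
Proof.
move=> /andP[e0 e1].
have c4 : 0 <= 1 + 4 * e by lra.
have x0 : 0 <= 1 + 8 * e by lra.
have x8 : 0 < 1 + 8 * e by lra.
have x18 : 1 <= 1 + 8 * e by lra.
have eh : 0 <= e / 2 by lra.
move=> z1j z2j rest dz d0 de.
pose z' : 'rV[R]_n := \row_i (if i == j then z2 0 j else z1 0 i).
have Ez : erase j z' = erase j z1.
  by apply/rowP => i; rewrite !mxE; case: ifP => // ->.
have z2E : z2 = z' + erase j (z2 - z1).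
  apply/rowP => i; rewrite !mxE; case: eqP => [->|_]; rewrite ?addr0//.
  by rewrite addrC subrK.
have N1 : z1 0 j <= lpR p z1.
  rewrite lpRE; apply: powR_inv_ge; rewrite ?lpsum_ge0 ?(ltW z1j)//.
  by rewrite (lpsum_erase j) gtr0_norm// lerDl lpsum_ge0.
have N' : (1 + 4 * e) * lpR p z1 <= lpR p z'.
  rewrite [leRHS]lpRE; apply: (powR_inv_ge p1); [exact: lpsum_ge0|exact: mulr_ge0 c4 (lpR_ge0 _ _)|].
  rewrite (powRM _ c4 (lpR_ge0 _ _)).
  rewrite lpRX// (lpsum_erase j z1) (lpsum_erase j z') Ez.
  rewrite [z' 0 j]mxE eqxx gtr0_norm//.
  have z2p : 0 < z2 0 j by apply: lt_le_trans z2j; exact: mulr_gt0.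
  rewrite gtr0_norm//.
  apply: (@le_trans _ _ (((1 + 8 * e) * z1 0 j) `^ p + lpsum p (erase j z1))); last first.
    have c8 := mulr_ge0 x0 (ltW z1j).
    by rewrite lerD2r; apply: ge0_ler_powR; rewrite ?nnegrE ?(ltW p0) ?(ltW z2p).
  rewrite (powRM _ x0 (ltW z1j)).
  have := powR_mean p1 x0; have -> : (1 + (1 + 8 * e)) / 2 = 1 + 4 * e by field.
  have sm : lpsum p (erase j z1) <= z1 0 j `^ p.
    by rewrite -lpRX//; apply: ge0_ler_powR; rewrite ?nnegrE ?lpR_ge0 ?(ltW p0) ?(ltW z1j).
  have x1 : 1 <= (1 + 8 * e) `^ p.
    by rewrite -[X in X <= _](powRr0 (1 + 8 * e)) ler_powR// ltW.
  move: sm x1 (lpsum_ge0 p (erase j z1)); move: ((1 + 8 * e) `^ p) ((1 + 4 * e) `^ p) (z1 0 j `^ p).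
  move: (lpsum p (erase j z1)) => r X Y P; clear => rP X1 r0 H.
  have : Y * (P + r) <= (1 + X) / 2 * (P + r) by apply: ler_wpM2r; lra.
  have : (X - 1) * r <= (X - 1) * P by apply: ler_wpM2l; lra.
  lra.
have N2 : lpR p z' - d <= lpR p z2.
  rewrite [in leRHS]z2E; apply: le_trans (lpR_triangleB p1 _ _); rewrite lerD2l lerN2.
  apply: le_trans (lpR_le_norm2 p1 _ p2) _.
  by rewrite -(ger0_norm d0) -sqrtr_sqr ler_sqrt ?sqr_ge0.
have : d <= e / 2 * lpR p z1 by apply: (le_trans de); apply: (ler_wpM2l eh N1).
have N0 : 0 < lpR p z1 by apply: lt_le_trans N1.
move: e0 e1 N0 N' N2; clear; move: (lpR p z1) (lpR p z') (lpR p z2) => a b c e0 e1 a0 ab bc da.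
have ea : e * e * a <= e * a by rewrite -mulrA ler_piMl ?mulr_ge0 ?ltW.
have ea0 : 0 < e * a by rewrite mulr_gt0.
have -> : (1 + e) ^+ 2 * a = a + 2 * (e * a) + e * e * a by ring.
have : (1 + 4 * e) * a = a + 4 * (e * a) by ring.
have : e / 2 * a = e * a / 2 by field.
lra.
Qed.

End Spike.

Lemma markov_card (R : realType) (n k : nat) (F : 'I_n -> R) (r : R) : (0 < n)%N -> (0 < k)%N ->
  (forall j, 0 <= F j) -> 0 < r -> \sum_j F j <= r ->
  ((1 - k%:R^-1) * n%:R : R) <= #|[pred j | (F j <= k%:R * r / n%:R)%R]|%:R.
Proof.
move=> n0 k0 F0 r0 Fr; have nR : 0 < (n%:R : R) by rewrite ltr0n.
have kR : 0 < (k%:R : R) by rewrite ltr0n.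
set A := [pred j | _].
have E : #|A|%:R + #|[predC A]|%:R = n%:R :> R by rewrite -natrD cardC card_ord.
have : #|[predC A]|%:R * (k%:R * r / n%:R) <= r.
  apply: le_trans Fr; rewrite mulrC mulr_natr -sumr_const [leRHS](bigID (mem [predC A])) /=.
  rewrite -[leLHS]addr0 lerD ?sumr_ge0//; apply: ler_sum => j; rewrite !inE -ltNge; exact: ltW.
rewrite mulrA ler_pdivrMr// mulrA [r * _]mulrC ler_pM2r// => H.
have : #|[predC A]|%:R <= n%:R / k%:R :> R by rewrite ler_pdivlMr.
by rewrite mulrBl mul1r mulrC; lra.
Qed.

(** As [h] is at least 9 e t, one step beats the factor 1 + 8 e on the base and leaves room for the
    noise. From multiple 1 to 20 the growth is enough even for [e] close to 1, when that factor
    approaches 9. *)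
Lemma mults_lt (R : realType) (k1 k2 : nat) (t h e : R) : (k1 < k2)%N -> (k2 < 3)%N ->
  0 < e < 1 -> 0 < t -> 9 * e * t <= h -> h <= 10 * e * t ->
  (1 + 8 * e) * (t + (nth 0%N [:: 0; 1; 20]%N k1)%:R * h + h / 100) <=
   t + (nth 0%N [:: 0; 1; 20]%N k2)%:R * h - h / 100.
Proof.
move=> k12 k23 /andP[e0 e1] t0 h9 h10.
have et : 0 < e * t by rewrite mulr_gt0.
rewrite -mulrA in h9; rewrite -mulrA in h10.
have h0 : 0 <= h by lra.
have eh : e * h <= h by rewrite ler_piMl// ltW.
have -> : (1 + 8 * e) * (t + (nth 0%N [:: 0; 1; 20]%N k1)%:R * h + h / 100) =
  t + 8 * (e * t) + ((nth 0%N [:: 0; 1; 20]%N k1)%:R + 1 / 100) * (h + 8 * (e * h)) by field.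
move: (e * t) et h9 h10 (e * h) eh => et et0 h9 h10 eh eh1.
by case: k1 k2 k12 k23 => [|[|[|k1]]] [|[|[|k2]]]//= _ _; lra.
Qed.

Lemma map_intr_delta (R : realType) (n k : nat) (j : 'I_n) :
  map_mx intr (k%:Z *: 'e_j) = k%:R *: 'e_j :> 'rV[R]_n.
Proof. by apply/rowP => i; rewrite !mxE intrM; congr (_ * _); case: (_ && _). Qed.

Lemma norm2_delta (R : realType) (n : nat) (a : R) (j : 'I_n) (H : 'M[R]_n) :
  norm2 (a *: 'e_j *m H) = a ^+ 2 * norm2 (row j H).
Proof. by rewrite -scalemxAl norm2Z rowE. Qed.

Lemma norm2_coord_le (R : realType) (n : nat) (x : 'rV[R]_n) i (b : R) :
  0 <= b -> norm2 x <= b ^+ 2 -> `|x 0 i| <= b.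
Proof.
move=> b0 xb; rewrite -(ger0_norm b0) -ler_sqr ?nnegrE// !real_normK ?num_real//.
apply: le_trans xb; rewrite /norm2 /dotv (bigD1 i)//= -expr2 lerDl.
by apply: sumr_ge0 => j _; rewrite -expr2 sqr_ge0.
Qed.

Lemma ln_inv_ge (R : realType) (t : R) : 0 < t -> t < 1 / 2 -> 1 / 2 <= ln (1 / t).
Proof. by move=> t0 t2; rewrite [1 / t]div1r lnV ?posrE//; have := ln_le_sub1 t0; lra. Qed.

(** With two hypotheses the multiple is at most 1 and the exponent is compared with ln (1 / t) / 2;
    with three, ln (1 / t) < 8 keeps 400 x tiny. *)
Lemma exp_moment_le (R : realType) (K k : nat) (t x : R) : 0 < t -> t < 1 / 2 ->
  K = num_mults t -> (k < K)%N -> 0 <= x -> 1000 * 1000 * x <= ln (1 / t) ->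
  expR ((nth 0%N [:: 0; 1; 20]%N k)%:R ^+ 2 * x) <= max_moment t.
Proof.
move=> t0 t2 -> kK x0 xm; move: kK; rewrite /num_mults /max_moment; case: ltP => m8 kK.
  have : (nth 0%N [:: 0; 1; 20]%N k)%:R ^+ 2 * x <= 400 * x.
    have : (nth 0%N [:: 0; 1; 20]%N k)%:R <= 20 :> R.
      by rewrite ler_nat; case: k kK => [|[|[|k]]].
    have := ler0n R (nth 0%N [:: 0; 1; 20]%N k).
    move: (_%:R) => c c0 c20; apply: ler_wpM2r => //; rewrite expr2; nra.
  move=> H; apply: (@le_trans _ _ (expR (32 / (100 * 100)))).
    by rewrite ler_expR; apply: le_trans H _; lra.
  have := @expR_ge1Dx R (- (32 / (100 * 100))); rewrite expRN => H2.
  move: H2 (expR_gt0 (32 / (100 * 100) : R)); move: (expR _) => z H2 z0.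
  by have := ler_wpM2r (ltW z0) H2; rewrite mulVf ?gt_eqF//; lra.
rewrite powRN -powRN; have -> : t `^ (- (1 / 2)) = expR (ln (1 / t) / 2).
  by rewrite /powR gt_eqF// [1 / t]div1r lnV ?posrE//; congr expR; field.
rewrite ler_expR; apply: (@le_trans _ _ (1 * x)).
  by apply: ler_wpM2r => //; case: k kK => [|[|k]]//= _; rewrite ?expr0n ?expr1n ?ler01//= expr2 mul0r ler01.
by lra.
Qed.

(** For [x] the squared scaled displacement: it is negligible against the step [hs] of the spike, so
    it disturbs neither the spike nor the typical noise. *)
Lemma spike_shift_le (R : realType) (c1 k x hs rn qi : R) : 100 <= c1 -> 0 < k ->
  k * (80 * 1000 * c1 ^+ 2 + 2) <= 1 / (1000 * 1000 * 4) ->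
  1 <= hs -> rn <= 2 * k -> qi <= k -> x <= 200 * hs ^+ 2 * rn + 2 * qi ->
  x <= (hs / (50 * 100)) ^+ 2.
Proof.
move=> c100 k0 hk h1 rk qk xx.
have c2 : 100 * 100 <= c1 ^+ 2 by rewrite expr2; nra.
have h2 : 1 <= hs ^+ 2 by rewrite expr2; nra.
have kc : k * (100 * 100) <= k * c1 ^+ 2 by apply: ler_wpM2l => //; exact: ltW.
have -> : (hs / (50 * 100)) ^+ 2 = hs ^+ 2 / (50 * 50 * 100 * 100) by field.
move: h2 xx; move: (hs ^+ 2) => z z1 xx.
have z0 : 0 <= z by lra.
have zr : z * rn <= z * (2 * k) by apply: ler_wpM2l.
have kz : k <= z * k by rewrite ler_peMl// ltW.
have kb : k <= 1 / (50 * 50 * 100 * 100) / 402.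
  move: hk kc; rewrite mulrDr.
  have -> : k * (80 * 1000 * c1 ^+ 2) = 80 * 1000 * (k * c1 ^+ 2) by ring.
  by move: (k * c1 ^+ 2) => y; lra.
have : z * k <= z * (1 / (50 * 50 * 100 * 100) / 402) by apply: ler_wpM2l.
move: zr kz xx; have -> : z * (2 * k) = 2 * (z * k) by ring.
rewrite -mulrA; move: (z * rn) (z * k) => a b; lra.
Qed.

(** For the same [x]: it is a tiny fraction of m = ln (1 / delta), so the second moment exp x is
    harmless. The relation [u * B = m] is what determines the rate [B]. *)
Lemma spike_moment_le (R : realType) (c1 k x u qi m B: R) : 0 < k ->
  k * (80 * 1000 * c1 ^+ 2 + 2) <= 1 / (1000 * 1000 * 4) ->
  0 <= u <= 1 -> 1 / 2 <= m -> u * B = m -> 0 <= qi -> qi <= k ->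
  x <= 80 * 1000 * c1 ^+ 2 * u * (qi + k * B) + 2 * qi ->
  1000 * 1000 * x <= m.
Proof.
move=> k0 hk /andP[u0 u1] m2 uB q0 qk xx.
have c2 : 0 <= 80 * 1000 * c1 ^+ 2 by apply: mulr_ge0; [lra|exact: sqr_ge0].
move: (80 * 1000 * c1 ^+ 2) c2 hk xx => c c2 hk xx.
have uq : u * (qi + k * B) <= k * (1 + m).
  have -> : u * (qi + k * B) = u * qi + k * m by rewrite -uB; ring.
  rewrite mulrDr mulr1 lerD2r; apply: le_trans qk; exact: ler_piMl.
have : c * u * (qi + k * B) <= c * (k * (1 + m)) by rewrite -mulrA; exact: ler_wpM2l.
have km : k <= k * (1 + m) by rewrite ler_peMr// ?ltW//; lra.
have m0 : 0 <= 1 + m by lra.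
have := ler_wpM2r m0 hk.
have -> : k * (c + 2) * (1 + m) = c * (k * (1 + m)) + 2 * (k * (1 + m)) by ring.
move: (c * (k * (1 + m))) (c * u * (qi + k * B)) xx => a a' xx.
move: (k * (1 + m)) km => b kb; lra.
Qed.

Lemma quiet_radius_const (R : realType) (c p : R) : 100 * 100 * p <= c -> 0 < p -> 100 * p <= 4 / 10 * c.
Proof. lra. Qed.

Lemma coord_variance_le (R : realType) (z x : R) : 100 ^+ 2 * z <= x -> 4 * z <= 1 / 2500 * x.
Proof. by rewrite expr2; lra. Qed.

Lemma spike_height_large (R : realType) (c p : R) : 100 * 100 * p <= c -> 2 < p -> 200 * 200 <= 9 * c.
Proof. lra. Qed.

Lemma inv_sqr_tail_le (R : realType) (x z : R) : 200 <= x -> z <= 4 / x ^+ 2 -> 4 * z <= 1 / 2500.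
Proof.
move=> x200 zx; apply: (@le_trans _ _ (4 * (4 / x ^+ 2))); first by rewrite ler_pM2l//; lra.
have x2 : 200 * 200 <= x ^+ 2 by rewrite expr2; nra.
by rewrite mulrA ler_pdivrMr; lra.
Qed.

Lemma two_tails_le (R : realType) (x y : R) : x <= 1 / 2500 -> y <= 1 / 2500 -> x + y <= 1 / 1000.
Proof. lra. Qed.

Lemma quiet_radius_shift (R : realType) (h t : R) : 0 < t -> h <= 10 * t ->
  1 * 4 / 10 * t + 20 * (h / (50 * 100)) <= 2 * 4 / 10 * t.
Proof. lra. Qed.

Lemma quiet_coord_shift (R : realType) (h : R) : 0 <= h ->
  1 * h / 200 + 20 * (h / (50 * 100)) <= 2 * h / 200.
Proof. lra. Qed.

Lemma intrM_nat (R : realType) (a : int) (m : nat) : (a *+ m)%:~R = m%:R * a%:~R :> R.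
Proof. by rewrite rmorphMn mulr_natl. Qed.

Lemma spike_height_ge1 (R : realType) (c : R) : 100 <= c -> 1 <= 9 * c.
Proof. lra. Qed.

Lemma spike_displacement_le (R : realType) (w h N q s : R) : w <= h / (50 * 100) -> h <= 10 * (s * N) ->
  N <= q -> 0 <= s -> 1 <= q -> 40 * w <= s * q ^+ 2.
Proof.
move=> wh ht Nq s0 q1; have sN : s * N <= s * q by apply: ler_wpM2l.
have sq : s * q <= s * q ^+ 2 by apply: ler_wpM2l => //; rewrite expr2; nra.
have sq0 : 0 <= s * q by rewrite mulr_ge0//; lra.
lra.
Qed.

Lemma quiet_radius_mono (R : realType) : 1 * 4 / 10 <= 2 * 4 / 10 :> R.
Proof. lra. Qed.

Lemma quiet_coord_mono (R : realType) (h : R) : 0 <= h -> 1 * h / 200 <= 2 * h / 200.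
Proof. lra. Qed.

Lemma spike_entry_ge (R : realType) (t a h g : R) : 0 < t -> h <= 10 * t -> 0 <= a ->
  - (h / 100) <= g -> 9 / 10 * t <= t + a + g.
Proof. lra. Qed.

Lemma spike_growth (R : realType) (e t a b h g1 g2 : R) : 0 < e < 1 -> `|g1| <= h / 100 -> `|g2| <= h / 100 ->
  (1 + 8 * e) * (t + a + h / 100) <= t + b - h / 100 ->
  (1 + 8 * e) * (t + a + g1) <= t + b + g2.
Proof.
move=> /andP[e0 e1]; rewrite !ler_norml => /andP[_ g1h] /andP[g2h _] H.
have : (1 + 8 * e) * (t + a + g1) <= (1 + 8 * e) * (t + a + h / 100).
  by apply: ler_wpM2l; lra.
lra.
Qed.

Lemma quiet_radius_lt_spike (R : realType) (t : R) : 0 < t -> 2 * 4 / 10 * t <= 9 / 10 * t.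
Proof. lra. Qed.

Lemma multiple_norm_le (R : realType) (m x h : R) : 0 <= m -> m <= 20 -> 0 <= x ->
  x <= (h / (50 * 100)) ^+ 2 -> m ^+ 2 * x <= (h / 250) ^+ 2.
Proof.
move=> m0 m20 x0 xh; have m2 : m ^+ 2 <= 400 by rewrite expr2; nra.
apply: (@le_trans _ _ (400 * (h / (50 * 100)) ^+ 2)); first by apply: ler_pM; rewrite ?sqr_ge0.
by apply: eq_ler; field.
Qed.

Lemma spike_gap_le (R : realType) (e t h : R) : 0 < e -> 0 < t -> h <= 10 * e * t ->
  h / 250 <= e / 2 * (9 / 10 * t).
Proof.
move=> e0 t0; have : 0 < e * t by rewrite mulr_gt0.
have -> : e / 2 * (9 / 10 * t) = 9 / 20 * (e * t) by field.
by rewrite -mulrA; move: (e * t) => x; lra.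
Qed.

Lemma heavy_coords_weight (R : realType) : 99 / 100 <= 1 - 100^-1 :> R.
Proof. lra. Qed.

Lemma min_good_le1 (R : realType) (t : R) : 0 < t -> t < 1 / 2 -> min_good t <= 1.
Proof.
move=> t0 t2; rewrite /min_good; case: ifP => _; first lra.
have := @ge0_ler_powR R (1 / 12) _ t 1; rewrite powR1; apply; rewrite ?nnegrE; lra.
Qed.

(** * A spike at a random coordinate *)

Section SpikeTest.
Variables (R : realType) (n L q : nat) (p eps delta : R).
Hypotheses (n0 : (0 < n)%N) (nq : (n <= q)%N) (q400 : (400 <= q)%N) (qL : (q ^ 5 <= L)%N).
Hypotheses (eps01 : 0 < eps < 1) (delta0 : 0 < delta) (delta2 : delta < 1 / 2) (p2 : 2 < p).
Variables (c1 kp rho B : R) (N0 h : nat).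
Hypothesis c1p : 100 * 100 * p <= c1.
Hypothesis N0ge : c1 * n%:R `^ p^-1 <= N0%:R.
Hypothesis N0le : N0%:R <= 2 * c1 * n%:R `^ p^-1.
Hypothesis epsn : 1 <= eps * n%:R `^ p^-1.
Hypotheses (kp0 : 0 < kp) (kpc : kp * (80 * 1000 * c1 ^+ 2 + 2) <= 1 / (1000 * 1000 * 4)).
Hypotheses (qk : q%:R^-1 <= kp) (N0q : (N0 <= q)%N).
Hypothesis BE : eps ^+ 2 * (n%:R `^ p^-1) ^+ 2 / n%:R * B = ln (1 / delta).
Hypothesis nrt : (n%:R `^ p^-1) ^+ 2 <= n%:R.
Hypotheses (rhoB : rho <= q%:R^-1 + kp * B) (rhon : rho <= q%:R^-1 + kp * n%:R).

Local Notation s := (L ^ 4)%N.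
Local Notation Q := (L ^ 17)%N.
Local Notation X := (L ^ 8)%N.
Local Notation M := (L ^ 4 * q ^ 2)%N.
Local Notation G := 'rV['Z_Q]_n.
Local Notation D := (@noise R n Q s M X).
Local Notation lft := (@lift n Q X).
Local Notation K := (num_mults delta).
Local Notation vR := (map_mx intr : 'rV[int]_n -> 'rV[R]_n).
Local Notation t := (s%:R * N0%:R : R).

Hypotheses (h9 : 9 * eps * t <= h%:R) (h10 : h%:R <= 10 * eps * t).

Definition spike_base (j : 'I_n) : 'rV[int]_n := (s * N0)%N%:Z *: 'e_j.
Definition spike_step (j : 'I_n) (_ : unit) : 'rV[int]_n := h%:Z *: 'e_j.

Let p1 : 1 <= p. Proof. by apply/ltW/(lt_trans _ p2); rewrite ltr1n. Qed.
Let p0 : 0 < p. Proof. exact: lt_le_trans p1. Qed.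
Let nR : 0 < (n%:R : R). Proof. by rewrite ltr0n. Qed.
Let sR : 0 < (s%:R : R). Proof. by rewrite ltr0n (s_gt0 q400 qL). Qed.
Let qR : 0 < (q%:R : R). Proof. by rewrite ltr0n (q_gt0 q400). Qed.
Let c100 : 100 <= c1. Proof. by apply: le_trans c1p; move: p1; lra. Qed.
Let rn0 : 0 < (n%:R : R) `^ p^-1. Proof. by rewrite powR_gt0. Qed.
Let eN : c1 <= eps * N0%:R.
Proof.
have /andP[e0 _] := eps01.
apply: (@le_trans _ _ (eps * (c1 * n%:R `^ p^-1))); last exact: (ler_wpM2l (ltW e0) N0ge).
by rewrite mulrCA ler_peMr// (le_trans _ c100).
Qed.
Let tp : 0 < t.
Proof.
rewrite mulr_gt0//; have /andP[e0 _] := eps01.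
by rewrite -(pmulr_rgt0 _ e0); apply: lt_le_trans eN; apply: lt_le_trans c100.
Qed.
Let hs_ge : 9 * c1 <= h%:R / s%:R.
Proof.
rewrite ler_pdivlMr//; apply: le_trans h9.
have -> : 9 * eps * t = 9 * (eps * N0%:R) * s%:R by ring.
exact: (ler_wpM2r (ltW sR) (ler_wpM2l (ler0n _ 9) eN)).
Qed.
Let h0 : 0 < (h%:R : R).
Proof.
apply: lt_le_trans h9; have /andP[e0 _] := eps01.
by apply: mulr_gt0 => //; apply: mulr_gt0.
Qed.

(** [a = 1] serves as [typS] and [a = 2] as [typ]: a displacement at most doubles the bounds. *)
Definition quiet (a : R) (j : 'I_n) (g : 'rV[int]_n) : bool :=
  (lpR p (vR g) <= a * 4 / 10 * t) && (`|(g 0 j)%:~R| <= a * h%:R / 200).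

(** Markov's inequality for the p-th power of the norm, whose threshold exceeds 100 p n^(1/p) s, and
    the exponential tail at coordinate [j], where h / s is at least 9 c1. *)
Lemma quiet_tail j : \sum_(g | ~~ quiet 1 j (lft g)) D g <= 1 / 1000.
Proof.
have [[[sp qp] mx] xm] := (s_gt0 q400 qL, Q_gt1 q400 qL, M_leX q400 qL, XM_Q q400 qL).
pose Lam : R := (4 / 10 * N0%:R) `^ p.
have N00 : 0 < (N0%:R : R) by move: tp; rewrite pmulr_rgt0.
have Lam0 : 0 < Lam by rewrite powR_gt0// mulr_gt0//; lra.
have T1 := @noise_lp_tail R n Q s M X sp qp mx xm p Lam p0 Lam0.
have T2 := @noise_coord_tail R n Q s M X sp qp mx xm j (h%:R / 200).
apply: le_trans (_ : n%:R * (4 * p `^ p) / Lam + 4 * expR (- (h%:R / 200 / s%:R)) <= _).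
  apply: le_trans (lerD T1 T2).
  apply: le_trans (@noise_orb R n Q s M X sp qp mx xm _ _).
  apply: (@noise_sub R n Q s M X sp qp mx xm) => g.
  rewrite negb_and -!ltNge /= => /orP[H|H]; apply/orP; [left|right]; last by rewrite mul1r in H.
  have H' : 4 / 10 * N0%:R < s%:R^-1 * lpR p (vR (lft g)).
    rewrite ltr_pdivlMl//; apply: le_lt_trans H; apply: eq_ler; ring.
  have -> : \sum_i (`|(lft g 0 i)%:~R| / s%:R) `^ p = (s%:R^-1 * lpR p (vR (lft g))) `^ p.
    rewrite powRM ?lpR_ge0 ?invr_ge0 ?(ltW sR)// lpRX// mulr_sumr; apply: eq_bigr => i _.
    rewrite [(map_mx _ _) 0 i]mxE; move: `|_| (normr_ge0 ((lft g 0 i)%:~R : R)) => z z0.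
    by rewrite mulrC powRM// invr_ge0 ltW.
  by rewrite /Lam gt0_ltr_powR// nnegrE ?mulr_ge0 ?invr_ge0 ?(ltW sR) ?lpR_ge0 ?(ltW N00)//; lra.
have E1 : n%:R * (4 * p `^ p) / Lam <= 1 / 2500.
  have : (100 * p) `^ p * n%:R <= Lam.
    have a1 : 0 <= 100 * p := mulr_ge0 (ler0n _ 100) (ltW p0).
    have a3 : 0 <= 4 / 10 * N0%:R :> R := mulr_ge0 (divr_ge0 (ler0n _ 4) (ler0n _ 10)) (ltW N00).
    rewrite -[X in _ * X](powRVK p1 (ltW nR)) -(powRM _ a1 (ltW rn0)).
    apply: (ge0_ler_powR (ltW p0)); rewrite ?nnegrE ?(mulr_ge0 a1 (ltW rn0))//.
    apply: (@le_trans _ _ (4 / 10 * (c1 * n%:R `^ p^-1))); last exact: (ler_wpM2l (divr_ge0 (ler0n _ 4) (ler0n _ 10)) N0ge).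
    by rewrite mulrA; apply: (ler_wpM2r (ltW rn0)); exact: quiet_radius_const c1p p0.
  rewrite powRM ?(ltW p0)// => H.
  have p100 : 100 ^+ 2 <= 100 `^ p :> R.
    by rewrite -powR_mulrn// ler_powR ?ler1n// ltW.
  rewrite ler_pdivrMr//; have pp : 0 < p `^ p by rewrite powR_gt0.
  have : 100 ^+ 2 * (p `^ p * n%:R) <= Lam.
    by apply: le_trans H; rewrite -mulrA ler_wpM2r ?mulr_ge0 ?(ltW pp).
  have -> : n%:R * (4 * p `^ p) = 4 * (p `^ p * n%:R) by ring.
  exact: coord_variance_le.
have E2 : 4 * expR (- (h%:R / 200 / s%:R)) <= 1 / 2500 :> R.
  have -> : h%:R / 200 / s%:R = h%:R / s%:R / 200 :> R by rewrite mulrAC.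
  have x200 : 200 <= h%:R / s%:R / 200 :> R.
    rewrite ler_pdivlMr; last by lra.
    by apply: le_trans hs_ge; exact: spike_height_large c1p p2.
  have xp : 0 < h%:R / s%:R / 200 :> R by apply: lt_le_trans x200; rewrite ltr0n.
  exact: inv_sqr_tail_le x200 (expRN_le xp).
exact: two_tails_le E1 E2.
Qed.

Lemma quiet_shift j (g w : 'rV[int]_n) (m : nat) : (m <= 20)%N ->
  norm2 (vR w) <= (h%:R / (50 * 100)) ^+ 2 -> quiet 1 j g -> quiet 2 j (g - w *+ m).
Proof.
move=> m20 wb /andP[g1 g2].
have hb : 0 <= h%:R / (50 * 100) :> R by rewrite divr_ge0 ?(ltW h0)// mulr_ge0// ler0n.
have mR : (m%:R : R) <= 20 by rewrite ler_nat.
have ht : h%:R <= 10 * t.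
  apply: le_trans h10 _; apply: ler_wpM2r; rewrite ?(ltW tp)//.
  by rewrite ler_piMr ?ler0n//; have /andP[_ /ltW] := eps01.
have wl : lpR p (vR w) <= h%:R / (50 * 100).
  apply: le_trans (lpR_le_norm2 p1 _ (ltW p2)) _.
  by rewrite -(ger0_norm hb) -sqrtr_sqr ler_sqrt ?sqr_ge0.
have E : vR (g - w *+ m) = vR g + (- m%:R) *: vR w.
  by rewrite map_mxB map_intrMn scaleNr.
apply/andP; split.
  rewrite E; apply: le_trans (lpR_triangle p1 _ _) _.
  have -> : lpR p (- m%:R *: vR w) = m%:R * lpR p (vR w).
    rewrite scaleNr lpRN !lpRE; have -> : lpsum p (m%:R *: vR w) = m%:R `^ p * lpsum p (vR w).
      rewrite /lpsum mulr_sumr; apply: eq_bigr => i _.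
      by rewrite mxE normrM ger0_norm// powRM.
    by rewrite powRM ?powR_ge0 ?lpsum_ge0// powRK.
  apply: le_trans (lerD g1 (ler_pM (ler0n _ _) (lpR_ge0 _ _) mR wl)) _.
  exact: quiet_radius_shift tp ht.
have wj := norm2_coord_le j hb wb; rewrite mxE in wj.
rewrite mxE [(- (w *+ m)) 0 j]mxE mulmxnE intrB intrM_nat.
apply: le_trans (ler_normB _ _) _; rewrite normrM ger0_norm ?ler0n//.
apply: le_trans (lerD g2 (ler_pM (ler0n _ _) (normr_ge0 _) mR wj)) _.
exact: quiet_coord_shift (ltW h0).
Qed.

Hypothesis rho0 : 0 < rho.

Lemma spike_step_scaled j i : scaled R L (spike_step j i) = (h%:R / s%:R) *: 'e_j.
Proof.
by rewrite /scaled /spike_step map_intr_delta scalerA mulrC.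
Qed.

Lemma spike_entry j i (g : 'rV[int]_n) m :
  vR (spike_base j + spike_step j i *+ m + g) = (t + m%:R * h%:R) *: 'e_j + vR g.
Proof.
by rewrite !map_mxD map_intrMn /spike_base /spike_step !map_intr_delta scalerA -scalerDl natrM.
Qed.

(** Up to rounding, the scaled displacement has squared norm at most (h / s)^2 H j j. Here (h / s)^2
    is of order (eps n^(1/p))^2 and H j j of order rho / n with rho about kp B, so the product is of
    order kp ln (1 / delta). *)
Lemma spike_w_small (H Sg : 'M[R]_n) j (w : 'rV[int]_n) :
  ridge_like H Sg -> H j j <= 100 * rho / n%:R ->
  norm2 (scaled R L w + scaled R L (spike_step j tt) *m H) <= (q%:R ^+ 3)^-1 ->
  norm2 (vR w) <= (h%:R / (50 * 100)) ^+ 2 /\ 1000 * 1000 * (norm2 (vR w) / s%:R ^+ 2) <= ln (1 / delta).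
Proof.
move=> [Ssym Spsd piv] Hj werr; have /andP[e0 e1] := eps01.
pose hs : R := h%:R / s%:R; pose x : R := norm2 (scaled R L w).
have xE : x = norm2 (vR w) / s%:R ^+ 2 by rewrite /x /scaled norm2Z mulrC exprVn.
have q1 : (q%:R ^+ 3)^-1 <= q%:R^-1 :> R.
  rewrite lef_pV2 ?posrE ?exprn_gt0//; rewrite -[leLHS]expr1 ler_weXn2l// ler1n.
  by rewrite (q_gt0 q400).
have xle : x <= 200 * hs ^+ 2 * (rho / n%:R) + 2 * q%:R^-1.
  have -> : x = norm2 ((scaled R L w + scaled R L (spike_step j tt) *m H) -
       scaled R L (spike_step j tt) *m H) by rewrite addrK.
  apply: le_trans (norm2D_le _ _) _; rewrite addrC norm2N spike_step_scaled norm2_delta.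
  apply: lerD; last by rewrite spike_step_scaled in werr; rewrite ler_pM2l// (le_trans werr).
  have Hr := le_trans (pivotal_row_norm2 Spsd j piv) Hj.
  have -> : 200 * hs ^+ 2 * (rho / n%:R) = 2 * (hs ^+ 2 * (100 * rho / n%:R)).
    by rewrite -[200%:R]/((2 * 100)%N%:R) natrM; ring.
  by rewrite ler_pM2l//; apply: ler_wpM2l; rewrite ?sqr_ge0.
have hs1 : 1 <= hs.
  by apply: le_trans hs_ge; exact: spike_height_ge1.
have rn : rho / n%:R <= 2 * kp.
  rewrite ler_pdivrMr//; apply: le_trans rhon _.
  have : kp <= kp * n%:R by rewrite ler_peMr ?(ltW kp0)// ler1n.
  by move: qk => qk' kn; rewrite -mulrA [2 * _]mulr_natl mulr2n lerD2r (le_trans qk').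
have x1 : x <= (hs / (50 * 100)) ^+ 2 := spike_shift_le c100 kp0 kpc hs1 rn qk xle.
split.
  have := x1; rewrite xE ler_pdivrMr ?exprn_gt0// => x2; apply: le_trans x2 _; apply: eq_ler.
  rewrite /hs -exprMn; congr (_ ^+ 2); rewrite mulrAC divfK ?gt_eqF//.
rewrite -xE; pose u : R := eps ^+ 2 * (n%:R `^ p^-1) ^+ 2 / n%:R.
have u0 : 0 <= u <= 1.
  apply/andP; split; first exact: (divr_ge0 (mulr_ge0 (sqr_ge0 _) (sqr_ge0 _)) (ltW nR)).
  rewrite /u ler_pdivrMr// mul1r; apply: le_trans nrt.
  by rewrite ler_piMl ?sqr_ge0// expr_le1 ?ltW.
have q0' : 0 <= q%:R^-1 :> R by rewrite invr_ge0 ltW.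
apply: (spike_moment_le (B := B) kp0 kpc u0 (ln_inv_ge delta0 delta2) BE q0' qk).
apply: le_trans xle _; rewrite lerD2r.
have hs2 : hs ^+ 2 <= 400 * c1 ^+ 2 * (eps ^+ 2 * (n%:R `^ p^-1) ^+ 2).
  have hs20 : hs <= 20 * c1 * (eps * n%:R `^ p^-1).
    rewrite /hs ler_pdivrMr//; apply: le_trans h10 _.
    have -> : 10 * eps * t = 10 * eps * s%:R * N0%:R by ring.
    have -> : 20 * c1 * (eps * n%:R `^ p^-1) * s%:R = 10 * eps * s%:R * (2 * c1 * n%:R `^ p^-1).
      by rewrite -[20%:R]/((10 * 2)%N%:R) natrM; ring.
    apply: ler_wpM2l => //; rewrite mulr_ge0 ?(ltW sR)//; rewrite mulr_ge0 ?(ltW e0)//.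
  have -> : 400 * c1 ^+ 2 * (eps ^+ 2 * (n%:R `^ p^-1) ^+ 2) = (20 * c1 * (eps * n%:R `^ p^-1)) ^+ 2.
    by rewrite -[400%:R]/((20 * 20)%N%:R) natrM; ring.
  have hs0 : 0 <= hs := le_trans ler01 hs1.
  by rewrite ler_sqr ?nnegrE// (le_trans hs0).
have -> : 80 * 1000 * c1 ^+ 2 * u * (q%:R^-1 + kp * B) =
    200 * (400 * c1 ^+ 2 * (eps ^+ 2 * (n%:R `^ p^-1) ^+ 2)) * ((q%:R^-1 + kp * B) / n%:R).
  have -> : 80 * 1000 = 200 * 400 :> R by rewrite -!natrM.
  by rewrite /u; ring.
apply: ler_pM; rewrite ?mulr_ge0 ?sqr_ge0 ?invr_ge0 ?(ltW rho0) ?(ltW nR)//.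
  by rewrite ler_pM2l// ltr0n.
by rewrite ler_wpM2r// invr_ge0 ltW.
Qed.

(** The coordinate of the spike is random because only most diagonal entries of [H] are at most 100
    times rho / n. Given the coordinate, the mixture is a single point. *)
Lemma spike_inst (H Sg : 'M[R]_n) (w : 'I_n -> unit -> 'rV[int]_n) :
  ridge_like H Sg -> \tr H <= rho ->
  (forall j i, norm2 (scaled R L (w j i) + scaled R L (spike_step j i) *m H) <= (q%:R ^+ 3)^-1) ->
  exists2 goodJ : pred 'I_n, 99 / 100 <= \sum_(j | goodJ j) (n%:R^-1 : R) &
    forall j, goodJ j -> testable L q p eps delta (fun=> 1) (spike_base j) (spike_step j) (w j).
Proof.
move=> rl trH werr; have /andP[e0 e1] := eps01.
have [Ssym Spsd piv] := rl.
have H0 j : 0 <= H j j by exact: (pivotal_diag_ge0 Spsd j piv).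
exists [pred j | H j j <= 100%:R * rho / n%:R].
  have := @markov_card R n 100 (fun j => H j j) rho n0 isT H0 rho0 trH.
  rewrite sumr_const -[n%:R^-1 *+ _]mulr_natl ler_pdivlMr// => /(le_trans _); apply.
  exact: (ler_wpM2r (ltW nR) (heavy_coords_weight R)).
move=> j /= Hj; have [wb wm] := spike_w_small rl Hj (werr j tt).
have hb : 0 <= h%:R / (50 * 100) :> R by rewrite divr_ge0 ?(ltW h0)// mulr_ge0// ler0n.
have ht : h%:R <= 10 * t.
  apply: le_trans h10 _; apply: ler_wpM2r; rewrite ?(ltW tp)//.
  by rewrite ler_piMr ?ler0n// ltW.
exists xpredT, (quiet 2 j), (quiet 1 j); split.
- case=> c _; have wc := norm2_coord_le c hb wb; rewrite mxE in wc.
  have NR : (N0%:R : R) <= q%:R by rewrite ler_nat.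
  have : (40 * `|w j tt 0 c|)%:~R <= (M%:Z)%:~R :> R.
    rewrite intrM intr_norm -[X in _ <= X]/(M%:R) natrM [(q ^ 2)%N%:R]natrX -[40%:~R]/(40 : R).
    have q1R : 1 <= (q%:R : R) by rewrite ler1n (q_gt0 q400).
    have HH := spike_displacement_le wc ht NR (ltW sR) q1R.
    exact: HH.
  by rewrite ler_int.
- move=> k [] g _ qg; apply/andP; split.
    have /andP[g1 g2] := qg; apply/andP; split.
      apply: le_trans g1 _; apply: ler_wpM2r; rewrite ?(ltW tp)//.
      exact: quiet_radius_mono.
    by apply: le_trans g2 _; exact: (quiet_coord_mono (ltW h0)).
  by apply: quiet_shift => //; exact: mults_le.
- exact: quiet_tail.
- by rewrite (big_pred1 tt)//; apply: min_good_le1.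
split.
  move=> k1 k2 [] [] g1 g2 k12 _ _ /andP[q1 q1'] /andP[q2 q2'] gE.
  have k23 : (k2 < 3)%N by rewrite (leq_trans (ltn_ord k2))// /num_mults; case: ifP.
  rewrite !lp_normE !spike_entry.
  have dv a (v : 'rV[R]_n) : (a *: 'e_j + v) 0 j = a + v 0 j.
    by rewrite mxE [(a *: 'e_j) 0 j]mxE mxE !eqxx mulr1.
  have er a (v : 'rV[R]_n) : erase j (a *: 'e_j + v) = erase j v.
    apply/rowP => i; rewrite !mxE; case: eqP => // _; by rewrite andbF mulr0 add0r.
  have G1 : `|(vR g1) 0 j| <= h%:R / 100 by rewrite mxE; apply: le_trans q1' _; apply: eq_ler; field.
  have G2 : `|(vR g2) 0 j| <= h%:R / 100 by rewrite mxE; apply: le_trans q2' _; apply: eq_ler; field.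
  have Gm := mults_lt k12 k23 eps01 tp h9 h10.
  have m0 : 0 <= (mults k1)%:R * h%:R :> R := mulr_ge0 (ler0n _ _) (ltW h0).
  have P1 : 9 / 10 * t <= t + (mults k1)%:R * h%:R + (vR g1) 0 j.
    by move: G1; rewrite ler_norml => /andP[G0 _]; exact: (spike_entry_ge tp ht m0 G0).
  apply: (spike_sep (ltW p2) (j := j) (d := h%:R / 250) eps01).
  + by rewrite dv; apply: lt_le_trans P1; rewrite mulr_gt0// divr_gt0// ltr0n.
  + rewrite !dv; exact: spike_growth G1 G2 Gm.
  + rewrite er dv; apply: le_trans (erase_lp_le (ltW p2) _ _) _; apply: le_trans q1 _.
    by apply: le_trans P1; exact: quiet_radius_lt_spike tp.
  + rewrite opprD addrACA -scalerBl er -map_mxB.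
    apply: le_trans (erase_norm2_le _ _) _.
    have -> : g2 - g1 = w j tt *+ (mults k2 - mults k1).
      have mk : (mults k1 <= mults k2)%N.
        by move: k12 k23; rewrite /mults; case: (val k1) (val k2) => [|[|[|?]]] [|[|[|?]]].
      have -> : g2 = g1 - w j tt *+ mults k1 + w j tt *+ mults k2 by rewrite gE subrK.
      by rewrite mulrnBr// addrC addrA addrA addNr add0r addrC.
    rewrite map_intrMn norm2Z.
    have mk20 : (mults k2 - mults k1)%N%:R <= 20 :> R.
      by rewrite ler_nat (leq_trans (leq_subr _ _))// mults_le.
    exact: multiple_norm_le (ler0n _ _) mk20 (norm2_ge0 _) wb.
  + by apply: (divr_ge0 (ltW h0)); exact: ler0n.
  + apply: (@le_trans _ _ (eps / 2 * (9 / 10 * t))); first exact: spike_gap_le.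
    by rewrite dv; apply: (ler_wpM2l _ P1); rewrite divr_ge0 ?ltW.
move=> k; rewrite (big_pred1 tt)//= (big_pred1 tt)//= !mulr1 mul1r -mulrA.
apply: exp_moment_le erefl (ltn_ord k) _ _ => //.
by rewrite divr_ge0 ?norm2_ge0// sqr_ge0.
Qed.

End SpikeTest.

(** * Random words of spikes *)

Section Design.
Variables (R : realType) (n mi : nat) (G0 : pred 'I_n) (psi : 'I_n -> 'I_n -> R).
Variables (theta dmax pmax : R) (dg : nat).
Hypothesis psi_sym : forall i j, psi i j = psi j i.
Hypothesis psi_max : forall i j, G0 i -> G0 j -> psi i j <= pmax.
Hypothesis psi_deg : forall i, G0 i -> #|[pred j | theta < psi i j]|%:R <= dmax.
Hypotheses (theta0 : 0 <= theta) (pmax0 : 0 <= pmax).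

Local Notation word := {ffun 'I_mi -> 'I_n}.

Definition hits (f : word) (j : 'I_n) : nat := #|[pred l | theta < psi (f l) j]|.

Definition in_G0 (f : word) : bool := [forall l, G0 (f l)].

Definition spread (f : word) : bool := in_G0 f && [forall j, G0 j ==> (hits f j <= dg)%N].

Lemma sum_in_G0 (F : 'I_mi -> 'I_n -> R) :
  \sum_(f : word | in_G0 f) \prod_l F l (f l) = \prod_l \sum_(i | G0 i) F l i.
Proof.
rewrite bigA_distr_big /=; apply: eq_bigl => f.
by apply/forallP/ffun_onP => H l; have := H l; rewrite unfold_in.
Qed.

Lemma card_in_G0 : #|[pred f | in_G0 f]|%:R = #|G0|%:R ^+ mi :> R.
Proof.
have := sum_in_G0 (fun _ _ => 1); rewrite [X in X = _](eq_bigr (fun=> 1)); last by move=> f _ /=; rewrite big1.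
by rewrite sumr_const => ->; rewrite sumr_const prodr_const card_ord.
Qed.

(** A Chernoff bound: the sum of c^(hits f j) over words factorises over the letters, and a word
    that is not spread has a [j] with more than [dg] hits. *)
Lemma card_not_spread (c : R) : 1 <= c ->
  #|[pred f : word | in_G0 f && ~~ spread f]|%:R * c ^+ dg.+1 <=
  #|G0|%:R * (#|G0|%:R + c * dmax) ^+ mi.
Proof.
move=> c1; have c0 : 0 <= c by apply: le_trans c1.
have pow f j : c ^+ hits f j = \prod_l (if theta < psi (f l) j then c else 1).
  by rewrite /hits -prodr_const [LHS]big_mkcond; apply: eq_bigr => l _; rewrite inE.
apply: (@le_trans _ _ (\sum_(f : word | in_G0 f) \sum_(j | G0 j) c ^+ hits f j)).
  rewrite mulr_natl -sumr_const [leLHS]big_mkcond [leRHS]big_mkcond; apply: ler_sum => f _.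
  rewrite inE; case: ifP => [/andP[gf]|_]; last first.
    by case: ifP => // _; apply: sumr_ge0 => j _; rewrite exprn_ge0.
  rewrite /spread gf /= negb_forall => /existsP[j]; rewrite negb_imply -ltnNge => /andP[gj hj].
  rewrite (bigD1 j)//= -[leLHS]addr0 lerD//; last by apply: sumr_ge0 => i _; rewrite exprn_ge0.
  exact: ler_weXn2l.
rewrite exchange_big /= mulr_natl -sumr_const; apply: ler_sum => j gj.
under eq_bigr do rewrite pow.
rewrite (sum_in_G0 (fun _ i => if theta < psi i j then c else 1)) prodr_const card_ord.
have S0 : 0 <= \sum_(i | G0 i) (if theta < psi i j then c else 1).
  by apply: sumr_ge0 => i _; case: ifP.
have Sle : \sum_(i | G0 i) (if theta < psi i j then c else 1) <= #|G0|%:R + c * dmax.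
  apply: (@le_trans _ _ (\sum_(i | G0 i) (1 + (if theta < psi i j then c else 0)))).
    by apply: ler_sum => i _; case: ifP => _; rewrite ?addr0// lerDr.
  rewrite big_split /= sumr_const lerD2l -big_mkcondr /=.
  apply: (@le_trans _ _ (\sum_(i | theta < psi j i) c)).
    rewrite big_mkcond [leRHS]big_mkcond; apply: ler_sum => i _.
    by rewrite psi_sym; case: (G0 i) => //=; case: ifP.
  rewrite sumr_const -mulr_natr ler_wpM2l//; exact: psi_deg.
by apply: lerXn2r => //; rewrite nnegrE// (le_trans S0).
Qed.

(** For fixed [f] the sum over all [f2] in [G0] factorises over the letters of [f2]. A letter
    coupled to no letter of [f] contributes at most exp (mi theta). At most mi dmax letters are
    coupled, and since [f] is spread their exponents are at most mi theta + dg pmax. *)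
Lemma spread_moment (f : word) : spread f ->
  \sum_(f2 | spread f2) expR (\sum_l \sum_l' psi (f l) (f2 l')) <=
  (expR (mi%:R * theta) * (#|G0|%:R + mi%:R * dmax * expR (dg%:R * pmax))) ^+ mi.
Proof.
case/andP => /forallP gf /forallP df.
apply: (@le_trans _ _ (\sum_(f2 | in_G0 f2) \prod_l' expR (\sum_l psi (f l) (f2 l')))).
  rewrite [leLHS]big_mkcond [leRHS]big_mkcond; apply: ler_sum => f2 _.
  rewrite /spread; case: (in_G0 f2) => //=.
  rewrite -expR_sum exchange_big; by case: ifP => // _; rewrite expR_ge0.
rewrite (sum_in_G0 (fun _ j => expR (\sum_l psi (f l) j))) prodr_const card_ord.
have S0 : 0 <= \sum_(j | G0 j) expR (\sum_l psi (f l) j).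
  by apply: sumr_ge0 => j _; rewrite expR_ge0.
have Sle : \sum_(j | G0 j) expR (\sum_l psi (f l) j) <=
    expR (mi%:R * theta) * (#|G0|%:R + mi%:R * dmax * expR (dg%:R * pmax)).
  apply: (@le_trans _ _ (\sum_(j | G0 j) expR (mi%:R * theta) *
      (1 + \sum_l (if theta < psi (f l) j then expR (dg%:R * pmax) else 0)))); last first.
    rewrite -mulr_sumr ler_wpM2l ?expR_ge0// big_split /= sumr_const lerD2l exchange_big /=.
    apply: (@le_trans _ _ (\sum_(l < mi) dmax * expR (dg%:R * pmax))); last first.
      by rewrite sumr_const card_ord -[leLHS]mulr_natl mulrA.
    apply: ler_sum => l _; rewrite -big_mkcondr /=.
    apply: (@le_trans _ _ (\sum_(j | theta < psi (f l) j) expR (dg%:R * pmax))).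
      rewrite big_mkcond [leRHS]big_mkcond; apply: ler_sum => j _.
      by case: (G0 j) => //=; case: ifP => // _; rewrite expR_ge0.
    rewrite sumr_const -[leLHS]mulr_natl ler_wpM2r ?expR_ge0//; exact: psi_deg.
  apply: ler_sum => j gj.
  have split_sum : \sum_l psi (f l) j <= mi%:R * theta + (hits f j)%:R * pmax.
    apply: (@le_trans _ _ (\sum_l (theta + (if theta < psi (f l) j then pmax else 0)))).
      apply: ler_sum => l _; case: ltP => H; last by rewrite addr0.
      by apply: le_trans (psi_max (gf l) gj) _; rewrite lerDr.
    rewrite big_split /= sumr_const card_ord -[theta *+ mi]mulr_natl lerD2l -big_mkcond /=.
    by rewrite sumr_const -[leLHS]mulr_natl.
  apply: (@le_trans _ _ (expR (mi%:R * theta + (hits f j)%:R * pmax))); first by rewrite ler_expR.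
  rewrite expRD ler_wpM2l ?expR_ge0//.
  have e0 l : 0 <= (if theta < psi (f l) j then expR (dg%:R * pmax) else 0).
    by case: ifP => // _; rewrite expR_ge0.
  have := implyP (df j) gj; case: (posnP (hits f j)) => [->|hp] hle.
    by rewrite mul0r expR0 lerDl sumr_ge0.
  have [l hl] : exists l, theta < psi (f l) j by have /card_gt0P[l] := hp; rewrite inE; exists l.
  rewrite (bigD1 l)//= hl addrCA -[leLHS]addr0 lerD ?addr_ge0 ?sumr_ge0//.
  by rewrite ler_expR ler_wpM2r// ler_nat.
by apply: lerXn2r => //; rewrite nnegrE// (le_trans S0).
Qed.

End Design.

Lemma block_slack (R : realType) (u8 u2 u10 u v z : R) : u8 + u2 <= u10 -> u <= z + u2 ->
  z + u10 <= v -> u + u8 <= v.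
Proof. lra. Qed.

Lemma half_ge0 (R : realType) : 0 <= 2^-1 :> R.
Proof. lra. Qed.

Lemma block_radius (R : realType) (a r : R) : 0 <= a -> a <= r -> 4 * a + r <= 2^-1 * (10 * r).
Proof. lra. Qed.

Lemma block_gain (R : realType) (u v z f : R) : 10 * u < f -> 0 < f -> v <= f -> z <= 5 * u + 4 * v ->
  z < 8 * f.
Proof. lra. Qed.

Section BlockNorm.
Variables (R : realType) (p : R) (n : nat).
Hypothesis p2 : 2 <= p.

Let p1 : 1 <= p. Proof. by apply: le_trans p2; rewrite ler1n. Qed.
Let p0 : 0 < p. Proof. exact: lt_le_trans p1. Qed.

Lemma powR_lt_inv (x y : R) : 0 <= x -> 0 <= y -> x `^ p < y `^ p -> x < y.
Proof.
move=> x0 y0; apply: contraTT; rewrite -!leNgt => yx.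
by apply: ge0_ler_powR; rewrite ?nnegrE// ltW.
Qed.

(* [(1 + 3 e) a + d] is the convex combination [(1 - e) a + e (4 a + d / e)]. *)
Lemma convex_gain (a b d r g e : R) : 0 < e < 1 -> 0 <= a -> 0 <= b -> 0 <= d -> d <= e * r ->
  e * (4 * a + r) `^ p < g -> a `^ p + g <= b `^ p -> (1 + 3 * e) * a + d < b.
Proof.
move=> /andP[e0 e1]; have e3 : 0 <= 1 + 3 * e by lra.
move=> a0 b0 d0 dr gl gb.
have r0 : 0 <= r by rewrite -(pmulr_rge0 _ e0) (le_trans d0).
have ar : 0 <= 4 * a + r by rewrite addr_ge0// mulr_ge0.
apply: (@le_lt_trans _ _ ((1 + 3 * e) * a + e * r)); first by rewrite lerD2l.
apply: powR_lt_inv => //.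
  exact: (addr_ge0 (mulr_ge0 e3 a0) (mulr_ge0 (ltW e0) r0)).
apply: lt_le_trans gb.
have -> : (1 + 3 * e) * a + e * r = e * (4 * a + r) + (1 - e) * a by ring.
have te : 0 <= e <= 1 by rewrite !ltW.
apply: le_lt_trans (powR_convex p1 te ar a0) _.
rewrite addrC; apply: ler_ltD gl.
by rewrite ler_piMl ?powR_ge0// gerBl ltW.
Qed.

Lemma pow_add_signed (g x : R) : 0 <= x -> `|g| <= x -> `|g| `^ p + (x - 2 * `|g|) `^ p <= `|g + x| `^ p \/ x < 2 * `|g|.
Proof.
move=> x0 gx; case: (ltP x (2 * `|g|)) => H; [by right|left].
apply: le_trans (powR_superadd p1 (normr_ge0 _) _) _; first by rewrite subr_ge0.
apply: ge0_ler_powR; rewrite ?nnegrE ?(ltW p0)//; first by rewrite addr_ge0// subr_ge0.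
have := ler_normD (g + x) (- g); rewrite normrN addrAC subrr add0r (ger0_norm x0); lra.
Qed.

(** Even against noise of opposite sign, |g + x| is at least |g| + (x - 2 |g|), and superadditivity
    of the power gives a gain of (x / 2)^p on top of |g|^p. *)
Lemma lpsum_gain0 (v : 'rV[R]_n) (x : 'I_n -> R) : (forall j, 0 <= x j) ->
  (forall j, x j = 0 \/ `|v 0 j| <= x j / 100) ->
  lpsum p v + (2^-1) `^ p * \sum_j x j `^ p <= lpsum p (v + \row_j x j).
Proof.
move=> x0 xv; rewrite /lpsum mulr_sumr -big_split; apply: ler_sum => j _ /=.
rewrite !mxE; have := x0 j; case: (xv j) => [->|]; first by rewrite powR0 ?gt_eqF// !mulr0 !addr0.
move: (v 0 j) (x j) => g y gy y0; have gy' : `|g| <= y by lra.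
case: (pow_add_signed y0 gy') => [H|H]; last by have := normr_ge0 g; lra.
have c98 : 0 <= 2^-1 :> R by lra.
apply: le_trans H; rewrite lerD2l -powRM//.
apply: ge0_ler_powR; rewrite ?nnegrE ?(ltW p0) ?mulr_ge0//; first by lra.
by lra.
Qed.

Lemma lpsum_upper (v : 'rV[R]_n) (x : 'I_n -> R) : (forall j, 0 <= x j) ->
  (forall j, x j = 0 \/ `|v 0 j| <= x j / 100) ->
  lpsum p (v + \row_j x j) <= lpsum p v + 2 `^ p * \sum_j x j `^ p.
Proof.
move=> x0 xv; rewrite /lpsum mulr_sumr -big_split; apply: ler_sum => j _ /=.
rewrite !mxE; have := x0 j; case: (xv j) => [->|]; first by rewrite powR0 ?gt_eqF// !mulr0 !addr0.
move: (v 0 j) (x j) => g y gy y0; apply: (@le_trans _ _ (2 `^ p * y `^ p)); last first.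
  by rewrite lerDr powR_ge0.
rewrite -powRM//; apply: (ge0_ler_powR (ltW p0)); rewrite ?nnegrE ?mulr_ge0//.
by apply: le_trans (ler_normD _ _) _; rewrite (ger0_norm y0); lra.
Qed.

Lemma lpR_row_le (x : 'I_n -> R) E : (forall j, 0 <= x j) -> E = (\sum_j x j `^ p) `^ p^-1 ->
  lpR p (\row_j x j) = E.
Proof.
move=> x0 ->; rewrite lpRE /lpsum; congr (_ `^ _); apply: eq_bigr => j _.
by rewrite mxE ger0_norm.
Qed.

Lemma half_twenty (x : 'I_n -> R) : (forall j, 0 <= x j) ->
  2^-1 `^ p * (\sum_j (20 * x j) `^ p) = 10 `^ p * \sum_j x j `^ p.
Proof.
move=> x0; rewrite !mulr_sumr; apply: eq_bigr => j _.
have h2 : 0 <= (2 : R)^-1 by rewrite invr_ge0 ler0n.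
rewrite -(powRM _ h2 (mulr_ge0 (ler0n _ 20) (x0 j))) -(powRM _ (ler0n _ 10) (x0 j)) mulrA.
by congr ((_ * _) `^ p); lra.
Qed.

Lemma pow_8_2_10 (E : R) : 0 <= E -> 8 `^ p * E + 2 `^ p * E <= 10 `^ p * E.
Proof.
move=> E0; rewrite -mulrDl; apply: (ler_wpM2r E0).
by apply: le_trans (powR_superadd p1 (ler0n _ 8) (ler0n _ 2)) _; rewrite -natrD.
Qed.

(** After taking p-th roots, with e' = e^(1/p) <= 1, the hypothesis reads 10 e' r < F, and e' (4 (r
    + F) + r) <= 5 e' r + 4 F stays below 8 F. *)
Lemma block_root (e r N1 F : R) : 0 < e < 1 -> 0 <= r -> 0 <= N1 -> 0 <= F -> N1 <= r + F ->
  e * (10 * r) `^ p < F `^ p -> e * (4 * N1 + r) `^ p < 8 `^ p * F `^ p.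
Proof.
move=> /andP[e0 e1] r0 N10 F0 N1le big.
pose e' := e `^ p^-1; have e'E : e' `^ p = e by rewrite /e' powRVK// ltW.
have e'0 : 0 < e' by rewrite powR_gt0.
have e'1 : e' <= 1.
  by apply: (powR_inv_le p1); rewrite ?powR1 ?ler01 ?(ltW e0) ?(ltW e1).
have rF : e' * (10 * r) < F.
  apply: powR_lt_inv => //; first exact: (mulr_ge0 (ltW e'0) (mulr_ge0 (ler0n _ 10) r0)).
  by rewrite (powRM _ (ltW e'0) (mulr_ge0 (ler0n _ 10) r0)) e'E.
have N4 : 0 <= 4 * N1 + r := addr_ge0 (mulr_ge0 (ler0n _ 4) N10) r0.
rewrite -{1}e'E -(powRM _ (ltW e'0) N4) -(powRM _ (ler0n _ 8) F0).
apply: (gt0_ltr_powR p0).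
- by rewrite nnegrE (mulr_ge0 (ltW e'0) N4).
- by rewrite nnegrE (mulr_ge0 (ler0n _ 8) F0).
have : e' * (4 * N1 + r) <= e' * (4 * (r + F) + r).
  by rewrite ler_pM2l// lerD2r ler_pM2l.
have : e' * F <= F by rewrite ler_piMl.
have Fp : 0 < F by apply: le_lt_trans rF; exact: (mulr_ge0 (ltW e'0) (mulr_ge0 (ler0n _ 10) r0)).
move: rF; have -> : e' * (10 * r) = 10 * (e' * r) by ring.
have -> : e' * (4 * (r + F) + r) = 5 * (e' * r) + 4 * (e' * F) by ring.
by move=> h1 h2 h3; exact: block_gain h1 Fp h2 h3.
Qed.

(** Both cases feed [convex_gain]. Starting from multiple 0 the base is noise, and the gain (1/2)^p
    E suffices. From 1 to 20 the base may itself be dominated by spikes: they account for at most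
    2^p E, the larger ones gain 10^p E, and 8^p E remains. This comparison needs equal energies,
    which one-letter words have. *)
Lemma block_sep (a b : nat) (g1 g2 : 'rV[R]_n) (x1 x2 : 'I_n -> R) (e r d : R) : 0 < e < 1 ->
  (a = 0%N /\ (1 <= b)%N) \/ [/\ a = 1%N, b = 20%N & \sum_j x1 j `^ p = \sum_j x2 j `^ p] ->
  (forall j, 0 <= x1 j) -> (forall j, x1 j = 0 \/ `|g1 0 j| <= x1 j / 100) ->
  (forall j, 0 <= x2 j) -> (forall j, x2 j = 0 \/ `|g1 0 j| <= x2 j / 100) ->
  lpR p g1 <= r -> 0 <= d -> norm2 (g2 - g1) <= d ^+ 2 -> d <= e * r ->
  e * (10 * r) `^ p < \sum_j x2 j `^ p ->
  (1 + e) ^+ 2 * lpR p (g1 + \row_j (a%:R * x1 j)) < lpR p (g2 + \row_j (b%:R * x2 j)).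
Proof.
move=> e01; have /andP[e0 e1] := e01; have es : (1 + e) ^+ 2 <= 1 + 3 * e by rewrite expr2; nra.
move=> ab x10 x1g x0 xg gr d0 gd dr big.
set N1 := lpR p (g1 + _); pose N2' := lpR p (g1 + \row_j (b%:R * x2 j)).
have r0 : 0 <= r by apply: le_trans gr; exact: lpR_ge0.
have N2 : N2' - d <= lpR p (g2 + \row_j (b%:R * x2 j)).
  have -> : g2 + \row_j (b%:R * x2 j) = (g1 + \row_j (b%:R * x2 j)) + (g2 - g1).
    by rewrite [g1 + _]addrC -addrA [g1 + _]addrC subrK addrC.
  apply: le_trans (lpR_triangleB p1 _ _); rewrite lerD2l lerN2.
  apply: le_trans (lpR_le_norm2 p1 _ p2) _.
  by rewrite -(ger0_norm d0) -sqrtr_sqr ler_sqrt ?sqr_ge0.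
set E := \sum_j x2 j `^ p in big.
have E0 : 0 <= E by apply: sumr_ge0 => j _; exact: powR_ge0.
suff key : (1 + 3 * e) * N1 + d < N2'.
  apply: lt_le_trans N2; rewrite ltrBrDr; apply: le_lt_trans key.
  by rewrite lerD2r; apply: ler_wpM2r; first exact: lpR_ge0.
case: ab => [[a0 b1]|[a1 b20 x12]].
  have N1E : N1 = lpR p g1.
    by rewrite /N1; congr lpR; apply/rowP => j; rewrite !mxE a0 mul0r addr0.
  apply: (@convex_gain N1 N2' d r ((2^-1) `^ p * E) e e01 (lpR_ge0 _ _) (lpR_ge0 _ _) d0 dr).
    apply: (@le_lt_trans _ _ ((2^-1) `^ p * (e * (10 * r) `^ p))); last first.
      by rewrite ltr_pM2l// powR_gt0// invr_gt0 ltr0n.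
    have r100 : 0 <= 10 * r := mulr_ge0 (ler0n _ 10) r0.
    rewrite mulrCA (ler_pM2l e0) -(powRM _ (half_ge0 R) r100).
    have n1 : 0 <= N1 by exact: lpR_ge0.
    have gr' : N1 <= r by rewrite N1E.
    have a1 : 0 <= 4 * N1 + r := addr_ge0 (mulr_ge0 (ler0n _ 4) n1) r0.
    have a2 : 0 <= 2^-1 * (10 * r) := mulr_ge0 (half_ge0 R) r100.
    by apply: (ge0_ler_powR (ltW p0)); rewrite ?nnegrE; last exact: block_radius.
  have bx0 j : 0 <= b%:R * x2 j := mulr_ge0 (ler0n _ _) (x0 j).
  have bx j : x2 j <= b%:R * x2 j by apply: (ler_peMl (x0 j)); rewrite ler1n.
  have bxg j : b%:R * x2 j = 0 \/ `|g1 0 j| <= b%:R * x2 j / 100.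
    case: (xg j) => [->|H]; [by left; rewrite mulr0|right].
    by apply: (le_trans H); rewrite ler_pM2r ?invr_gt0 ?ltr0n.
  have H := lpsum_gain0 bx0 bxg; rewrite -!(lpRX p1) in H.
  apply: (le_trans _ H); rewrite N1E lerD2l; apply: ler_wpM2l; first exact: powR_ge0.
  by apply: ler_sum => j _; apply: (ge0_ler_powR (ltW p0)); rewrite ?nnegrE.
have N1E : N1 = lpR p (g1 + \row_j x1 j).
  by rewrite /N1; congr lpR; apply/rowP => j; rewrite !mxE a1 mul1r.
have N1le : N1 <= r + E `^ p^-1.
  rewrite N1E; apply: le_trans (lpR_triangle p1 _ _) _; apply: (lerD gr).
  by rewrite (lpR_row_le x10 erefl) x12.
set F := E `^ p^-1 in N1le; have F0 : 0 <= F by exact: powR_ge0.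
have FE : F `^ p = E by rewrite /F powRVK.
apply: (@convex_gain N1 N2' d r (8 `^ p * E) e e01 (lpR_ge0 _ _) (lpR_ge0 _ _) d0 dr); last first.
  have bx0 j : 0 <= 20 * x2 j := mulr_ge0 (ler0n _ _) (x0 j).
  have bx j : x2 j <= 20 * x2 j by apply: (ler_peMl (x0 j)); rewrite ler1n.
  have bxg j : 20 * x2 j = 0 \/ `|g1 0 j| <= 20 * x2 j / 100.
    case: (xg j) => [->|H]; [by left; rewrite mulr0|right].
    by apply: (le_trans H); rewrite ler_pM2r ?invr_gt0 ?ltr0n.
  have H := lpsum_gain0 bx0 bxg; have H' := lpsum_upper x10 x1g.
  rewrite -(lpRX p1 (g1 + _)) x12 in H'; rewrite -(lpRX p1 (g1 + _)) in H.
  have HE : 2^-1 `^ p * (\sum_j (20 * x2 j) `^ p) = 10 `^ p * E.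
    exact: half_twenty.
  rewrite HE in H; rewrite -/E in H'.
  by rewrite N1E /N2' b20; exact: (block_slack (pow_8_2_10 E0) H' H).
have N10 : 0 <= N1 by exact: lpR_ge0.
rewrite -FE; rewrite -FE in big; exact: (block_root e01 r0 N10 F0 N1le big).
Qed.

End BlockNorm.

Lemma lp_radius_tail (R : realType) (n Q s M X : nat) (p rad : R) : (0 < s)%N -> (1 < Q)%N ->
  (M <= X)%N -> (X + M < Q)%N -> (0 < n)%N -> 2 < p -> 100 * p * n%:R `^ p^-1 <= rad ->
  \sum_(g | s%:R * rad < lpR p (map_mx intr (@lift n Q X g))) @noise R n Q s M X g <= 1 / 2500.
Proof.
move=> sp qp mx xm n0 p2 radp.
have p1 : 1 <= p by apply/ltW/(lt_trans _ p2); rewrite ltr1n.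
have p0 : 0 < p by apply: lt_le_trans p1.
have nR : 0 < (n%:R : R) by rewrite ltr0n.
have sR : 0 < (s%:R : R) by rewrite ltr0n.
have rn0 : 0 < (n%:R : R) `^ p^-1 by rewrite powR_gt0.
have a1 : 0 <= 100 * p := mulr_ge0 (ler0n _ 100) (ltW p0).
have rad0 : 0 < rad by apply: lt_le_trans radp; rewrite !mulr_gt0.
have Lam0 : 0 < rad `^ p by rewrite powR_gt0.
apply: (@le_trans _ _ (n%:R * (4 * p `^ p) / rad `^ p)); last first.
  have : (100 * p) `^ p * n%:R <= rad `^ p.
    rewrite -[X in _ * X](powRVK p1 (ltW nR)) -(powRM _ a1 (ltW rn0)).
    by apply: (ge0_ler_powR (ltW p0)); rewrite ?nnegrE ?(mulr_ge0 a1 (ltW rn0)) ?(ltW rad0).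
  rewrite powRM ?(ltW p0)// => H.
  have p100 : 100 ^+ 2 <= 100 `^ p :> R.
    by rewrite -powR_mulrn// ler_powR ?ler1n// ltW.
  rewrite ler_pdivrMr//; have pp : 0 < p `^ p by rewrite powR_gt0.
  have : 100 ^+ 2 * (p `^ p * n%:R) <= rad `^ p.
    by apply: le_trans H; rewrite -mulrA ler_wpM2r ?mulr_ge0 ?(ltW pp).
  have -> : n%:R * (4 * p `^ p) = 4 * (p `^ p * n%:R) by ring.
  exact: coord_variance_le.
apply: le_trans (@noise_lp_tail R n Q s M X sp qp mx xm p (rad `^ p) p0 Lam0).
apply: (@noise_sub R n Q s M X sp qp mx xm) => g H.
have H' : rad < s%:R^-1 * lpR p (map_mx intr (lift X g)) by rewrite ltr_pdivlMl.
have -> : \sum_i (`|(lift X g 0 i)%:~R| / s%:R) `^ p = (s%:R^-1 * lpR p (map_mx intr (lift X g))) `^ p.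
  rewrite powRM ?lpR_ge0 ?invr_ge0 ?(ltW sR)// lpRX// mulr_sumr; apply: eq_bigr => i _.
  rewrite [(map_mx _ _) 0 i]mxE; move: `|_| (normr_ge0 ((lift X g 0 i)%:~R : R)) => z z0.
  by rewrite mulrC powRM// invr_ge0 ltW.
by rewrite gt0_ltr_powR// nnegrE ?mulr_ge0 ?invr_ge0 ?(ltW sR) ?lpR_ge0 ?(ltW rad0).
Qed.

Lemma norm2_sum_le (R : realType) (n : nat) (I : finType) (x : I -> 'rV[R]_n) (b : R) :
  (forall i, norm2 (x i) <= b) -> norm2 (\sum_i x i) <= #|I|%:R ^+ 2 * b.
Proof.
move=> xb; rewrite /norm2 dotv_suml.
apply: (@le_trans _ _ (\sum_(i : I) \sum_(j : I) b)).
  apply: ler_sum => i _; rewrite dotvC dotv_suml; apply: ler_sum => j _.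
  have := dotv_le (x j) (x i) (@ltr01 R); rewrite invr1 !mul1r.
  by have := xb i; have := xb j; lra.
rewrite sumr_const sumr_const -mulrnA -[_ *+ _]mulr_natl natrM expr2; apply: eq_ler.
by rewrite !cardE.
Qed.

Lemma calm_radius_shift (R : realType) (r m l : R) : 0 <= m -> m <= 20 -> 0 <= l -> l <= r / 20 ->
  1 * r + m * l <= 2 * r.
Proof. move=> m0 m20 l0 lr; have : m * l <= 20 * (r / 20) by apply: ler_pM. lra. Qed.

Lemma calm_coord_shift (R : realType) (t m l : R) : 0 <= m -> m <= 20 -> 0 <= l -> l <= t / (50 * 100) ->
  1 * t / 200 + m * l <= 2 * t / 200.
Proof.
move=> m0 m20 l0 lt; have : m * l <= 20 * (t / (50 * 100)) by apply: ler_pM.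
have : 0 <= t by lra.
lra.
Qed.

Lemma lpRZ (R : realType) (p : R) (n : nat) (a : R) (x : 'rV[R]_n) : 1 <= p -> 0 <= a ->
  lpR p (a *: x) = a * lpR p x.
Proof.
move=> p1 a0; rewrite !lpRE; have -> : lpsum p (a *: x) = a `^ p * lpsum p x.
  by rewrite /lpsum mulr_sumr; apply: eq_bigr => i _; rewrite mxE normrM ger0_norm// powRM.
by rewrite powRM ?powR_ge0 ?lpsum_ge0// powRK.
Qed.

Lemma lpR_le_of_norm2 (R : realType) (p : R) (n : nat) (b : R) (x : 'rV[R]_n) : 2 <= p -> 0 <= b ->
  norm2 x <= b ^+ 2 -> lpR p x <= b.
Proof.
move=> p2 b0 xb; have p1 : 1 <= p by apply: le_trans p2; rewrite ler1n.
apply: le_trans (lpR_le_norm2 p1 _ p2) _.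
by rewrite -(ger0_norm b0) -sqrtr_sqr ler_sqrt ?sqr_ge0.
Qed.

Lemma multiple_norm2_le (R : realType) (m x b : R) : 0 <= m -> m <= 20 -> 0 <= x -> x <= (b / 20) ^+ 2 ->
  2 * (m ^+ 2 * x) <= 2 * b ^+ 2.
Proof.
move=> m0 m20 x0 xb; rewrite ler_pM2l//; apply: (@le_trans _ _ (20 ^+ 2 * (b / 20) ^+ 2)).
  by apply: ler_pM; rewrite ?sqr_ge0// lerXn2r// nnegrE.
by apply: eq_ler; field.
Qed.

(** The rounding errors [e1], [e2] are so small that AM-GM with weight [q] on them still leaves the
    factor 1 / q on [A]. *)
Lemma cross_terms_le (R : realType) (q a b d e1 e2 f1 f2 A : R) : 0 <= q ->
  2 * a <= q * e1 + q^-1 * f2 -> 2 * b <= q * e2 + q^-1 * f1 -> 2 * d <= e1 + e2 ->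
  e1 <= (q ^+ 3)^-1 -> e2 <= (q ^+ 3)^-1 -> f1 <= A -> f2 <= A -> 1 <= q ->
  a + b + d <= A / q + 2 / q ^+ 2.
Proof.
move=> q0 ha hb hd he1 he2 hf1 hf2 q1; have qp : 0 < q by apply: lt_le_trans q1.
have qe1 : q * e1 <= (q ^+ 2)^-1.
  apply: le_trans (ler_wpM2l q0 he1) _; apply: eq_ler; field; exact: lt0r_neq0.
have qe2 : q * e2 <= (q ^+ 2)^-1.
  apply: le_trans (ler_wpM2l q0 he2) _; apply: eq_ler; field; exact: lt0r_neq0.
have q32 : (q ^+ 3)^-1 <= (q ^+ 2)^-1.
  by rewrite lef_pV2 ?posrE ?exprn_gt0// ler_weXn2l.
have qi : 0 <= q^-1 by rewrite invr_ge0.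
have qf1 := ler_wpM2l qi hf1; have qf2 := ler_wpM2l qi hf2.
rewrite [A / q]mulrC; move: (q * e1) (q * e2) (q^-1 * f1) (q^-1 * f2) (q^-1 * A) qe1 qe2 qf1 qf2 ha hb.
move: (q ^- 2) (q ^- 3) q32 he1 he2 => x y xy he1 he2 u1 u2 v1 v2 v hu1 hu2 hv1 hv2 h1 h2.
lra.
Qed.

Lemma dense_moment_le_max (R : realType) (t : R) (m : nat) : 0 < t -> (1 <= m)%N ->
  (ln (1 / t) < 8 -> m = 1%N) -> (8 <= ln (1 / t) -> 4 * m%:R <= ln (1 / t)) ->
  expR (1 / 1000 + m%:R * (2 / 1000)) <= max_moment t.
Proof.
move=> t0 m1 mA mB; rewrite /max_moment; case: ltP => [/mA ->|m8].
  have -> : 1 / 1000 + 1%:R * (2 / 1000) = 3 / 1000 :> R by lra.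
  have := @expR_ge1Dx R (- (3 / 1000)); rewrite expRN; move: (expR_gt0 (3 / 1000 : R)).
  move: (expR _) => z z0 H2; have := ler_wpM2r (ltW z0) H2; rewrite mulVf ?gt_eqF//; lra.
have -> : t `^ (- (1 / 2)) = expR (ln (1 / t) / 2).
  by rewrite /powR gt_eqF// [1 / t]div1r lnV ?posrE//; congr expR; field.
have := mB m8; rewrite ler_expR; move: (ln _) m8 => l l8; have := ler0n R m.
by move: (m%:R) => x; lra.
Qed.

(** [x] counts the words over the [g] light letters that are not spread. As mi y <= n / 2 <= g, (g +
    y)^mi is at most e g^mi, and the Chernoff factor [K] beats the remaining 3 n by the factor
    [u]. *)
Lemma spread_count_ge (R : realType) (u x g y n K : R) (mi : nat) : 2 <= u -> 0 < n -> 0 <= y ->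
  x * K <= g * (g + y) ^+ mi -> mi%:R * y <= n / 2 -> (1 - u^-1) * n <= g -> g <= n ->
  3 * u * n <= K -> (1 - u^-1) ^+ mi.+1 * n ^+ mi <= g ^+ mi - x.
Proof.
move=> u2 n0 y0 xK yn gn gle nK.
have u0 : 0 < u by lra.
have ui : u^-1 <= 1 / 2 by rewrite div1r lef_pV2 ?posrE.
have g2 : n / 2 <= g by nra.
have g0 : 0 < g by lra.
have E1 : (g + y) ^+ mi <= 3 * g ^+ mi.
  have -> : g + y = g * (1 + y / g) by field; rewrite gt_eqF.
  rewrite exprMn mulrC; apply: ler_wpM2r; first by rewrite exprn_ge0// ltW.
  apply: (@le_trans _ _ (expR (y / g) ^+ mi)).
    by apply: lerXn2r; rewrite ?nnegrE ?expR_ge0 ?expR_ge1Dx// addr_ge0// divr_ge0// ltW.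
  rewrite -expRM_natl; apply: (@le_trans _ _ (expR 1)).
    by rewrite ler_expR mulrA ler_pdivrMr// mul1r; lra.
  have -> : 1 = 8%:R * (1 / 8) :> R by lra.
  rewrite expRM_natl; have := expR_ge1Dx (- (1 / 8) : R); rewrite expRN => H.
  have h8 : expR (1 / 8) <= 8 / 7 :> R.
    by rewrite -[leRHS]invrK -[leLHS]invrK lef_pV2 ?posrE ?invr_gt0 ?expR_gt0//; lra.
  by apply: (le_trans (lerXn2r 8 _ _ h8)); rewrite ?nnegrE ?expR_ge0//; lra.
have gm0 : 0 < g ^+ mi by rewrite exprn_gt0.
have K0 : 0 < K by apply: lt_le_trans nK; rewrite !mulr_gt0.
have E2 : x <= g ^+ mi / u.
  rewrite -(ler_pM2r K0); apply: (le_trans xK).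
  apply: (@le_trans _ _ (n * (3 * g ^+ mi))); first exact: (ler_pM (ltW g0) (exprn_ge0 _ (addr_ge0 (ltW g0) y0)) gle E1).
  have -> : n * (3 * g ^+ mi) = g ^+ mi / u * (3 * u * n) by field; rewrite gt_eqF.
  exact: (ler_wpM2l (divr_ge0 (ltW gm0) (ltW u0)) nK).
have E3 : ((1 - u^-1) * n) ^+ mi <= g ^+ mi.
  by apply: lerXn2r; rewrite ?nnegrE ?(ltW g0)// mulr_ge0 ?(ltW n0)//; lra.
rewrite exprS -mulrA -exprMn; move: E2 E3; move: (_ ^+ mi) (_ ^+ mi) => a b E2 E3.
have a1 : 0 <= 1 - u^-1 :> R by lra.
by apply: (le_trans (ler_wpM2l a1 E3)); rewrite mulrBl mul1r mulrC; lra.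
Qed.

(** For small delta the claim reduces to (mi + 1) / 6 <= ln (1 / delta) / 12, which follows from 2
    (mi + 1) <= 4 mi. *)
Lemma min_good_exp (R : realType) (delta : R) (mi : nat) : 0 < delta -> (1 <= mi)%N ->
  (ln (1 / delta) < 8 -> mi = 1%N) -> (8 <= ln (1 / delta) -> 4 * mi%:R <= ln (1 / delta)) ->
  min_good delta <= (1 - 2000%:R^-1) ^+ mi.+1.
Proof.
move=> d0 mi1 mA mB; rewrite /min_good; case: ifP => [/mA ->|/negbT]; first by rewrite expr2; lra.
rewrite -leNgt => /mB m4.
have dE : delta `^ (1 / 12) = expR (- (ln (1 / delta) / 12)).
  rewrite /powR gt_eqF// [1 / delta]div1r lnV ?posrE//; congr expR; lra.
have a1 : expR (- (1 / 6)) <= 1 - 2000%:R^-1 :> R.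
  have := expR_ge1Dx (1 / 6 : R); rewrite expRN => H.
  apply: (@le_trans _ _ (6 / 7)); last by lra.
  by rewrite -[leRHS]invrK lef_pV2 ?posrE ?invr_gt0 ?expR_gt0//; lra.
rewrite dE; apply: (@le_trans _ _ (expR (- (1 / 6)) ^+ mi.+1)); last first.
  exact: (lerXn2r _ (expR_ge0 _) (le_trans (expR_ge0 _) a1) a1).
rewrite -expRM_natl ler_expR -[mi.+1%:R]natr1; have : 1 <= mi%:R :> R by rewrite ler1n.
by lra.
Qed.

(** * The test with a random word of equal spikes *)

Section DenseTest.
Variables (R : realType) (n L q : nat) (p eps delta : R).
Hypotheses (n0 : (0 < n)%N) (nq : (n <= q)%N) (q400 : (400 <= q)%N) (qL : (q ^ 5 <= L)%N).
Hypotheses (eps01 : 0 < eps < 1) (delta0 : 0 < delta) (delta2 : delta < 1 / 2) (p2 : 2 < p).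
Variables (mi N0 dg : nat) (cC rho kc : R).

Local Notation s := (L ^ 4)%N.
Local Notation Q := (L ^ 17)%N.
Local Notation X := (L ^ 8)%N.
Local Notation M := (L ^ 4 * q ^ 2)%N.
Local Notation G := 'rV['Z_Q]_n.
Local Notation D := (@noise R n Q s M X).
Local Notation lft := (@lift n Q X).
Local Notation K := (num_mults delta).
Local Notation vR := (map_mx intr : 'rV[int]_n -> 'rV[R]_n).
Local Notation word := {ffun 'I_mi -> 'I_n}.
Local Notation t := (s%:R * N0%:R : R).
(** [hm] bounds the diagonal entries of [H] at light coordinates, [A2] the squared scaled
    displacement of a word, [pmax] a coupling, and [dmax] the number of coordinates coupled to a
    given one. The factor 400 is the square of the largest multiple. *)
Local Notation hm := (2000%:R * rho / n%:R).
Local Notation r0 := (s%:R * (cC * n%:R `^ p^-1) : R).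
Local Notation A2 := (N0%:R ^+ 2 * (mi%:R ^+ 2 * hm) : R).
Local Notation pmax := (400 * N0%:R ^+ 2 * hm : R).
Local Notation dmax := ((400 * N0%:R ^+ 2 * (1000 * mi%:R)) ^+ 2 * hm : R).

Hypothesis cCp : 100 * p <= cC.
Hypotheses (mi1 : (1 <= mi)%N) (miA : ln (1 / delta) < 8 -> mi = 1%N).
Hypothesis miB : 8 <= ln (1 / delta) -> 4 * mi%:R <= ln (1 / delta).
Hypotheses (N0q : (N0 <= q)%N) (N01 : (0 < N0)%N) (miq : (mi <= q)%N) (rho0 : 0 < rho).
Hypothesis tailN : n%:R * (4 * expR (- (N0%:R / 200))) <= 1 / 2500 :> R.
Hypothesis HE : eps * (10 * (2 * (cC * n%:R `^ p^-1))) `^ p < mi%:R * N0%:R `^ p.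
Hypothesis Hw : 2 * A2 + 2 * q%:R^-1 <= (eps * (cC * n%:R `^ p^-1) / 20) ^+ 2.
Hypothesis HwN : 2 * A2 + 2 * q%:R^-1 <= (N0%:R / (50 * 100)) ^+ 2.
Hypothesis Herr : 400 * (A2 / q%:R + 2 / q%:R ^+ 2) <= 1 / 1000.
Hypotheses (kc1 : 1 <= kc) (Hdeg1 : mi%:R * (kc * dmax) <= n%:R / 2).
Hypothesis Hkc : 3 * 2000%:R * n%:R <= kc ^+ dg.+1.
Hypothesis Hdeg2 : mi%:R * dmax * expR (dg%:R * pmax) <= n%:R / 1000.

Let p1 : 1 <= p. Proof. by apply/ltW/(lt_trans _ p2); rewrite ltr1n. Qed.
Let p0 : 0 < p. Proof. exact: lt_le_trans p1. Qed.
Let nR : 0 < (n%:R : R). Proof. by rewrite ltr0n. Qed.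
Let sR : 0 < (s%:R : R). Proof. by rewrite ltr0n (s_gt0 q400 qL). Qed.
Let qR : 0 < (q%:R : R). Proof. by rewrite ltr0n (q_gt0 q400). Qed.
Let NR : 0 < (N0%:R : R). Proof. by rewrite ltr0n. Qed.
Let miR : 0 < (mi%:R : R). Proof. by rewrite ltr0n. Qed.
Let tp : 0 < t. Proof. exact: (mulr_gt0 sR NR). Qed.
Let hm0 : 0 <= hm :> R. Proof. exact: (divr_ge0 (mulr_ge0 (ler0n _ _) (ltW rho0)) (ler0n _ _)). Qed.
Let rn0 : 0 < (n%:R : R) `^ p^-1. Proof. by rewrite powR_gt0. Qed.
Let cC0 : 0 < cC. Proof. by apply: lt_le_trans cCp; rewrite mulr_gt0. Qed.
Let r00 : 0 < r0. Proof. by rewrite mulr_gt0// mulr_gt0. Qed.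

Definition dense_step (_ : unit) (f : word) : 'rV[int]_n := \sum_l (s * N0)%N%:Z *: 'e_(f l).

Definition occ (f : word) (j : 'I_n) : nat := #|[pred l | f l == j]|.

Lemma dense_entry u f j : dense_step u f 0 j = (s * N0 * occ f j)%N%:Z.
Proof.
rewrite /dense_step summxE (eq_bigr (fun l => if f l == j then (s * N0)%N%:Z else 0)); last first.
  by move=> l _; rewrite !mxE eqxx /= eq_sym; case: eqP => _; rewrite ?mulr1 ?mulr0.
by rewrite -big_mkcond /= sumr_const -[(s * N0 * _)%N%:Z]natz natrM mulr_natr natz.
Qed.

Lemma occ_le f j : (occ f j <= mi)%N.
Proof. by rewrite /occ -[X in (_ <= X)%N]card_ord max_card. Qed.

Lemma dense_point u f m (g : 'rV[int]_n) :
  vR (0 + dense_step u f *+ m + g) = vR g + \row_j (m%:R * (t * (occ f j)%:R)).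
Proof.
apply/rowP => j; rewrite add0r addrC mxE [(g + _) 0 j]mxE mulmxnE dense_entry intrD intrM_nat.
rewrite [in RHS]mxE [vR g 0 j]mxE [(\row_j _) 0 j]mxE; congr (_ + _ * _).
by rewrite -[LHS]/((s * N0 * occ f j)%N%:R : R) !natrM.
Qed.

Lemma dense_scaled u f : scaled R L (dense_step u f) = \sum_l N0%:R *: 'e_(f l).
Proof.
rewrite /scaled /dense_step map_mx_sum scaler_sumr; apply: eq_bigr => l _.
by rewrite map_intr_delta scalerA natrM mulrA mulVf ?mul1r// gt_eqF.
Qed.

Definition calm (a : R) (g : 'rV[int]_n) : bool :=
  (lpR p (vR g) <= a * r0) && [forall j, `|(g 0 j)%:~R| <= a * t / 200].

Lemma calm_tail : \sum_(g | ~~ calm 1 (lft g)) D g <= 1 / 1000.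
Proof.
have [[[sp qp] mx] xm] := (s_gt0 q400 qL, Q_gt1 q400 qL, M_leX q400 qL, XM_Q q400 qL).
have rad : 100 * p * n%:R `^ p^-1 <= cC * n%:R `^ p^-1 by rewrite ler_pM2r.
have T1 := lp_radius_tail sp qp mx xm n0 p2 rad.
have T2 := @noise_coords_tail R n Q s M X sp qp mx xm (t / 200).
have E2 : t / 200 / s%:R = N0%:R / 200 :> R by rewrite mulrAC [t / _]mulrAC mulfV ?mul1r// gt_eqF.
rewrite E2 in T2; apply: le_trans (two_tails_le T1 (le_trans T2 tailN)).
apply: le_trans (@noise_orb R n Q s M X sp qp mx xm _ _).
apply: (@noise_sub R n Q s M X sp qp mx xm) => g.
rewrite negb_and -ltNge mul1r negb_forall /= => /orP[H|/existsP[j H]]; apply/orP; [by left|right].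
by apply/existsP; exists j; rewrite ltNge; rewrite mul1r in H.
Qed.

Lemma calm_shift (g w : 'rV[int]_n) (m : nat) : (m <= 20)%N ->
  norm2 (vR w) <= (eps * r0 / 20) ^+ 2 -> norm2 (vR w) <= (t / (50 * 100)) ^+ 2 ->
  calm 1 g -> calm 2 (g - w *+ m).
Proof.
move=> m20 w1 w2 /andP[g1 /forallP g2]; have /andP[e0 e1] := eps01.
have mR : (m%:R : R) <= 20 by rewrite ler_nat.
have er0 : 0 <= eps * r0 / 20 := divr_ge0 (mulr_ge0 (ltW e0) (ltW r00)) (ler0n _ 20).
have t50 : 0 <= t / (50 * 100) := divr_ge0 (ltW tp) (mulr_ge0 (ler0n _ 50) (ler0n _ 100)).
have wl : lpR p (vR w) <= r0 / 20.
  apply: le_trans (lpR_le_of_norm2 (ltW p2) er0 w1) _.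
  by rewrite ler_wpM2r ?invr_ge0 ?ler0n// ler_piMl ?(ltW r00)// ltW.
apply/andP; split.
  have -> : vR (g - w *+ m) = vR g + - (m%:R *: vR w) by rewrite map_mxB map_intrMn.
  apply: le_trans (lpR_triangle p1 _ _) _; rewrite lpRN (lpRZ _ p1 (ler0n _ _)).
  apply: le_trans (lerD g1 (lexx _)) _.
  exact: (calm_radius_shift (ler0n _ _) mR (lpR_ge0 _ _) wl).
apply/forallP => j; have wj := norm2_coord_le j t50 w2; rewrite mxE in wj.
rewrite mxE [(- (w *+ m)) 0 j]mxE mulmxnE intrB intrM_nat.
apply: le_trans (ler_normB _ _) _; rewrite normrM (ger0_norm (ler0n _ m)).
apply: le_trans (lerD (g2 j) (lexx _)) _.
exact: (calm_coord_shift (ler0n _ _) mR (normr_ge0 _) wj).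
Qed.

Lemma sum_occ f : \sum_j (occ f j)%:R = mi%:R :> R.
Proof.
rewrite -natr_sum -[in RHS](card_ord mi) -sum1_card (partition_big f xpredT)//=.
by congr (_%:R); apply: eq_bigr => j _; rewrite sum1_card.
Qed.

(** Coinciding letters only add energy, since k^p >= k for integers k. *)
Lemma dense_energy f : t `^ p * mi%:R <= \sum_j (t * (occ f j)%:R) `^ p.
Proof.
rewrite -(sum_occ f) mulr_sumr; apply: ler_sum => j _.
rewrite (powRM _ (ltW tp) (ler0n _ _)); apply: ler_wpM2l; first exact: powR_ge0.
case: (occ f j) => [|k]; first by rewrite powR_ge0.
by rewrite -[leLHS]powRr1 ?ler0n// ler_powR// ler1n.
Qed.

Lemma dense_energy1 f : mi = 1%N -> \sum_j (t * (occ f j)%:R) `^ p = t `^ p * mi%:R.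
Proof.
move=> m1; rewrite -(sum_occ f) mulr_sumr; apply: eq_bigr => j _.
rewrite (powRM _ (ltW tp) (ler0n _ _)); congr (_ * _).
have := occ_le f j; rewrite m1; case: (occ f j) => [|[|k]]// _.
  by rewrite powR0// gt_eqF.
by rewrite powR1.
Qed.

Lemma dense_sep (k1 k2 : 'I_K) f1 f2 (w1 w2 g1 g2 : 'rV[int]_n) : (k1 < k2)%N ->
  norm2 (vR w1) <= (eps * r0 / 20) ^+ 2 -> norm2 (vR w2) <= (eps * r0 / 20) ^+ 2 ->
  calm 2 g1 -> calm 2 g2 -> g1 - w1 *+ mults k1 = g2 - w2 *+ mults k2 ->
  (1 + eps) ^+ 2 * lp_norm p (0 + dense_step tt f1 *+ mults k1 + g1) <
  lp_norm p (0 + dense_step tt f2 *+ mults k2 + g2).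
Proof.
move=> k12 wb1 wb2 /andP[c1 /forallP c1'] _ gE; have /andP[e0 e1] := eps01.
rewrite !lp_normE !dense_point.
have x0 f j : 0 <= t * (occ f j)%:R := mulr_ge0 (ltW tp) (ler0n _ _).
have xg f j : t * (occ f j)%:R = 0 \/ `|(vR g1) 0 j| <= t * (occ f j)%:R / 100.
  case: (posnP (occ f j)) => [->|o]; [by left; rewrite mulr0|right].
  rewrite mxE; apply: le_trans (c1' j) _; apply: (@le_trans _ _ (t * 1 / 100)).
    by rewrite mulr1; apply: eq_ler; field.
  by rewrite ler_wpM2r ?invr_ge0 ?ler0n// ler_wpM2l ?(ltW tp)// ler1n.
apply: (@block_sep R p n (ltW p2) (mults k1) (mults k2) (vR g1) (vR g2) (fun j => t * (occ f1 j)%:R)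
  (fun j => t * (occ f2 j)%:R) eps (2 * r0) (eps * (2 * r0))) => //.
- have kk : (k2 < 3)%N by rewrite (leq_trans (ltn_ord k2))// /num_mults; case: ifP.
  have mm : (k2 = 2 :> nat)%N -> mi = 1%N.
    by move=> k22; apply: miA; have := ltn_ord k2; rewrite k22 /num_mults; case: ifP.
  move: k12 kk mm; rewrite /mults; case: (val k1) (val k2) => [|[|[|?]]] [|[|[|?]]]//= _ _ mm.
  + by left.
  + by left.
  + by right; split => //; rewrite !dense_energy1// mm.
- exact: (mulr_ge0 (ltW e0) (mulr_ge0 (ler0n _ 2) (ltW r00))).
- have -> : vR g2 - vR g1 = (mults k2)%:R *: vR w2 - (mults k1)%:R *: vR w1.
    have -> : g2 = g1 - w1 *+ mults k1 + w2 *+ mults k2 by rewrite gE subrK.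
    rewrite map_mxD map_mxB !map_intrMn.
    move: (vR g1) (_ *: vR w1) (_ *: vR w2) => u v1 v2.
    by rewrite addrAC [u - v1 - u]addrAC subrr add0r addrC.
  apply: le_trans (norm2D_le _ _) _; rewrite norm2N !norm2Z.
  have m20 (k : 'I_K) : (mults k)%:R <= 20 :> R by rewrite ler_nat mults_le.
  have := multiple_norm2_le (ler0n _ (mults k2)) (m20 k2) (norm2_ge0 _) wb2.
  have := multiple_norm2_le (ler0n _ (mults k1)) (m20 k1) (norm2_ge0 _) wb1.
  move=> h1 h2; apply: le_trans (lerD h2 h1) _; apply: eq_ler; by field.
apply: lt_le_trans (dense_energy f2).
have -> : 10 * (2 * r0) = s%:R * (10 * (2 * (cC * n%:R `^ p^-1))) by ring.
have c0 : 0 <= 10 * (2 * (cC * n%:R `^ p^-1)) := mulr_ge0 (ler0n _ 10) (mulr_ge0 (ler0n _ 2) (mulr_ge0 (ltW cC0) (ltW rn0))).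
rewrite (powRM _ (ltW sR) c0) (powRM _ (ltW sR) (ltW NR)) mulrCA -mulrA.
by rewrite ltr_pM2l ?powR_gt0// [ltRHS]mulrC.
Qed.

Section Kernel.
Variables (H Sg : 'M[R]_n) (w : unit -> word -> 'rV[int]_n).
Hypotheses (rl : ridge_like H Sg) (trH : \tr H <= rho).
Hypothesis werr : forall u f,
  norm2 (scaled R L (w u f) + scaled R L (dense_step u f) *m H) <= (q%:R ^+ 3)^-1.

Definition light : pred 'I_n := [pred j | H j j <= hm].
(** The entries of the square of [H]: inner products of the displacements caused by single
    spikes. *)
Definition corr (i j : 'I_n) : R := dotv (row i H) (row j H).
Definition coupling (i j : 'I_n) : R := 400 * N0%:R ^+ 2 * `|corr i j|.
Definition good_word (f : word) : bool :=
  spread light coupling (1 / (1000 * mi%:R)) dg f.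

Let piv := rl_piv rl.
Let psd := rl_psd rl.
Let c400 : 0 < 400 * N0%:R ^+ 2 :> R.
Proof. by apply: mulr_gt0; [rewrite ltr0n|rewrite exprn_gt0]. Qed.

Lemma coupling_sym i j : coupling i j = coupling j i.
Proof. by rewrite /coupling /corr dotvC. Qed.

Lemma light_row i : light i -> norm2 (row i H) <= hm.
Proof. move=> li; exact: (le_trans (pivotal_row_norm2 psd i piv) li). Qed.

Lemma coupling_max i j : light i -> light j -> coupling i j <= pmax.
Proof.
move=> li lj; rewrite /coupling ler_pM2l//.
rewrite -(ger0_norm hm0) -ler_sqr ?nnegrE// !real_normK ?num_real//.
apply: le_trans (dotv_sqr_le _ _) _; rewrite expr2.
by apply: ler_pM; rewrite ?norm2_ge0// light_row.
Qed.

(** The sum is the squared norm of row i of H^2, and [H] is a contraction, so it is at most that of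
    row i of [H]. *)
Lemma corr_sqr_sum i : light i -> \sum_j corr i j ^+ 2 <= hm.
Proof.
move=> li; have -> : \sum_j corr i j ^+ 2 = norm2 (row i H *m H).
  rewrite /norm2 /dotv; apply: eq_bigr => j _; rewrite -expr2; congr (_ ^+ 2).
  rewrite mxE /corr /dotv; apply: eq_bigr => k _; congr (_ * _).
  by have [Hs _] := piv; rewrite mxE -[in RHS]Hs mxE.
apply: le_trans (light_row li).
by apply: le_trans (pivotal_norm2_le psd _ piv) _; exact: (pivotal_le psd _ piv).
Qed.

Lemma coupling_degree i : light i -> #|[pred j | 1 / (1000 * mi%:R) < coupling i j]|%:R <= dmax.
Proof.
move=> li; set c := 400 * N0%:R ^+ 2; set th := 1 / _.
have m0 : 0 < 1000 * mi%:R :> R by apply: mulr_gt0; [rewrite ltr0n|exact: miR].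
have th0 : 0 < th by exact: (divr_gt0 ltr01 m0).
have : #|[pred j | th < coupling i j]|%:R * th ^+ 2 <= c ^+ 2 * hm.
  apply: (@le_trans _ _ (\sum_j coupling i j ^+ 2)); last first.
    have -> : \sum_j coupling i j ^+ 2 = c ^+ 2 * \sum_j corr i j ^+ 2.
      rewrite mulr_sumr; apply: eq_bigr => j _.
      by rewrite /coupling exprMn real_normK// num_real.
    by rewrite ler_wpM2l ?sqr_ge0// corr_sqr_sum.
  rewrite mulr_natl -sumr_const big_mkcond; apply: ler_sum => j _; rewrite inE.
  case: ifP => [H1|_]; last exact: sqr_ge0.
  by rewrite ler_sqr ?nnegrE ?(ltW th0)// ltW// (le_lt_trans _ H1)// ltW.
move=> H1; have -> : (c * (1000 * mi%:R)) ^+ 2 * hm = c ^+ 2 * hm / th ^+ 2.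
  by rewrite /th; move: (1000 * mi%:R) => u; rewrite div1r exprVn invrK exprMn mulrAC.
by rewrite ler_pdivlMr ?exprn_gt0.
Qed.

Let am (f : word) : 'rV[R]_n := \sum_l N0%:R *: row (f l) H.

Lemma scaled_step_mul u f : scaled R L (dense_step u f) *m H = am f.
Proof.
rewrite dense_scaled mulmx_suml; apply: eq_bigr => l _.
by rewrite -scalemxAl rowE.
Qed.

Lemma am_norm2 f : good_word f -> norm2 (am f) <= A2.
Proof.
case/andP => /forallP gf _.
have b l : norm2 (N0%:R *: row (f l) H) <= N0%:R ^+ 2 * hm.
  by rewrite norm2Z ler_wpM2l ?sqr_ge0//; apply: light_row.
apply: le_trans (norm2_sum_le b) _; rewrite card_ord.
by apply: eq_ler; rewrite mulrCA.
Qed.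

Let er u f : 'rV[R]_n := scaled R L (w u f) + am f.

Let er_norm2 u f : norm2 (er u f) <= (q%:R ^+ 3)^-1.
Proof. by rewrite /er -(scaled_step_mul u); exact: werr. Qed.

Let wE u f : scaled R L (w u f) = er u f - am f.
Proof. by rewrite /er addrK. Qed.

Let q3 : (q%:R ^+ 3)^-1 <= q%:R^-1 :> R.
Proof.
by rewrite lef_pV2 ?posrE ?exprn_gt0// -[leLHS]expr1 ler_weXn2l// ler1n (q_gt0 q400).
Qed.

Lemma dense_w_small u f : good_word f ->
  norm2 (vR (w u f)) <= (eps * r0 / 20) ^+ 2 /\ norm2 (vR (w u f)) <= (t / (50 * 100)) ^+ 2.
Proof.
move=> gf; have xle : norm2 (scaled R L (w u f)) <= 2 * A2 + 2 * q%:R^-1.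
  rewrite wE; apply: le_trans (norm2D_le _ _) _; rewrite norm2N addrC; apply: lerD.
    by rewrite ler_pM2l// am_norm2.
  by rewrite ler_pM2l// (le_trans (er_norm2 u f)).
have xE : norm2 (vR (w u f)) = s%:R ^+ 2 * norm2 (scaled R L (w u f)).
  by rewrite /scaled norm2Z mulrA -exprMn mulfV ?gt_eqF// expr1n mul1r.
rewrite xE; have s2 : 0 < s%:R ^+ 2 :> R by rewrite exprn_gt0.
split.
  apply: (@le_trans _ _ (s%:R ^+ 2 * (eps * (cC * n%:R `^ p^-1) / 20) ^+ 2)).
    by rewrite ler_pM2l// (le_trans xle).
  by apply: eq_ler; rewrite -exprMn; congr (_ ^+ 2); ring.
apply: (@le_trans _ _ (s%:R ^+ 2 * (N0%:R / (50 * 100)) ^+ 2)).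
  by rewrite ler_pM2l// (le_trans xle).
by apply: eq_ler; rewrite -exprMn; congr (_ ^+ 2); ring.
Qed.

Lemma am_dot f1 f2 : dotv (am f1) (am f2) = N0%:R ^+ 2 * \sum_l \sum_l' corr (f1 l) (f2 l').
Proof.
rewrite /am dotv_suml mulr_sumr; apply: eq_bigr => l _.
rewrite dotvZl dotvC dotv_suml mulr_sumr mulr_sumr; apply: eq_bigr => l' _.
by rewrite dotvZl dotvC mulrA -expr2.
Qed.

(** The scaled displacement is [er - am]. The product of the [am] parts gives the couplings; the
    terms with an error [er] are negligible because the squared errors are below q^-3 while [A2] is
    much smaller than [q]. *)
Lemma dense_dot_le (c : R) f1 f2 : 0 <= c -> c <= 20 -> good_word f1 -> good_word f2 ->
  c ^+ 2 * dotv (vR (w tt f1)) (vR (w tt f2)) / s%:R ^+ 2 <=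
  \sum_l \sum_l' coupling (f1 l) (f2 l') + 1 / 1000.
Proof.
move=> c0 c20 gf1 gf2.
have -> : c ^+ 2 * dotv (vR (w tt f1)) (vR (w tt f2)) / s%:R ^+ 2 =
   c ^+ 2 * dotv (scaled R L (w tt f1)) (scaled R L (w tt f2)).
  rewrite [in RHS]/scaled [in RHS]dotvZl [in RHS]dotvC [in RHS]dotvZl [in RHS]dotvC.
  by rewrite expr2 invfM -!mulrA; congr (_ * _); ring.
have D1 : dotv (scaled R L (w tt f1)) (scaled R L (w tt f2)) <= dotv (am f1) (am f2) + (A2 / q%:R + 2 / q%:R ^+ 2).
  rewrite !wE.
  have -> : dotv (er tt f1 - am f1) (er tt f2 - am f2) = dotv (am f1) (am f2) +
      (dotv (er tt f1) (- am f2) + dotv (- am f1) (er tt f2) + dotv (er tt f1) (er tt f2)).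
    rewrite dotvDl !dotvNl !(dotvC (er tt f1)) !(dotvC (am f1)) !dotvDl !dotvNl.
    by rewrite !(dotvC _ (er tt f1)) !(dotvC _ (am f1)); ring.
  rewrite lerD2l.
  have qi : 0 < q%:R^-1 :> R by rewrite invr_gt0.
  have E1 := dotv_le (er tt f1) (- am f2) qR; have E2 := dotv_le (er tt f2) (- am f1) qR.
  have E3 := dotv_le (er tt f1) (er tt f2) (@ltr01 R).
  rewrite !norm2N in E1 E2; rewrite dotvC in E2; rewrite invr1 !mul1r in E3.
  apply: (cross_terms_le (ltW qR) E1 E2 E3 (er_norm2 tt f1) (er_norm2 tt f2) (am_norm2 gf1) (am_norm2 gf2)).
  by rewrite ler1n (q_gt0 q400).
have c2 : c ^+ 2 <= 400 by rewrite expr2; nra.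
have cd : c ^+ 2 * dotv (am f1) (am f2) <= \sum_l \sum_l' coupling (f1 l) (f2 l').
  rewrite am_dot mulrA mulr_sumr; apply: ler_sum => l _; rewrite mulr_sumr; apply: ler_sum => l' _.
  apply: le_trans (ler_norm _) _; rewrite normrM ger0_norm ?mulr_ge0 ?sqr_ge0//.
  by rewrite /coupling ler_wpM2r// ler_wpM2r ?sqr_ge0.
have e0 : 0 <= A2 / q%:R + 2 / q%:R ^+ 2.
  have A20 : 0 <= A2 := mulr_ge0 (sqr_ge0 _) (mulr_ge0 (sqr_ge0 _) hm0).
  exact: (addr_ge0 (divr_ge0 A20 (ltW qR)) (divr_ge0 (ler0n _ 2) (sqr_ge0 _))).
apply: le_trans (ler_wpM2l (sqr_ge0 c) D1) _; rewrite mulrDr; apply: (lerD cd).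
exact: (le_trans (ler_wpM2r e0 c2) Herr).
Qed.

Lemma light_card : (1 - 2000%:R^-1) * n%:R <= #|light|%:R :> R.
Proof.
apply: markov_card => //; first by move=> j; exact: (pivotal_diag_ge0 psd j piv).
Qed.

(** The bound is a product of factors exp (1/1000): one for the rounding errors and, for each
    letter, one for the weak couplings and one for the rare strong ones. *)
Lemma good_word_moment (k : 'I_K) :
  \sum_(f1 | good_word f1) \sum_(f2 | good_word f2) n%:R ^- mi * n%:R ^- mi *
    expR ((mults k)%:R ^+ 2 * dotv (vR (w tt f1)) (vR (w tt f2)) / s%:R ^+ 2) <= max_moment delta.
Proof.
have m20 : (mults k)%:R <= 20 :> R by rewrite ler_nat mults_le.
pose Fb : R := (expR (mi%:R * (1 / (1000 * mi%:R))) *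
  (#|light|%:R + mi%:R * dmax * expR (dg%:R * pmax))) ^+ mi.
have nm : 0 < n%:R ^- mi :> R by rewrite invr_gt0 exprn_gt0.
have th0 : 0 <= 1 / (1000 * mi%:R) :> R.
  exact: (divr_ge0 ler01 (mulr_ge0 (ler0n _ 1000) (ler0n _ mi))).
have pm0 : 0 <= pmax :> R by exact: (mulr_ge0 (ltW c400) hm0).
have inner f1 : good_word f1 -> \sum_(f2 | good_word f2) n%:R ^- mi * n%:R ^- mi *
    expR ((mults k)%:R ^+ 2 * dotv (vR (w tt f1)) (vR (w tt f2)) / s%:R ^+ 2) <=
    n%:R ^- mi * (n%:R ^- mi * expR (1 / 1000) * Fb).
  move=> gf1; have Hm := spread_moment coupling_max coupling_degree th0 pm0 gf1.
  apply: (@le_trans _ _ (n%:R ^- mi * (n%:R ^- mi * expR (1 / 1000) *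
    \sum_(f2 | good_word f2) expR (\sum_l \sum_l' coupling (f1 l) (f2 l'))))); last first.
    apply: (ler_wpM2l (ltW nm)); apply: ler_wpM2l Hm.
    exact: (mulr_ge0 (ltW nm) (expR_ge0 _)).
  rewrite !mulr_sumr; apply: ler_sum => f2 gf2; rewrite -mulrA; apply: (ler_wpM2l (ltW nm)).
  rewrite -[X in _ <= X]mulrA; apply: (ler_wpM2l (ltW nm)).
  by rewrite -expRD ler_expR addrC; exact: (dense_dot_le (ler0n _ _) m20 gf1 gf2).
apply: (@le_trans _ _ (\sum_(f1 : word) n%:R ^- mi * (n%:R ^- mi * expR (1 / 1000) * Fb))).
  rewrite [leLHS]big_mkcond; apply: ler_sum => f1 _; case: ifP => [/inner//|_].
  apply: (mulr_ge0 (ltW nm)); apply: mulr_ge0; first exact: (mulr_ge0 (ltW nm) (expR_ge0 _)).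
  apply: exprn_ge0; apply: (mulr_ge0 (expR_ge0 _)); apply: addr_ge0; first exact: ler0n.
  apply: mulr_ge0 (expR_ge0 _); apply: (mulr_ge0 (ltW miR)).
  exact: (mulr_ge0 (sqr_ge0 _) hm0).
rewrite sumr_const card_ffun !card_ord -[_ *+ _]mulr_natl natrX mulrA mulfV ?[1 * _]mul1r; last first.
  by rewrite expf_neq0// gt_eqF.
have lc : #|light|%:R <= n%:R :> R by rewrite ler_nat -[X in (_ <= X)%N]card_ord max_card.
have Fle : Fb <= (expR (1 / 1000) * (n%:R * expR (1 / 1000))) ^+ mi.
  have e1 : mi%:R * (1 / (1000 * mi%:R)) = 1 / 1000 :> R.
    by rewrite mulrA mulr1 invfM mulrCA mulfV ?mulr1 ?gt_eqF// div1r.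
  rewrite /Fb e1; apply: lerXn2r; rewrite ?nnegrE.
  - apply: (mulr_ge0 (expR_ge0 _)); apply: addr_ge0; first exact: ler0n.
    apply: mulr_ge0 (expR_ge0 _); apply: (mulr_ge0 (ltW miR)); exact: (mulr_ge0 (sqr_ge0 _) hm0).
  - exact: (mulr_ge0 (expR_ge0 _) (mulr_ge0 (ltW nR) (expR_ge0 _))).
  apply: (ler_wpM2l (expR_ge0 _)); apply: (le_trans (lerD lc Hdeg2)).
  have := ler_wpM2l (ltW nR) (expR_ge1Dx (1 / 1000 : R)); apply: le_trans.
  by apply: eq_ler; rewrite mulrDr mulr1 mulrA mulr1.
apply: (@le_trans _ _ (expR (1 / 1000) * expR (2 / 1000) ^+ mi)).
  have e2 : expR (2 / 1000) ^+ mi = n%:R ^- mi * (expR (1 / 1000) * (n%:R * expR (1 / 1000))) ^+ mi :> R.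
    rewrite -exprVn -exprMn; congr (_ ^+ _).
    have -> : 2 / 1000 = 1 / 1000 + 1 / 1000 :> R by lra.
    by rewrite expRD; move: (expR _) => z; field; rewrite gt_eqF.
  move: (ler_wpM2l (ltW nm) Fle); rewrite -e2 => F2.
  apply: (@le_trans _ _ (expR (1 / 1000) * (n%:R ^- mi * Fb))).
    by apply: eq_ler; rewrite mulrA; congr (_ * _); rewrite mulrC div1r.
  exact: (ler_wpM2l (expR_ge0 _) F2).
rewrite -expRM_natl -expRD; exact: dense_moment_le_max.
Qed.

(** Each of the [mi] letters is light with probability at least 1 - 1/2000, and discarding the words
    that are not spread costs one further such factor. *)
Lemma good_word_prob : min_good delta <= \sum_(f | good_word f) n%:R ^- mi.
Proof.
apply: (le_trans (min_good_exp delta0 mi1 miA miB)).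
have nm : 0 < n%:R ^+ mi :> R by rewrite exprn_gt0.
have dm0 : 0 <= dmax :> R := mulr_ge0 (sqr_ge0 _) hm0.
have kc0 : 0 <= kc := le_trans ler01 kc1.
have lc : #|light|%:R <= n%:R :> R by rewrite ler_nat -[X in (_ <= X)%N]card_ord max_card.
have cs := card_not_spread mi dg coupling_sym coupling_degree kc1.
rewrite sumr_const -[leRHS]mulr_natl ler_pdivlMr//.
apply: (le_trans (spread_count_ge _ nR (mulr_ge0 kc0 dm0) cs Hdeg1 light_card lc Hkc)); first by rewrite ler_nat.
rewrite -(card_in_G0 R mi light) -natrB; last first.
  by apply: subset_leq_card; apply/fintype.subsetP => f /andP[].
rewrite ler_nat leq_subLR -(cardID good_word [pred f | in_G0 light f]) addnC leq_add//.
  apply: subset_leq_card; apply/fintype.subsetP => f; rewrite !inE => /andP[a b]; exact/andP.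
by apply: subset_leq_card; apply/fintype.subsetP => f; rewrite !inE => /andP[a b].
Qed.

Lemma dense_testable : testable L q p eps delta (fun=> n%:R ^- mi) 0 (dense_step tt) (w tt).
Proof.
exists good_word, (calm 2), (calm 1); have /andP[e0 e1] := eps01.
split.
- move=> f c gf; have [_ w2] := dense_w_small tt gf.
  have t50 : 0 <= t / (50 * 100) := divr_ge0 (ltW tp) (mulr_ge0 (ler0n _ 50) (ler0n _ 100)).
  have := norm2_coord_le c t50 w2; rewrite mxE => wc.
  rewrite -(ler_int R) intrM intr_norm -[M%:Z%:~R]/(M%:R : R) natrM.
  have NN : N0%:R <= (q ^ 2)%N%:R :> R.
    by rewrite ler_nat (leq_trans N0q)// expnS leq_pmulr// (q_gt0 q400).
  apply: le_trans (ler_wpM2l (ltW sR) NN); rewrite -[40%:~R]/(40 : R).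
  move: wc; move: t tp (`|_|) => z z0 a az; lra.
- move=> k f g gf g1; have [w1 w2] := dense_w_small tt gf; apply/andP; split.
    case/andP: g1 => g1 /forallP g2; apply/andP; split.
      by apply: le_trans g1 _; rewrite ler_wpM2r ?(ltW r00)// ler1n.
    apply/forallP => j; apply: le_trans (g2 j) _.
    by rewrite ler_wpM2r ?invr_ge0 ?ler0n// ler_wpM2r ?(ltW tp)// ler1n.
  by apply: calm_shift => //; exact: mults_le.
- exact: calm_tail.
- exact: good_word_prob.
split; last exact: good_word_moment.
move=> k1 k2 f1 f2 g1 g2 k12 gf1 gf2 c1 c2.
have [w1 _] := dense_w_small tt gf1; have [w2 _] := dense_w_small tt gf2.
exact: dense_sep k12 w1 w2 c1 c2.
Qed.

End Kernel.

Lemma dense_inst (H Sg : 'M[R]_n) (w : unit -> word -> 'rV[int]_n) : ridge_like H Sg -> \tr H <= rho ->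
  (forall u f, norm2 (scaled R L (w u f) + scaled R L (dense_step u f) *m H) <= (q%:R ^+ 3)^-1) ->
  exists2 goodJ : pred unit, 99 / 100 <= \sum_(u | goodJ u) (1 : R) &
    forall u, goodJ u -> testable L q p eps delta (fun=> n%:R ^- mi) 0 (dense_step u) (w u).
Proof.
move=> rl trH werr; exists xpredT => [|[] _]; last exact: (dense_testable rl trH werr).
by rewrite big_const card_unit /= addr0; lra.
Qed.

End DenseTest.

(** * Choice of the parameters *)

(** [L] is the largest integer with L^20 <= W. Then W < (L + 1)^20 <= L^40, so ln L is a fixed
    fraction of ln W. *)
Lemma stream_base (R : realType) (W q : nat) : (2 <= q)%N -> (q ^ 100 <= W)%N ->
  exists L, [/\ (q ^ 5 <= L)%N, (L ^ 20 <= W)%N & ln W%:R <= 40 * ln L%:R :> R].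
Proof.
move=> q2 qW; have q0 : (0 < q)%N by exact: ltn_trans q2.
have qP : ((q ^ 5) ^ 20 <= W)%N by rewrite -expnM.
have ub L : (L ^ 20 <= W)%N -> (L <= W)%N.
  case: L => // L; apply: leq_trans; by rewrite -[X in (X <= _)%N]expn1 leq_pexp2l.
have [L LW maxL] := ex_maxnP (ex_intro (fun L => (L ^ 20 <= W)%N) _ qP) ub.
exists L; split=> //; first exact: maxL.
have qL := maxL _ qP.
have L2 : (2 <= L)%N by apply: leq_trans qL; rewrite (leq_trans q2)// -[X in (X <= _)%N]expn1 leq_pexp2l.
have WL : (W < L.+1 ^ 20)%N by rewrite ltnNge; apply/negP => /maxL; rewrite ltnn.
have WL2 : (W <= L ^ 40)%N.
  rewrite (leq_trans (ltnW WL))// -[40%N]/(2 * 20)%N expnM leq_exp2r//.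
  by rewrite (leq_trans (_ : _ <= 2 * L)%N)// ?leq_mul2r ?L2 ?orbT//; lia.
have W0 : (0 < W)%N by rewrite (leq_trans _ LW)// expn_gt0 (leq_trans _ L2).
rewrite -[40%:R]/(40%N%:R) -(ln_natX R L 40) ler_ln ?posrE ?ltr0n ?expn_gt0 ?(leq_trans _ L2)//.
by rewrite ler_nat.
Qed.

Lemma approximates_le (R : realType) (eps eps' a v : R) : 0 < eps -> eps <= eps' -> 0 <= a ->
  approximates eps a v -> approximates eps' a v.
Proof.
move=> e0 ee a0 /andP[lo hi]; apply/andP; split.
  by apply: le_trans lo; rewrite ler_wpM2l// lef_pV2 ?posrE ?lerD2l//; lra.
by apply: (le_trans hi); rewrite ler_wpM2r// lerD2l.
Qed.

Lemma lp_norm_ge0 (R : realType) (n : nat) (p : R) (x : 'rV[int]_n) : 0 <= lp_norm p x.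
Proof. exact: powR_ge0. Qed.

Lemma sum_pair1 (R : realType) (T : Type) (a b : T) (F : T -> R) :
  \sum_(q <- [:: (1, a); (1, b)]) q.1 * F q.2 = F a + F b.
Proof. by rewrite !big_cons big_nil !mul1r addr0. Qed.

Lemma orb_le_natr (R : realType) (a b : bool) : a || b -> 1 <= a%:R + b%:R :> R.
Proof. by case: a b => [] [] // _; rewrite ?addr0 ?add0r// lerDl. Qed.

Lemma ex_ub3 (R : realType) (a b c : R) : exists u, [/\ a <= u, b <= u & c <= u].
Proof. by exists (Num.max a (Num.max b c)); rewrite !le_max !lexx !orbT. Qed.

Lemma spike_rateE (R : realType) (n e r z : R) : n != 0 -> e != 0 -> r != 0 ->
  e ^+ 2 * r ^+ 2 / n * (n / (e * r) ^+ 2 * z) = z.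
Proof. by move=> n0 e0 r0; field; rewrite n0 e0 r0. Qed.

Section Estimates.
Variables (R : realType) (n : nat) (d : measure_display) (T : measurableType d).
Variables (P : probability T R) (A : rand_stream_alg R n T) (p delta : R) (W : nat).

Lemma estimates_le (eps eps' : R) : 0 < eps -> eps <= eps' ->
  estimates_lp_norm P A p eps delta W -> estimates_lp_norm P A p eps' delta W.
Proof.
move=> e0 ee est s sW; apply: (le_trans (est s sW)).
apply: le_measure; rewrite ?inE; [exact: measurable_success|exact: measurable_success|].
by move=> w /=; apply: approximates_le => //; exact: lp_norm_ge0.
Qed.

(** With one state, the empty stream and a single update receive the same answer, which is wrong for
    one of them. This covers the streams too short for the tests. *)
Lemma bits_gt0 (eps : R) (S : nat) : 0 < p -> (0 < n)%N -> 0 < eps -> delta < 1 / 2 -> (0 < W)%N ->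
  uses_bits A S -> estimates_lp_norm P A p eps delta W -> (0 < S)%N.
Proof.
case: n A => [|n'] A' p0 // _ e0 d2 W0 ub est; rewrite lt0n; apply/eqP => S0.
have one w (x y : state (A' w)) : x = y.
  have := ub w; rewrite S0 expn0 => /card_le1_eqP; exact.
pose u : stream n'.+1 := [:: (ord0, true)].
have := @success_average _ _ _ _ P A' p eps delta W [:: (1, [::]); (1, u)] 1 ler01 est.
rewrite big_cons big_cons big_nil addr0 => H.
suff H1 : 1 <= delta * (1 + 1) by lra.
apply: H => [q|w]; first by rewrite !inE => /orP[] /eqP ->.
rewrite (sum_pair1 _ _ (fun s => (~~ succeeds eps (lp_norm p (frequency s)) (run (A' w) s))%:R)).
have -> : run (A' w) u = run (A' w) [::] by rewrite /run; congr output; exact: one.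
have l0 : lp_norm p (frequency [::] : 'rV[int]_n'.+1) = 0.
  rewrite /lp_norm big1 ?powR0 ?invr_eq0 ?gt_eqF// => i _.
  by rewrite mxE big_nil normr0 powR0 ?gt_eqF.
have lu : 0 < lp_norm p (frequency u).
  rewrite /lp_norm; apply: powR_gt0; rewrite (bigD1 ord0)//=.
  apply: ltr_pwDl; last by apply: sumr_ge0 => i _; exact: powR_ge0.
  by rewrite powR_gt0// mxE big_cons big_nil /= addr0 ltr01.
have ex : (1 + eps) ^+ 2 * lp_norm p (frequency [::] : 'rV[int]_n'.+1) < lp_norm p (frequency u).
  by rewrite l0 mulr0.
exact: (orb_le_natr _ (succeeds_excl (run (A' w) [::]) e0 ex)).
Qed.

End Estimates.

Lemma spike_scale (R : realType) : 0 < 1 / (1000 * 1000 * 4) :> R.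
Proof. by lra. Qed.

Lemma spike_const (R : realType) (c : R) : 1 <= c -> 0 < 80 * 1000 * c ^+ 2 + 2.
Proof. by move=> c1; have := sqr_ge0 c; lra. Qed.

Lemma round_up_double (R : realType) (k x : R) : k <= x + 1 -> 1 <= x -> k <= 2 * x.
Proof. lra. Qed.

Lemma round_up_ten (R : realType) (k e t : R) : k <= 9 * e * t + 1 -> 1 <= e * t -> k <= 10 * e * t.
Proof. by rewrite -!mulrA; lra. Qed.

(** 160 = 4 * 40, the 40 being that of [stream_base]. *)
Lemma trace_rate (R : realType) (x S w l : R) : 0 < l -> w <= 40 * l -> 0 <= x ->
  S <= x / 160 * w -> 4 * S / l <= x.
Proof.
move=> l0 wl x0 Sx; rewrite ler_pdivrMr//.
have : x * w <= x * (40 * l) by rewrite ler_wpM2l.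
by move: Sx; rewrite mulrAC; move: (x * w) => xw; lra.
Qed.

Lemma norm2_unit (R : realType) (n : nat) (j : 'I_n) : norm2 ('e_j : 'rV[R]_n) = 1.
Proof.
rewrite /norm2 /dotv (bigD1 j)//= big1 => [|i ij]; last by rewrite !mxE (negPf ij) andbF mulr0.
by rewrite !mxE !eqxx mulr1 addr0.
Qed.

Section Spike.
Variables (R : realType) (p : R).
Hypothesis p2 : 2 < p.

Let p0 : 0 < p. Proof. by apply: lt_trans p2. Qed.
Lemma root_sqr_le (n : nat) : (0 < n)%N -> (n%:R `^ p^-1) ^+ 2 <= n%:R :> R.
Proof.
move=> n0; rewrite -powR_mulrn ?powR_ge0// -powRrM -[leRHS]powRr1 ?ler0n//.
by apply: ler_powR; [rewrite ler1n|rewrite mulrC ler_pdivrMr// mul1r ltW].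
Qed.

Lemma root_ge1 (n : nat) : (0 < n)%N -> 1 <= n%:R `^ p^-1 :> R.
Proof.
move=> n0; rewrite -[leLHS](powRr0 n%:R); apply: ler_powR; first by rewrite ler1n.
by rewrite invr_ge0 ltW.
Qed.

Lemma ceil_nat (x : R) : 0 <= x -> exists m : nat, x <= m%:R <= x + 1.
Proof.
move=> x0; exists (Num.truncn x).+1; have /andP[a b] := truncn_itv x0.
by rewrite (ltW b) -natr1 lerD2r.
Qed.

Lemma spike_bound : exists c q0 : R, 0 < c /\
  forall (n q W S : nat) (eps delta : R) (d : measure_display) (T : measurableType d)
    (P : probability T R) (A : rand_stream_alg R n T),
  (0 < n)%N -> 0 < eps < 1 -> 1 <= eps * n%:R `^ p^-1 -> 0 < delta -> delta < 1 / 2 ->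
  (n <= q)%N -> delta^-1 <= q%:R -> q0 <= q%:R -> (q ^ 100 <= W)%N ->
  uses_bits A S -> estimates_lp_norm P A p eps delta W ->
  c * (Num.min (n%:R / (eps * n%:R `^ p^-1) ^+ 2 * ln (1 / delta)) n%:R * ln W%:R) <= S%:R.
Proof.
have [c1 c1p c11] : exists2 c1, 100 * 100 * p <= c1 & 1 <= c1.
  by exists (1 + 100 * 100 * p); [rewrite lerDr|rewrite lerDl; exact: (mulr_ge0 (mulr_ge0 (ler0n _ 100) (ler0n _ 100)) (ltW p0))].
have [kp kp0 kpc] : exists2 kp, 0 < kp & kp * (80 * 1000 * c1 ^+ 2 + 2) <= 1 / (1000 * 1000 * 4).
  exists (1 / (1000 * 1000 * 4) / (80 * 1000 * c1 ^+ 2 + 2)).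
    exact: (divr_gt0 (spike_scale R) (spike_const c11)).
  rewrite mulfVK; first exact: lexx.
  exact: (lt0r_neq0 (spike_const c11)).
(* The third bound on [q] ensures that the spike height N0 <= 2 c1 n^(1/p) is at most [q], because
   n^(2/p) <= n <= q. *)
have [q0 [q0a q0b q0c]] := ex_ub3 400%:R kp^-1 ((2 * c1) ^+ 2).
exists (kp / 160), q0; split; first exact: divr_gt0.
move=> n q W S eps delta d T P A n0 eps01 epsn d0 d2 nq dq q0q qW ub est.
rewrite leNgt; apply/negP => Slt.
have /andP[e0 e1] := eps01.
have kpi : 0 < kp^-1 by rewrite invr_gt0.
have c12 : 0 <= (2 * c1) ^+ 2 := sqr_ge0 _.
have q400 : (400 <= q)%N.
  by rewrite -(ler_nat R); exact: le_trans q0a q0q.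
have qR : 0 < (q%:R : R) by rewrite ltr0n (leq_trans _ q400).
have qk : q%:R^-1 <= kp.
  rewrite -[leRHS]invrK lef_pV2 ?posrE//; exact: le_trans q0b q0q.
have [L [qL LW WL]] := stream_base R (leq_trans (isT : (2 <= 400)%N) q400) qW.
set r : R := n%:R `^ p^-1 in epsn Slt *.
have nR : 0 < (n%:R : R) by rewrite ltr0n.
have r1 : 1 <= r.
  exact: root_ge1.
have r2n : r ^+ 2 <= n%:R := root_sqr_le n0.
have [N0 /andP[N0ge N0le]] := ceil_nat (mulr_ge0 (le_trans ler01 c11) (le_trans ler01 r1)).
have cr1 : 1 <= c1 * r by rewrite -[leLHS](mulr1 1) ler_pM.
have {}N0le : N0%:R <= 2 * c1 * r by rewrite -mulrA; exact: round_up_double N0le cr1.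
have N0q : (N0 <= q)%N.
  rewrite -(ler_nat R); apply: le_trans N0le _.
  have rq : r ^+ 2 <= q%:R by rewrite (le_trans r2n)// ler_nat.
  have cq : (2 * c1) ^+ 2 <= q%:R := le_trans q0c q0q.
  rewrite -ler_sqr ?nnegrE ?ler0n ?mulr_ge0 ?(le_trans ler01 c11) ?(le_trans ler01 r1)//.
  by rewrite exprMn expr2; apply: ler_pM; rewrite ?sqr_ge0.
set B := n%:R / (eps * r) ^+ 2 * ln (1 / delta) in Slt.
have m0 := ln_inv_ge d0 d2.
have er0 : 0 < eps * r by apply: lt_le_trans epsn.
have B0 : 0 < B by apply: mulr_gt0; [rewrite divr_gt0// exprn_gt0|exact: (lt_le_trans (divr_gt0 ltr01 (ltr0Sn R 1)) m0)].
have BE : eps ^+ 2 * r ^+ 2 / n%:R * B = ln (1 / delta).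
  have rn : r != 0 by rewrite gt_eqF// (lt_le_trans ltr01).
  exact: (spike_rateE _ (lt0r_neq0 nR) (lt0r_neq0 e0) rn).
have min0 : 0 < Num.min B n%:R by rewrite lt_min B0.
set rho := q%:R^-1 + kp * Num.min B n%:R.
have rho0 : 0 < rho by rewrite addr_gt0 ?invr_gt0// mulr_gt0.
have rhoB : rho <= q%:R^-1 + kp * B by rewrite lerD2l ler_pM2l// ge_min lexx.
have rhon : rho <= q%:R^-1 + kp * n%:R by rewrite lerD2l ler_pM2l// ge_min lexx orbT.
have sg := L_gt0 q400 qL.
have q10 : (10 * q <= L)%N.
  apply: leq_trans qL; rewrite [(q ^ 5)%N]expnSr leq_mul2r; apply/orP; right.
  by rewrite (leq_trans (_ : _ <= q)%N) ?(leq_trans _ q400)// -[X in (X <= _)%N]expn1 leq_pexp2l// (leq_trans _ q400).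
have qLe : (q <= L)%N by apply: leq_trans q10; rewrite leq_pmull.
have LR : 0 < (L%:R : R) by rewrite ltr0n.
set t : R := (L ^ 4)%:R * N0%:R.
have N01 : 1 <= N0%:R :> R by apply: le_trans N0ge.
have eN1 : 1 <= eps * N0%:R.
  apply: le_trans epsn _; rewrite ler_pM2l//; apply: le_trans N0ge.
  by rewrite ler_peMl// (le_trans ler01).
have et1 : 1 <= eps * t.
  by rewrite /t mulrCA -[leLHS](mulr1 1); apply: ler_pM => //; rewrite ler1n expn_gt0 sg.
have [h /andP[h9 h10]] := ceil_nat (mulr_ge0 (mulr_ge0 (ler0n R 9) (ltW e0)) (mulr_ge0 (ler0n R (L ^ 4)) (ler0n R N0))).
have {}h10 : h%:R <= 10 * eps * t := round_up_ten h10 et1.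
have hL : (h <= L ^ 5)%N.
  rewrite -(ler_nat R); apply: le_trans h10 _; rewrite expnSr natrM /t.
  have b : eps * ((L ^ 4)%:R * N0%:R) <= (L ^ 4)%:R * q%:R.
    rewrite -[leRHS]mul1r; apply: ler_pM; rewrite ?(ltW e0) ?(ltW e1)//.
    by apply: ler_wpM2l; [exact: ler0n|rewrite ler_nat].
  have b2 : (L ^ 4)%:R * (10 * q)%N%:R <= (L ^ 4)%:R * L%:R :> R.
    by apply: ler_wpM2l; [exact: ler0n|rewrite ler_nat].
  apply: le_trans b2; rewrite natrM [leRHS]mulrCA -[leLHS]mulrA; exact: (ler_wpM2l (ler0n _ 10) b).
have trle H : \tr H <= q%:R^-1 + 4 * S%:R / ln L%:R -> \tr H <= rho :> R.
  move=> tH; apply: (le_trans tH); rewrite /rho lerD2l.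
  apply: (trace_rate _ WL (ltW (mulr_gt0 kp0 min0))).
    by apply: ln_gt0; rewrite ltr1n (leq_trans _ qLe)// (leq_trans _ q400).
  by move: Slt => /ltW; rewrite mulrA [kp / 160 * _]mulrAC.
apply: (no_test n0 nq q400 qL ub est LW e0 d0 d2 dq (J := 'I_n) (I := unit) (wJ := fun=> n%:R^-1)
  (pi := fun=> 1) (xb := spike_base L N0) (y := spike_step h)).
- by [].
- by rewrite sumr_const card_ord -[LHS]mulr_natl mulfV ?gt_eqF.
- by [].
- by rewrite big_const card_unit /= addr0.
- move=> j i; rewrite mxE mxE eqxx /=; case: (_ == _); rewrite ?mulr0 ?normr0// mulr1.
  rewrite lez_nat (expnD L 4 2) leq_mul2l -[(L ^ 2)%N]/(L * L)%N; apply/orP; right.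
  by rewrite (leq_trans N0q)// (leq_trans qLe)// leq_pmull.
- move=> j i i'; rewrite mxE mxE eqxx /=; case: (_ == _); rewrite ?mulr0 ?normr0// mulr1.
  by rewrite lez_nat (leq_trans hL)// leq_pexp2l.
- move=> j i; rewrite /spike_step map_intr_delta norm2Z norm2_unit mulr1 lerXn2r ?nnegrE ?ler0n ?exprn_ge0//.
  by rewrite -natrX ler_nat.
move=> H Sg w rl trH werr.
exact: (spike_inst n0 q400 qL eps01 d0 d2 p2 c1p N0ge N0le epsn kp0 kpc qk N0q BE r2n rhoB rhon h9 h10 rho0 rl (trle _ _ trH) werr).
Qed.
End Spike.

Lemma word_length (R : realType) (m : R) : 1 / 2 <= m ->
  exists mi : nat, [/\ (1 <= mi)%N, m < 8 -> mi = 1%N, 8 <= m -> 4 * mi%:R <= m,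
    m / 16 <= mi%:R & mi%:R <= 2 * m].
Proof.
move=> m0; have [m8|m8] := ltP m 8.
  by exists 1%N; split=> //; lra.
have m4 : 0 <= m / 4 by lra.
have := truncn_itv m4; move E : (Num.truncn (m / 4)) => k; rewrite -[k.+1%:R]natr1 => /andP[a b].
by exists k; split=> //; [rewrite -(ltr0n R)| | |]; lra.
Qed.

(** * Inequalities in z = n^t, a small power that dominates constants and logarithms *)

Section DenseArith.
Variables (R : realType) (z r N : R).
Hypotheses (zC : 400 * 1000 <= z) (r0 : 0 < r) (zr : z ^+ 8 <= r) (rN : r ^+ 2 * z ^+ 10 <= N).

Let z1000 : 1000 * 5 <= z. Proof. by move: zC; lra. Qed.
Let z4 : 4 <= z. Proof. by move: zC; lra. Qed.
Let z1 : 1 <= z. Proof. by move: z4; lra. Qed.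
Let zp : 0 < z. Proof. exact: lt_le_trans z1. Qed.

(** The left side is mi dmax. The assumption r^2 z^10 <= N leaves two factors [z] between this bound
    and [N]; [degree_lt] spends them on the exponential and on the constant. *)
Lemma degree_mass (u v mi N0 hm : R) : 0 <= u -> 0 <= v -> 0 <= mi -> 0 <= N0 -> 0 <= hm ->
  u * v <= z -> mi <= z -> N0 <= z * r -> N0 ^+ 2 * hm <= z ->
  mi * ((u * N0 ^+ 2 * (v * mi)) ^+ 2 * hm) <= z ^+ 8 * r ^+ 2.
Proof.
move=> u0 v0 m0 n0 h0 uv mz Nz hz.
have -> : mi * ((u * N0 ^+ 2 * (v * mi)) ^+ 2 * hm) =
  (u * v) ^+ 2 * mi ^+ 3 * (N0 ^+ 2 * (N0 ^+ 2 * hm)) by ring.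
have -> : z ^+ 8 * r ^+ 2 = z ^+ 2 * z ^+ 3 * ((z * r) ^+ 2 * z) by ring.
have zr0 : 0 <= z * r := mulr_ge0 (ltW zp) (ltW r0).
apply: ler_pM.
- by rewrite mulr_ge0 ?exprn_ge0// mulr_ge0.
- by rewrite mulr_ge0 ?exprn_ge0// mulr_ge0 ?exprn_ge0.
- apply: ler_pM; rewrite ?exprn_ge0 ?mulr_ge0//; apply: lerXn2r; rewrite ?nnegrE ?mulr_ge0//; exact: ltW.
apply: ler_pM; rewrite ?exprn_ge0 ?mulr_ge0 ?exprn_ge0//.
by apply: lerXn2r; rewrite ?nnegrE.
Qed.

Lemma degree_lt (D E k : R) : 0 < k -> k <= z -> 0 <= D -> 0 <= E -> E <= z ->
  D <= z ^+ 8 * r ^+ 2 -> D * E <= N / k.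
Proof.
move=> k0 kz D0 E0 Ez Dle; rewrite ler_pdivlMr//; apply: le_trans rN.
have -> : r ^+ 2 * z ^+ 10 = z ^+ 8 * r ^+ 2 * z * z by ring.
by apply: ler_pM => //; [exact: mulr_ge0|exact: ltW|apply: ler_pM].
Qed.

Lemma shift_small (A qi y : R) : A <= z ^+ 3 -> qi <= 1 -> z ^+ 5 <= y ->
  2 * A + 2 * qi <= y ^+ 2.
Proof.
move=> A3 q1 y5.
have z3 : 1 <= z ^+ 3 by exact: exprn_ege1.
have zz : 4 * z ^+ 3 <= z ^+ 5.
  have -> : z ^+ 5 = z * z * z ^+ 3 by ring.
  apply: ler_wpM2r; first by lra.
  by move: z4 z1; nra.
have y1 : 1 <= y by apply: le_trans y5; exact: exprn_ege1.
apply: (@le_trans _ _ y); first by lra.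
by rewrite expr2 ler_peMl// (le_trans ler01).
Qed.

Lemma shift_const : 400 * z^-1 <= 1 / 1000.
Proof.
have zi : 1 / 1000 * z^-1^-1 = z / 1000 by rewrite invrK mul1r mulrC.
have zi0 : 0 < z^-1 by rewrite invr_gt0.
rewrite -(ler_pM2r zp) mulfVK ?gt_eqF//.
by move: zC; lra.
Qed.

Lemma shift_err (A q : R) : 0 <= A -> A <= z ^+ 3 -> z ^+ 5 <= q ->
  400 * (A / q + 2 / q ^+ 2) <= 1 / 1000.
Proof.
move=> A0 A3 q5.
have q1 : 1 <= q by apply: le_trans q5; exact: exprn_ege1.
have q0 : 0 < q by exact: lt_le_trans q1.
have E1 : A / q + 2 / q ^+ 2 <= z ^+ 4 / q.
  have e : 2 / q ^+ 2 <= 2 / q.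
    by rewrite ler_wpM2l// lef_pV2 ?posrE ?exprn_gt0// expr2 ler_peMl// ltW.
  have z3 : 1 <= z ^+ 3 by exact: exprn_ege1.
  have zz : 4 * z ^+ 3 <= z ^+ 4 by rewrite [z ^+ 4]exprS ler_wpM2r//; lra.
  apply: (le_trans (lerD (lexx _) e)); rewrite -mulrDl ler_wpM2r ?invr_ge0 ?(ltW q0)//; lra.
have E2 : z ^+ 4 / q <= z^-1.
  rewrite ler_pdivrMr// ler_pdivlMl// -exprS; exact: q5.
apply: (le_trans (ler_wpM2l (ler0n R 400) (le_trans E1 E2))); exact: shift_const.
Qed.

Lemma weight_tail (N0 : R) : 0 < N -> ln N <= z -> z ^+ 6 <= N0 ->
  N * (4 * expR (- (N0 / 200))) <= 1 / 2500.
Proof.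
move=> Np lz n6.
have zz : 400 * z <= z ^+ 6.
  have -> : z ^+ 6 = z ^+ 4 * z * z by ring.
  apply: ler_wpM2r; first exact: ltW.
  have h1 : 1 <= z ^+ 4 by exact: exprn_ege1.
  by move: zC; nra.
have x2 : ln N + z <= N0 / 200 by lra.
apply: (@le_trans _ _ (N * (4 * expR (- (ln N + z))))).
  by rewrite ler_wpM2l ?(ltW Np)// ler_wpM2l// ler_expR lerN2.
rewrite opprD expRD expRN lnK ?posrE// mulrCA mulrA mulrA.
rewrite -[4 * N * _]mulrA mulfV ?gt_eqF// mulr1 expRN ler_pdivrMr ?expR_gt0//.
by have := expR_ge1Dx z; move: zC; lra.
Qed.
End DenseArith.

Lemma cancel_rates (R : realType) (e e' m m' N N' M l : R) : e * e' = 1 -> m * m' = 1 -> N * N' = M ->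
  e * N * m * (N' * e' * l * m') = M * l.
Proof.
move=> ee mm nn; have -> : e * N * m * (N' * e' * l * m') = (e * e') * (m * m') * (N * N') * l by ring.
by rewrite ee mm nn !mul1r.
Qed.

Section DenseSize.
Variables (R : realType) (p z r N eps m k0 y : R) (mi N0 : nat).
Hypotheses (p2 : 2 < p) (z1 : 1 <= z) (N1 : 1 <= N) (rE : r = N `^ p^-1).
Hypotheses (eps0 : 0 < eps) (eps1 : eps < 1) (ez : 1 <= eps * z).
Hypotheses (mi1 : (1 <= mi)%N) (miz : mi%:R <= z) (k01 : 1 <= k0) (k0z : 4 * k0 <= z).
Hypothesis yE : y = (2 * k0 * eps * N / mi%:R) `^ p^-1.
Hypotheses (zr : z ^+ 8 <= r) (N0y : y <= N0%:R) (N0y1 : N0%:R <= y + 1).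

Let p0 : 0 < p. Proof. by apply: lt_trans p2. Qed.
Let pi0 : 0 <= p^-1. Proof. by rewrite invr_ge0 ltW. Qed.
Let pi1 : p^-1 <= 1. Proof. by rewrite invf_le1// ltW// (lt_trans _ p2)// ltr1n. Qed.
Let zp : 0 < z. Proof. exact: lt_le_trans z1. Qed.
Let miR : 0 < (mi%:R : R). Proof. by rewrite ltr0n. Qed.
Let k2 : 1 <= 2 * k0. Proof. by move: k01; lra. Qed.
Let x : R := 2 * k0 * eps / mi%:R.
Let x0 : 0 < x. Proof. by rewrite divr_gt0// !mulr_gt0// (lt_le_trans _ k01). Qed.
Let N_gt0 : 0 < N. Proof. exact: lt_le_trans N1. Qed.

Let yx : y = x `^ p^-1 * r.
Proof. by rewrite yE rE -powRM ?(ltW x0) ?(ltW N_gt0)// /x mulrAC. Qed.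

Lemma size_root : r <= z ^+ 2 * y.
Proof.
have xz : (z ^+ 2)^-1 <= x.
  rewrite -div1r ler_pdivrMr ?exprn_gt0// /x.
  have -> : 2 * k0 * eps / mi%:R * z ^+ 2 = 2 * k0 * (eps * z) * (z / mi%:R) by ring.
  have h1 : 1 <= z / mi%:R by rewrite ler_pdivlMr// mul1r.
  apply: mulr_ege1 => //; exact: mulr_ege1.
have z2 : 0 < z ^+ 2 by rewrite exprn_gt0.
have xp : (z ^+ 2)^-1 <= x `^ p^-1.
  apply: (@le_trans _ _ ((z ^+ 2)^-1 `^ p^-1)).
    have a0 : 0 < (z ^+ 2) `^ p^-1 by rewrite powR_gt0.
    rewrite -(ler_pM2l a0) -powRM ?invr_ge0 ?(ltW z2)// mulfV ?gt_eqF// powR1.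
    rewrite ler_pdivrMr// mul1r -[leRHS]powRr1 ?(ltW z2)//.
    by apply: ler_powR => //; exact: exprn_ege1.
  by apply: ge0_ler_powR => //; rewrite nnegrE ?invr_ge0 ltW.
have r0 : 0 <= r by rewrite rE powR_ge0.
rewrite yx mulrA ler_peMl// -ler_pdivrMl//; move: xp; rewrite mulr1; apply.
Qed.

Lemma size_ge : z ^+ 6 <= N0%:R.
Proof.
apply: le_trans N0y; rewrite -(ler_pM2l (exprn_gt0 2 zp)); apply: le_trans size_root.
by rewrite -exprD.
Qed.

Let y1 : 1 <= y.
Proof.
have z2 : 0 < z ^+ 2 by rewrite exprn_gt0.
rewrite -(ler_pM2l z2) mulr1; apply: le_trans size_root; apply: le_trans zr.
by rewrite -[8%N]/(2 + 6)%N exprD ler_peMr ?(ltW z2)// exprn_ege1.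
Qed.

Lemma size_gt0 : (0 < N0)%N.
Proof. by rewrite -(ltr0n R) (lt_le_trans _ N0y)// (lt_le_trans _ y1). Qed.

Lemma size_le2 : N0%:R <= 2 * y.
Proof. by apply: (le_trans N0y1); move: y1; lra. Qed.

Lemma size_le : N0%:R <= z * r.
Proof.
apply: (le_trans size_le2); rewrite yx mulrA; apply: ler_wpM2r; first by rewrite rE powR_ge0.
have x2 : x <= 2 * k0.
  rewrite /x ler_pdivrMr//; apply: ler_wpM2l; first exact: le_trans ler01 k2.
  by rewrite (le_trans (ltW eps1))// ler1n.
have : x `^ p^-1 <= 2 * k0.
  apply: (@le_trans _ _ ((2 * k0) `^ p^-1)).
    by apply: ge0_ler_powR => //; rewrite nnegrE ?(ltW x0)// (le_trans ler01 k2).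
  by rewrite -[leRHS]powRr1 ?(le_trans ler01)// ler_powR.
by move: k0z; lra.
Qed.

(** [y] is chosen so that mi y^p = 2 k0 eps N, twice the energy required. *)
Lemma size_energy (c : R) : 0 <= c -> k0 = c `^ p -> eps * (c * r) `^ p < mi%:R * N0%:R `^ p.
Proof.
move=> c0 kE.
have yp : mi%:R * y `^ p = 2 * k0 * eps * N.
  rewrite yE -powRrM mulVf ?gt_eqF// powRr1; first by rewrite mulrC mulfVK ?gt_eqF.
  by rewrite divr_ge0// !mulr_ge0// ?(ltW eps0) ?(ltW N_gt0)// (le_trans ler01 k01).
have : mi%:R * y `^ p <= mi%:R * N0%:R `^ p.
  rewrite ler_pM2l//; apply: ge0_ler_powR; rewrite ?nnegrE ?(ltW p0)//.
  exact: le_trans ler01 y1.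
apply: lt_le_trans; rewrite yp.
have r0 : 0 <= r by rewrite rE powR_ge0.
rewrite powRM// -kE rE -powRrM mulVf ?gt_eqF// powRr1 ?(ltW N_gt0)//.
have : 0 < k0 * eps * N by rewrite !mulr_gt0// (lt_le_trans _ k01).
have -> : eps * (k0 * N) = k0 * eps * N by ring.
lra.
Qed.

(** N0^2 is of order (eps N / m)^(2/p). Multiplied by the rate N^(1 - 2/p) eps^(-2/p) l m^(2/p) and
    divided by [N], all powers cancel and a constant times [l] remains; [kap] makes that constant
    [beta]. The term with 1 / q is absorbed by [z]. *)
Lemma size_coupling (u rho q kap beta l : R) :
  0 <= u ->  0 < m -> m / 16 <= mi%:R -> 0 <= kap -> 0 < q -> 0 < beta -> 1 / 2 <= l ->
  r ^+ 2 * z ^+ 10 <= N -> 4 * u / beta <= z -> z <= q ->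
  kap * (8 * u * (32 * k0) `^ (2 / p)) <= beta ->
  rho <= q^-1 + kap * (N `^ (1 - 2 / p) * eps `^ (- (2 / p)) * l * m `^ (2 / p)) ->
  N0%:R ^+ 2 * (u * rho / N) <= beta * l.
Proof.
move=> u0 m0 mmi kap0 q0 b0 l2 rN bz zq kb rle.
have r0 : 0 < r by rewrite rE powR_gt0.
have n0 : N0%:R ^+ 2 <= (z * r) ^+ 2.
  by apply: lerXn2r; rewrite ?nnegrE ?ler0n ?mulr_ge0 ?(ltW zp) ?(ltW r0)//; exact: size_le.
have E1 : N0%:R ^+ 2 * (u * q^-1 / N) <= beta / 4.
  have zn : N0%:R ^+ 2 / N <= 1.
    rewrite ler_pdivrMr// mul1r; apply: (le_trans n0); apply: le_trans rN.
    rewrite exprMn mulrC; apply: ler_wpM2l; first exact: sqr_ge0.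
    by rewrite -[10%N]/(2 + 8)%N exprD ler_peMr ?exprn_ge0 ?(ltW zp)// exprn_ege1.
  have qz : u / q <= beta / 4.
    rewrite ler_pdivrMr//; move: bz; rewrite ler_pdivrMr// => bz.
    have : beta * z <= beta * q by rewrite ler_pM2l.
    by move: bz; rewrite [z * _]mulrC; lra.
  have -> : N0%:R ^+ 2 * (u * q^-1 / N) = (N0%:R ^+ 2 / N) * (u / q) by ring.
  rewrite -[leRHS]mul1r; apply: ler_pM zn qz; last by rewrite divr_ge0// ltW.
  by rewrite divr_ge0 ?sqr_ge0// ltW.
set U := N `^ (1 - 2 / p) * eps `^ (- (2 / p)) * l * m `^ (2 / p).
have U0 : 0 <= U by rewrite !mulr_ge0 ?powR_ge0//; lra.
have E2 : N0%:R ^+ 2 * U <= 4 * (32 * k0) `^ (2 / p) * (N * l).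
  have y2 : y ^+ 2 <= ((32 * k0) * (eps * N / m)) `^ (2 / p).
    rewrite yE -powR_mulrn ?powR_ge0// -powRrM [p^-1 * _]mulrC; apply: ge0_ler_powR.
    - by rewrite divr_ge0// ltW.
    - by rewrite nnegrE divr_ge0// !mulr_ge0// ?(ltW eps0) ?(ltW N_gt0)// (le_trans ler01 k01).
    - rewrite nnegrE; apply: mulr_ge0; first by apply: mulr_ge0 => //; exact: le_trans ler01 k01.
      by rewrite divr_ge0 ?(ltW m0)// mulr_ge0 ?(ltW eps0) ?(ltW N_gt0).
    have -> : 2 * k0 * eps * N / mi%:R = 2 * k0 * (eps * N) * mi%:R^-1 by ring.
    have -> : 32 * k0 * (eps * N / m) = 2 * k0 * (eps * N) * (16 / m) by ring.
    apply: ler_wpM2l.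
      by rewrite !mulr_ge0// ?(ltW eps0) ?(ltW N_gt0)// (le_trans ler01 k01).
    rewrite -[16 / m]invrK lef_pV2 ?posrE ?invr_gt0 ?divr_gt0//.
    by rewrite invf_div; exact: mmi.
  have k32 : 0 <= 32 * k0 by apply: mulr_ge0 => //; exact: le_trans ler01 k01.
  have enm : 0 <= eps * N / m by rewrite divr_ge0 ?(ltW m0)// mulr_ge0 ?(ltW eps0) ?(ltW N_gt0).
  have EU : (eps * N / m) `^ (2 / p) * U = N * l.
    have m1 : m^-1 `^ (2 / p) * m `^ (2 / p) = 1.
      by rewrite -powRM ?invr_ge0 ?(ltW m0)// mulVf ?gt_eqF// powR1.
    have e1 : eps `^ (2 / p) * eps `^ (- (2 / p)) = 1 by rewrite powRN mulfV// gt_eqF// powR_gt0.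
    have n1 : N `^ (2 / p) * N `^ (1 - 2 / p) = N.
      by rewrite -powRD; [rewrite addrC subrK powRr1// ltW|rewrite [N == 0]gt_eqF ?implybT].
    have eN : 0 <= eps * N by rewrite mulr_ge0 ?(ltW eps0) ?(ltW N_gt0).
    rewrite powRM ?invr_ge0 ?(ltW m0)// powRM ?(ltW eps0) ?(ltW N_gt0)// /U.
    exact: (cancel_rates _ e1 m1 n1).
  have n4 : N0%:R ^+ 2 <= 4 * y ^+ 2.
    have -> : 4 * y ^+ 2 = (2 * y) ^+ 2 by ring.
    by apply: lerXn2r; rewrite ?nnegrE ?ler0n ?mulr_ge0 ?(le_trans ler01 y1)//; exact: size_le2.
  apply: (@le_trans _ _ (4 * ((32 * k0) * (eps * N / m)) `^ (2 / p) * U)).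
    by apply: ler_wpM2r => //; apply: (le_trans n4); apply: ler_wpM2l.
  by rewrite powRM// -EU -!mulrA.
have E3 : N0%:R ^+ 2 * (u * (kap * U) / N) <= beta / 2 * l.
  have -> : N0%:R ^+ 2 * (u * (kap * U) / N) = u * kap * (N0%:R ^+ 2 * U) / N by ring.
  rewrite ler_pdivrMr//.
  apply: (le_trans (ler_wpM2l (mulr_ge0 u0 kap0) E2)).
  have Nl : 0 <= N * l by rewrite mulr_ge0// ?(ltW N_gt0)//; lra.
  have := ler_wpM2r Nl kb; move: (_ `^ _) => v.
  have -> : kap * (8 * u * v) * (N * l) = 2 * (u * kap * (4 * v * (N * l))) by ring.
  have -> : beta * (N * l) = 2 * (beta / 2 * l * N) by field.
  by rewrite ler_pM2l.
apply: (@le_trans _ _ (N0%:R ^+ 2 * (u * q^-1 / N) + N0%:R ^+ 2 * (u * (kap * U) / N))).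
  rewrite -mulrDr -mulrDl -mulrDr; apply: ler_wpM2l; first exact: sqr_ge0.
  by rewrite ler_wpM2r ?invr_ge0 ?(ltW N_gt0)// ler_wpM2l.
apply: (le_trans (lerD E1 E3)); have : beta / 2 * (1 / 2) <= beta / 2 * l by rewrite ler_pM2l ?divr_gt0.
by lra.
Qed.
End DenseSize.

(* Every logarithmic factor is absorbed by a small power of [N]. *)
Lemma log_absorbed (R : realType) (t a C : R) : 0 < t -> 0 < a -> 0 <= C -> exists N0 : R, 1 <= N0 /\
  forall N, N0 <= N -> [/\ C <= N `^ t, C * ln N <= N `^ t & C * ln N `^ a <= N `^ t].
Proof.
move=> t0 a0 C0.
have [h h0 ->] : exists2 h, 0 < h & t = h + h by exists (t / 2); [rewrite divr_gt0|rewrite -splitr].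
have key b N : 0 < b -> 1 <= N -> ln N `^ b <= (b / h) `^ b * N `^ h.
  move=> b0 N1; have l0 := ln_ge0 N1.
  have := powR_le_expR b0 (mulr_ge0 (ltW h0) l0).
  have -> : expR (h * ln N) = N `^ h by rewrite /powR gt_eqF// (lt_le_trans ltr01).
  rewrite (powRM _ (ltW h0) l0) => H.
  have hb : 0 < h `^ b by rewrite powR_gt0.
  have e : h `^ b * (b / h) `^ b = b `^ b.
    by rewrite -powRM ?divr_ge0 ?(ltW h0) ?(ltW b0)// [h * _]mulrC mulfVK ?gt_eqF.
  by rewrite -(ler_pM2l hb) mulrA e.
have P1 := powR_ge0 (1 / h) 1; have Pa := powR_ge0 (a / h) a.
have M1 := mulr_ge0 C0 P1; have Ma := mulr_ge0 C0 Pa.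
pose D := 1 + C + C * (1 / h) `^ 1 + C * (a / h) `^ a.
have D1 : 1 <= D by rewrite /D; lra.
have D0 : 0 < D := lt_le_trans ltr01 D1.
have hi : 0 <= h^-1 by rewrite invr_ge0 ltW.
have E1 : 1 <= D `^ h^-1 by rewrite -[leLHS](powRr0 D) ler_powR.
exists (D `^ h^-1); split=> // N NN; have N1 := le_trans E1 NN.
have N0 : 0 < N := lt_le_trans ltr01 N1.
have DN : D <= N `^ h.
  rewrite -[leLHS]powRr1 ?(ltW D0)// -[X in D `^ X](mulVf (lt0r_neq0 h0)) powRrM.
  by apply: ge0_ler_powR; rewrite ?nnegrE ?powR_ge0 ?(ltW h0) ?(ltW N0).
have sq : N `^ (h + h) = N `^ h * N `^ h by rewrite powRD// [N == 0]gt_eqF ?implybT.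
have z1 : 1 <= N `^ h := le_trans D1 DN.
have k1 := key 1 N ltr01 N1; rewrite [ln N `^ 1]powRr1 ?ln_ge0// in k1; have ka := key a N a0 N1.
have absorb x v : x <= v * N `^ h -> C * v <= D -> C * x <= N `^ (h + h).
  move=> xv Cv; apply: (@le_trans _ _ (C * (v * N `^ h))); first exact: ler_wpM2l.
  by rewrite sq mulrA; apply: ler_wpM2r; [exact: powR_ge0|exact: le_trans Cv DN].
split.
- rewrite sq; apply: le_trans (_ : D <= _); first by rewrite /D; lra.
  by apply: (le_trans DN); rewrite ler_peMl ?powR_ge0.
- by apply: (absorb _ _ k1); rewrite /D; lra.
- by apply: (absorb _ _ ka); rewrite /D; lra.
Qed.

Lemma dense_rate (R : realType) (p : R) : 2 < p -> exists t : R,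
  [/\ 0 < t, 2 / p + 10 * t <= 1 & 8 * t <= p^-1].
Proof.
move=> p2; have p0 : 0 < p by apply: lt_trans p2.
have i0 : 0 < p^-1 by rewrite invr_gt0.
have i1 : 2 * p^-1 < 1 by rewrite ltr_pdivrMr ?mul1r.
(* With i = 1 / p, the slack 1 - 2 i - 10 t equals (1 - 2 i)(1 - i), which is positive because p >
   2. *)
exists (p^-1 * (1 - 2 * p^-1) / 10); move: i0 i1; move: (p^-1) => i i0 i1.
have h : 0 < 1 - 2 * i by lra.
split; [by rewrite divr_gt0// mulr_gt0|nra|nra].
Qed.

Lemma dense_powers (R : realType) (p t N : R) : 2 < p -> 2 / p + 10 * t <= 1 -> 8 * t <= p^-1 -> 1 <= N ->
  (N `^ t) ^+ 8 <= N `^ p^-1 /\ (N `^ p^-1) ^+ 2 * (N `^ t) ^+ 10 <= N.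
Proof.
move=> p2 t10 t8 N1; have N0 : 0 < N := lt_le_trans ltr01 N1.
rewrite -!powR_mulrn ?powR_ge0// -!powRrM; split; first by apply: ler_powR => //; rewrite mulrC.
rewrite -powRD ?[N == 0]gt_eqF ?implybT// -[leRHS]powRr1 ?(ltW N0)//.
by apply: ler_powR => //; apply: le_trans t10; rewrite [p^-1 * _]mulrC [t * _]mulrC.
Qed.

Lemma dense_const_le (R : realType) (z : R) : 400 * 1000 <= z ->
  [/\ 3 * 2000%:R <= z, 1000 <= z, 400 <= z & 2 <= z].
Proof. by move=> z4; split; lra. Qed.

Lemma dense_cC_le (R : realType) (p c e x : R) : 2 < p -> 100 * p <= c -> 0 <= e * x -> e * x <= e * (c * x) / 20.
Proof.
move=> p2 pc ex; have -> : e * (c * x) / 20 = c / 20 * (e * x) by ring.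
by rewrite ler_peMl//; lra.
Qed.

Lemma size_scaled (R : realType) (z N0 : R) : 400 * 1000 <= z -> z ^+ 6 <= N0 -> z ^+ 5 <= N0 / (50 * 100).
Proof.
move=> zC H; have z5 : 50 * 100 <= z by lra.
have c0 : 0 < 50 * 100 :> R by lra.
rewrite ler_pdivlMr//; apply: le_trans H; rewrite [z ^+ 6]exprSr; apply: ler_wpM2l z5.
by apply: exprn_ge0; lra.
Qed.

Section DenseCore.
Variables (R : realType) (p a t cC k0 beta kap : R) (dg : nat).
Hypotheses (p2 : 2 < p) (t10 : 2 / p + 10 * t <= 1) (t8 : 8 * t <= p^-1).
Hypotheses (cCp : 100 * p <= cC) (k0E : k0 = (10 * (2 * cC)) `^ p) (k01 : 1 <= k0).
Hypotheses (dgt : 2 <= t * dg%:R) (bt : dg%:R * 400 * beta <= t) (b0 : 0 < beta) (b1 : beta <= 1).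
Hypotheses (kap0 : 0 < kap) (kb : kap * (8 * 2000%:R * (32 * k0) `^ (2 / p)) <= beta).
Variables (n q W S : nat) (eps delta : R) (d : measure_display) (T : measurableType d).
Variables (P : probability T R) (A : rand_stream_alg R n T).
Local Notation N := (n%:R : R).
Local Notation z := (N `^ t).
Local Notation r := (N `^ p^-1).
Local Notation m := (ln (1 / delta)).
Local Notation rate := (N `^ (1 - 2 / p) * eps `^ (- (2 / p)) * ln N * m `^ (2 / p)).
Hypotheses (zC : 400 * 1000 <= z) (k0z : 4 * k0 <= z) (bz : 4 * 2000%:R / beta <= z).
Hypotheses (lz : 2 * ln N <= z) (laz : 4 * ln N `^ a <= z).
Hypotheses (n2 : (2 <= n)%N) (eps01 : 0 < eps < 1) (epsl : 1 <= eps * (2 * ln N)).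
Hypotheses (delta0 : 0 < delta) (delta2 : delta < 1 / 2) (mla : m <= ln N `^ a).
Hypotheses (nq : (n <= q)%N) (dq : delta^-1 <= q%:R) (qW : (q ^ 100 <= W)%N).
Hypotheses (ub : uses_bits A S) (est : estimates_lp_norm P A p eps delta W).

Lemma dense_core : kap / 160 * (rate * ln W%:R) <= S%:R.
Proof.
rewrite leNgt; apply/negP => Slt.
have n0 : (0 < n)%N by apply: leq_trans n2.
have nR : 0 < N by rewrite ltr0n.
have N1 : 1 <= N by rewrite ler1n.
have /andP[e0 e1] := eps01.
have [z6000 z1000 z400 z2] := dense_const_le zC.
have z1 : 1 <= z := le_trans (ler1n R 2) z2.
have zp : 0 < z := lt_le_trans ltr01 z1.
have [zr rN] := dense_powers p2 t10 t8 N1.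
have r0 : 0 < r by rewrite powR_gt0.
have zN : z <= N.
  apply: le_trans rN; have r1 : 1 <= r by apply: le_trans zr; exact: exprn_ege1.
  rewrite -[X in X <= _]mul1r; apply: ler_pM => //; first exact: exprn_ege1.
  by rewrite -[leLHS]expr1; apply: ler_weXn2l.
have l2 : 1 / 2 <= ln N.
  have := @ln_le_sub1 R N^-1; rewrite invr_gt0 lnV ?posrE// => /(_ nR).
  have : N^-1 <= 2^-1 by rewrite lef_pV2 ?posrE// ler_nat.
  by lra.
have l0 : 0 <= ln N by apply: le_trans l2.
have m2 := ln_inv_ge delta0 delta2; have m0 : 0 < m by apply: lt_le_trans m2.
have [mi [mi1 miA miB m16 mile]] := word_length m2.
have miz : mi%:R <= z.
  apply: (le_trans mile); apply: le_trans laz.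
  apply: (@le_trans _ _ (2 * ln N `^ a)); first by rewrite ler_pM2l.
  by have := powR_ge0 (ln N) a; lra.
have ez : 1 <= eps * z by apply: (le_trans epsl); rewrite ler_pM2l.
pose y := (2 * k0 * eps * N / mi%:R) `^ p^-1.
have [N0 /andP[N0y N0y1]] := ceil_nat (powR_ge0 (2 * k0 * eps * N / mi%:R) p^-1).
rewrite -/y in N0y N0y1.
have N06 := size_ge p2 z1 N1 erefl e0 ez mi1 miz k01 erefl zr N0y.
have N0r := size_le p2 z1 N1 erefl e0 e1 ez mi1 miz k01 k0z erefl zr N0y1.
have N00 := size_gt0 p2 z1 N1 erefl e0 ez mi1 miz k01 erefl zr N0y.
have qR : N <= q%:R by rewrite ler_nat.
have qz : z <= q%:R := le_trans zN qR.
have q400 : (400 <= q)%N by rewrite -(ler_nat R); exact: le_trans z400 qz.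
have q0 : 0 < (q%:R : R) := lt_le_trans zp qz.
have [L [qL LW WL]] := stream_base R (leq_trans (isT : (2 <= 400)%N) q400) qW.
have q10 : (10 * q <= L)%N.
  apply: leq_trans qL; rewrite [(q ^ 5)%N]expnSr leq_mul2r; apply/orP; right.
  by rewrite (leq_trans (_ : _ <= q)%N) ?(leq_trans _ q400)// -[X in (X <= _)%N]expn1 leq_pexp2l// (leq_trans _ q400).
have qLe : (q <= L)%N by apply: leq_trans q10; rewrite leq_pmull.
have rate0 : 0 <= rate by rewrite !mulr_ge0 ?powR_ge0.
pose rho := q%:R^-1 + kap * rate.
have rho0 : 0 < rho by rewrite ltr_pwDl ?invr_gt0// mulr_ge0// ltW.
have eta := size_coupling p2 z1 N1 erefl e0 e1 ez mi1 miz k01 k0z erefl zr N0y1 (ler0n R 2000)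
  m0 m16 (ltW kap0) q0 b0 l2 rN bz qz kb (lexx rho).
set hm := 2000%:R * rho / N in eta.
have hm0 : 0 <= hm by apply: (divr_ge0 _ (ltW nR)); exact: (mulr_ge0 (ler0n R 2000) (ltW rho0)).
have etaz : N0%:R ^+ 2 * hm <= z.
  apply: (le_trans eta); apply: (@le_trans _ _ (1 * ln N)); first exact: ler_wpM2r.
  by rewrite mul1r; apply: le_trans lz; rewrite ler_peMl// ler1n.
have dm := degree_mass zC r0 (ler0n R 400) (ler0n R 1000) (ler0n R mi) (ler0n R N0) hm0 zC miz N0r etaz.
have dm0 : 0 <= mi%:R * ((400 * N0%:R ^+ 2 * (1000 * mi%:R)) ^+ 2 * hm) := mulr_ge0 (ler0n R mi) (mulr_ge0 (sqr_ge0 _) hm0).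
have A20 : 0 <= N0%:R ^+ 2 * (mi%:R ^+ 2 * hm) := mulr_ge0 (sqr_ge0 _) (mulr_ge0 (sqr_ge0 _) hm0).
have A23 : N0%:R ^+ 2 * (mi%:R ^+ 2 * hm) <= z ^+ 3.
  rewrite mulrCA [z ^+ 3]exprSr; apply: ler_pM etaz; [exact: sqr_ge0|exact: (mulr_ge0 (sqr_ge0 _) hm0)|].
  by apply: lerXn2r => //; rewrite nnegrE ?ler0n// ltW.
have qi : q%:R^-1 <= 1 :> R by rewrite invf_le1// (le_trans z1 qz).
have q5 : z ^+ 5 <= q%:R.
  apply: le_trans qR; apply: le_trans rN.
  have r1 : 1 <= r by apply: le_trans zr; exact: exprn_ege1.
  rewrite -[X in X <= _]mul1r; apply: ler_pM => //; [exact: exprn_ege1|exact: ler_weXn2l].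
have r1 : 1 <= r by apply: le_trans zr; exact: exprn_ege1.
have N0q : (N0 <= q)%N.
  rewrite -(ler_nat R); apply: (le_trans N0r); apply: le_trans qR; apply: le_trans rN.
  rewrite mulrC; apply: ler_pM; [exact: ltW|exact: ltW| |].
    by rewrite -[leLHS]expr1; apply: ler_weXn2l.
  by rewrite -[leLHS]expr1; apply: ler_weXn2l.
have lzN : ln N <= z by apply: le_trans lz; rewrite ler_peMl// ler1n.
have HE : eps * (10 * (2 * (cC * r))) `^ p < mi%:R * N0%:R `^ p.
  have -> : 10 * (2 * (cC * r)) = 10 * (2 * cC) * r by ring.
  apply: (size_energy p2 z1 N1 erefl e0 ez mi1 miz k01 erefl zr N0y _ k0E).
  apply: (mulr_ge0 (ler0n R 10) (mulr_ge0 (ler0n R 2) _)).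
  by apply: le_trans cCp; exact: (mulr_ge0 (ler0n R 100) (ltW (lt_trans (ltr0Sn R 1) p2))).
have er7 : z ^+ 5 <= eps * r.
  apply: (@le_trans _ _ (eps * z * z ^+ 5)); first by rewrite ler_peMl// exprn_ge0// ltW.
  rewrite -[leLHS]mulrA ler_pM2l// -exprS; apply: le_trans zr; exact: ler_weXn2l.
have Hw : z ^+ 5 <= eps * (cC * r) / 20.
  apply: (le_trans er7); apply: (dense_cC_le p2 cCp).
  exact: ltW (mulr_gt0 e0 r0).
have HwN : z ^+ 5 <= N0%:R / (50 * 100).
  exact: size_scaled zC N06.
have deg1 : mi%:R * (z * ((400 * N0%:R ^+ 2 * (1000 * mi%:R)) ^+ 2 * hm)) <= N / 2.
  rewrite mulrCA [leLHS]mulrC; exact: (degree_lt rN (ltr0Sn R 1) z2 dm0 (ltW zp) (lexx _) dm).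
(* The log n factor is gained here: a coupling may be as large as a constant times ln n, because
   [dg] of them together cost only exp (t ln n) = z. *)
have pm : dg%:R * (400 * N0%:R ^+ 2 * hm) <= t * ln N.
  rewrite -[400 * _ * _]mulrA mulrA.
  apply: (le_trans (ler_wpM2l (mulr_ge0 (ler0n R dg) (ler0n R 400)) eta)).
  by rewrite mulrA; apply: ler_wpM2r.
have deg2 : mi%:R * ((400 * N0%:R ^+ 2 * (1000 * mi%:R)) ^+ 2 * hm) *
    expR (dg%:R * (400 * N0%:R ^+ 2 * hm)) <= N / 1000.
  have ez' : expR (dg%:R * (400 * N0%:R ^+ 2 * hm)) <= z by rewrite /powR gt_eqF// ler_expR.
  exact: (degree_lt rN (ltr0Sn R 999) z1000 dm0 (expR_ge0 _) ez' dm).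
have kcN : 3 * 2000%:R * N <= z ^+ dg.+1.
  apply: (@le_trans _ _ (z * N)); first by rewrite ler_pM2r.
  rewrite exprS; apply: (ler_wpM2l (ltW zp)).
  rewrite -powR_mulrn ?powR_ge0// -powRrM -[leLHS]powRr1 ?ler0n//; apply: ler_powR => //.
  exact: le_trans (ler1n R 2) dgt.
have inst := dense_inst (L := L) (q := q) (kc := z) (dg := dg) (N0 := N0) n0 q400 qL eps01 delta0 p2 cCp mi1 miA miB N0q N00 rho0
  (weight_tail zC nR lzN N06) HE
  (shift_small zC A23 qi Hw) (shift_small zC A23 qi HwN) (shift_err zC A20 A23 q5) z1 deg1 kcN deg2.
have trle H : \tr H <= q%:R^-1 + 4 * S%:R / ln L%:R -> \tr H <= rho :> R.
  move=> tH; apply: (le_trans tH); rewrite /rho lerD2l.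
  apply: (trace_rate _ WL (mulr_ge0 (ltW kap0) rate0)).
    by apply: ln_gt0; rewrite ltr1n (leq_trans _ qLe)// (leq_trans _ q400).
  by move: Slt => /ltW; rewrite mulrA [kap / 160 * _]mulrAC.
have miq : (mi <= q)%N by rewrite -(ler_nat R) (le_trans miz qz).
have cap k : (k <= mi)%N -> (L ^ 4 * N0 * k <= L ^ 6)%N.
  move=> kmi; rewrite (expnD L 4 2) -mulnA leq_mul2l -[(L ^ 2)%N]/(L * L)%N; apply/orP; right.
  by apply: leq_mul; rewrite (leq_trans _ qLe)// (leq_trans kmi).
have stepL : (mi * (L ^ 4 * N0) <= L ^ 5)%N.
  rewrite mulnCA (expnSr L 4) leq_mul2l; apply/orP; right.
  rewrite (leq_trans _ qL)// (leq_trans (leq_mul miq N0q))// (expnD q 2 3) leq_pmulr//.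
  by rewrite expn_gt0 (leq_trans _ q400).
have nm : 0 < N ^+ mi by rewrite exprn_gt0.
apply: (no_test n0 nq q400 qL ub est LW e0 delta0 delta2 dq (J := unit) (I := {ffun 'I_mi -> 'I_n})
  (wJ := fun=> 1) (pi := fun=> N ^- mi) (xb := fun=> 0) (y := dense_step L N0)).
- by [].
- by rewrite big_const card_unit /= addr0.
- by move=> _; rewrite invr_ge0 ltW.
- by rewrite sumr_const card_ffun !card_ord -[LHS]mulr_natl natrX mulfV ?gt_eqF.
- by move=> j i; rewrite mxE normr0.
- move=> j f i; rewrite dense_entry lez_nat; apply: cap.
  exact: occ_le.
- move=> j f; rewrite /dense_step map_mx_sum.
  apply: (le_trans (norm2_sum_le (b := (L ^ 4 * N0)%:R ^+ 2) _)).
    by move=> l; rewrite map_intr_delta norm2Z norm2_unit mulr1.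
  rewrite card_ord -exprMn; apply: lerXn2r; rewrite ?nnegrE ?exprn_ge0 ?mulr_ge0 ?ler0n//.
  by rewrite -natrX -natrM ler_nat.
move=> H Sg w rl trH werr.
exact: (inst _ _ _ rl (trle _ _ trH) werr).
Qed.
End DenseCore.

Lemma dense_absorb_const (R : realType) (C u : R) : 400 * 1000 <= C -> 0 <= u -> 2 * u <= C * u /\ 4 * u <= C * u.
Proof. by move=> hC u0; split; apply: ler_wpM2r => //; lra. Qed.

Lemma dense_bound (R : realType) (p a : R) : 2 < p -> 0 < a -> exists c n0 : R, 0 < c /\
  forall (n q W S : nat) (eps delta : R) (d : measure_display) (T : measurableType d)
    (P : probability T R) (A : rand_stream_alg R n T),
  n0 <= n%:R -> (2 <= n)%N -> 0 < eps < 1 -> 1 <= eps * (2 * ln n%:R) -> 0 < delta -> delta < 1 / 2 ->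
  ln (1 / delta) <= ln n%:R `^ a ->
  (n <= q)%N -> delta^-1 <= q%:R -> (q ^ 100 <= W)%N ->
  uses_bits A S -> estimates_lp_norm P A p eps delta W ->
  c * (n%:R `^ (1 - 2 / p) * eps `^ (- (2 / p)) * ln n%:R * ln (1 / delta) `^ (2 / p) * ln W%:R) <= S%:R.
Proof.
move=> p2 a0; have [t [t0 t10 t8]] := dense_rate p2.
have p0 : 0 < p by apply: lt_trans p2.
have [cC cCp cC1] : exists2 cC, 100 * p <= cC & 1 <= cC.
  by exists (1 + 100 * p); [rewrite lerDr|rewrite lerDl; exact: (mulr_ge0 (ler0n _ 100) (ltW p0))].
have cC0 := le_trans ler01 cC1.
have k11 : 1 <= 10 * (2 * cC).
  by rewrite mulrA -[leLHS](mulr1 1); apply: ler_pM => //; rewrite -natrM ler1n.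
have [k0 k0E k01] : exists2 k0, k0 = (10 * (2 * cC)) `^ p & 1 <= k0.
  eexists; first by []; rewrite -[leLHS](powRr0 (10 * (2 * cC))); apply: ler_powR => //; exact: ltW.
have t20 : 0 < 2 / t by rewrite divr_gt0.
have [dg /andP[dg1 _]] := ceil_nat (ltW t20).
have dg0 : 0 < dg%:R :> R by apply: lt_le_trans dg1.
have dgt : 2 <= t * dg%:R by rewrite mulrC -ler_pdivrMr.
have dg400 : 0 < dg%:R * 400 :> R := mulr_gt0 dg0 (ltr0Sn R 399).
(* [dg] is fixed first, by t dg >= 2, so that z^dg >= n; then [beta] keeps [dg] couplings below t ln
   n, and [kap] is adapted to [beta]. *)
have [beta [b0 b1 bt]] : exists beta, [/\ 0 < beta, beta <= 1 & dg%:R * 400 * beta <= t].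
  exists (Num.min 1 (t / (dg%:R * 400))); split.
  - by rewrite lt_min ltr01; exact: divr_gt0 t0 dg400.
  - by rewrite ge_min lexx.
  - by rewrite mulrC -(ler_pdivlMr _ _ dg400) ge_min lexx orbT.
have v0 : 0 < 8 * 2000%:R * (32 * k0) `^ (2 / p).
  apply: mulr_gt0; first exact: (mulr_gt0 (ltr0Sn R 7) (ltr0Sn R 1999)).
  by rewrite powR_gt0//; exact: (mulr_gt0 (ltr0Sn R 31) (lt_le_trans ltr01 k01)).
have [kap kap0 kb] : exists2 kap, 0 < kap & kap * (8 * 2000%:R * (32 * k0) `^ (2 / p)) <= beta.
  exists (beta / (8 * 2000%:R * (32 * k0) `^ (2 / p))); first exact: divr_gt0 b0 v0.
  by rewrite mulfVK; [exact: lexx|exact: lt0r_neq0 v0].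
have [C [Ca Cb Cc]] := ex_ub3 (400 * 1000) (4 * k0) (4 * 2000%:R / beta).
have C0 : 0 <= C := le_trans (mulr_ge0 (ler0n R 400) (ler0n R 1000)) Ca.
have [Nl [Nl1 big]] := log_absorbed t0 a0 C0.
exists (kap / 160), Nl; split; first exact: (divr_gt0 kap0 (ltr0Sn R 159)).
move=> n q W S eps delta d T P A nn n2 eps01 epsl d0 d2 mla nq dq qW ub est.
have [zC lz laz] := big _ nn.
have l0 : 0 <= ln n%:R :> R by apply: ln_ge0; rewrite ler1n (leq_trans _ n2).
have [lz' _] := dense_absorb_const Ca l0; have [_ laz'] := dense_absorb_const Ca (powR_ge0 (ln n%:R) a).
exact: (dense_core p2 t10 t8 cCp k0E k01 dgt bt b0 b1 kap0 kb (le_trans Ca zC) (le_trans Cb zC)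
  (le_trans Cc zC) (le_trans lz' lz) (le_trans laz' laz) n2 eps01 epsl d0 d2 mla nq dq qW ub est).
Qed.

(** * Comparison of the two rates and conclusion *)

Lemma ex_lb3 (R : realType) (a b c : R) : 0 < a -> 0 < b -> 0 < c ->
  exists u, [/\ 0 < u, u <= a, u <= b & u <= c].
Proof.
move=> a0 b0 c0; exists (Num.min a (Num.min b c)).
by rewrite !lt_min a0 b0 c0 !ge_min !lexx !orbT.
Qed.

Lemma min_scale (R : realType) (k x y N : R) : 1 <= k -> 0 <= N -> x <= k * y ->
  Num.min x N <= k * Num.min y N.
Proof.
move=> k1 N0 xy; have k0 := le_trans ler01 k1.
rewrite minr_pMr// le_min !ge_min xy /=.
by rewrite ler_peMl// orbT.
Qed.

Section Rates.
Variables (R : realType) (p N e m : R).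
Hypotheses (p2 : 2 < p) (N1 : 1 <= N) (e0 : 0 < e) (e1 : e < 1) (m2 : 1 / 2 <= m).
Local Notation b := (2 / p).
Local Notation rateA := (N `^ (1 - b) * e `^ (- b) * ln N * m `^ b).
Local Notation rateB := (N `^ (1 - b) * e ^- 2 * m).

Let p0 : 0 < p. Proof. by apply: lt_trans p2. Qed.
Let m0 : 0 < m. Proof. by apply: lt_le_trans m2. Qed.
Let b0 : 0 < b. Proof. exact: divr_gt0. Qed.
Let b1 : b < 1. Proof. by rewrite ltr_pdivrMr// mul1r. Qed.
Let l0 : 0 <= ln N. Proof. exact: ln_ge0. Qed.

Lemma rateB_gt0 : 0 < rateB.
Proof. by rewrite !mulr_gt0 ?powR_gt0 ?invr_gt0 ?exprn_gt0// (lt_le_trans ltr01). Qed.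

(** The quotient of the two rates is ln N e^(2 - b) / m^(1 - b): the first dominates only if [e] is
    not too small and [m] not too large. *)
Lemma rate_trade : rateA * m `^ (1 - b) = rateB * (ln N * e `^ (2 - b)).
Proof.
have em : m `^ b * m `^ (1 - b) = m.
  by rewrite -powRD ?[m == 0]gt_eqF ?implybT// addrC subrK powRr1// ltW.
have ee : e `^ (2 - b) = e ^+ 2 * e `^ (- b).
  by rewrite powRD ?[e == 0]gt_eqF ?implybT// -powR_mulrn// ltW.
rewrite ee -[in RHS]em; move: (_ `^ _) (_ `^ _) (_ `^ _) (_ `^ _) => x y z t.
by field; rewrite gt_eqF.
Qed.

Let half_le : 1 / 2 <= m `^ (1 - b).
Proof.
have c0 : 0 <= 1 - b by rewrite subr_ge0 ltW.
apply: (@le_trans _ _ ((1 / 2) `^ (1 - b))); last first.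
  by apply: ge0_ler_powR; rewrite ?nnegrE ?(ltW m0)// divr_ge0.
have a0 : 0 < 2 `^ (1 - b) :> R by rewrite powR_gt0.
have h : 2 * (1 / 2) = 1 :> R by lra.
rewrite -(ler_pM2l a0) -powRM ?divr_ge0// h powR1 mulrA mulr1 ler_pdivrMr// mul1r.
by rewrite -[leRHS]powRr1// ler_powR ?ler1n// gerBl ltW.
Qed.

Let e_le : e `^ (2 - b) <= e.
Proof.
rewrite /powR gt_eqF// -[leRHS]lnK ?posrE// ler_expR.
by have := ln_le0 (ltW e1); move: b1; nra.
Qed.

Lemma rate_small (C : R) : ln N <= C -> rateA <= 2 * C * rateB.
Proof.
move=> lC; have B0 := rateB_gt0.
have A0 : 0 <= rateA by rewrite !mulr_ge0// powR_ge0.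
have H1 : rateA * (1 / 2) <= rateA * m `^ (1 - b) := ler_wpM2l A0 half_le.
have H2 : rateB * (ln N * e `^ (2 - b)) <= rateB * (C * 1).
  apply: (ler_wpM2l (ltW B0)); apply: ler_pM => //; first exact: powR_ge0.
  exact: le_trans e_le (ltW e1).
by move: H1; rewrite rate_trade => /le_trans/(_ H2); lra.
Qed.

(** Where the first rate dominates, 1 / e and [m] are polylogarithmic in [N], which is the regime of
    [dense_bound]. *)
Lemma rate_regime : rateB < rateA -> 1 <= e * (2 * ln N) /\ m <= ln N `^ (1 - b)^-1.
Proof.
move=> BA; have B0 := rateB_gt0.
have h : 0 < m `^ (1 - b) by rewrite powR_gt0.
have H : m `^ (1 - b) < ln N * e `^ (2 - b).
  by rewrite -(ltr_pM2l B0) -rate_trade ltr_pM2r.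
split.
  have := le_trans half_le (le_trans (ltW H) (ler_wpM2l l0 e_le)); lra.
have c0 : 0 < 1 - b by rewrite subr_gt0.
rewrite -[leLHS]powRr1 ?(ltW m0)// -[X in m `^ X](mulfV (lt0r_neq0 c0)) powRrM.
apply: ge0_ler_powR; rewrite ?nnegrE ?powR_ge0 ?invr_ge0 ?(ltW c0)//.
apply: (le_trans (ltW H)); rewrite ler_piMr//; exact: le_trans e_le (ltW e1).
Qed.

(** The spike test needs e n^(1/p) >= 1. A smaller accuracy parameter is relaxed to n^(-1/p), where
    the spike bound is already of order [n]; the factor 2 is due to m >= 1/2. *)
Lemma rateB_clip e' : e' = Num.max e (N `^ p^-1)^-1 ->
  Num.min rateB N <= 2 * Num.min (N / (e' * N `^ p^-1) ^+ 2 * m) N.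
Proof.
move=> ->; have N0 := lt_le_trans ltr01 N1; have r0 : 0 < N `^ p^-1 by rewrite powR_gt0.
have [er|re] := leP e (N `^ p^-1)^-1.
  rewrite mulVf ?gt_eqF// expr1n divr1; apply: (@le_trans _ _ N); first by rewrite ge_min lexx orbT.
  rewrite minr_pMr// le_min; apply/andP; split; last by rewrite ler_peMl ?(ltW N0)// ler1n.
  by rewrite mulrCA ler_peMr ?(ltW N0)//; move: m2; lra.
apply: min_scale; rewrite ?ler1n ?(ltW N0)//.
have r2 : (N `^ p^-1) ^+ 2 = N `^ b by rewrite -powR_mulrn ?powR_ge0// -powRrM mulrC.
have Nb : N `^ (1 - b) = N / N `^ b.
  rewrite powRD ?[N == 0]gt_eqF ?implybT// powRr1 ?(ltW N0)//; congr (_ * _).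
  by rewrite powRN.
have E : N `^ (1 - b) * e ^- 2 * m = N / (e * N `^ p^-1) ^+ 2 * m.
  have v0 : N `^ b != 0 by rewrite gt_eqF// powR_gt0.
  by rewrite Nb exprMn r2; field; rewrite v0 gt_eqF.
by rewrite E ler_peMl ?ler1n// mulr_ge0 ?(ltW m0)// divr_ge0 ?sqr_ge0 ?(ltW N0).
Qed.

End Rates.

(** The ceiling of n / delta is at most (n / delta)^2, so its 100th power is at most (n /
    delta)^200. *)
Lemma modulus_choice (R : realType) (n W Q0 : nat) (delta : R) : (2 <= n)%N -> 0 < delta -> delta < 1 / 2 ->
  (n%:R / delta) `^ 200 <= W%:R -> (Q0 ^ 100 <= W)%N -> exists q : nat,
  [/\ (n <= q)%N, delta^-1 <= q%:R, (Q0 <= q)%N & (q ^ 100 <= W)%N].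
Proof.
move=> n2 d0 d2 nW QW.
have d1 : 1 <= delta^-1 by rewrite invf_ge1//; lra.
have N2 : 2 <= n%:R :> R by rewrite ler_nat.
have x2 : 2 <= n%:R / delta by rewrite -[leLHS]mulr1; apply: ler_pM.
have x0 : 0 <= n%:R / delta by apply: le_trans x2.
have [k /andP[k1 k2]] := ceil_nat x0.
have kx : k%:R <= (n%:R / delta) ^+ 2 by apply: (le_trans k2); move: x2; move: (_ / _) => x; nra.
have kW : (k ^ 100 <= W)%N.
  rewrite -(ler_nat R) natrX; apply: le_trans nW.
  rewrite -[200]/(200%N%:R) powR_mulrn// -[200%N]/(2 * 100)%N exprM.
  by apply: lerXn2r => //; rewrite nnegrE ?ler0n ?exprn_ge0.
exists (maxn Q0 k); split.
- by rewrite leq_max -(ler_nat R) -(ler_nat R n k) (le_trans _ k1) ?orbT// ler_peMr.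
- apply: (@le_trans _ _ k%:R); last by rewrite ler_nat leq_maxr.
  by apply: le_trans k1; rewrite ler_peMl ?invr_ge0 ?(ltW d0)// (le_trans _ N2)// ler1n.
- exact: leq_maxl.
- by rewrite /maxn; case: ifP.
Qed.

Lemma two_le_dim (R : realType) (n : nat) (delta : R) :
  2 `^ (- (n%:R `^ 1)) < delta -> delta < 1 / 2 -> (2 <= n)%N.
Proof.
case: n => [|[|n]]//; rewrite powRr1// => dl d2.
  by move: dl; rewrite oppr0 powRr0; lra.
by move: dl; rewrite powRN powRr1//; lra.
Qed.

Theorem theorem7p1p6 (R : realType) :
  exists c0 C0 : R, 0 < c0 /\ 0 < C0 /\
  forall p : R, 2 < p ->
  exists c : R, 0 < c /\
  forall (n W S : nat) (eps delta : R) (d : measure_display)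
      (T : measurableType d) (P : probability T R) (A : rand_stream_alg R n T),
    0 < eps < 1 ->
    2 `^ (- (n%:R `^ c0)) < delta ->
    delta < 1 / 2 ->
    (n%:R / delta) `^ C0 <= W%:R ->
    uses_bits A S ->
    estimates_lp_norm P A p eps delta W ->
    c * (Num.min
           (n%:R `^ (1 - 2 / p) * eps `^ (- (2 / p)) * ln n%:R
              * ln (1 / delta) `^ (2 / p)
            + n%:R `^ (1 - 2 / p) * eps ^- 2 * ln (1 / delta))
           n%:R
         * ln W%:R) <= S%:R.
Proof.
(* [c0 = 1] already forces n >= 2 when delta < 1/2, and 200 is the exponent in [modulus_choice]. *)
exists 1, 200; split; first exact: ltr01; split; first exact: ltr0Sn.
move=> p p2; have p0 : 0 < p by apply: lt_trans p2.
have a0 : 0 < (1 - 2 / p)^-1 by rewrite invr_gt0 subr_gt0 ltr_pdivrMr// mul1r.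
have [cs [qs [cs0 spike]]] := spike_bound p2.
have [cd [nd [cd0 dense]]] := dense_bound p2 a0.
have [Q0 /andP[qQ _]] := ceil_nat (normr_ge0 qs).
pose K : R := 1 + `|nd|.
have K1 : 1 <= K by rewrite lerDl.
have K0 : 0 < K := lt_le_trans ltr01 K1.
pose w : R := (Q0 ^ 100)%:R + 1.
have w0 : 0 < w by rewrite ltr_wpDl.
have [c [c0 cw ccs ccd]] := ex_lb3 (divr_gt0 ltr01 (exprn_gt0 2 w0))
  (divr_gt0 cs0 (mulr_gt0 (ltr0Sn R 1) (addr_gt0 ltr01 (mulr_gt0 (ltr0Sn R 1) K0))))
  (divr_gt0 cd0 (ltr0Sn R 1)).
exists c; split=> // n W S eps delta d T P A eps01 dl d2 nW ub est.
have n2 := two_le_dim dl d2; have n0 : (0 < n)%N by apply: leq_trans n2.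
have d0 : 0 < delta by apply: lt_trans dl; rewrite powR_gt0.
have /andP[e0 e1] := eps01.
have N1 : 1 <= n%:R :> R by rewrite ler1n.
have m2 := ln_inv_ge d0 d2.
have NW : n%:R <= W%:R :> R.
  apply: le_trans nW; have x1 : n%:R <= n%:R / delta.
    by rewrite ler_peMr// invf_ge1//; lra.
  apply: (le_trans x1); rewrite -[leLHS]powRr1 ?(le_trans _ x1)//; apply: ler_powR; last by rewrite ler1n.
  exact: le_trans N1 x1.
have W0 : (0 < W)%N by rewrite -(ltr0n R) (lt_le_trans _ NW)// ltr0n.
have lW : 0 <= ln W%:R :> R by rewrite ln_ge0// ler1n.
set rateA := n%:R `^ (1 - 2 / p) * eps `^ (- (2 / p)) * ln n%:R * ln (1 / delta) `^ (2 / p).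
set rateB := n%:R `^ (1 - 2 / p) * eps ^- 2 * ln (1 / delta).
have B0 : 0 < rateB := rateB_gt0 _ N1 e0 m2.
have A0 : 0 <= rateA by rewrite !mulr_ge0 ?powR_ge0// ln_ge0.
have min0 : 0 <= Num.min (rateA + rateB) n%:R by rewrite le_min ler0n andbT addr_ge0// ltW.
(* If [W] is below the constant Q0^100, then [n] and ln W are at most [w], and S >= 1 together with
   c <= 1 / w^2 suffices. *)
have [QW|WQ] := leqP (Q0 ^ 100) W; last first.
  have S1 : 1 <= S%:R :> R by rewrite ler1n; exact: (bits_gt0 p0 n0 e0 d2 W0 ub est).
  apply: le_trans S1; have Ww : W%:R <= w by rewrite /w ler_wpDr// ler_nat ltnW.
  apply: (@le_trans _ _ (1 / w ^+ 2 * (w * w))); last by rewrite -expr2 mulfVK// lt0r_neq0// exprn_gt0.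
  apply: ler_pM => //; [exact: ltW|exact: mulr_ge0|].
  apply: ler_pM => //; first by rewrite ge_min (le_trans NW Ww) orbT.
  by apply: le_trans Ww; apply/ltW/ln_sublinear; rewrite ltr0n.
have [q [nq dq Qq qW]] := modulus_choice n2 d0 d2 nW QW.
have qsq : qs <= q%:R by apply: (le_trans (ler_norm qs)); apply: (le_trans qQ); rewrite ler_nat.
pose e' := Num.max eps (n%:R `^ p^-1)^-1.
have r1 : 1 < n%:R `^ p^-1 :> R.
  have : 1 `^ p^-1 < n%:R `^ p^-1 :> R by apply: gt0_ltr_powR; rewrite ?nnegrE ?ler0n ?ltr1n// invr_gt0.
  by rewrite powR1.
have r0 : 0 < n%:R `^ p^-1 :> R := lt_trans ltr01 r1.
have ee' : eps <= e' by rewrite le_max lexx.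
have e'01 : 0 < e' < 1 by rewrite lt_max e0 gt_max e1 invf_lt1.
have e'r : 1 <= e' * n%:R `^ p^-1.
  by rewrite -ler_pdivrMr// le_max mul1r lexx orbT.
have SB := spike n q W S e' delta d T P A n0 e'01 e'r d0 d2 nq dq qsq qW ub (estimates_le e0 ee' est).
have {}SB : cs / 2 * (Num.min rateB n%:R * ln W%:R) <= S%:R.
  apply: le_trans SB; rewrite mulrA [leRHS]mulrA; apply: ler_wpM2r => //.
  rewrite -mulrA; apply: (ler_wpM2l (ltW cs0)).
  have := rateB_clip (p := p) N1 e0 m2 (erefl e'); rewrite -/rateB => H.
  by rewrite ler_pdivrMl.
have spike_case : rateA <= 2 * K * rateB -> c * (Num.min (rateA + rateB) n%:R * ln W%:R) <= S%:R.
  move=> AB; apply: le_trans SB; rewrite mulrA [leRHS]mulrA; apply: ler_wpM2r => //.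
  have k1 : 1 <= 1 + 2 * K by rewrite lerDl mulr_ge0// ltW.
  have H := @min_scale _ (1 + 2 * K) (rateA + rateB) rateB n%:R k1 (ler0n _ _).
  have {}H : Num.min (rateA + rateB) n%:R <= (1 + 2 * K) * Num.min rateB n%:R.
    by apply: H; rewrite mulrDl mul1r addrC lerD2l.
  apply: (le_trans (ler_pM (ltW c0) min0 ccs H)).
  have kk : 1 + 2 * K != 0 by rewrite gt_eqF// (lt_le_trans ltr01).
  by apply: eq_ler; move: (Num.min _ _) (1 + 2 * K) kk => M k kk; field.
have [AB|BA] := leP rateA (2 * K * rateB); first exact: spike_case.
have BA' : rateB < rateA.
  by apply: le_lt_trans BA; rewrite ler_peMl ?(ltW B0)//; lra.
(* For [n] below the threshold of the dense bound, ln n <= K, and the first rate is at most a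
   constant times the second. *)
have [nn|nn] := leP nd n%:R; last first.
  apply: spike_case; apply: (@rate_small _ p n%:R eps _ p2 N1 e0 e1 m2).
  apply: (@le_trans _ _ nd); last by apply: (le_trans (ler_norm nd)); rewrite lerDr.
  by apply: le_trans (ltW nn); apply/ltW/ln_sublinear; rewrite ltr0n.
have [epsl mla] := rate_regime p2 N1 e0 e1 m2 BA'.
have SA := dense n q W S eps delta d T P A nn n2 eps01 epsl d0 d2 mla nq dq qW ub est.
rewrite -/rateA in SA; apply: le_trans SA; rewrite [leLHS]mulrA [leRHS]mulrA; apply: ler_wpM2r => //.
have H : Num.min (rateA + rateB) n%:R <= 2 * rateA.
  by rewrite ge_min mulr_natl mulr2n lerD2l ltW.
apply: (le_trans (ler_pM (ltW c0) min0 ccd H)).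
by rewrite mulrA mulfVK.
Qed.
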